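(* Let $d\ge1$, $a>0$, $\alpha\in(1,2]$, $\beta\in(0,1)$, $T>0$, and let $p\ge0$ be an integer. For $t\in(0,T]$ let $$\Psi_t(f_0)(y)=\int_{\mathbb{R}^d}S_{\beta,1}(t,y-x)f_0(x)\,dx+\int_0^t\int_{\mathbb{R}^d}G_\beta(t-s,y-x)h(s,x)\,dx\,ds,$$ and write $f(t,\cdot)=\Psi_t(f_0)$. Then there is a constant $C>0$, independent of $t\in(0,T]$, $f_0$ and $h$, such that the following hold. 1. If $f_0\in C^p(\mathbb{R}^d)$ and $h:[0,T]\times\mathbb{R}^d\to\mathbb{R}$ is measurable with $h(s,\cdot)\in C^p(\mathbb{R}^d)$ uniformly in time, i.e. $\|h\|_{C^p}:=\sup_{s\in[0,T]}\|h(s,\cdot)\|_{C^p}<\infty$, then for any $t\in(0,T]$ one has $f(t,\cdot)\in C^{p+1}(\mathbb{R}^d)$ and $$\|\Psi_t(f_0)\|_{C^{p+1}(\mathbb{R}^d)}\le C\,t^{-\beta/\alpha}\|f_0\|_{C^p(\mathbb{R}^d)}+C\,t^{\beta-\beta/\alpha}\|h\|_{C^p}.$$ 2. If $f_0\in H^p_1(\mathbb{R}^d)$ and $h:[0,T]\times\mathbb{R}^d\to\mathbb{R}$ is measurable with $h(s,\cdot)\in H^p_1(\mathbb{R}^d)$ uniformly in time, i.e. $\|h\|_{H^p_1}:=\sup_{s\in[0,T]}\|h(s,\cdot)\|_{H^p_1}<\infty$, then for any $t\in(0,T]$ one has $f(t,\cdot)\in H^{p+1}_1(\mathbb{R}^d)$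 and $$\|\Psi_t(f_0)\|_{H^{p+1}_1(\mathbb{R}^d)}\le C\,t^{-\beta/\alpha}\|f_0\|_{H^p_1(\mathbb{R}^d)}+C\,t^{\beta-\beta/\alpha}\|h\|_{H^p_1}.$$ In particular one may choose $p=0$, in which case $H^0_1(\mathbb{R}^d)=L^1(\mathbb{R}^d)$.
   Context: $C^p(\mathbb{R}^d)$ is the space of $p$ times continuously differentiable functions with finite norm $\|\cdot\|_{C^p}$, the sum of the sup-norms of the function and all its derivatives up to and including order $p$. $H^p_1(\mathbb{R}^d)$ is the Sobolev space of functions whose generalised derivatives up to and including order $p$ are in $L^1(\mathbb{R}^d)$, with the sum of the $L^1$-norms of these derivatives as norm. $E_{\beta,\gamma}(z)=\sum_{k=0}^\infty \frac{z^k}{\Gamma(\beta k+\gamma)}$ is the Mittag-Leffler function, and for $t>0$, $y\in\mathbb{R}^d$ $$S_{\beta,1}(t,y)=\frac{1}{(2\pi)^d}\int_{\mathbb{R}^d}e^{ipy}E_{\beta,1}(-a|p|^\alpha t^\beta)\,dp,\qquad G_\beta(t,y)=\frac{t^{\beta-1}}{(2\pi)^d}\int_{\mathbb{R}^d}e^{ipy}E_{\beta,\beta}(-a|p|^\alpha t^\beta)\,dp ,$$ the integrals being understood as inverse Fourier transforms (here $p$ is the Fourier variable). Equivalently, $$S_{\beta,1}(t,y)=\frac1\beta\int_0^\infty x^{-1-1/\beta}w(x^{-1/\beta},\beta,1)\,g(-y,\alpha,t^\beta x)\,dx,\quad G_\beta(t,y)=t^{\beta-1}\int_0^\infty x^{-1/\beta}w(x^{-1/\beta},\beta,1)\,g(-y,\alpha,t^\beta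 x)\,dx,$$ where $g(y,\alpha,\sigma)=\frac{1}{(2\pi)^d}\int_{\mathbb{R}^d}\exp\{-ipy-a\sigma|p|^\alpha\}dp$ and $w(x,\beta,1)=\frac1{2\pi}\int_{-\infty}^\infty \exp\{-ipx-|p|^\beta e^{-i\frac{\pi}{2}\beta\,\mathrm{sign}(p)}\}dp$ is the one-sided $\beta$-stable density (vanishing for $x<0$, with Laplace transform $\lambda\mapsto e^{-\lambda^\beta}$). *)

(* Defs.v *)
From HB Require Import structures.
From mathcomp Require Import all_boot all_order all_algebra.
From mathcomp Require Import all_classical all_reals all_analysis.
From mathcomp Require Import complex.

Set Implicit Arguments.
Unset Strict Implicit.
Unset Printing Implicit Defensive.

Import Order.TTheory GRing.Theory Num.Theory.
Import numFieldNormedType.Exports.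

Local Open Scope classical_set_scope.
Local Open Scope ring_scope.

(* R^d is 'rV[R]_d, with the sigma-algebra generated by the coordinates, i.e. the
   Borel one. *)

Definition measure_rV_display : measure_display.
Proof. exact: default_measure_display. Qed.

Definition rV_coord (R : realType) (n : nat) (i : 'I_n) (x : 'rV[R]_n) :
  measurableTypeR R := x ord0 i.

Section measurable_rV.
Context {R : realType} (n : nat).

Let rV_set0 : g_sigma_preimage (@rV_coord R n) set0.
Proof. exact: sigma_algebra0. Qed.

Let rV_setC A : g_sigma_preimage (@rV_coord R n) A ->
  g_sigma_preimage (@rV_coord R n) (~` A).
Proof. exact: sigma_algebraC. Qed.

Let rV_bigcup (F : (set 'rV[R]_n)^nat) :
  (forall i, g_sigma_preimage (@rV_coord R n) (F i)) ->
  g_sigma_preimage (@rV_coord R n) (\bigcup_i (F i)).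
Proof. exact: sigma_algebra_bigcup. Qed.

HB.instance Definition _ := @isMeasurable.Build measure_rV_display
  'rV[R]_n (g_sigma_preimage (@rV_coord R n)) rV_set0 rV_setC rV_bigcup.

End measurable_rV.

Lemma measurable_rV_coord (R : realType) (n : nat) (i : 'I_n) :
  measurable_fun [set: 'rV[R]_n] (@rV_coord R n i).
Proof.
move=> _ Y mY; rewrite setTI; apply: sub_sigma_algebra => /=.
rewrite -bigcup_seq/=; exists i => /=; first by rewrite mem_index_enum.
by exists Y => //; rewrite setTI.
Qed.

Lemma measurable_fun_rV d (T : measurableType d) (R : realType) (n : nat)
    (f : T -> 'rV[R]_n) :
  (forall i, measurable_fun [set: T] (@rV_coord R n i \o f)) ->
  measurable_fun [set: T] f.
Proof.
move=> mf.
apply: (@measurability _ _ _ _ _ _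
  (\big[setU/set0]_(i < n)
    preimage_set_system setT (@rV_coord R n i) measurable)) => //.
move=> _ [B + <-]; rewrite -bigcup_seq/= => -[i _ [A mA <-]].
by have := mf i measurableT A mA; rewrite !setTI.
Qed.

Definition cons_rV (R : realType) (n : nat) (x : measurableTypeR R * 'rV[R]_n) :
  'rV[R]_n.+1 := row_mx (const_mx x.1 : 'rV[R]_1) x.2.

Definition uncons_rV (R : realType) (n : nat) (v : 'rV[R]_n.+1) :
  measurableTypeR R * 'rV[R]_n :=
  (v ord0 ord0, @rsubmx R 1 1 n v).

Lemma cons_rVK (R : realType) (n : nat) : cancel (@cons_rV R n) (@uncons_rV R n).
Proof.
move=> [x v]; congr pair; last exact: row_mxKr.
by rewrite /cons_rV mxE /=; case: splitP => // j _; rewrite mxE.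
Qed.

Lemma measurable_cons_rV (R : realType) (n : nat) :
  measurable_fun setT (@cons_rV R n).
Proof.
apply: measurable_fun_rV => i.
rewrite (_ : _ \o _ = fun x => match @fintype.split 1 n i with
  inl _ => x.1 | inr j => rV_coord j x.2 end); last first.
  apply/funext => x; rewrite /= /rV_coord /cons_rV mxE.
  by case: splitP => j _ //; rewrite mxE.
case: (fintype.split _) => j; first exact: measurable_fst.
exact: (measurableT_comp (@measurable_rV_coord _ _ j) measurable_snd).
Qed.

Lemma measurable_uncons_rV (R : realType) (n : nat) :
  measurable_fun setT (@uncons_rV R n).
Proof.
apply/measurable_fun_pairP; split; first exact: measurable_rV_coord.
apply: measurable_fun_rV => i.
rewrite (_ : _ \o _ = @rV_coord R n.+1 (@rshift 1 n i)).
  exact: measurable_rV_coord.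
by apply/funext => v; rewrite /= /rV_coord /uncons_rV mxE.
Qed.

Section lebesgue_rV_cons.
Local Open Scope ereal_scope.
Context (R : realType) (n : nat)
  (m : {sigma_finite_measure set 'rV[R]_n -> \bar R}).

Definition lebesgue_rV_cons : set 'rV[R]_n.+1 -> \bar R :=
  pushforward (@lebesgue_measure R \x m) (@cons_rV R n).

Let lebesgue_rV_cons0 : lebesgue_rV_cons set0 = 0.
Proof. by rewrite /lebesgue_rV_cons /pushforward preimage_set0 measure0. Qed.

Let lebesgue_rV_cons_ge0 A : 0 <= lebesgue_rV_cons A.
Proof. by rewrite /lebesgue_rV_cons /pushforward measure_ge0. Qed.

Let lebesgue_rV_cons_sigma_additive : semi_sigma_additive lebesgue_rV_cons.
Proof.
move=> F mF tF mUF; rewrite /lebesgue_rV_cons /pushforward preimage_bigcup.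
apply: measure_semi_sigma_additive.
- by move=> k; rewrite -[X in measurable X]setTI; exact: measurable_cons_rV.
- apply/trivIsetP => /= i j _ _ ij; rewrite -preimage_setI.
  by move/trivIsetP : tF => /(_ _ _ _ _ ij) ->//; rewrite preimage_set0.
- rewrite -preimage_bigcup -[X in measurable X]setTI.
  exact: measurable_cons_rV.
Qed.

HB.instance Definition _ := isMeasure.Build _ _ _ lebesgue_rV_cons
  lebesgue_rV_cons0 lebesgue_rV_cons_ge0 lebesgue_rV_cons_sigma_additive.

Let lebesgue_rV_cons_sigma_finite : sigma_finite setT lebesgue_rV_cons.
Proof.
have /sigma_finiteP[F [TF ndF Foo]] := sigma_finiteT (@lebesgue_measure R).
have /sigma_finiteP[G [TG ndG Goo]] := sigma_finiteT m.
exists (fun k => @uncons_rV R n @^-1` (F k `*` G k)).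
  apply/esym; rewrite -preimage_bigcup -subTset => v _ /=.
  have [i _ Fi] : (\bigcup_k F k) (uncons_rV v).1 by rewrite -TF.
  have [j _ Gj] : (\bigcup_k G k) (uncons_rV v).2 by rewrite -TG.
  exists (maxn i j) => //; split.
  - by apply: (subsetPset _ _ (ndF _ _ (leq_maxl i j))).
  - by apply: (subsetPset _ _ (ndG _ _ (leq_maxr i j))).
move=> k; have [mFk Fkoo] := Foo k; have [mGk Gkoo] := Goo k; split.
  rewrite -[X in measurable X]setTI.
  by apply: measurable_uncons_rV => //; exact: measurableX.
rewrite /lebesgue_rV_cons /pushforward -comp_preimage.
rewrite (_ : _ \o _ = id); last by apply/funext => x /=; rewrite cons_rVK.
by rewrite preimage_id product_measure1E// lte_mul_pinfty// ge0_fin_numE.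
Qed.

HB.instance Definition _ := Measure_isSigmaFinite.Build _ _ _ lebesgue_rV_cons
  lebesgue_rV_cons_sigma_finite.

End lebesgue_rV_cons.

(* The n-fold product of the one-dimensional Lebesgue measure. *)
Fixpoint lebesgue_rV (R : realType) (n : nat) :
    {sigma_finite_measure set 'rV[R]_n -> \bar R} :=
  match n with
  | 0 => dirac (0 : 'rV[R]_0)
  | k.+1 => lebesgue_rV_cons (lebesgue_rV R k)
  end.

(* [`|p|] on 'rV[R]_d is the maximum norm of the library; the Euclidean norm is
   needed here. *)
Definition dotR (R : realType) (d : nat) (x y : 'rV[R]_d) : R :=
  \sum_(i < d) x ord0 i * y ord0 i.

Definition enorm (R : realType) (d : nat) (x : 'rV[R]_d) : R :=
  Num.sqrt (dotR x x).

Definition partial (R : realType) (d : nat) (i : 'I_d) (f : 'rV[R]_d -> R) :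
  'rV[R]_d -> R := fun x => 'D_(delta_mx ord0 i) f x.

Definition pderiv (R : realType) (d : nat) (k : 'I_d -> nat)
  (f : 'rV[R]_d -> R) : 'rV[R]_d -> R :=
  foldr (fun i g => iter (k i) (partial i) g) f (enum 'I_d).

Fixpoint times_cont_diff (R : realType) (d p : nat) (f : 'rV[R]_d -> R) : Prop :=
  match p with
  | 0 => continuous f
  | q.+1 => continuous f /\
      forall i : 'I_d, (forall x, derivable f x (delta_mx ord0 i)) /\
        times_cont_diff q (partial i f)
  end.

(* In both norms below, k ranges over all multi-indices of order at most p. *)
Definition Cnorm (R : realType) (d p : nat) (f : 'rV[R]_d -> R) : \bar R :=
  (\sum_(k : {ffun 'I_d -> 'I_p.+1} | (\sum_(i < d) k i <= p)%N)
     ereal_sup [set `|pderiv (fun i => k i) f x|%:E | x in [set: 'rV[R]_d]])%E.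

Definition Cspace (R : realType) (d p : nat) (f : 'rV[R]_d -> R) : Prop :=
  times_cont_diff p f /\ (Cnorm p f < +oo)%E.

Definition L1 (R : realType) (d : nat) (f : 'rV[R]_d -> R) : Prop :=
  (lebesgue_rV R d).-integrable setT (EFin \o f).

Definition test_function (R : realType) (d : nat) (phi : 'rV[R]_d -> R) : Prop :=
  (forall n, times_cont_diff n phi) /\ compact (closure [set x | phi x != 0]).

Definition is_gen_deriv (R : realType) (d : nat) (k : 'I_d -> nat)
    (f g : 'rV[R]_d -> R) : Prop :=
  forall phi, test_function phi ->
    \int[lebesgue_rV R d]_x (f x * pderiv k phi x) =
    (-1) ^+ (\sum_(i < d) k i)%N * \int[lebesgue_rV R d]_x (g x * phi x).

(* The integrable generalised derivative, unique up to a null set; the default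
   value 0 is irrelevant on H^p_1. *)
Definition gen_deriv (R : realType) (d : nat) (k : 'I_d -> nat)
    (f : 'rV[R]_d -> R) : 'rV[R]_d -> R :=
  xget (fun=> 0) [set g | L1 g /\ is_gen_deriv k f g].

(* Elements are functions, not classes modulo null sets. *)
Definition Hspace (R : realType) (d p : nat) (f : 'rV[R]_d -> R) : Prop :=
  L1 f /\
  forall k : {ffun 'I_d -> 'I_p.+1}, (\sum_(i < d) k i <= p)%N ->
    exists2 g, L1 g & is_gen_deriv (fun i => k i) f g.

Definition Hnorm (R : realType) (d p : nat) (f : 'rV[R]_d -> R) : \bar R :=
  (\sum_(k : {ffun 'I_d -> 'I_p.+1} | (\sum_(i < d) k i <= p)%N)
     \int[lebesgue_rV R d]_x `|gen_deriv (fun i => k i) f x|%:E)%E.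

Lemma Hspace0 (R : realType) (d : nat) (f : 'rV[R]_d -> R) :
  Hspace 0 f <-> L1 f.
Proof.
split=> [[]//|L1f]; split => // k _; exists f => // phi _.
have k0 i : k i = 0%N :> nat by case: (k i) => -[].
rewrite big1 ?expr0 ?mul1r; last by move=> i _; rewrite k0.
congr Rintegral; apply/funext => x; congr (_ * _).
rewrite /pderiv; elim: (enum _) => //= i s IHs.
by rewrite k0.
Qed.

Definition Gamma (R : realType) (x : R) : R :=
  \int[lebesgue_measure]_(t in `]0, +oo[) (t `^ (x - 1) * expR (- t)).

(* Only real arguments z occur. *)
Definition mittag_leffler (R : realType) (beta gamma z : R) : R :=
  limn (series (fun k => z ^+ k / Gamma (beta * k%:R + gamma))).

Definition fourier (R : realType) (d : nat) (u : 'rV[R]_d -> R) (p : 'rV[R]_d) :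
  R[i] := Complex (\int[lebesgue_rV R d]_y (cos (dotR p y) * u y))
                  (- \int[lebesgue_rV R d]_y (sin (dotR p y) * u y)).

(* (2 pi)^-d \int e^{ipy} phi(p) dp as an inverse Fourier transform: the
   integrable function u, unique up to a null set, with
   \int e^{-ipy} u(y) dy = phi(p) for all p. The symbols it is applied to below
   decay like a power of |p| and are in general not integrable, so the integral
   cannot be taken literally; they are transforms of integrable functions, so the
   default value 0 is not used, and S and G only occur under Lebesgue integrals
   in the space variable. *)
Definition inverse_fourier (R : realType) (d : nat) (phi : 'rV[R]_d -> R) :
  'rV[R]_d -> R :=
  xget (fun=> 0) [set u | L1 u /\ forall p, fourier u p = Complex (phi p) 0].

Definition S_kernel (R : realType) (d : nat) (a alpha beta t : R) :
  'rV[R]_d -> R :=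
  inverse_fourier (fun p : 'rV[R]_d =>
    mittag_leffler beta 1 (- a * enorm p `^ alpha * t `^ beta)).

Definition G_kernel (R : realType) (d : nat) (a alpha beta t : R) :
  'rV[R]_d -> R :=
  fun y => t `^ (beta - 1) *
  inverse_fourier (fun p : 'rV[R]_d =>
    mittag_leffler beta beta (- a * enorm p `^ alpha * t `^ beta)) y.

Definition Psi (R : realType) (d : nat) (a alpha beta : R)
    (h : R -> 'rV[R]_d -> R) (t : R) (f0 : 'rV[R]_d -> R) : 'rV[R]_d -> R :=
  fun y =>
    \int[lebesgue_rV R d]_x (S_kernel a alpha beta t (y - x) * f0 x) +
    \int[lebesgue_measure]_(s in `[0, t])
      \int[lebesgue_rV R d]_x (G_kernel a alpha beta (t - s) (y - x) * h s x).

(* Main.v *)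
(* Let P and Q be the laws on (0, oo) with Laplace transforms exp (- l^beta) and
   exp (- l^(alpha/2)).  Comparing the power series in l with the negative moments
   E_P [u^(-beta k)] = k! / Gamma (beta k + 1) gives E_{beta,1}(-l) = E_P [exp (- l u^(-beta))] and
   E_{beta,beta}(-l) = E_P [beta u^(-beta) exp (- l u^(-beta))].  As exp (- c |p|^alpha) is in turn
   a Q-mixture of the Gaussian symbols exp (- c' |p|^2), uniqueness of Fourier transforms shows that
   S and t^(1-beta) G are mixtures of Gaussian densities over P x Q, the precision k of the Gaussian
   scaling like t^(-2beta/alpha).  A Gaussian has mass 1 and its gradient has L^1-norm at most a
   constant times k^(1/2), so that one derivative of the convolution with a mixture costs a factor
   t^(-beta/alpha) times a half moment of k, which is finite because the stable laws have all
   negative moments and P has the moment of order beta/alpha < beta.  The same estimate with t - s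
   in place of t, integrated against (t - s)^(beta-1), gives t^(beta-beta/alpha) for the source
   term. *)
From HB Require Import structures.
Require Import Defs.
From mathcomp Require Import all_boot all_order all_algebra.
From mathcomp Require Import all_classical all_reals all_analysis.
From mathcomp Require Import measurable_realfun complex ring lra.

Set Implicit Arguments.
Unset Strict Implicit.
Unset Printing Implicit Defensive.

Import Order.TTheory GRing.Theory Num.Theory.
Import numFieldNormedType.Exports.

Local Open Scope classical_set_scope.
Local Open Scope ring_scope.

(** * Lebesgue measure and measurability on R^n *)

(** The two laws are constructed. The jump intensity that is the image of Lebesgue measure under x
    |-> x^(-1/beta) is cut into pieces of mass one. Each piece gives a compound Poisson law, and the
    distribution functions of their successive convolutions decrease, so that they converge
    pointwise and only a loss of mass at infinity has to be excluded. Two choices shape the rest.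
    The kernels are chosen functions, known through their Fourier transforms and hence only almost
    everywhere, so they are replaced by mixtures under the integral sign. Generalised derivatives
    are chosen as well, separately at every time, which leaves their measurability in time open.
    Only the derivative of order p + 1 falls on a Gaussian. The lower ones fall on the data and give
    terms of order t^0 and t^beta, which are absorbed by t^(beta/alpha) <= T^(beta/alpha); this is
    how the constant comes to depend on T. Both terms of [Psi] are treated together, as time
    integrals against a Dirac mass and against Lebesgue measure. *)

Section affine1.
Context {R : realType}.

(** The boolean covers at once the translations x + v and the reflections v - x, the two
    substitutions that occur in convolutions. *)
Definition flip (b : bool) (v x : R) : R := v + (-1) ^+ b * x.

Lemma measurable_flip b v : measurable_fun setT (flip b v : measurableTypeR R -> measurableTypeR R).
Proof. by apply: measurable_funD => //; exact: measurable_funM. Qed.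

Let leb_shift (v : R) (A : set R) : measurable A ->
  pushforward (@lebesgue_measure R) (+%R v : _ -> measurableTypeR R) A = lebesgue_measure A.
Proof.
move=> mA; apply/esym/lebesgue_measure_unique => //=; first exact: measurable_funD.
move=> mf _ [[a b]] _ <-; rewrite /pushforward (_ : _ @^-1` _ = `]a - v, b - v]%classic); last first.
  by apply/seteqP; split => x /=; rewrite !in_itv/= ltrBlDl lerBrDl.
rewrite !lebesgue_measure_itv/= !lte_fin ltrBlDr subrK.
by case: ifPn => // _; rewrite -!EFinB; congr (_%:E); ring.
Qed.

Lemma lebesgue_flip b v (A : set (measurableTypeR R)) : measurable A ->
  lebesgue_measure (flip b v @^-1` A) = lebesgue_measure A.
Proof.
move=> mA; rewrite -[RHS](leb_shift v)//.
have mv : measurable (+%R v @^-1` A : set (measurableTypeR R)).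
  by rewrite -[X in measurable X]setTI; exact: measurable_funD.
case: b; last by congr lebesgue_measure; apply/seteqP; split => x; rewrite /flip/= expr0 mul1r.
rewrite -[RHS]lebesgue_measureN//; congr lebesgue_measure.
by apply/seteqP; split => x; rewrite /flip/= expr1 mulN1r.
Qed.

Lemma ge0_integral_flip b v (f : measurableTypeR R -> \bar R) :
  measurable_fun setT f -> (forall x, 0 <= f x)%E ->
  (\int[lebesgue_measure]_x f (flip b v x) = \int[lebesgue_measure]_x f x)%E.
Proof.
move=> mf f0.
transitivity (\int[pushforward (@lebesgue_measure R) (flip b v : _ -> measurableTypeR R)]_x f x)%E.
  by rewrite ge0_integral_pushforward//; exact: measurable_flip.
apply: eq_measure_integral; first exact: measurable_flip.
by move=> mf' A mA _; exact: lebesgue_flip.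
Qed.

End affine1.

Section affine_rV.
Context {R : realType}.

Definition flipv n (b : bool) (v x : 'rV[R]_n) : 'rV[R]_n := v + (-1) ^+ b *: x.

Lemma measurable_flipv n b v : measurable_fun setT (@flipv n b v).
Proof.
apply: measurable_fun_rV => i.
rewrite (_ : _ \o _ = flip b (v ord0 i) \o @rV_coord R n i).
  by apply: measurableT_comp; [exact: measurable_flip|exact: measurable_rV_coord].
by apply/funext => x; rewrite /= /rV_coord /flip !mxE.
Qed.

Lemma lebesgue_rVSE n (A : set 'rV[R]_n.+1) : measurable A ->
  lebesgue_rV R n.+1 A =
  (\int[lebesgue_measure]_x lebesgue_rV R n (xsection (@cons_rV R n @^-1` A) x))%E.
Proof. by []. Qed.

Lemma flipv_cons n b (v : 'rV[R]_n.+1) x y :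
  flipv b v (cons_rV (x, y)) = cons_rV (flip b (v ord0 ord0) x, flipv b (uncons_rV v).2 y).
Proof.
apply/rowP => j; rewrite /flip /flipv /cons_rV !mxE.
case: (@split_ordP 1 n j) => k ->; rewrite ?ord1 !mxE//=.
by rewrite /flip; congr (v _ _ + _); apply/val_inj.
Qed.

(** By induction on the dimension: the map acts separately on the first coordinate, where the
    invariance is one-dimensional, and on the remaining ones. In dimension 0 there is a single
    point. *)
Lemma lebesgue_rV_flipv n b v (A : set 'rV[R]_n) : measurable A ->
  lebesgue_rV R n (flipv b v @^-1` A) = lebesgue_rV R n A.
Proof.
elim: n v A => [|n IHn] v A mA /=.
  congr dirac; apply/seteqP; split => x /=; congr A; by apply/matrixP => i [].
have mF : measurable (flipv b v @^-1` A).
  by rewrite -[X in measurable X]setTI; exact: measurable_flipv.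
have mC (B : set 'rV[R]_n.+1) : measurable B -> measurable (@cons_rV R n @^-1` B).
  by move=> mB; rewrite -[X in measurable X]setTI; exact: measurable_cons_rV.
rewrite [LHS]lebesgue_rVSE// [RHS]lebesgue_rVSE//.
rewrite -[RHS](@ge0_integral_flip _ b (v ord0 ord0)); last 2 first.
- exact: (measurable_fun_xsection _ (mC _ mA)).
- by move=> x; apply: measure_ge0; exact/measurable_xsection/mC.
apply: eq_integral => x _.
rewrite -[RHS](IHn (uncons_rV v).2); last by apply: measurable_xsection; exact: mC.
congr (lebesgue_rV R n _); apply/seteqP; split => y; rewrite /xsection/= !inE/=;
  by rewrite flipv_cons.
Qed.

Lemma ge0_integral_flipv n b v (f : 'rV[R]_n -> \bar R) :
  measurable_fun setT f -> (forall x, 0 <= f x)%E ->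
  (\int[lebesgue_rV R n]_x f (flipv b v x) = \int[lebesgue_rV R n]_x f x)%E.
Proof.
move=> mf f0.
transitivity (\int[pushforward (lebesgue_rV R n) (flipv b v)]_x f x)%E.
  by rewrite ge0_integral_pushforward//; exact: measurable_flipv.
apply: eq_measure_integral; first exact: measurable_flipv.
by move=> mf' A mA _; exact: lebesgue_rV_flipv.
Qed.

Lemma integrable_flipv n b v (f : 'rV[R]_n -> \bar R) :
  (lebesgue_rV R n).-integrable setT f ->
  (lebesgue_rV R n).-integrable setT (fun x => f (flipv b v x)).
Proof.
move=> /integrableP[mf foo]; apply/integrableP; split.
  by apply: measurableT_comp => //; exact: measurable_flipv.
rewrite (@ge0_integral_flipv _ _ _ (fun x => `|f x|%E))//.
exact: measurableT_comp.
Qed.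

Lemma integral_flipv n b v (f : 'rV[R]_n -> \bar R) :
  measurable_fun setT f ->
  (\int[lebesgue_rV R n]_x f (flipv b v x) = \int[lebesgue_rV R n]_x f x)%E.
Proof.
move=> mf; rewrite integralE [RHS]integralE; congr (_ - _)%E.
  rewrite -[RHS](ge0_integral_flipv b v (measurable_funepos mf)) => [|x]; last exact: funepos_ge0.
  by apply: eq_integral => x _; rewrite !funeposE.
rewrite -[RHS](ge0_integral_flipv b v (measurable_funeneg mf)) => [|x]; last exact: funeneg_ge0.
  by apply: eq_integral => x _; rewrite !funenegE.
Qed.

Lemma ge0_integral_rVS n (f : 'rV[R]_n.+1 -> \bar R) :
  measurable_fun setT f -> (forall x, 0 <= f x)%E ->
  (\int[lebesgue_rV R n.+1]_x f x =
   \int[lebesgue_measure]_x \int[lebesgue_rV R n]_y f (cons_rV (x, y)))%E.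
Proof.
move=> mf f0.
have mc := @measurable_cons_rV R n.
rewrite -(fubini_tonelli1 (fun z => f (cons_rV z)))//; last exact: measurableT_comp.
rewrite -(@ge0_integral_pushforward _ _ _ _ _ (@cons_rV R n) _ _ setT)//.
Qed.

End affine_rV.

Section measurability.
Context {R : realType}.

Lemma cvg_rV n (u : nat -> 'rV[R]_n) (l : 'rV[R]_n) :
  (forall i, (fun k => u k ord0 i) @ \oo --> l ord0 i) -> u @ \oo --> l.
Proof.
move=> ul; apply/cvg_ballP => e e0.
have : \forall k \near \oo, forall i : 'I_n, ball (l ord0 i) e (u k ord0 i).
  by apply: filter_forall => i; move/cvg_ballP : (ul i); exact.
by apply: filterS => k uk; split=> // a i; rewrite !ord1.
Qed.

(** Lets dominated convergence, which speaks of sequences, prove continuity in the space variable.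
    If continuity failed at y, points picked in the balls of radius 1/(k+1) around y would form a
    sequence against the hypothesis. *)
Lemma seq_continuous n (f : 'rV[R]_n -> R) :
  (forall (u : nat -> 'rV[R]_n) y, u @ \oo --> y -> f (u k) @[k --> \oo] --> f y) ->
  continuous f.
Proof.
move=> H; suff key (y : 'rV[R]_n) : f z @[z --> y] --> f y by move=> y; exact: key.
apply: contrapT => nc.
have [e e0 He] : exists2 e, 0 < e & forall d, 0 < d ->
    exists2 z, `|y - z| < d & e <= `|f y - f z|.
  apply: contrapT => /forall2NP hn; apply: nc; apply/(@cvgrPdist_lt _ _ _ (nbhs y) (nbhs_filter y)) => e e0.
  have [//|/existsNP[d /not_implyP[d0 hd]]] := hn e.
  apply: (@filterS _ _ (nbhs_filter y) _ _ _ (nbhsx_ballx y d d0)) => z; rewrite -ball_normE /= => yz.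
  by rewrite ltNge; apply/negP => fz; apply: hd; exists z.
have /choice[u Hu] : forall k : nat, exists z, `|y - z| < k.+1%:R^-1 /\ e <= `|f y - f z|.
  by move=> k; have [|z ? ?] := He k.+1%:R^-1; [rewrite invr_gt0|exists z].
have uy : u @ \oo --> y.
  apply/cvgrPdist_lt => r r0; near=> k.
  have [+ _] := Hu k => /lt_trans; apply; near: k; exact: near_infty_natSinv_lt (PosNum r0).
have /cvgrPdist_lt/(_ e e0)[N _ /(_ N (leqnn _))] := H u y uy.
by rewrite ltNge; have [_ ->] := Hu N.
Unshelve. all: by end_near. Qed.

Let grid n (k : nat) (x : 'rV[R]_n) : 'rV[int]_n := \row_i Num.floor (k.+1%:R * x ord0 i).

Let ungrid n (k : nat) (z : 'rV[int]_n) : 'rV[R]_n := \row_i ((z ord0 i)%:~R / k.+1%:R).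

Let measurable_grid n k (B : set 'rV[int]_n) : measurable (@grid n k @^-1` B).
Proof.
rewrite (_ : _ @^-1` _ = \bigcup_(z : 'rV[int]_n)
   (if z \in B then \bigcap_(i : 'I_n) (@rV_coord R n i @^-1`
      `[(z ord0 i)%:~R / k.+1%:R, (z ord0 i + 1)%:~R / k.+1%:R[%classic) else set0)); last first.
  apply/seteqP; split => x /=.
    move=> Bx; exists (grid k x) => //; rewrite mem_set// => i _ /=.
    rewrite in_itv/= /grid !mxE ler_pdivrMr// ltr_pdivlMr// !(mulrC (rV_coord _ _)).
    by rewrite floor_le_tmp/= floorD1_gt.
  move=> [z _]; case: ifPn => // /[!inE] Bz H.
  rewrite (_ : grid k x = z)//; apply/rowP => i; rewrite /grid mxE.
  have := H i I; rewrite /= in_itv/= ler_pdivrMr// ltr_pdivlMr// !(mulrC (rV_coord _ _)).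
  exact: floor_def.
apply: countable_bigcupT_measurable => [|z]; first exact: countableP.
case: ifPn => // _.
apply: fin_bigcap_measurable => // i _.
by rewrite -[X in measurable X]setTI; exact: measurable_rV_coord.
Qed.

(** The sigma-algebra is generated by the coordinates and not by the open sets, so an argument is
    needed. f is the limit of its values at the corners of the cubes of mesh 1/(k+1), and there are
    only countably many cubes for each k. *)
Lemma continuous_measurable_rV n (f : 'rV[R]_n -> R) :
  continuous f -> measurable_fun setT f.
Proof.
move=> cf.
apply: (@measurable_fun_cvg _ _ _ setT (fun k x => f (ungrid k (grid k x)))) => [k _ B mB|x _].
  rewrite setTI (_ : _ @^-1` _ = @grid n k @^-1` [set z | B (f (ungrid k z))])//.
  exact: measurable_grid.
apply: (cvg_comp (fun k => ungrid k (grid k x)) f); last exact: cf.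
apply: cvg_rV => i; apply/cvgrPdist_lt => e e0; near=> k.
rewrite /ungrid /grid !mxE.
have k0 : 0 < k.+1%:R :> R by [].
have h1 := @floor_le_tmp R (k.+1%:R * x ord0 i).
have h2 := @floorD1_gt R (k.+1%:R * x ord0 i).
rewrite -(ltr_pM2l k0) -{1}(gtr0_norm k0) -normrM mulrBr mulrCA divff ?mulr1 ?gt_eqF//.
have : 1 < k.+1%:R * e.
  rewrite -ltr_pdivrMl// mulr1.
  near: k; exact: near_infty_natSinv_lt (PosNum e0).
apply: le_lt_trans; rewrite ger0_norm ?subr_ge0// lerBlDl.
by move: h2; rewrite intrD => /ltW; rewrite addrC.
Unshelve. all: by end_near. Qed.

Lemma measurable_rVD d (T : measurableType d) n (f g : T -> 'rV[R]_n) :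
  measurable_fun setT f -> measurable_fun setT g -> measurable_fun setT (fun x => f x + g x).
Proof.
move=> mf mg; apply: measurable_fun_rV => i.
rewrite (_ : _ \o _ = (rV_coord i \o f) \+ (rV_coord i \o g)).
  by apply: measurable_funD; (apply: measurableT_comp => //; exact: measurable_rV_coord).
by apply/funext => x; rewrite /rV_coord/= mxE.
Qed.

Lemma measurable_rVN d (T : measurableType d) n (f : T -> 'rV[R]_n) :
  measurable_fun setT f -> measurable_fun setT (fun x => - f x).
Proof.
move=> mf; rewrite (_ : (fun x => - f x) = flipv true 0 \o f).
  by apply: measurableT_comp => //; exact: measurable_flipv.
by apply/funext => x; rewrite /flipv/= expr1 scaleN1r add0r.
Qed.

Lemma measurable_rVB d (T : measurableType d) n (f g : T -> 'rV[R]_n) :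
  measurable_fun setT f -> measurable_fun setT g -> measurable_fun setT (fun x => f x - g x).
Proof. by move=> mf mg; apply: measurable_rVD => //; exact: measurable_rVN. Qed.

Definition jmeas d (T : measurableType d) n (f : T -> 'rV[R]_n -> R) :=
  measurable_fun setT (fun z : T * 'rV[R]_n => f z.1 z.2).

Lemma jmeas_comp d (T : measurableType d) n (f : T -> 'rV[R]_n -> R)
    d' (T' : measurableType d') (g : T' -> T) (h : T' -> 'rV[R]_n) :
  jmeas f -> measurable_fun setT g -> measurable_fun setT h ->
  measurable_fun setT (fun x => f (g x) (h x)).
Proof.
move=> mf mg mh.
apply: (@measurableT_comp _ _ _ _ _ _ (fun z : T * 'rV[R]_n => f z.1 z.2) _ (fun x => (g x, h x))) => //.
exact: measurable_fun_pair.
Qed.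

Lemma jmeas2 d (T : measurableType d) n (f : T -> 'rV[R]_n -> R) x :
  jmeas f -> measurable_fun setT (f x).
Proof. by move=> mf; apply: (jmeas_comp mf). Qed.

Lemma partial_cvg n (i : 'I_n) (f : 'rV[R]_n -> R) y : derivable f y (delta_mx ord0 i) ->
  k.+1%:R * (f (y + k.+1%:R^-1 *: delta_mx ord0 i) - f y) @[k --> \oo] --> partial i f y.
Proof.
move=> /cvgP/= df.
have -> : partial i f y = lim (h^-1 *: ((f \o shift y) (h *: delta_mx ord0 i) - f y) @[h --> 0^']).
  by [].
pose u (k : nat) : R := k.+1%:R^-1.
have : (fun k => (u k)^-1 *: ((f \o shift y) (u k *: delta_mx ord0 i) - f y)) @ \oo -->
   lim (h^-1 *: ((f \o shift y) (h *: delta_mx ord0 i) - f y) @[h --> 0^']).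
  apply: (cvgr_dnbhsP (fun h : R => h^-1 *: ((f \o shift y) (h *: delta_mx ord0 i) - f y)) 0 _).1.
    exact: df.
  split; first by move=> k; rewrite gt_eqF// invr_gt0.
  exact: cvg_harmonic.
by under eq_fun do rewrite /= /u invrK (addrC _ y).
Qed.

(** A pointwise limit of the difference quotients with step 1/(k+1), each of which is jointly
    measurable. *)
Lemma jmeas_partial d (T : measurableType d) n (i : 'I_n) (f : T -> 'rV[R]_n -> R) :
  jmeas f -> (forall x y, derivable (f x) y (delta_mx ord0 i)) ->
  jmeas (fun x => partial i (f x)).
Proof.
move=> mf df.
apply: (@measurable_fun_cvg _ _ _ setT (fun k (z : T * 'rV[R]_n) =>
  k.+1%:R * (f z.1 (z.2 + k.+1%:R^-1 *: delta_mx ord0 i) - f z.1 z.2))) => [k|z _].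
  apply: measurable_funM => //; apply: measurable_funB => //.
  by apply: (jmeas_comp mf) => //; exact: measurable_rVD.
exact: partial_cvg.
Qed.

End measurability.

(** * Iterated partial derivatives *)

Section partial_calculus.
Context {R : realType} {d : nat}.
Local Notation V := 'rV[R]_d.
Local Notation e_ i := (delta_mx ord0 i : V).
Implicit Types (f g : V -> R) (i j : 'I_d) (l : seq 'I_d).

(** Reduces partial derivatives to functions of one real variable, to which the mean value theorem
    and differentiation under the integral sign apply. *)
Lemma is_derive_line (f : V -> R) (x v : V) (t df : R) :
  is_derive (x + t *: v) v f df <-> is_derive t 1 (fun s => f (x + s *: v)) df.
Proof.
have E : (fun h : R => h^-1 *: ((f \o shift (x + t *: v)) (h *: v) - f (x + t *: v)))
   = (fun h : R => h^-1 *: (((fun s => f (x + s *: v)) \o shift t) (h *: (1 : R)) - f (x + t *: v))).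
  by apply/funext => h /=; rewrite scalerDl /GRing.scale/= mulr1 addrCA.
split=> -[H1 H2]; split; rewrite -?H2.
- by rewrite /derivable -E.
- by rewrite /derive -E.
- by rewrite /derivable E.
- by rewrite /derive E.
Qed.

Lemma is_derive_line0 (f : V -> R) (x v : V) (df : R) :
  is_derive x v f df <-> is_derive (0 : R) 1 (fun s => f (x + s *: v)) df.
Proof. by rewrite -is_derive_line scale0r addr0. Qed.

Lemma partialE i f y a : is_derive y (e_ i) f a -> partial i f y = a.
Proof. by case. Qed.

Lemma derivable_shift (v w y : V) f :
  derivable f (y + w) v -> is_derive y v (fun y => f (y + w)) ('D_v f (y + w)).
Proof.
have E : (fun h : R => h^-1 *: ((f \o shift (y + w)) (h *: v) - f (y + w))) =
  (fun h : R => h^-1 *: (((fun y => f (y + w)) \o shift y) (h *: v) - f (y + w))).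
  by apply/funext => h /=; rewrite addrA.
by move=> df; split; rewrite /derivable /derive -E.
Qed.

Lemma partial_shift i f w : (forall x, derivable f x (e_ i)) ->
  partial i (fun y => f (y + w)) = (fun y => partial i f (y + w)).
Proof. by move=> df; apply/funext => y; apply/partialE/derivable_shift. Qed.

(** Iterated derivatives are indexed by lists of directions: a list can be extended at either end,
    as the inductions on the order require. [pderiv_klist] and [dlist_pderiv] translate from and to
    multi-indices. *)
Definition dlist l f : V -> R := foldr (@partial R d) f l.

Lemma dlist_cat l l' f : dlist (l ++ l') f = dlist l (dlist l' f).
Proof. by rewrite /dlist foldr_cat. Qed.

Lemma dlist_rcons l i f : dlist (rcons l i) f = dlist l (partial i f).
Proof. by rewrite -cats1 dlist_cat. Qed.

Lemma tcd_cont p f : times_cont_diff p f -> continuous f.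
Proof. by case: p => [|p] // []. Qed.

Lemma tcdW p q f : (q <= p)%N -> times_cont_diff p f -> times_cont_diff q f.
Proof.
elim: q p f => [|q IH] [|p] f //=; first by move=> _ [].
rewrite ltnS => qp [cf H]; split=> // i; have [df tf] := H i.
by split=> //; exact: IH tf.
Qed.

Lemma tcd_derivable p f i x : times_cont_diff p.+1 f -> derivable f x (e_ i).
Proof. by case=> _ /(_ i) []. Qed.

Lemma tcd_partial p f i : times_cont_diff p.+1 f -> times_cont_diff p (partial i f).
Proof. by case=> _ /(_ i) []. Qed.

Lemma tcd_dlist p l f : times_cont_diff (size l + p) f -> times_cont_diff p (dlist l f).
Proof.
elim/last_ind: l f => //= l i IH f; rewrite size_rcons addSn => tf.
by rewrite dlist_rcons; exact/IH/tcd_partial.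
Qed.

Lemma tcd_cst p (c : R) : times_cont_diff p (fun _ : V => c).
Proof.
elim: p c => [|p IH] c; first exact: cst_continuous.
split; first exact: cst_continuous.
move=> i; split; first by move=> x; exact: derivable_cst.
rewrite (_ : partial i _ = fun=> 0); last by apply/funext => x; exact: derive_cst.
exact: IH.
Qed.

Lemma tcdD p f g : times_cont_diff p f -> times_cont_diff p g ->
  times_cont_diff p (fun x => f x + g x).
Proof.
elim: p f g => [|p IH] f g; first by move=> cf cg x; apply: continuousD; [exact: cf|exact: cg].
move=> [cf Hf] [cg Hg]; split; first by move=> x; apply: continuousD; [exact: cf|exact: cg].
move=> i; have [df tf] := Hf i; have [dg tg] := Hg i; split.
  by move=> x; apply: derivableD.
rewrite (_ : partial i _ = fun x => partial i f x + partial i g x); first exact: IH.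
by apply/funext => x; exact: deriveD.
Qed.

Lemma partialM i f g x : derivable f x (e_ i) -> derivable g x (e_ i) ->
  partial i (fun x => f x * g x) x = partial i f x * g x + f x * partial i g x.
Proof.
move=> df dg; transitivity (f x *: 'D_(e_ i) g x + g x *: 'D_(e_ i) f x); first exact: (@deriveM _ _ f g x (e_ i) df dg).
by rewrite addrC; congr (_ + _); exact: mulrC.
Qed.

Lemma tcdM p f g : times_cont_diff p f -> times_cont_diff p g ->
  times_cont_diff p (fun x => f x * g x).
Proof.
elim: p f g => [|p IH] f g; first by move=> cf cg x; apply: continuousM; [exact: cf|exact: cg].
move=> tf tg; split.
  by move=> x; apply: continuousM; [exact: (tcd_cont tf)|exact: (tcd_cont tg)].
move=> i; split.
  by move=> x; apply: derivableM; [exact: tcd_derivable tf|exact: tcd_derivable tg].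
rewrite (_ : partial i _ = fun x => partial i f x * g x + f x * partial i g x).
  by apply: tcdD; apply: IH; [exact: tcd_partial|exact: tcdW tg|exact: tcdW tf|exact: tcd_partial].
by apply/funext => x; apply: partialM; [exact: tcd_derivable tf|exact: tcd_derivable tg].
Qed.

Lemma tcd_prod p n (f : 'I_n -> V -> R) : (forall k, times_cont_diff p (f k)) ->
  times_cont_diff p (fun x => \prod_(k < n) f k x).
Proof.
move=> tf; elim: (index_enum _) => [|k s IH].
  by under eq_fun do rewrite big_nil; exact: tcd_cst.
by under eq_fun do rewrite big_cons; exact: tcdM.
Qed.

Lemma tcd_shift p f w : times_cont_diff p f -> times_cont_diff p (fun y => f (y + w)).
Proof.
have cs (h : V -> R) : continuous h -> continuous (fun y : V => h (y + w)).
  move=> ch; apply: seq_continuous => u y uy.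
  apply: (cvg_comp (fun k => u k + w) h); last exact: ch.
  exact: cvgD uy (cvg_cst _).
elim: p f => [|p IH] f; first exact: cs.
move=> tf; split; first exact/cs/(tcd_cont tf).
move=> i; split.
  by move=> x; case: (@derivable_shift (e_ i) w x f (tcd_derivable tf)).
rewrite partial_shift; first exact/IH/tcd_partial.
by move=> x; exact: tcd_derivable tf.
Qed.

Lemma dlist_shift l f w : times_cont_diff (size l) f ->
  dlist l (fun y => f (y + w)) = (fun y => dlist l f (y + w)).
Proof.
elim/last_ind: l f => //= l i IH f; rewrite size_rcons => tf.
rewrite !dlist_rcons partial_shift; last by move=> x; exact: tcd_derivable tf.
exact/IH/tcd_partial.
Qed.

Section schwarz.

(** The mean value theorem, applied twice to the second difference over a square of side h: first in
    direction i to the difference in direction j, then in direction j to the derivative. *)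
Let mixed_mvt f i j x (h : R) : times_cont_diff 2 f -> 0 < h ->
  exists c c', [/\ 0 < c < h, 0 < c' < h &
   f (x + h *: e_ i + h *: e_ j) - f (x + h *: e_ i) - f (x + h *: e_ j) + f x =
   h * h * partial j (partial i f) (x + c *: e_ i + c' *: e_ j)].
Proof.
move=> tf h0.
have D1 (y : V) (t : R) : is_derive t 1 (fun s => f (y + s *: e_ i)) (partial i f (y + t *: e_ i)).
  by apply/is_derive_line; split=> //; exact: tcd_derivable tf.
have D2 (y : V) (t : R) : is_derive t 1 (fun s => partial i f (y + s *: e_ j))
    (partial j (partial i f) (y + t *: e_ j)).
  by apply/is_derive_line; split=> //; apply: (@tcd_derivable 0); exact: tcd_partial.
pose phi (s : R) := f (x + h *: e_ j + s *: e_ i) - f (x + s *: e_ i).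
have Dphi (t : R) : is_derive t 1 phi (partial i f (x + h *: e_ j + t *: e_ i) - partial i f (x + t *: e_ i)).
  by apply: is_deriveB; exact: D1.
have [|c ch ec] := @MVT R phi _ 0 h h0 (fun t _ => Dphi t).
  by apply: derivable_within_continuous => t _; case: (Dphi t).
have [|c' ch' ec'] := @MVT R (fun s => partial i f (x + c *: e_ i + s *: e_ j)) _ 0 h h0 (fun t _ => D2 _ t).
  by apply: derivable_within_continuous => t _; case: (D2 (x + c *: e_ i) t).
move: ch ch'; rewrite !in_itv/= => ch ch'.
exists c, c'; split=> //; rewrite subr0 in ec'; rewrite subr0 in ec.
have E : x + c *: e_ i + h *: e_ j = x + h *: e_ j + c *: e_ i by rewrite addrAC.
rewrite E scale0r addr0 in ec'.
rewrite ec' in ec; move: ec; rewrite /phi !scale0r !addr0 => ec.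
rewrite mulrC mulrA -ec (addrAC x (h *: e_ j)); ring.
Qed.

Lemma schwarz f i j : times_cont_diff 2 f ->
  partial i (partial j f) = partial j (partial i f).
Proof.
move=> tf; apply/funext => x.
have cji : continuous (partial j (partial i f)) by exact/(@tcd_cont 0)/tcd_partial/tcd_partial.
have cij : continuous (partial i (partial j f)) by exact/(@tcd_cont 0)/tcd_partial/tcd_partial.
pose h (k : nat) : R := k.+1%:R^-1.
have h0 k : 0 < h k by rewrite invr_gt0.
have /choice[c /choice[c' Hc]] := fun k => mixed_mvt i j x tf (h0 k).
have /choice[a /choice[a' Ha]] := fun k => mixed_mvt j i x tf (h0 k).
have small (s : nat -> R) : (forall k, 0 < s k < h k) -> s @ \oo --> 0.
  move=> sh; apply: (@squeeze_cvgr _ _ _ _ (fun=> 0) h); [|exact: cvg_cst|exact: cvg_harmonic].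
  by apply: nearW => k; have /andP[/ltW -> /ltW ->] := sh k.
have lim (s s' : nat -> R) (k1 k2 : 'I_d) : (forall k, 0 < s k < h k) ->
    (forall k, 0 < s' k < h k) -> (fun k => x + s k *: e_ k1 + s' k *: e_ k2) @ \oo --> x.
  move=> /small s0 /small s0'.
  have E : x + (0 : R) *: e_ k1 + (0 : R) *: e_ k2 = x by rewrite !scale0r !addr0.
  rewrite -[X in _ --> X]E.
  by apply: cvgD; [apply: cvgD; [exact: cvg_cst|]|]; exact: cvgZr_tmp.
pose s1 k : V := x + c k *: e_ i + c' k *: e_ j.
pose s2 k : V := x + a k *: e_ j + a' k *: e_ i.
have L1 : (fun k => partial j (partial i f) (s1 k)) @ \oo --> partial j (partial i f) x.
  by apply: (cvg_comp s1 _ _ (cji x)); apply: lim => k; have [] := Hc k.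
have L2 : (fun k => partial i (partial j f) (s2 k)) @ \oo --> partial i (partial j f) x.
  by apply: (cvg_comp s2 _ _ (cij x)); apply: lim => k; have [] := Ha k.
(* The second difference is symmetric in i and j, so the two mixed derivatives agree at points that
   both tend to x. *)
have E : (fun k => partial j (partial i f) (s1 k)) = (fun k => partial i (partial j f) (s2 k)).
  apply/funext => k.
  have [_ _ E1] := Hc k; have [_ _ E2] := Ha k.
  have hh : h k * h k != 0 by rewrite mulf_neq0// gt_eqF.
  apply: (mulfI hh); apply: (etrans (esym E1)); apply: (etrans _ E2); congr (_ + _).
  by rewrite addrAC; congr (f _ - _ - _); exact: addrAC.
rewrite E in L1; exact: (cvg_unique _ L2 L1).
Qed.

End schwarz.

Lemma dlist_comm1 l i f : times_cont_diff (size l).+1 f ->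
  partial i (dlist l f) = dlist l (partial i f).
Proof.
elim: l f => //= j l IH f tf; rewrite schwarz; last by apply: tcd_dlist; rewrite addn2.
by rewrite IH//; exact: (@tcdW (size l).+2 _ f (leqnSn _) tf).
Qed.

(** The head of l occurs somewhere in l'; Schwarz moves it past the entries in front of it, and the
    induction hypothesis treats the rest. *)
Lemma dlist_perm l l' f : perm_eq l l' -> times_cont_diff (size l) f ->
  dlist l f = dlist l' f.
Proof.
elim: l l' f => [|i l IH] l' f; first by move=> /perm_size/esym/size0nil ->.
move=> pl tf; have il' : i \in l' by rewrite -(perm_mem pl) mem_head.
case/splitPr: l' / il' pl => a b; rewrite perm_sym -cat1s perm_catCA/= perm_cons perm_sym => pl.
rewrite -[RHS]/(dlist (a ++ i :: b) f) dlist_cat/= -dlist_comm1; last first.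
  apply: tcd_dlist; move: tf; rewrite /= (perm_size pl) size_cat addnS addnC //.
rewrite -dlist_cat -(IH _ _ pl)//; exact: tcdW tf.
Qed.

Definition klist (k : 'I_d -> nat) : seq 'I_d := flatten [seq nseq (k i) i | i <- enum 'I_d].

Lemma pderiv_klist k f : pderiv k f = dlist (klist k) f.
Proof.
rewrite /pderiv /klist; elim: (enum 'I_d) => //= i s IH.
rewrite dlist_cat -IH; elim: (k i) => //= n ->.
by [].
Qed.

Lemma size_klist k : size (klist k) = (\sum_(i < d) k i)%N.
Proof.
rewrite /klist size_flatten /shape -map_comp sumnE big_map big_enum/=.
by apply: eq_bigr => i _; rewrite size_nseq.
Qed.

Lemma count_klist k i : count_mem i (klist k) = k i.
Proof.
rewrite /klist count_flatten -map_comp sumnE big_map big_enum/= (bigD1 i)//=.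
rewrite count_nseq/= eqxx mul1n big1 ?addn0// => j ji.
by rewrite count_nseq/= (negbTE ji).
Qed.

Lemma dlist_pderiv l f : times_cont_diff (size l) f ->
  dlist l f = pderiv (fun i => count_mem i l) f.
Proof.
move=> tf; rewrite pderiv_klist; apply: dlist_perm => //.
by apply/allP => i _; rewrite /= count_klist.
Qed.

End partial_calculus.

(** * Test functions *)

Section test_functions.
Context {R : realType} {d : nat}.
Local Notation V := 'rV[R]_d.
Local Notation e_ i := (delta_mx ord0 i : V).

(** A class of functions closed under differentiation consists of smooth functions. The induction of
    [tcd_coord] carries a whole class because the derivatives of exp(-1/x) and of exp(-k x^2) leave
    these functions but keep their shape up to a polynomial factor. *)
Definition derivation_stable (P : (R -> R) -> Prop) :=
  forall f, P f -> exists2 g, P g & forall x : R, is_derive x 1 f (g x).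

Lemma tcd_coord (P : (R -> R) -> Prop) f i (a b : R) n :
  derivation_stable P -> P f -> times_cont_diff n (fun x : V => f (a * x ord0 i + b)).
Proof.
move=> sP; elim: n f => [|n IH] f Pf.
  have [g _ fg] := sP f Pf; apply: seq_continuous => u y uy.
  apply: (cvg_comp (fun k => a * u k ord0 i + b) f).
    apply: cvgD; last exact: cvg_cst.
    apply: cvgM; first exact: cvg_cst.
    apply: (cvg_comp u (fun x : V => x ord0 i)) uy _; exact: coord_continuous.
  have /derivable1_diffP/differentiable_continuous : derivable f (a * y ord0 i + b) 1.
    by case: (fg (a * y ord0 i + b)).
  exact.
split; first exact/(@tcd_cont _ _ n)/IH.
have [g Pg fg] := sP f Pf => j.
have D x : is_derive x (e_ j) (fun x : V => f (a * x ord0 i + b))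
    ((a * (j == i)%:R) * g (a * x ord0 i + b)).
  apply/is_derive_line0.
  have -> : (fun s : R => f (a * (x + s *: e_ j) ord0 i + b)) =
     (f \o (fun s : R => (a * (j == i)%:R) * s + (a * x ord0 i + b))).
    apply/funext => s /=; rewrite !mxE eqxx/= eq_sym; congr f; ring.
  have fg0 := fg ((a * (j == i)%:R) * 0 + (a * x ord0 i + b)).
  rewrite mulr0 add0r in fg0.
  rewrite [X in is_derive _ _ _ X]mulrC; apply: is_derive1_comp.
    by rewrite mulr0 add0r.
  rewrite -[X in is_derive _ _ _ X]addr0; apply: is_deriveD.
  rewrite -[X in is_derive _ _ _ X]mulr1; exact: is_deriveZ.
split; first by move=> x; case: (D x).
rewrite (_ : partial j _ = fun x => (a * (j == i)%:R) * g (a * x ord0 i + b)).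
  by apply: tcdM; [exact: tcd_cst|exact: IH].
by apply/funext => x; apply: partialE.
Qed.

End test_functions.

Section smooth_bump.
Context {R : realType}.

(** The flat function exp(-1/x) with a polynomial factor in 1/x, the form that all its derivatives
    have. *)
Definition bump_fun (p : {poly R}) (x : R) : R :=
  if 0 < x then p.[x^-1] * expR (- x^-1) else 0.

Lemma pow_exp_bound n (y : R) : 0 <= y -> y ^+ n * expR (- y) <= n`!%:R.
Proof.
move=> y0; rewrite expRN ler_pdivrMr ?expR_gt0// mulrC -ler_pdivrMr ?ltr0n ?fact_gt0//.
case: n => [|n]; first by rewrite expr0 fact0 divr1 -expR0 ler_expR.
by apply: le_trans (expR_ge1Dxn n y0); rewrite lerDr.
Qed.

Let horner_exp_bound (p : {poly R}) : exists C : R,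
  forall y, 0 <= y -> `|p.[y] * expR (- y)| <= C.
Proof.
exists (\sum_(i < size p) `|p`_i| * i`!%:R) => y y0.
rewrite horner_coef mulr_suml (le_trans (ler_norm_sum _ _ _))//.
apply: ler_sum => i _; rewrite -mulrA normrM ler_wpM2l//.
by rewrite ger0_norm ?pow_exp_bound// mulr_ge0 ?exprn_ge0 ?expR_ge0.
Qed.

Let is_derive0_sqr (f : R -> R) (C : R) : (forall x, `|f x| <= C * x ^+ 2) ->
  is_derive (0 : R) 1 f 0.
Proof.
move=> fC; have f0 : f 0 = 0.
  by apply/eqP; rewrite -normr_le0; have := fC 0; rewrite expr0n mulr0.
have : h^-1 *: ((f \o shift 0) (h *: (1 : R)) - f 0) @[h --> 0^'] --> (0 : R).
  apply: norm_cvg0; apply: (@squeeze_cvgr _ _ _ _ (fun=> 0) (fun h => C * `|h|)).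
  - near=> h; rewrite normr_ge0/= f0 subr0 addr0 /GRing.scale/= mulr1 normrM normfV.
    rewrite ler_pdivrMl ?normr_gt0; last by near: h; exact: nbhs_dnbhs_neq.
    by rewrite mulrCA mulrA -mulrA (le_trans (fC h))// -normrM -expr2 ger0_norm ?sqr_ge0// mulrC.
  - exact: cvg_cst.
  - have H : C * `|h| @[h --> (0 : R)] --> C * `|0 : R|.
      by apply: cvgM; [exact: cvg_cst|apply: cvg_norm; exact: cvg_id].
    by rewrite normr0 mulr0 in H; exact: cvg_within_filter.
move=> H; split; first by apply/cvg_ex; exists 0.
exact/cvg_lim.
Unshelve. all: by end_near. Qed.

Lemma is_derive_bump (p : {poly R}) (x : R) : is_derive x 1 (bump_fun p) (bump_fun ('X^2 * (p - p^`())) x).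
Proof.
have [x0|x0|->] := ltgtP x 0.
- rewrite {2}/bump_fun ltNge (ltW x0)/=.
  apply: (near_eq_is_derive (f := cst (0 : R))).
  by near=> y; rewrite /bump_fun ltNge (_ : y <= 0)//; apply/ltW; near: y; exact: lt_nbhsl.
- rewrite {2}/bump_fun x0.
  apply: (near_eq_is_derive (f := fun x : R => p.[x^-1] * expR (- x^-1))).
    by near=> y; rewrite /bump_fun (_ : 0 < y)//; near: y; exact: lt_nbhsr.
  have xn : x != 0 by rewrite gt_eqF.
  have D : is_derive x 1 (fun x : R => x^-1) (- x ^- 2).
    by have := is_deriveV xn (is_derive_id x 1); rewrite /GRing.scale/= mulr1.
  have D1 := is_derive1_comp (is_derive_poly p x^-1) D.
  have D2 := @is_derive1_comp _ expR (fun x => - x^-1) _ _ _ (is_derive_expR _) (is_deriveN D).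
  have D3 := is_deriveM D1 D2.
  apply: is_derive_eq; rewrite /GRing.scale/= !hornerE/= exprVn.
  move: (p.[_]) (p^`().[_]) (expR _) => u v w; field.
  exact: xn.
- rewrite {2}/bump_fun ltxx.
  (* The exponential also beats the polynomial of degree larger by two, so that the function is
     O(x^2) and its derivative at 0 vanishes. *)
  have [C HC] := horner_exp_bound ('X^2 * p).
  apply: (is_derive0_sqr (C := C)) => {}x; rewrite /bump_fun; case: ifPn => x0; last first.
    by rewrite normr0 mulr_ge0 ?sqr_ge0// (le_trans _ (HC 0 _)).
  rewrite -ler_pdivrMr ?exprn_gt0// -[X in X <= _]ger0_norm ?mulr_ge0 ?invr_ge0 ?sqr_ge0//.
  apply: le_trans (HC x^-1 _); last by rewrite invr_ge0 ltW.
  have -> : ('X^2 * p).[x^-1] * expR (- x^-1) = p.[x^-1] * expR (- x^-1) / x ^+ 2.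
    by rewrite hornerM hornerXn exprVn; ring.
  by rewrite [leRHS]normrM [leLHS]normrM normr_id.
Unshelve. all: by end_near. Qed.

Lemma bump_stable : derivation_stable (fun f => exists p, f = bump_fun p).
Proof.
by move=> _ [p ->]; eexists; [exists ('X^2 * (p - p^`())); reflexivity|exact: is_derive_bump].
Qed.

Lemma gauss_stable (k : R) :
  derivation_stable (fun f => exists p : {poly R}, f = fun x => p.[x] * expR (- (k * x ^+ 2))).
Proof.
move=> _ [p ->]; exists (fun x => (p^`() - (2 * k) *: 'X * p).[x] * expR (- (k * x ^+ 2))).
  by eexists.
move=> x.
have D1 := is_derive_poly p x.
have D0 : is_derive x 1 (fun x : R => - (k * x ^+ 2)) (- (k * (2 * x))).
  have D := is_deriveN (is_deriveZ k (is_deriveX 1 (is_derive_id x (1 : R)))).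
  by apply: is_derive_eq; rewrite /GRing.scale/=; ring.
have D2 := @is_derive1_comp _ expR (fun x => - (k * x ^+ 2)) _ _ _ (is_derive_expR _) D0.
have D3 := is_deriveM D1 D2.
apply: is_derive_eq; rewrite /GRing.scale/= !hornerE/=; ring.
Qed.

End smooth_bump.

Section test_functions2.
Context {R : realType} {d : nat}.
Local Notation V := 'rV[R]_d.
Local Notation e_ i := (delta_mx ord0 i : V).
Implicit Types phi : V -> R.

(** Bounded support, which by [test_functionP] is the compactness asked of a test function; it is
    easier to carry through sums, products and translations. *)
Definition vanishes_far phi := exists M : R, forall x, phi x != 0 -> `|x| <= M.

Lemma norm_gt_near (x : V) (M : R) : M < `|x| -> nbhs x [set z : V | M < `|z|].
Proof.
move=> Mx; have r0 : 0 < `|x| - M by rewrite subr_gt0.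
apply: (@filterS _ _ (nbhs_filter x) _ _ _ (nbhsx_ballx x _ r0)) => z.
rewrite -ball_normE /= => xz; have := ler_normD z (x - z); rewrite addrC subrK => h.
by rewrite -(ltrD2r (`|x - z|)) (lt_le_trans _ h)// addrC -ltrBrDr.
Qed.

Lemma closure_norm_le (S : set V) (M : R) : (forall x, S x -> `|x| <= M) ->
  forall x, closure S x -> `|x| <= M.
Proof.
move=> HM x Sx; rewrite leNgt; apply/negP => /norm_gt_near /Sx[z [/HM + /=]].
by rewrite leNgt => /negP.
Qed.

Lemma compact_vanishes phi : vanishes_far phi -> compact (closure [set x | phi x != 0]).
Proof.
move=> [M HM]; apply: bounded_closed_compact; last exact: closed_closure.
exists M; split; first exact: num_real.
by move=> y My x /(closure_norm_le HM)/le_trans; apply; exact: ltW.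
Qed.

Lemma test_functionP phi :
  test_function phi <-> (forall n, times_cont_diff n phi) /\ vanishes_far phi.
Proof.
split=> -[tphi H]; split=> //; last exact: compact_vanishes.
have [M [_ HM]] := compact_bounded H.
exists (M + 1) => x px; apply: (HM (M + 1)); first by rewrite ltrDl.
exact: subset_closure.
Qed.

Lemma vanishes_far_bounded phi : continuous phi -> vanishes_far phi ->
  exists2 C : R, 0 <= C & forall x, `|phi x| <= C.
Proof.
move=> cphi /compact_vanishes cK.
have cI : compact (phi @` closure [set x | phi x != 0]).
  by apply: continuous_compact => //; exact: continuous_subspaceT.
have [C [_ HC]] := compact_bounded cI.
exists (`|C| + 1); first by rewrite addr_ge0.
move=> x; have [->|x0] := eqVneq (phi x) 0; first by rewrite normr0 addr_ge0.
apply: HC; first by rewrite ltr_pwDr// ler_norm.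
by exists x => //; exact: subset_closure.
Qed.

Lemma test_partial phi i : test_function phi -> test_function (partial i phi).
Proof.
move=> /test_functionP[tphi [M HM]]; apply/test_functionP; split.
  by move=> n; exact/tcd_partial/(tphi n.+1).
exists M => x; apply: contraNT; rewrite -ltNge => Mx; apply/eqP.
rewrite /partial -[RHS](derive_cst (0 : R) x (e_ i)); apply: near_eq_derive.
apply: (@filterS _ _ (nbhs_filter x) _ _ _ (norm_gt_near Mx)) => y My.
by apply/eqP; apply: contraTT My => /HM; rewrite -leNgt.
Qed.

Lemma test_dlist phi l : test_function phi -> test_function (dlist l phi).
Proof. by elim: l => //= i l IH /IH; exact: test_partial. Qed.

Lemma test_bounded phi : test_function phi -> exists2 C : R, 0 <= C & forall x, `|phi x| <= C.
Proof.
by move=> /test_functionP[tphi sphi]; apply: vanishes_far_bounded => //; exact: (tphi 0%N).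
Qed.

Lemma test_measurable phi : test_function phi -> measurable_fun setT phi.
Proof. by case=> /(_ 0%N) cphi _; exact: continuous_measurable_rV. Qed.

Lemma test_shift phi w : test_function phi -> test_function (fun x => phi (x + w)).
Proof.
move=> /test_functionP[tphi [M HM]]; apply/test_functionP; split.
  by move=> n; exact: tcd_shift.
exists (M + `|w|) => x /HM xwM; rewrite -(addrK w x) (le_trans (ler_normB _ _))//.
by rewrite lerD2r.
Qed.

Lemma testM phi f : (forall n, times_cont_diff n f) -> test_function phi ->
  test_function (fun x => f x * phi x).
Proof.
move=> tf /test_functionP[tphi [M HM]]; apply/test_functionP; split.
  by move=> n; exact: tcdM.
by exists M => x; rewrite mulf_eq0 negb_or => /andP[_ /HM].
Qed.

(** Since exp(-1/(m s)) tends to 1 for s > 0 as m grows, these test functions, all between 0 and 1,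
    converge to the indicator of the open box. *)
Definition box_bump (a b : V) (m : R) (x : V) : R :=
  \prod_(i < d) (bump_fun 1 (m * (x ord0 i - a ord0 i)) * bump_fun 1 (m * (b ord0 i - x ord0 i))).

Definition obox (a b : V) : set V := [set x | forall i, a ord0 i < x ord0 i < b ord0 i].

Let bump1E (x : R) : bump_fun 1 x = if 0 < x then expR (- x^-1) else 0.
Proof. by rewrite /bump_fun hornerE mul1r. Qed.

Let bump1_bound (x : R) : 0 <= bump_fun 1 x <= 1.
Proof.
rewrite bump1E; case: ifPn => x0; last by rewrite lexx ler01.
by rewrite expR_ge0/= -expR0 ler_expR lerNl oppr0 invr_ge0 ltW.
Qed.

Lemma box_bump_bound a b m x : 0 <= box_bump a b m x <= 1.
Proof.
apply/andP; split; first by apply: prodr_ge0 => i _; by rewrite mulr_ge0//; have /andP[] := bump1_bound (m * (x ord0 i - a ord0 i)); have /andP[] := bump1_bound (m * (b ord0 i - x ord0 i)).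
apply: prodr_ile1 => i _.
have /andP[a0 a1] := bump1_bound (m * (x ord0 i - a ord0 i)).
have /andP[b0 b1] := bump1_bound (m * (b ord0 i - x ord0 i)).
by rewrite mulr_ge0//= mulr_ile1.
Qed.

Lemma box_bump_eq0 a b m x : 0 < m -> ~ obox a b x -> box_bump a b m x = 0.
Proof.
move=> m0 /existsNP[i xi]; rewrite /box_bump (bigD1 i)//= !bump1E !pmulr_rgt0// !subr_gt0.
by move/negP: xi; rewrite negb_and => /orP[] /negbTE -> /=; rewrite ?mul0r ?mulr0 ?mul0r.
Qed.

Lemma box_bump_test a b m : 0 < m -> test_function (box_bump a b m).
Proof.
move=> m0; apply/test_functionP; split.
  move=> n; apply: tcd_prod => i; apply: tcdM.
    under eq_fun do rewrite mulrBr -mulrN.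
    by apply: (tcd_coord (f := bump_fun 1) _ _ _ _ bump_stable); exists 1.
  under eq_fun do rewrite mulrBr addrC -mulNr.
  by apply: (tcd_coord (f := bump_fun 1) _ _ _ _ bump_stable); exists 1.
exists (`|a| + `|b|) => x; apply: contraNT; rewrite -ltNge => xab.
apply/eqP/box_bump_eq0 => // xI; move: xab; apply/negP; rewrite -leNgt.
have coord (z : V) i : `|z ord0 i| <= `|z|.
  by rewrite -[leRHS]/(mx_norm z) mx_normrE; apply/bigmax_geP; right => /=; exists (ord0, i).
rewrite -[leLHS]/(mx_norm x) mx_normrE; apply/bigmax_leP; split=> /=; first by rewrite addr_ge0.
move=> [k i] _ /=; rewrite ord1.
have /andP[ax xb] := xI i; have := coord a i; have := coord b i.
rewrite !ler_norml => /andP[b1 b2] /andP[a1 a2]; apply/andP; split.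
  by rewrite opprD; apply: le_trans (ltW ax); rewrite lerBlDl (le_trans a1)// lerDr.
by apply: (le_trans (ltW xb)); rewrite (le_trans b2)// lerDr.
Qed.

Lemma box_bump_cvg a b x : box_bump a b k.+1%:R x @[k --> \oo] --> (\1_(obox a b) x : R).
Proof.
have H (y : R) : 0 < y -> bump_fun 1 (k.+1%:R * y) @[k --> \oo] --> (1 : R).
  move=> y0.
  have : expR (- (k.+1%:R^-1 * y^-1)) @[k --> \oo] --> expR (- (0 * y^-1)).
    apply: (cvg_comp (fun k => - (k.+1%:R^-1 * y^-1)) expR); last exact: continuous_expR.
    by apply: cvgN; apply: cvgM; [exact: cvg_harmonic|exact: cvg_cst].
  rewrite mul0r oppr0 expR0; apply: cvg_trans; apply: near_eq_cvg; apply: nearW => k.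
  by rewrite bump1E mulr_gt0// invfM.
have [xI|xI] := pselect (obox a b x); last first.
  rewrite indicE memNset//; under eq_fun do rewrite box_bump_eq0//.
  exact: cvg_cst.
rewrite indicE mem_set//.
have : \prod_(i < d) (bump_fun 1 (k.+1%:R * (x ord0 i - a ord0 i)) *
    bump_fun 1 (k.+1%:R * (b ord0 i - x ord0 i))) @[k --> \oo] --> \prod_(i < d) (1 : R).
  elim: (index_enum _) => [|i s IH].
    by under eq_fun do rewrite big_nil; rewrite big_nil; exact: cvg_cst.
  under eq_fun do rewrite big_cons; rewrite big_cons; apply: cvgM => //.
  have /andP[] := xI i; rewrite -subr_gt0 => /H Ha; rewrite -subr_gt0 => /H Hb.
  by rewrite -[X in _ --> (X : R)]mulr1; exact: (cvgM Ha Hb).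
by rewrite big1.
Qed.

End test_functions2.

(** * Integrals of real functions *)

Section Rintegral_tools.
Context d (T : measurableType d) (R : realType) (mu : {measure set T -> \bar R}).
Local Notation intble f := (mu.-integrable setT (EFin \o (f : T -> R))).
Implicit Types f g : T -> R.

Lemma intble_measurable f : intble f -> measurable_fun setT f.
Proof. by move=> /(measurable_int mu)/measurable_EFinP. Qed.

Lemma intble_le f g : measurable_fun setT f -> (forall x, `|f x| <= g x) ->
  intble g -> intble f.
Proof.
move=> mf fg ig; apply: le_integrable ig => //; first exact/measurable_EFinP.
by move=> x _; rewrite /= lee_fin (le_trans (fg x))// ler_norm.
Qed.

Lemma intbleP f : intble f <-> measurable_fun setT f /\ (\int[mu]_x `|f x|%:E < +oo)%E.
Proof.
by split=> [/integrableP[/measurable_EFinP]|[mf foo]] //; apply/integrableP; split=> //; exact/measurable_EFinP.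
Qed.

Lemma intbleM_bounded f g C : intble f -> measurable_fun setT g -> (forall x, `|g x| <= C) ->
  intble (fun x => f x * g x).
Proof.
move=> intf mg gC.
apply: (@intble_le _ (fun x => C * `|f x|)).
- by apply: measurable_funM => //; exact: intble_measurable.
- by move=> x; rewrite normrM mulrC ler_wpM2r.
- have := integrableZl measurableT C (integrable_norm intf).
  by apply: eq_integrable => // x _; rewrite EFinM.
Qed.

Lemma Rintegral_dct (f_ : nat -> T -> R) f g :
  (forall n, measurable_fun setT (f_ n)) -> (forall x, f_ n x @[n --> \oo] --> f x) ->
  (forall n x, `|f_ n x| <= g x) -> intble g ->
  intble f /\ \int[mu]_x f_ n x @[n --> \oo] --> \int[mu]_x f x.
Proof.
move=> mf_ ff fg ig.
have mf : measurable_fun setT f by apply: (measurable_fun_cvg mf_) => x _; exact: ff.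
have ffE x : [set: T] x -> (EFin \o f_ ^~ x) @ \oo --> (EFin \o f) x.
  by move=> _; apply: cvg_EFin; [exact: nearW|exact: ff].
have [H1 _ H2] := @dominated_convergence _ T R mu setT measurableT
  (fun n => EFin \o f_ n) (EFin \o f) (EFin \o g)
  (fun n => (measurable_EFinP _ _).2 (mf_ n)) ((measurable_EFinP _ _).2 mf)
  (aeW _ ffE) ig
  (aeW _ (fun x n _ => fg n x)).
split=> //; apply: fine_cvg; rewrite fineK; last exact: integrable_fin_num.
exact: H2.
Qed.

(** No integrability is required: if the integral is infinite, [fine] makes the left side 0. *)
Lemma abs_Rintegral_le f : measurable_fun setT f ->
  (`|\int[mu]_x f x|%:E <= \int[mu]_x `|f x|%:E)%E.
Proof.
move=> mf; apply: (@le_trans _ _ `|\int[mu]_x (f x)%:E|%E).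
  by rewrite /Rintegral; case: (integral _ _ _) => //=; rewrite normr0 leey.
by apply: le_abse_integral => //; exact/measurable_EFinP.
Qed.

End Rintegral_tools.

Section Rfubini.
Context d1 d2 (T1 : measurableType d1) (T2 : measurableType d2) (R : realType).
Variables (m1 : {sigma_finite_measure set T1 -> \bar R}) (m2 : {sigma_finite_measure set T2 -> \bar R}).
Implicit Type F : T1 * T2 -> R.

(** Holds without integrability: the integrals of the positive and negative parts are measurable by
    Tonelli, and [fine] is total. *)
Lemma measurable_Rintegral2 F : measurable_fun setT F ->
  measurable_fun setT (fun x => \int[m2]_y F (x, y)).
Proof.
move=> mF; rewrite /Rintegral.
have mF' : measurable_fun setT (EFin \o F) by exact/measurable_EFinP.
apply: (measurableT_comp (f := fine)); first exact: fine_measurable.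
rewrite (_ : (fun x => _) = (fun x => \int[m2]_y (EFin \o F)^\+ (x, y) - \int[m2]_y (EFin \o F)^\- (x, y))%E); last first.
  apply/funext => x; rewrite integralE; congr (_ - _)%E; apply: eq_integral => y _;
    by rewrite ?funeposE ?funenegE.
apply: emeasurable_funB.
  by apply: (measurable_fun_fubini_tonelli_F (EFin \o F)^\+%E) => //; exact: measurable_funepos.
by apply: (measurable_fun_fubini_tonelli_F (EFin \o F)^\-%E) => //; exact: measurable_funeneg.
Qed.

Lemma measurable_Rintegral1 F : measurable_fun setT F ->
  measurable_fun setT (fun y => \int[m1]_x F (x, y)).
Proof.
move=> mF; rewrite /Rintegral.
have mF' : measurable_fun setT (EFin \o F) by exact/measurable_EFinP.
apply: (measurableT_comp (f := fine)); first exact: fine_measurable.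
rewrite (_ : (fun x => _) = (fun y => \int[m1]_x (EFin \o F)^\+ (x, y) - \int[m1]_x (EFin \o F)^\- (x, y))%E); last first.
  apply/funext => x; rewrite integralE; congr (_ - _)%E; apply: eq_integral => y _;
    by rewrite ?funeposE ?funenegE.
apply: emeasurable_funB.
  by apply: (measurable_fun_fubini_tonelli_G (EFin \o F)^\+%E) => //; exact: measurable_funepos.
by apply: (measurable_fun_fubini_tonelli_G (EFin \o F)^\-%E) => //; exact: measurable_funeneg.
Qed.

Lemma intble_prod12 F : measurable_fun setT F ->
  (\int[m1]_x \int[m2]_y `|F (x, y)|%:E < +oo)%E -> (m1 \x m2)%E.-integrable setT (EFin \o F).
Proof. by move=> mF foo; apply/integrable12ltyP => //; exact/measurable_EFinP. Qed.

Variables (F : T1 * T2 -> R) (intF : (m1 \x m2)%E.-integrable setT (EFin \o F)).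

Let mF : measurable_fun setT F. Proof. exact: (intble_measurable intF). Qed.

Lemma Rfubini12 : \int[m1]_x \int[m2]_y F (x, y) = \int[(m1 \x m2)%E]_z F z.
Proof.
rewrite [RHS]/Rintegral -(integral12_prod_meas1 intF) [LHS]/Rintegral; congr fine.
apply: ae_eq_integral => //.
- by apply/measurable_EFinP; exact: measurable_Rintegral2.
- exact: (measurable_int m1 (integrable_fubini_F intF)).
- have := integrable_ae measurableT (integrable_fubini_F intF).
  by apply: filterS => x H _; rewrite /= /Rintegral fineK//; exact: H.
Qed.

Lemma Rfubini21 : \int[m2]_y \int[m1]_x F (x, y) = \int[(m1 \x m2)%E]_z F z.
Proof.
rewrite [RHS]/Rintegral -(integral21_prod_meas1 intF) [LHS]/Rintegral; congr fine.
apply: ae_eq_integral => //.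
- by apply/measurable_EFinP; exact: measurable_Rintegral1.
- exact: (measurable_fubini_G intF).
- have := ae_integrable2 intF.
  apply: filterS => x /integrable_fin_num H _.
  by rewrite /= /Rintegral /fubini_G fineK//; exact: (H measurableT).
Qed.

Lemma Rfubini : \int[m1]_x \int[m2]_y F (x, y) = \int[m2]_y \int[m1]_x F (x, y).
Proof. by rewrite Rfubini12 Rfubini21. Qed.

Lemma ae_intble1 : {ae m2, forall y, m1.-integrable setT (EFin \o (fun x => F (x, y)))}.
Proof. exact: (ae_integrable2 intF). Qed.

Lemma intble_Rintegral2 : m1.-integrable setT (EFin \o (fun x => \int[m2]_y F (x, y))).
Proof.
apply/intbleP; split; first exact: measurable_Rintegral2.
have /integrable12ltyP : (m1 \x m2)%E.-integrable setT (EFin \o F) by [].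
move=> /(_ (measurable_int _ intF)); apply: le_lt_trans; apply: ge0_le_integral => //.
- by apply/measurable_EFinP; apply: measurableT_comp => //; exact: measurable_Rintegral2.
- apply: (measurable_fun_fubini_tonelli_F (fun z => `|F z|%:E)) => //.
  by apply/measurable_EFinP; exact: measurableT_comp.
- by move=> x _; apply: abs_Rintegral_le; exact: measurableT_comp.
Qed.

Lemma intble_Rintegral1 : m2.-integrable setT (EFin \o (fun y => \int[m1]_x F (x, y))).
Proof.
apply/intbleP; split; first exact: measurable_Rintegral1.
have /integrable21ltyP : (m1 \x m2)%E.-integrable setT (EFin \o F) by [].
move=> /(_ (measurable_int _ intF)); apply: le_lt_trans; apply: ge0_le_integral => //.
- by apply/measurable_EFinP; apply: measurableT_comp => //; exact: measurable_Rintegral1.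
- apply: (measurable_fun_fubini_tonelli_G (fun z => `|F z|%:E)) => //.
  by apply/measurable_EFinP; exact: measurableT_comp.
- by move=> x _; apply: abs_Rintegral_le; exact: measurableT_comp.
Qed.

End Rfubini.

(** * The fundamental lemma of the calculus of variations *)

Section fundamental.
Context {R : realType} {d : nat}.
Local Notation V := 'rV[R]_d.
Local Notation lam := (lebesgue_rV R d).

Lemma measurable_obox (a b : V) : measurable (obox a b).
Proof.
rewrite (_ : obox a b = \bigcap_(i : 'I_d) (@rV_coord R d i @^-1` `]a ord0 i, b ord0 i[%classic)).
  apply: fin_bigcap_measurable => // i _.
  by rewrite -[X in measurable X]setTI; exact: measurable_rV_coord.
by apply/seteqP; split => [x xab i _|x xab i]; have := xab i; rewrite /= in_itv/=; [|apply].
Qed.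

Let ball_box (n : nat) : set V := obox (const_mx (- n%:R)) (const_mx n%:R).

Let ball_box_cover (x : V) : \forall n \near \oo, ball_box n x.
Proof.
have : \forall n \near \oo, forall i : 'I_d, `|x ord0 i| < n%:R.
  by apply: filter_forall => i; exact: nbhs_infty_gtr.
by apply: filterS => n H i; rewrite !mxE -ltr_norml.
Qed.

Lemma measurable_rV_obox :
  @measurable _ 'rV[R]_d = <<s [set X | exists a b, X = obox a b] >>.
Proof.
apply/seteqP; split; last first.
  by apply: smallest_sub; [exact: sigma_algebra_measurable|move=> _ [a [b ->]]; exact: measurable_obox].
apply: smallest_sub; first exact: smallest_sigma_algebra.
move=> X; rewrite -bigcup_seq/= => -[i _ [B mB <-]]; rewrite setTI.
pose pull := [set B : set (measurableTypeR R) | <<s [set X | exists a b, X = obox a b] >> (@rV_coord R d i @^-1` B)].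
suff : measurable `<=` pull by apply.
apply: smallest_sub; first split.
- by rewrite /pull/= preimage_set0; exact: sigma_algebra0.
- move=> A; by rewrite /pull/= setTD preimage_setC; exact: sigma_algebraC.
- by move=> F HF; rewrite /pull/= preimage_bigcup; exact: sigma_algebra_bigcup.
move=> _ [[u v] _ <-]; rewrite /pull/=.
(* The slab u < x_i <= v is the intersection over m of the union over n of the boxes with i-th side
   ]u, v + 1/(m+1)[ and all other sides ]-n, n[. *)
pose a (n : nat) : V := \row_k (if k == i then u else - n%:R).
pose b (n m : nat) : V := \row_k (if k == i then v + m.+1%:R^-1 else n%:R).
rewrite (_ : _ @^-1` _ = \bigcap_m \bigcup_n obox (a n) (b n m)).
  rewrite -[X in smallest _ _ X]setCK setC_bigcap; apply: sigma_algebraC.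
  apply: sigma_algebra_bigcup => m; apply: sigma_algebraC; apply: sigma_algebra_bigcup => n.
  by apply: sub_sigma_algebra; exists (a n), (b n m).
apply/seteqP; split => x.
  rewrite /= in_itv/= => /andP[ux xv] m _.
  have [N _ HN] := ball_box_cover x; exists N => // k.
  rewrite !mxE; case: eqP => [->|_].
    by rewrite ux (le_lt_trans xv)// ltrDl invr_gt0.
  by have := HN N (leqnn _) k; rewrite !mxE.
move=> H; rewrite /= in_itv/=.
have [n _ /(_ i)] := H 0%N I; rewrite !mxE eqxx => /andP[-> _] /=.
apply/ler_addgt0Pr => e e0.
have [m _ Hm] := near_infty_natSinv_lt (PosNum e0).
have [k _ /(_ i)] := H m I; rewrite !mxE eqxx => /andP[_ /ltW]/le_trans; apply.
by rewrite lerD2l ltW//; exact: Hm (leqnn _).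
Qed.

(** Indicators of boxes are bounded limits of test functions, so w has integral 0 over every box.
    Boxes are stable under intersection and generate the sigma-algebra, and Dynkin's argument
    extends this to every measurable set. *)
Lemma L1_eq0 (w : V -> R) : L1 w ->
  (forall phi, test_function phi -> \int[lam]_x (w x * phi x) = 0) ->
  {ae lam, forall x, w x = 0}.
Proof.
move=> Lw H.
have mw := intble_measurable Lw.
have lim_box (f_ : nat -> V -> R) (f : V -> R) : (forall n, measurable_fun setT (f_ n)) ->
    (forall n x, 0 <= f_ n x <= 1) -> (forall x, f_ n x @[n --> \oo] --> f x) ->
    (forall n, \int[lam]_x (w x * f_ n x) = 0) -> \int[lam]_x (w x * f x) = 0.
  move=> mf f01 ff w0.
  have [||||_] := @Rintegral_dct _ _ _ lam (fun n x => w x * f_ n x) (fun x => w x * f x) (fun x => `|w x|).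
  - by move=> n; exact: measurable_funM.
  - by move=> x; apply: cvgM => //; exact: cvg_cst.
  - by move=> n x; rewrite normrM ler_piMr//; have /andP[? ?] := f01 n x; rewrite ger0_norm.
  - exact: integrable_norm.
  under eq_fun do rewrite w0.
  by move=> /(cvg_unique _ (cvg_cst 0))/esym; apply.
have indE (A : set V) : measurable A -> \int[lam]_x (w x * \1_A x) = 0 -> (\int[lam]_(x in A) (w x)%:E = 0)%E.
  move=> mA w0; rewrite -[RHS]/((0 : R)%:E) -w0 integral_mkcond /Rintegral fineK; last first.
    have : lam.-integrable setT (EFin \o (fun x => w x * \1_A x)).
      apply: (@intbleM_bounded _ _ _ lam w \1_A 1) => //. 
      by move=> x; rewrite indicE; case: (_ \in _); rewrite ?normr1 ?normr0.
    exact: integrable_fin_num.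
  by apply: eq_integral => x _; rewrite patchE indicE; case: ifPn; rewrite /= ?mulr1 ?mulr0.
have box0 a b : \int[lam]_x (w x * \1_(obox a b) x) = 0.
  apply: (lim_box (fun k => box_bump a b k.+1%:R)).
  - by move=> n; apply: test_measurable; exact: box_bump_test.
  - by move=> n x; exact: box_bump_bound.
  - exact: box_bump_cvg.
  - by move=> n; apply: H; exact: box_bump_test.
have all0 (A : set V) : measurable A -> (\int[lam]_(x in A) (w x)%:E = 0)%E.
  rewrite measurable_rV_obox; move: A.
  apply: (dynkin_induction measurable_rV_obox).
  - move=> _ _ [a [b ->]] [a' [b' ->]].
    exists (\row_i Num.max (a ord0 i) (a' ord0 i)), (\row_i Num.min (b ord0 i) (b' ord0 i)).
    apply/seteqP; split => [x [H1 H2] i|x Hx].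
      by rewrite !mxE gt_max lt_min; have /andP[-> ->] := H1 i; have /andP[-> ->] := H2 i.
    by split=> i; have := Hx i; rewrite !mxE gt_max lt_min => /andP[/andP[h1 h2] /andP[h3 h4]];
      rewrite ?h1 ?h2 ?h3 ?h4.
  - apply: indE => //; apply: (lim_box (fun n => \1_(ball_box n))).
    + by move=> n; apply: measurable_indic; exact: measurable_obox.
    + by move=> n x; rewrite indicE; case: (_ \in _); rewrite ?lexx ler01.
    + move=> x; rewrite indicT; apply: cvg_near_cst.
      by apply: filterS (ball_box_cover x) => n xn; rewrite indicE mem_set.
    + by move=> n; exact: box0.
  - by move=> _ [a [b ->]]; apply: indE => //; exact: measurable_obox.
  - move=> S mS S0.
    have : (\int[lam]_(x in S `|` ~` S) (w x)%:E = \int[lam]_(x in S) (w x)%:E + \int[lam]_(x in ~` S) (w x)%:E)%E.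
      apply: integral_setU => //; first exact: measurableC.
        by apply: measurable_funTS; exact/measurable_EFinP.
      by apply/disj_setPRL.
    rewrite S0 add0e => <-; rewrite setUv.
    apply: indE => //; apply: (lim_box (fun n => \1_(ball_box n))).
    + by move=> n; apply: measurable_indic; exact: measurable_obox.
    + by move=> n x; rewrite indicE; case: (_ \in _); rewrite ?lexx ler01.
    + move=> x; rewrite indicT; apply: cvg_near_cst.
      by apply: filterS (ball_box_cover x) => n xn; rewrite indicE mem_set.
    + by move=> n; exact: box0.
  - move=> F mF tF F0; rewrite integral_bigcup//; first by apply: eseries0 => n _ _; exact: F0.
    by apply: integrableS Lw => //; exact: bigcup_measurable.
have : ae_eq lam setT (EFin \o w) (cst 0%E).
  apply: integral_ae_eq => // E _ mE; rewrite all0//.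
  by rewrite integral0.
by apply: filterS => x /(_ I) [].
Qed.

End fundamental.

Section tensor.
Context d1 d2 (T1 : measurableType d1) (T2 : measurableType d2) (R : realType).
Variables (m1 : {sigma_finite_measure set T1 -> \bar R}) (m2 : {sigma_finite_measure set T2 -> \bar R}).

Lemma intble_tensor (f : T1 -> R) (g : T2 -> R) :
  m1.-integrable setT (EFin \o f) -> m2.-integrable setT (EFin \o g) ->
  (m1 \x m2)%E.-integrable setT (EFin \o (fun z => f z.1 * g z.2)).
Proof.
move=> /intbleP[mf foo] /intbleP[mg goo].
have mf' : measurable_fun setT (fun x => `|f x|%:E) by apply/measurable_EFinP/measurableT_comp.
have mg' : measurable_fun setT (fun x => `|g x|%:E) by apply/measurable_EFinP/measurableT_comp.
apply: intble_prod12.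
  by apply: measurable_funM; exact: measurableT_comp.
rewrite (_ : (\int[m1]_x _)%E = (\int[m1]_x (`|f x|%:E * \int[m2]_y `|g y|%:E))%E); last first.
  apply: eq_integral => x _; rewrite -ge0_integralZl//.
  by apply: eq_integral => y _; rewrite normrM EFinM.
rewrite ge0_integralZr//; last exact: integral_ge0.
by rewrite lte_mul_pinfty//; [exact: integral_ge0|rewrite ge0_fin_numE//; exact: integral_ge0].
Qed.

End tensor.

Lemma Rintegral_eq0 d (T : measurableType d) (R : realType) (mu : {measure set T -> \bar R}) (f : T -> R) :
  (forall x, f x = 0) -> \int[mu]_x f x = 0.
Proof.
move=> f0; rewrite /Rintegral (_ : integral _ _ _ = 0%E)//.
by apply: integral0_eq => x _; rewrite f0.
Qed.

Lemma intbleM_boundedl d (T : measurableType d) (R : realType) (mu : {measure set T -> \bar R}) (f g : T -> R) (C : R) :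
  mu.-integrable setT (EFin \o f) -> measurable_fun setT g -> (forall x, `|g x| <= C) ->
  mu.-integrable setT (EFin \o (fun x => g x * f x)).
Proof.
move=> intf mg gC; have := intbleM_bounded intf mg gC.
by apply: eq_integrable => // x _ /=; rewrite mulrC.
Qed.
Lemma eq_leW disp (T : porderType disp) (x y : T) : x = y -> (x <= y)%O.
Proof. by move=> ->. Qed.

Section derive_under_integral.
Context d (T : measurableType d) (R : realType) (mu : {measure set T -> \bar R}).

(** Domination is asked for within distance 1 only, because a Gaussian translated by h is bounded by
    one wider Gaussian uniformly in |h| <= 1, but not uniformly in all h. *)
Lemma is_derive_Rintegral (f f' : R -> T -> R) (a : R) (G : T -> R) :
  (forall x, `|x - a| < 1 -> mu.-integrable setT (EFin \o f x)) ->
  (forall x y, `|x - a| < 1 -> is_derive x 1 (f ^~ y) (f' x y)) ->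
  (forall x y, `|x - a| < 1 -> `|f' x y| <= G y) ->
  mu.-integrable setT (EFin \o G) ->
  is_derive a 1 (fun x => \int[mu]_y f x y) (\int[mu]_y f' a y).
Proof.
move=> intf df f'G intG.
have I x : `]a - 1, a + 1[%classic x -> `|x - a| < 1.
  by rewrite /= in_itv/= => /andP[h1 h2]; rewrite ltr_norml ltrBrDr addrC h1/= ltrBlDl.
have Ia : `]a - 1, a + 1[%classic a by rewrite /= in_itv/=; lra.
have dE x y : `|x - a| < 1 -> partial1of2 f x y = f' x y.
  by move=> /(df _ y) D; rewrite partial1of2E; case: D.
have G0 y : 0 <= G y by apply: le_trans (f'G a y _); rewrite ?subrr ?normr0.
have H1 x : `]a - 1, a + 1[%classic x -> mu.-integrable setT (EFin \o f x) by move=> /I; exact: intf.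
have H2 x y : `]a - 1, a + 1[%classic x -> setT y -> derivable (f ^~ y) x 1.
  by move=> /I xa _; case: (df x y xa).
have H3 x y : `]a - 1, a + 1[%classic x -> setT y -> `|partial1of2 f x y| <= G y.
  by move=> /I xa _; rewrite dE//; exact: f'G.
split; first exact: (derivable_under_integral measurableT Ia H1 H2 G0 intG H3).
rewrite -derive1E (differentiation_under_integral measurableT Ia H1 H2 G0 intG H3).
by apply: eq_Rintegral => y _; rewrite dE// subrr normr0.
Qed.

End derive_under_integral.

(** * Gaussian densities *)

Section gaussian1.
Context {R : realType}.
Local Notation mu := (@lebesgue_measure R).

(** The centred normal density of variance 1/(2k). With this parameter its Fourier transform is
    exp(-p^2/(4k)). *)
Definition gauss1 (k x : R) : R := (k / pi) `^ 2^-1 * expR (- (k * x ^+ 2)).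

Let pin0 : pi != 0 :> R. Proof. by rewrite gt_eqF// pi_gt0. Qed.

Lemma gauss1_ge0 k x : 0 <= gauss1 k x.
Proof. by rewrite mulr_ge0 ?expR_ge0 ?powR_ge0. Qed.

Lemma gauss1_normal k : 0 < k -> gauss1 k = normal_pdf 0 (Num.sqrt (2 * k)^-1).
Proof.
move=> k0; have s0 : 0 < Num.sqrt (2 * k)^-1 by rewrite sqrtr_gt0 invr_gt0 mulr_gt0.
apply/funext => x; rewrite normal_pdfE ?gt_eqF// /normal_peak /normal_fun /gauss1.
rewrite sqr_sqrtr ?invr_ge0 ?mulr_ge0 ?ltW//.
rewrite subr0 powR12_sqrt ?divr_ge0 ?pi_ge0 ?ltW//; congr (_ * expR _); last by field; exact: lt0r_neq0.
rewrite -sqrtrV; last by rewrite mulrn_wge0// mulr_ge0 ?pi_ge0// invr_ge0 mulr_ge0// ltW.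
by congr Num.sqrt; move: pi pin0 => P P0; field; rewrite P0 gt_eqF.
Qed.

Lemma integral_gauss1 k : 0 < k -> (\int[mu]_x (gauss1 k x)%:E = 1)%E.
Proof. by move=> k0; rewrite gauss1_normal// integral_normal_pdf. Qed.

Lemma intble_gauss1 k : 0 < k -> mu.-integrable setT (EFin \o gauss1 k).
Proof. by move=> k0; rewrite gauss1_normal//; exact: integrable_normal_pdf. Qed.

Lemma measurable_gauss1 d (T : measurableType d) (k x : T -> R) :
  measurable_fun setT k -> measurable_fun setT x ->
  measurable_fun setT (fun t => gauss1 (k t) (x t)).
Proof.
move=> mk mx; apply: measurable_funM.
  apply: (measurableT_comp (measurable_powR _)).
  by apply: measurable_funM.
apply: (measurableT_comp (@measurable_expR R)); apply: measurable_funN.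
by apply: measurable_funM => //; exact: measurable_funX.
Qed.

Lemma is_derive_gauss1 (k x : R) : is_derive x 1 (gauss1 k) (- (2 * k * x * gauss1 k x)).
Proof.
have D0 : is_derive x 1 (fun x : R => - (k * x ^+ 2)) (- (k * (2 * x))).
  have D := is_deriveN (is_deriveZ k (is_deriveX 1 (is_derive_id x (1 : R)))).
  by apply: is_derive_eq; rewrite /GRing.scale/=; ring.
have D2 := @is_derive1_comp _ expR (fun x => - (k * x ^+ 2)) _ _ _ (is_derive_expR _) D0.
have D3 := is_deriveZ ((k / pi) `^ 2^-1) D2.
by apply: is_derive_eq; rewrite /GRing.scale/= /gauss1; ring.
Qed.

Let exp_bound (y : R) : 0 <= y -> Num.sqrt y * expR (- y) <= 1.
Proof.
move=> y0; rewrite expRN ler_pdivrMr ?expR_gt0// mul1r.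
have h1 : 1 + y <= expR y by exact: expR_ge1Dx.
have [y1|y1] := leP y 1.
  by apply: le_trans h1; rewrite (@le_trans _ _ 1)// ?lerDl// -sqrtr1 ler_wsqrtr.
apply: le_trans h1; rewrite (@le_trans _ _ y)// ?lerDr//.
rewrite -[leRHS]sqr_sqrtr// expr2 ler_peMr ?sqrtr_ge0// -[leLHS]sqrtr1 ler_wsqrtr// ltW//.
Qed.

(* [s exp (- s ^ 2) <= 1] with [s = sqrt (k / 2) |x|]; half of the exponent is kept. *)
Lemma gauss1_grad_bound k x : 0 < k ->
  `|2 * k * x * gauss1 k x| <= 4 * k `^ 2^-1 * gauss1 (k / 2) x.
Proof.
move=> k0.
have k20 : 0 < k / 2 by rewrite divr_gt0.
have := @exp_bound (k / 2 * x ^+ 2) (mulr_ge0 (ltW k20) (sqr_ge0 x)).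
rewrite (sqrtrM _ (ltW k20)) sqrtr_sqr => H.
have E1 : gauss1 k x = Num.sqrt 2 * gauss1 (k / 2) x * expR (- (k / 2 * x ^+ 2)).
  rewrite /gauss1 -!mulrA -expRD mulrA; congr (_ * expR _); last by field.
  rewrite !powR12_sqrt ?mulr_ge0 ?invr_ge0 ?pi_ge0 ?ltW// -sqrtrM//; congr Num.sqrt.
  by move: pi pin0 => P P0; field.
have E2 : `|2 * k * x * gauss1 k x| = 4 * k `^ 2^-1 * gauss1 (k / 2) x *
    (Num.sqrt (k / 2) * `|x| * expR (- (k / 2 * x ^+ 2))).
  rewrite E1; move: (gauss1 _ _) (gauss1_ge0 (k / 2) x) => g g0.
  rewrite !normrM (ger0_norm g0) (ger0_norm (expR_ge0 _)).
  rewrite (ger0_norm (sqrtr_ge0 _)) (ger0_norm (ltW k0)) (ger0_norm (ler0n R 2)).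
  rewrite (powR12_sqrt (ltW k0)).
  have -> : Num.sqrt k = Num.sqrt 2 * Num.sqrt (k / 2).
    by rewrite -(@sqrtrM _ 2)//; congr Num.sqrt; field.
  have H2 : Num.sqrt (k / 2) * Num.sqrt (k / 2) = k / 2 by rewrite -expr2 sqr_sqrtr// ltW.
  have -> : 2 * k = 4 * (k / 2) by field.
  rewrite -{1}H2; ring.
by rewrite E2 ler_piMr// !mulr_ge0 ?powR_ge0 ?gauss1_ge0.
Qed.

(* [(x + h) ^ 2 >= x ^ 2 / 2 - h ^ 2] *)
Lemma gauss1_shift_bound k x h : 0 < k -> `|h| <= 1 ->
  gauss1 k (x + h) <= Num.sqrt 2 * expR k * gauss1 (k / 2) x.
Proof.
move=> k0 h1.
have -> : Num.sqrt 2 * expR k * gauss1 (k / 2) x = (k / pi) `^ 2^-1 * expR (k - k / 2 * x ^+ 2).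
  rewrite /gauss1 expRD !powR12_sqrt ?divr_ge0 ?pi_ge0 ?ltW ?divr_gt0//.
  have -> : k / pi = 2 * (k / 2 / pi).
    by move: pi pin0 => P P0; field.
  rewrite (@sqrtrM _ 2)//; ring.
rewrite ler_wpM2l ?powR_ge0// ler_expR.
have h2 : h ^+ 2 <= 1 by rewrite -real_normK ?num_real// exprn_ile1.
have -> : k - k / 2 * x ^+ 2 = k * (1 - x ^+ 2 / 2) by field.
rewrite -mulrN ler_pM2l//.
have : 0 <= (x / 2 + h) ^+ 2 by exact: sqr_ge0.
nra.
Qed.

Lemma Rintegral_flip1 (f : R -> R) b v : measurable_fun setT f ->
  \int[mu]_x f (flip b v x) = \int[mu]_x f x.
Proof.
move=> mf; rewrite /Rintegral; congr fine; rewrite integralE [RHS]integralE.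
have mf' : measurable_fun setT (EFin \o f) by exact/measurable_EFinP.
congr (_ - _)%E.
  rewrite -[RHS](ge0_integral_flip b v (measurable_funepos mf')) => [|x]; last exact: funepos_ge0.
  by apply: eq_integral => x _; rewrite !funeposE.
rewrite -[RHS](ge0_integral_flip b v (measurable_funeneg mf')) => [|x]; last exact: funeneg_ge0.
by apply: eq_integral => x _; rewrite !funenegE.
Qed.

Let grad_bound' (k x : R) : 0 < k -> `|x * gauss1 k x| <= 2 / k * k `^ 2^-1 * gauss1 (k / 2) x.
Proof.
move=> k0; have := gauss1_grad_bound x k0.
have -> : 2 * k * x * gauss1 k x = (2 * k) * (x * gauss1 k x) by ring.
have k2 : 0 < 2 * k by rewrite mulr_gt0.
rewrite normrM (gtr0_norm k2) mulrC -ler_pdivlMr//; move/le_trans; apply.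
by apply: eq_leW; field; rewrite gt_eqF.
Qed.

Section fourier1.
Variables (k : R) (k0 : 0 < k).

Let k20 : 0 < k / 2. Proof. by rewrite divr_gt0. Qed.
Let k40 : 0 < k / 2 / 2. Proof. by rewrite divr_gt0. Qed.

Let mc (q : R) : measurable_fun setT (fun x : R => cos (q * x)).
Proof.
apply: continuous_measurable_fun => x; apply: (continuous_comp (f := *%R q)); last exact: continuous_cos.
exact: mulrl_continuous.
Qed.

Let ms (q : R) : measurable_fun setT (fun x : R => sin (q * x)).
Proof.
apply: continuous_measurable_fun => x; apply: (continuous_comp (f := *%R q)); last exact: continuous_sin.
exact: mulrl_continuous.
Qed.

Let ic (q : R) : mu.-integrable setT (EFin \o (fun x : R => cos (q * x) * gauss1 k x)).
Proof.
under [X in _ \o X]eq_fun do rewrite mulrC.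
by apply: (intbleM_bounded (C := 1)) => [||x]; [exact: intble_gauss1|exact: mc|rewrite ler_norml cos_geN1 cos_le1].
Qed.

Let is_ (q : R) : mu.-integrable setT (EFin \o (fun x : R => sin (q * x) * gauss1 k x)).
Proof.
under [X in _ \o X]eq_fun do rewrite mulrC.
by apply: (intbleM_bounded (C := 1)) => [||x]; [exact: intble_gauss1|exact: ms|rewrite ler_norml sin_geN1 sin_le1].
Qed.

Lemma fourier_gauss1_sin p : \int[mu]_x (sin (p * x) * gauss1 k x) = 0.
Proof.
have := @Rintegral_flip1 (fun x => sin (p * x) * gauss1 k x) true 0 (intble_measurable (is_ p)).
have -> : (fun x => sin (p * flip true 0 x) * gauss1 k (flip true 0 x)) =
    (fun x => (- 1) * (sin (p * x) * gauss1 k x)).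
  apply/funext => x; rewrite /flip expr1 add0r mulN1r mulrN sinN /gauss1 sqrrN; ring.
rewrite RintegralZl//; lra.
Qed.

Let E q := \int[mu]_x (cos (q * x) * gauss1 k x).

Let dE (q : R) : is_derive q 1 E (\int[mu]_x (- (x * sin (q * x) * gauss1 k x))).
Proof.
apply: (@is_derive_Rintegral _ _ R mu (fun q x => cos (q * x) * gauss1 k x)
   (fun q x => - (x * sin (q * x) * gauss1 k x)) q
   (fun x => 2 / k * k `^ 2^-1 * gauss1 (k / 2) x)).
- by move=> x _; exact: ic.
- move=> x y _.
  have D := @is_derive1_comp _ cos (fun q => q * y) x _ _ (is_derive_cos _) (is_deriveM (is_derive_id x (1:R)) (is_derive_cst y x (1:R))).
  have D2 := is_deriveM D (is_derive_cst (gauss1 k y) x (1:R)).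
  by apply: is_derive_eq; rewrite /GRing.scale/=; ring.
- move=> x y _; rewrite normrN -mulrA mulrCA mulrA -mulrA.
  rewrite normrM (le_trans _ (grad_bound' y k0))// ler_piMl// ler_norml sin_geN1 sin_le1//.
- by have := integrableZl measurableT (2 / k * k `^ 2^-1) (intble_gauss1 k20).
Qed.

(** An integration by parts obtained from translation invariance: the integral of sin(q(x+h))
    [gauss1 k] (x+h) over x is constant in h, and its derivative at h = 0, taken under the integral
    sign, is therefore 0. *)
Let parts q : \int[mu]_x (- (x * sin (q * x) * gauss1 k x)) = - (q / (2 * k)) * E q.
Proof.
pose F h x := sin (q * (x + h)) * gauss1 k (x + h).
pose F' h x := q * cos (q * (x + h)) * gauss1 k (x + h) - sin (q * (x + h)) * (2 * k * (x + h) * gauss1 k (x + h)).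
have flE h x : x + h = flip false h x by rewrite /flip expr0 mul1r addrC.
have cF h : \int[mu]_x F h x = \int[mu]_x (sin (q * x) * gauss1 k x).
  rewrite -[RHS](@Rintegral_flip1 _ false h); last exact: intble_measurable (is_ q).
  by apply: eq_Rintegral => x _; rewrite -flE.
have sqrt2_0 : 0 <= Num.sqrt 2 :> R by exact: sqrtr_ge0.
have D : is_derive (0 : R) 1 (fun h => \int[mu]_x F h x) (\int[mu]_x F' 0 x).
  apply: (@is_derive_Rintegral _ _ R mu F F' 0 (fun x => `|q| * (Num.sqrt 2 * expR k * gauss1 (k / 2) x) +
     4 * k `^ 2^-1 * (Num.sqrt 2 * expR (k / 2) * gauss1 (k / 2 / 2) x))).
  - move=> h _; apply/intbleP; split.
      have -> : F h = (fun x => sin (q * x) * gauss1 k x) \o flip false h.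
        by apply/funext => x; rewrite /F flE.
      apply: measurableT_comp; last exact: measurable_flip.
      exact: intble_measurable (is_ q).
    have /intbleP[m1 f1] := is_ q; apply: le_lt_trans f1.
    have mn : measurable_fun setT (fun x : R => `|sin (q * x) * gauss1 k x|%:E).
      by apply/measurable_EFinP; exact: (measurableT_comp (@normr_measurable R setT) m1).
    rewrite -(ge0_integral_flip false h mn)//.
    by apply: eq_leW; apply: eq_integral => x _; rewrite /F flE.
  - move=> h x _; rewrite /F /F'.
    have D0 : is_derive h 1 (fun h : R => q * (x + h)) q.
      have D := is_deriveZ q (is_deriveD (is_derive_cst x h (1:R)) (is_derive_id h (1:R))).
      by apply: is_derive_eq; rewrite /GRing.scale/= add0r mulr1.
    have D1 : is_derive h 1 (fun h : R => x + h) 1.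
      have D := is_deriveD (is_derive_cst x h (1:R)) (is_derive_id h (1:R)).
      by apply: is_derive_eq; rewrite add0r.
    have D2 := @is_derive1_comp _ sin (fun h => q * (x + h)) h _ _ (is_derive_sin _) D0.
    have D3 := @is_derive1_comp _ (gauss1 k) (fun h => x + h) h _ _ (is_derive_gauss1 _ _) D1.
    have D4 := is_deriveM D2 D3.
    by apply: is_derive_eq; rewrite /GRing.scale/=; ring.
  - move=> h x; rewrite subr0 => /ltW h1; rewrite /F' (le_trans (ler_normB _ _))// lerD//.
      rewrite normrM (ger0_norm (gauss1_ge0 _ _)) normrM -mulrA ler_wpM2l//.
      apply: (@le_trans _ _ (gauss1 k (x + h))); last exact: gauss1_shift_bound.
      by rewrite ler_piMl ?gauss1_ge0// ler_norml cos_geN1 cos_le1.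
    rewrite normrM; apply: (@le_trans _ _ `|2 * k * (x + h) * gauss1 k (x + h)|).
      by rewrite ler_piMl// ler_norml sin_geN1 sin_le1.
    apply: (le_trans (gauss1_grad_bound _ k0)).
    by rewrite ler_wpM2l ?mulr_ge0 ?powR_ge0//; exact: gauss1_shift_bound.
  - have I1 := integrableZl measurableT `|q| (integrableZl measurableT (Num.sqrt 2 * expR k) (intble_gauss1 k20)).
    have I2 := integrableZl measurableT (4 * k `^ 2^-1) (integrableZl measurableT (Num.sqrt 2 * expR (k / 2)) (intble_gauss1 k40)).
    exact: integrableD I1 I2.
have : \int[mu]_x F' 0 x = 0.
  have D' : is_derive (0 : R) 1 (fun h => \int[mu]_x F h x) 0.
    under eq_fun do rewrite cF.
    exact: is_derive_cst.
  by case: D => _ <-; case: D'.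
have i1 : mu.-integrable setT (EFin \o (fun x => q * (cos (q * x) * gauss1 k x))).
  exact: (integrableZl measurableT q (ic q)).
have i2 : mu.-integrable setT (EFin \o (fun x => - (x * sin (q * x) * gauss1 k x))).
  apply: (@intble_le _ _ R mu (fun x => - (x * sin (q * x) * gauss1 k x)) (fun x => 2 / k * k `^ 2^-1 * gauss1 (k / 2) x)).
  - apply: measurable_funN; apply: measurable_funM; last exact: measurable_gauss1.
    by apply: measurable_funM => //; exact: ms.
  - move=> x; rewrite normrN -mulrA mulrCA mulrA -mulrA.
    by rewrite normrM (le_trans _ (grad_bound' x k0))// ler_piMl// ler_norml sin_geN1 sin_le1.
  - exact: (integrableZl measurableT (2 / k * k `^ 2^-1) (intble_gauss1 k20)).
have -> : F' 0 = (fun x => q * (cos (q * x) * gauss1 k x) + (2 * k) * (- (x * sin (q * x) * gauss1 k x))).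
  by apply/funext => x; rewrite /F' addr0; ring.
rewrite RintegralD//; last exact: (integrableZl measurableT (2 * k) i2).
rewrite RintegralZl// RintegralZl//.
rewrite -/(E q); move: (E q) (Rintegral _ _ _) => e s h.
have -> : s = - (q / (2 * k)) * e + (q * e + 2 * k * s) / (2 * k) by field; rewrite gt_eqF.
by rewrite h mul0r addr0.
Qed.

(** By [dE] and [parts] the transform E solves E'(q) = - q/(2k) E(q), so that E(q) exp(q^2/(4k)) is
    constant; at q = 0 it is the mass of the Gaussian. *)
Lemma fourier_gauss1_cos p : \int[mu]_x (cos (p * x) * gauss1 k x) = expR (- (p ^+ 2 / (4 * k))).
Proof.
rewrite -/(E p).
have D (q : R) : is_derive q 1 (fun q => E q * expR (q ^+ 2 / (4 * k))) 0.
  have D0 : is_derive q 1 (fun q : R => q ^+ 2 / (4 * k)) (q / (2 * k)).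
    have D := is_deriveM (is_deriveX 1 (is_derive_id q (1 : R))) (is_derive_cst (4 * k)^-1 q (1 : R)).
    by apply: is_derive_eq; rewrite /GRing.scale/=; field; rewrite gt_eqF.
  have D1 := @is_derive1_comp _ expR (fun q => q ^+ 2 / (4 * k)) q _ _ (is_derive_expR _) D0.
  have D2 := is_deriveM (dE q) D1.
  by apply: is_derive_eq; rewrite /GRing.scale/= parts; ring.
have := is_derive_0_is_cst p 0 D.
have -> : E 0 = 1.
  rewrite /E /Rintegral; under eq_integral do rewrite mul0r cos0 mul1r.
  by rewrite integral_gauss1.
rewrite expr0n/= mul0r expR0 mulr1 => H.
have e0 : expR (p ^+ 2 / (4 * k)) != 0 by rewrite gt_eqF ?expR_gt0.
by apply: (mulIf e0); rewrite H expRN mulVf.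
Qed.

End fourier1.

End gaussian1.

Section cons_rV_theory.
Context {R : realType}.

Lemma cons_rV0 n (x : R) (v : 'rV[R]_n) : cons_rV (x, v) ord0 ord0 = x.
Proof.
have := @row_mxEl R 1 1 n (const_mx x) v ord0 ord0; rewrite [X in _ = X]mxE => {2}<-; rewrite /cons_rV.
by congr (row_mx _ _ _ _); exact/val_inj.
Qed.

Lemma cons_rVS n (x : R) (v : 'rV[R]_n) i : cons_rV (x, v) ord0 (lift ord0 i) = v ord0 i.
Proof.
have := @row_mxEr R 1 1 n (const_mx x) v ord0 i; rewrite /cons_rV => <-.
by congr (row_mx _ _ _ _); exact/val_inj.
Qed.

Lemma Rintegral_rVS n (f : 'rV[R]_n.+1 -> R) : L1 f ->
  (@lebesgue_measure R \x lebesgue_rV R n)%E.-integrable setT (EFin \o (fun z => f (cons_rV z))) /\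
  \int[lebesgue_rV R n.+1]_x f x =
    \int[lebesgue_measure]_x \int[lebesgue_rV R n]_y f (cons_rV (x, y)).
Proof.
move=> Lf; have mf := intble_measurable Lf.
have mfc : measurable_fun setT (fun z => f (cons_rV z)).
  by apply: measurableT_comp => //; exact: measurable_cons_rV.
have I : (@lebesgue_measure R \x lebesgue_rV R n)%E.-integrable setT (EFin \o (fun z => f (cons_rV z))).
  apply: intble_prod12 => //.
  rewrite -(@ge0_integral_rVS _ n (fun x => `|f x|%:E))//; last first.
    by apply/measurable_EFinP; exact: measurableT_comp.
  by have /intbleP[] := Lf.
split=> //; rewrite (Rfubini12 I) /Rintegral; congr fine.
rewrite -[RHS](@integral_pushforward _ _ _ _ R (@cons_rV R n) (@measurable_cons_rV R n) _ setT (EFin \o f))//.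
exact/measurable_EFinP.
Qed.

Lemma dotR_cons n (p : 'rV[R]_n.+1) x v :
  dotR p (cons_rV (x, v)) = p ord0 ord0 * x + dotR (uncons_rV p).2 v.
Proof.
rewrite /dotR big_ord_recl cons_rV0; congr (_ + _); apply: eq_bigr => i _.
rewrite cons_rVS /uncons_rV /= mxE; congr (p _ _ * _); exact/val_inj.
Qed.

End cons_rV_theory.

Section gaussian_rV.
Context {R : realType}.

Definition gaussv n (k : R) (y : 'rV[R]_n) : R := \prod_(i < n) gauss1 k (y ord0 i).

Lemma gaussv_ge0 n k (y : 'rV[R]_n) : 0 <= gaussv k y.
Proof. by apply: prodr_ge0 => i _; exact: gauss1_ge0. Qed.

Lemma gaussv_cons n k x (v : 'rV[R]_n) : gaussv k (cons_rV (x, v)) = gauss1 k x * gaussv k v.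
Proof.
by rewrite /gaussv big_ord_recl cons_rV0; under [in LHS]eq_bigr do rewrite cons_rVS.
Qed.

Lemma measurable_gaussv d (T : measurableType d) n (k : T -> R) (y : T -> 'rV[R]_n) :
  measurable_fun setT k -> measurable_fun setT y ->
  measurable_fun setT (fun t => gaussv (k t) (y t)).
Proof.
move=> mk my; apply: measurable_prod => i _; apply: measurable_gauss1 => //.
by apply: (measurableT_comp (@measurable_rV_coord R n i) my).
Qed.

Lemma measurable_gaussv1 n (k : R) : measurable_fun setT (@gaussv n k).
Proof. exact: measurable_gaussv. Qed.

Lemma integral_gaussv n k : 0 < k -> (\int[lebesgue_rV R n]_y (gaussv k y)%:E = 1)%E.
Proof.
move=> k0; elim: n => [|n IH].
  rewrite /= integral_dirac//; last by apply/measurable_EFinP; exact: measurable_gaussv1.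
  by rewrite diracT mul1e /gaussv big_ord0.
rewrite ge0_integral_rVS; last 2 first.
- by apply/measurable_EFinP; exact: measurable_gaussv1.
- by move=> y; rewrite lee_fin gaussv_ge0.
rewrite -[RHS](integral_gauss1 k0); apply: eq_integral => x _.
under eq_integral do rewrite gaussv_cons EFinM.
rewrite ge0_integralZl//; first by rewrite IH mule1.
- by apply/measurable_EFinP; exact: measurable_gaussv1.
- by move=> y _; rewrite lee_fin gaussv_ge0.
- by rewrite lee_fin gauss1_ge0.
Qed.

Lemma L1_gaussv n k : 0 < k -> L1 (@gaussv n k).
Proof.
move=> k0; apply/intbleP; split; first exact: measurable_gaussv1.
under eq_integral do rewrite ger0_norm ?gaussv_ge0//.
by rewrite integral_gaussv// ltry.
Qed.

Lemma Rintegral_gaussv n k : 0 < k -> \int[lebesgue_rV R n]_y gaussv k y = 1.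
Proof. by move=> k0; rewrite /Rintegral integral_gaussv. Qed.

Lemma measurable_dotR n (p : 'rV[R]_n) : measurable_fun setT (dotR p).
Proof.
apply: measurable_sum => i; apply: measurable_funM => //.
exact: (@measurable_rV_coord R n i).
Qed.

Lemma measurable_cosR : measurable_fun setT (@cos R).
Proof. exact: (continuous_measurable_fun (@continuous_cos R)). Qed.

Lemma measurable_sinR : measurable_fun setT (@sin R).
Proof. exact: (continuous_measurable_fun (@continuous_sin R)). Qed.

Lemma cos_norm_le1 (x : R) : `|cos x| <= 1.
Proof. by rewrite ler_norml cos_geN1 cos_le1. Qed.

Lemma sin_norm_le1 (x : R) : `|sin x| <= 1.
Proof. by rewrite ler_norml sin_geN1 sin_le1. Qed.

Lemma L1_cosM n (p : 'rV[R]_n) u : L1 u -> L1 (fun y => cos (dotR p y) * u y).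
Proof.
move=> Lu; rewrite (_ : (fun y => _) = (fun y => u y * cos (dotR p y))); last first.
  by apply/funext => y; rewrite mulrC.
apply: (intbleM_bounded (C := 1)) => // [|x]; last exact: cos_norm_le1.
by apply: (measurableT_comp measurable_cosR); exact: measurable_dotR.
Qed.

Lemma L1_sinM n (p : 'rV[R]_n) u : L1 u -> L1 (fun y => sin (dotR p y) * u y).
Proof.
move=> Lu; rewrite (_ : (fun y => _) = (fun y => u y * sin (dotR p y))); last first.
  by apply/funext => y; rewrite mulrC.
apply: (intbleM_bounded (C := 1)) => // [|x]; last exact: sin_norm_le1.
by apply: (measurableT_comp measurable_sinR); exact: measurable_dotR.
Qed.

(** By induction on the dimension. The addition formulas separate the first coordinate from the
    others, and every term with a sine integral vanishes. *)
Lemma fourier_gaussv n k (p : 'rV[R]_n) : 0 < k ->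
  \int[lebesgue_rV R n]_y (cos (dotR p y) * gaussv k y) = expR (- (dotR p p / (4 * k))) /\
  \int[lebesgue_rV R n]_y (sin (dotR p y) * gaussv k y) = 0.
Proof.
move=> k0; elim: n p => [|n IH] p.
  rewrite /= /Rintegral !integral_dirac//; last 2 first.
  - by apply/measurable_EFinP/measurable_funM; [apply: (measurableT_comp measurable_sinR); exact: measurable_dotR|exact: measurable_gaussv1].
  - by apply/measurable_EFinP/measurable_funM; [apply: (measurableT_comp measurable_cosR); exact: measurable_dotR|exact: measurable_gaussv1].
  by rewrite diracT !mul1e/= /gaussv /dotR !big_ord0 mul0r oppr0 expR0 cos0 sin0 mul1r mul0r.
have Lg m := @L1_gaussv m _ k0.
set p' := (uncons_rV p).2; have [IHc IHs] := IH p'.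
have [_ ->] := Rintegral_rVS (L1_cosM p (Lg _)).
have [_ ->] := Rintegral_rVS (L1_sinM p (Lg _)).
have pp : dotR p p = p ord0 ord0 ^+ 2 + dotR p' p'.
  rewrite /dotR big_ord_recl expr2; congr (_ + _); apply: eq_bigr => i _.
  by rewrite /p' /uncons_rV/= mxE; congr (p _ _ * p _ _); exact/val_inj.
have mu_c : lebesgue_measure.-integrable setT (EFin \o (fun x : R => cos (p ord0 ord0 * x) * gauss1 k x)).
  rewrite (_ : (fun x => _) = (fun x : R => gauss1 k x * cos (p ord0 ord0 * x))); last by apply/funext => x; rewrite mulrC.
  apply: (intbleM_bounded (C := 1)) => [||x]; [exact: intble_gauss1| |exact: cos_norm_le1].
  by apply: (measurableT_comp measurable_cosR); exact: measurable_funM.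
have mu_s : lebesgue_measure.-integrable setT (EFin \o (fun x : R => sin (p ord0 ord0 * x) * gauss1 k x)).
  rewrite (_ : (fun x => _) = (fun x : R => gauss1 k x * sin (p ord0 ord0 * x))); last by apply/funext => x; rewrite mulrC.
  apply: (intbleM_bounded (C := 1)) => [||x]; [exact: intble_gauss1| |exact: sin_norm_le1].
  by apply: (measurableT_comp measurable_sinR); exact: measurable_funM.
set ec := expR (- (dotR p' p' / (4 * k))) in IHc *.
split.
- transitivity (\int[lebesgue_measure]_x (ec * (cos (p ord0 ord0 * x) * gauss1 k x))); last first.
    rewrite RintegralZl// fourier_gauss1_cos// -expRD pp; congr expR; field; exact: lt0r_neq0.
  apply: eq_Rintegral => x _.
  transitivity (\int[lebesgue_rV R n]_y (cos (p ord0 ord0 * x) * gauss1 k x * (cos (dotR p' y) * gaussv k y) -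
     sin (p ord0 ord0 * x) * gauss1 k x * (sin (dotR p' y) * gaussv k y))).
    by apply: eq_Rintegral => y _; rewrite dotR_cons gaussv_cons cosD -/p'; ring.
  rewrite RintegralB//; last 2 first.
  - exact: (integrableZl measurableT _ (L1_cosM p' (Lg _))).
  - exact: (integrableZl measurableT _ (L1_sinM p' (Lg _))).
  rewrite !RintegralZl//; [|exact: L1_sinM|exact: L1_cosM].
  by rewrite IHc IHs mulr0 subr0 mulrC.
- transitivity (\int[lebesgue_measure]_x (ec * (sin (p ord0 ord0 * x) * gauss1 k x))); last first.
    by rewrite RintegralZl// fourier_gauss1_sin// mulr0.
  apply: eq_Rintegral => x _.
  transitivity (\int[lebesgue_rV R n]_y (sin (p ord0 ord0 * x) * gauss1 k x * (cos (dotR p' y) * gaussv k y) +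
     cos (p ord0 ord0 * x) * gauss1 k x * (sin (dotR p' y) * gaussv k y))).
    by apply: eq_Rintegral => y _; rewrite dotR_cons gaussv_cons sinD -/p'; ring.
  rewrite RintegralD//; last 2 first.
  - exact: (integrableZl measurableT _ (L1_cosM p' (Lg _))).
  - exact: (integrableZl measurableT _ (L1_sinM p' (Lg _))).
  rewrite !RintegralZl//; [|exact: L1_sinM|exact: L1_cosM].
  by rewrite IHc IHs mulr0 addr0 mulrC.
Qed.

Section derivatives.
Variables (n : nat) (k : R).
Local Notation e_ i := (delta_mx ord0 i : 'rV[R]_n).

Lemma is_derive_gaussv i (y : 'rV[R]_n) :
  is_derive y (e_ i) (gaussv k) (- (2 * k * y ord0 i * gaussv k y)).
Proof.
apply/is_derive_line0.
pose c := \prod_(j < n | j != i) gauss1 k (y ord0 j).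
have E : (fun s : R => gaussv k (y + s *: e_ i)) = (fun s => gauss1 k (s + y ord0 i) * c).
  apply/funext => s; rewrite /gaussv (bigD1 i)//= !mxE !eqxx mulr1 addrC; congr (_ * _).
  by apply: eq_bigr => j ji; rewrite !mxE (negbTE ji) andbF mulr0 addr0.
rewrite E.
have D1 : is_derive (0 : R) 1 (fun s : R => s + y ord0 i) 1.
  have D := is_deriveD (is_derive_id (0:R) (1:R)) (is_derive_cst (y ord0 i) (0:R) (1:R)).
  by apply: is_derive_eq; rewrite addr0.
have D2 := @is_derive1_comp _ (gauss1 k) (fun s => s + y ord0 i) 0 _ _ (is_derive_gauss1 _ _) D1.
have D3 := is_deriveM D2 (is_derive_cst c (0:R) (1:R)).
apply: is_derive_eq; rewrite /GRing.scale/= add0r /gaussv (bigD1 i)//= -/c; ring.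
Qed.

Lemma partial_gaussv i : partial i (gaussv k) = fun y : 'rV[R]_n => - (2 * k * y ord0 i * gaussv k y).
Proof. by apply/funext => y; apply/partialE/is_derive_gaussv. Qed.

Hypothesis k0 : 0 < k.

Let gauss1_half x : gauss1 k x <= Num.sqrt 2 * gauss1 (k / 2) x.
Proof.
have k20 : 0 < k / 2 by rewrite divr_gt0.
have k1 : 0 <= k / 2 / pi by rewrite divr_ge0 ?pi_ge0// ltW.
have -> : gauss1 k x = Num.sqrt 2 * ((k / 2 / pi) `^ 2^-1 * expR (- (k * x ^+ 2))).
  rewrite /gauss1 [RHS]mulrA; congr (_ * expR _).
  have -> : k / pi = 2 * (k / 2 / pi).
    have : pi != 0 :> R by rewrite gt_eqF// pi_gt0.
    by move: pi => P P0; field.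
  rewrite !powR12_sqrt//; last exact: mulr_ge0.
  exact: (@sqrtrM _ 2).
rewrite /gauss1 ler_wpM2l ?sqrtr_ge0//.
rewrite ler_wpM2l ?powR_ge0// ler_expR lerN2 ler_wpM2r ?sqr_ge0//.
by rewrite ler_pdivrMr//; move: k0; lra.
Qed.

(** The 4 is that of [gauss1_grad_bound] in the differentiated coordinate; every other coordinate
    costs a factor sqrt 2 for halving the precision, and the exponent n - 1 is rounded up to n. *)
Definition gconst : R := 4 * Num.sqrt 2 ^+ n.

Lemma gconst_ge0 : 0 <= gconst.
Proof. by rewrite mulr_ge0// exprn_ge0// sqrtr_ge0. Qed.

Lemma partial_gaussv_bound i (y : 'rV[R]_n) :
  `|partial i (gaussv k) y| <= gconst * k `^ 2^-1 * gaussv (k / 2) y.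
Proof.
have s1 : 1 <= Num.sqrt 2 :> R by rewrite -[leLHS]sqrtr1 ler_wsqrtr// ler1n.
have s0 : 0 <= Num.sqrt 2 :> R by exact: sqrtr_ge0.
rewrite partial_gaussv normrN /gaussv (bigD1 i)//= mulrA normrM.
rewrite [X in _ * X <= _]ger0_norm; last by apply: prodr_ge0 => j _; exact: gauss1_ge0.
rewrite [in leRHS](bigD1 i)//=.
have H1 := gauss1_grad_bound (y ord0 i) k0.
have H2 : \prod_(j < n | j != i) gauss1 k (y ord0 j) <=
    Num.sqrt 2 ^+ n * \prod_(j < n | j != i) gauss1 (k / 2) (y ord0 j).
  apply: (@le_trans _ _ (\prod_(j < n | j != i) (Num.sqrt 2 * gauss1 (k / 2) (y ord0 j)))).
    by apply: ler_prod => j _; rewrite gauss1_ge0/= gauss1_half.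
  rewrite big_split/= ler_wpM2r//; first by apply: prodr_ge0 => j _; exact: gauss1_ge0.
  rewrite prodr_const; apply: ler_weXn2l => //.
  by apply: leq_trans (max_card _) _; rewrite card_ord.
apply: le_trans (ler_pM _ _ H1 H2) _ => //.
  by apply: prodr_ge0 => j _; exact: gauss1_ge0.
by apply: eq_leW; rewrite /gconst; ring.
Qed.

Lemma gaussv_shift_bound i (y : 'rV[R]_n) h : `|h| <= 1 ->
  gaussv k (y + h *: e_ i) <= Num.sqrt 2 ^+ n * expR k * gaussv (k / 2) y.
Proof.
move=> h1.
have s1 : 1 <= Num.sqrt 2 :> R by rewrite -[leLHS]sqrtr1 ler_wsqrtr// ler1n.
rewrite /gaussv (bigD1 i)//= [in leRHS](bigD1 i)//= !mxE !eqxx mulr1.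
have H1 := gauss1_shift_bound (y ord0 i) k0 h1.
have H2 : \prod_(j < n | j != i) gauss1 k ((y + h *: e_ i) ord0 j) <=
    Num.sqrt 2 ^+ n.-1 * \prod_(j < n | j != i) gauss1 (k / 2) (y ord0 j).
  apply: (@le_trans _ _ (\prod_(j < n | j != i) (Num.sqrt 2 * gauss1 (k / 2) (y ord0 j)))).
    apply: ler_prod => j ji; rewrite gauss1_ge0/= !mxE (negbTE ji) andbF mulr0 addr0.
    exact: gauss1_half.
  rewrite big_split/= prodr_const; apply: eq_leW; congr (_ ^+ _ * _).
  by rewrite cardC1 card_ord.
apply: le_trans (ler_pM _ _ H1 H2) _ => //.
- exact: gauss1_ge0.
- by apply: prodr_ge0 => j _; exact: gauss1_ge0.
apply: eq_leW; have n0 : (0 < n)%N by exact: leq_ltn_trans (ltn_ord i).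
have -> : Num.sqrt 2 ^+ n = Num.sqrt 2 * Num.sqrt 2 ^+ n.-1 :> R by rewrite -exprS prednK.
ring.
Qed.

End derivatives.

Lemma tcd_gaussv n m k (y : 'rV[R]_n) : times_cont_diff m (fun x => gaussv k (y - x)).
Proof.
apply: tcd_prod => i.
rewrite (_ : (fun x : 'rV[R]_n => _) = (fun x => gauss1 k (-1 * x ord0 i + y ord0 i))); last first.
  by apply/funext => x; rewrite !mxE mulN1r addrC.
refine (@tcd_coord R n _ (gauss1 k) i (-1) (y ord0 i) m (@gauss_stable R k) _).
by exists ((k / pi) `^ 2^-1)%:P; apply/funext => x; rewrite hornerC.
Qed.

End gaussian_rV.

Section convolution.
Context {R : realType} {n : nat}.
Local Notation V := 'rV[R]_n.
Local Notation lam := (lebesgue_rV R n).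

Lemma flipv_sub (v x : V) : flipv true v x = v - x.
Proof. by rewrite /flipv expr1 scaleN1r. Qed.

Lemma flipv_add (v x : V) : flipv false v x = x + v.
Proof. by rewrite /flipv expr0 scale1r addrC. Qed.

Lemma measurable_sub (v : V) : measurable_fun setT (fun x : V => v - x).
Proof. by under eq_fun do rewrite -flipv_sub; exact: measurable_flipv. Qed.

Lemma measurable_add (v : V) : measurable_fun setT (fun x : V => x + v).
Proof. by under eq_fun do rewrite -flipv_add; exact: measurable_flipv. Qed.

Lemma Rintegral_sub (v : V) (f : V -> R) : measurable_fun setT f ->
  \int[lam]_x f (v - x) = \int[lam]_x f x.
Proof.
move=> mf; rewrite /Rintegral -(@integral_flipv _ n true v (EFin \o f)); last exact/measurable_EFinP.
by under [in RHS]eq_integral do rewrite /= flipv_sub.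
Qed.

Lemma Rintegral_add (v : V) (f : V -> R) : measurable_fun setT f ->
  \int[lam]_x f (x + v) = \int[lam]_x f x.
Proof.
move=> mf; rewrite /Rintegral -(@integral_flipv _ n false v (EFin \o f)); last exact/measurable_EFinP.
by under [in RHS]eq_integral do rewrite /= flipv_add.
Qed.

Lemma L1_sub (v : V) f : L1 f -> L1 (fun x => f (v - x)).
Proof.
move=> /(integrable_flipv true v); apply: eq_integrable => // x _.
by rewrite /= flipv_sub.
Qed.

Lemma L1_add (v : V) f : L1 f -> L1 (fun x => f (x + v)).
Proof.
move=> /(integrable_flipv false v); apply: eq_integrable => // x _.
by rewrite /= flipv_add.
Qed.

Lemma convC (f g : V -> R) x : measurable_fun setT f -> measurable_fun setT g ->
  \int[lam]_z (f (x - z) * g z) = \int[lam]_z (f z * g (x - z)).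
Proof.
move=> mf mg; rewrite -(Rintegral_sub x); last first.
  apply: measurable_funM => //.
  by apply: measurableT_comp => //; exact: measurable_sub.
by apply: eq_Rintegral => z _; rewrite subKr.
Qed.

End convolution.

(** * Uniqueness of Fourier transforms *)

Section fourier_uniqueness.
Context {R : realType} {n : nat}.
Local Notation V := 'rV[R]_n.
Local Notation lam := (lebesgue_rV R n).

Lemma L1Z (a : R) (f : V -> R) : L1 f -> L1 (fun x => a * f x).
Proof. by move=> /(integrableZl measurableT a). Qed.

Lemma L1D (f g : V -> R) : L1 f -> L1 g -> L1 (fun x => f x + g x).
Proof. by move=> Lf Lg; exact: (integrableD measurableT Lf Lg). Qed.

Lemma gaussv_le (k : R) (z : V) : 0 < k -> gaussv k z <= ((k / pi) `^ 2^-1) ^+ n.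
Proof.
move=> k0; apply: (@le_trans _ _ (\prod_(i < n) ((k / pi) `^ 2^-1 * 1))); last first.
  by rewrite prodr_const card_ord mulr1.
apply: ler_prod => i _; rewrite gauss1_ge0/= ler_wpM2l ?powR_ge0//.
by rewrite -[leRHS]expR0 ler_expR oppr_le0 mulr_ge0 ?sqr_ge0// ltW.
Qed.

Lemma L1_measurable (f : V -> R) : L1 f -> measurable_fun setT f.
Proof. exact: intble_measurable. Qed.

Lemma gaussv_coord_bound (k : R) i (z : V) : 0 < k ->
  `|z ord0 i| * gaussv k z <= gconst n / 2 * k `^ (- 2^-1) * gaussv (k / 2) z.
Proof.
move=> k0; have := partial_gaussv_bound k0 i z; rewrite partial_gaussv normrN.
have -> : 2 * k * z ord0 i * gaussv k z = (2 * k) * (z ord0 i * gaussv k z) by ring.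
have k2 : 0 < 2 * k by rewrite mulr_gt0.
rewrite normrM (gtr0_norm k2) normrM (ger0_norm (gaussv_ge0 _ _)) mulrC -ler_pdivlMr//.
move/le_trans; apply; apply: eq_leW.
have <- : k `^ 2^-1 / k = k `^ (- 2^-1).
  rewrite -[in X in _ / X](powRr1 (ltW k0)) -powRN -powRD; last by rewrite (gt_eqF k0) implybT.
  by congr (_ `^ _); field.
by field; rewrite gt_eqF.
Qed.

(** The Gaussians of precision (k+1)^2 form an approximate identity: their width is of order
    1/(k+1). *)
Lemma gaussv_approx (phi : V -> R) (C : R) x : continuous phi -> (forall z, `|phi z| <= C) ->
  \int[lam]_z (phi (x - z) * gaussv (k.+1%:R ^+ 2) z) @[k --> \oo] --> phi x.
Proof.
move=> cphi phiC.
have mphi : measurable_fun setT phi by exact: continuous_measurable_rV.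
have k0 k : 0 < k.+1%:R ^+ 2 :> R by rewrite exprn_gt0.
have C0 : 0 <= C by exact: le_trans (phiC 0).
apply/cvgrPdist_le => e e0.
have e2 : 0 < e / 2 by rewrite divr_gt0.
have /nbhs_ballP[/= dl dl0 Hd] : nbhs x [set y | `|phi x - phi y| < e / 2].
  by have /(@cvgrPdist_lt _ _ _ (nbhs x) (nbhs_filter x)) := cphi x; apply.
(* Where all coordinates of z are below dl, continuity gives e/2. Elsewhere some |z_i| is at least
   dl, and the trivial bound 2C is at most (2C/dl) |z_i|, whose Gaussian mean is O(1/(k+1)) by
   [gaussv_coord_bound]. *)
have H z : `|phi (x - z) - phi x| <= e / 2 + \sum_(i < n) (2 * C / dl) * `|z ord0 i|.
  have [zd|] := pselect (forall i, `|z ord0 i| < dl).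
    apply: (@le_trans _ _ (e / 2)).
      rewrite distrC; apply/ltW/Hd; split => // a b; rewrite (ord1 a) !mxE /ball/= opprB addrCA subrr addr0.
      exact: zd.
    by rewrite lerDl; apply: sumr_ge0 => i _; rewrite !mulr_ge0// invr_ge0 ltW.
  move=> /existsNP[i /negP]; rewrite -leNgt => zi.
  apply: (@le_trans _ _ (2 * C)).
    by rewrite (le_trans (ler_normB _ _))// mulr_natl mulr2n lerD.
  apply: (@le_trans _ _ (2 * C / dl * `|z ord0 i|)).
    by rewrite -mulrA ler_peMr ?mulr_ge0// mulrC ler_pdivlMr// mul1r.
  rewrite (bigD1 i)//= addrCA lerDl; apply: (addr_ge0 (ltW e2)).
  by apply: sumr_ge0 => j _; rewrite !mulr_ge0// invr_ge0 ltW.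
have Lphi k : L1 (fun z => phi (x - z) * gaussv (k.+1%:R ^+ 2) z).
  apply: (intbleM_boundedl (C := C)) => //; first exact: L1_gaussv.
  by apply: measurableT_comp => //; exact: measurable_sub.
pose B k : R := e / 2 + n%:R * (2 * C / dl) * (gconst n / 2) * k.+1%:R^-1.
have HB k : `|phi x - \int[lam]_z (phi (x - z) * gaussv (k.+1%:R ^+ 2) z)| <= B k.
  have -> : phi x - \int[lam]_z (phi (x - z) * gaussv (k.+1%:R ^+ 2) z) =
      \int[lam]_z ((phi x - phi (x - z)) * gaussv (k.+1%:R ^+ 2) z).
    under [in RHS]eq_Rintegral do rewrite mulrBl.
    rewrite RintegralB//; [|by apply: L1Z; exact: L1_gaussv|exact: Lphi].
    by rewrite RintegralZl//; [rewrite Rintegral_gaussv// mulr1|exact: L1_gaussv].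
  have LB : L1 (fun z : V => e / 2 * gaussv (k.+1%:R ^+ 2) z +
      n%:R * (2 * C / dl) * (gconst n / 2) * k.+1%:R^-1 * gaussv (k.+1%:R ^+ 2 / 2) z).
    by apply: L1D; apply: L1Z; apply: L1_gaussv => //; rewrite divr_gt0.
  have pb z : `|(phi x - phi (x - z)) * gaussv (k.+1%:R ^+ 2) z| <=
     e / 2 * gaussv (k.+1%:R ^+ 2) z +
      n%:R * (2 * C / dl) * (gconst n / 2) * k.+1%:R^-1 * gaussv (k.+1%:R ^+ 2 / 2) z.
    rewrite normrM (ger0_norm (gaussv_ge0 _ _)) distrC.
    apply: le_trans (ler_wpM2r (gaussv_ge0 _ _) (H z)) _; rewrite mulrDl lerD2l mulr_suml.
    apply: (@le_trans _ _ (\sum_(i < n) (2 * C / dl) * ((gconst n / 2) * k.+1%:R^-1 * gaussv (k.+1%:R ^+ 2 / 2) z))).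
      apply: ler_sum => i _; rewrite -(mulrA (2 * C / dl)); apply: ler_wpM2l; first by rewrite !mulr_ge0// invr_ge0 ltW.
      have := gaussv_coord_bound i z (k0 k).
      have -> : (k.+1%:R ^+ 2) `^ (- 2^-1) = k.+1%:R^-1 :> R.
        by rewrite powRN powR12_sqrt ?sqr_ge0// sqrtr_sqr ger0_norm.
      by [].
    by rewrite sumr_const card_ord -[X in X <= _]mulr_natl !mulrA.
  apply: le_trans (le_normr_Rintegral measurableT _) _.
    apply: (intble_le _ pb LB); apply: measurable_funM; last exact: measurable_gaussv1.
    by apply: measurable_funB => //; apply: measurableT_comp => //; exact: measurable_sub.
  apply: (@le_trans _ _ (\int[lam]_z (e / 2 * gaussv (k.+1%:R ^+ 2) z +
      n%:R * (2 * C / dl) * (gconst n / 2) * k.+1%:R^-1 * gaussv (k.+1%:R ^+ 2 / 2) z))).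
    apply: le_Rintegral => //.
    apply: (intble_le _ _ LB); last by move=> z; rewrite normr_id.
    apply: measurableT_comp => //; apply: measurable_funM; last exact: measurable_gaussv1.
    by apply: measurable_funB => //; apply: measurableT_comp => //; exact: measurable_sub.
  have k20 : 0 < k.+1%:R ^+ 2 / 2 :> R by rewrite divr_gt0.
  rewrite RintegralD//; [|by apply: L1Z; exact: L1_gaussv|by apply: L1Z; exact: L1_gaussv].
  rewrite !RintegralZl//; [|exact: L1_gaussv|exact: L1_gaussv].
  by rewrite !Rintegral_gaussv// !mulr1.
have : (B k @[k --> \oo] --> e / 2 + n%:R * (2 * C / dl) * (gconst n / 2) * 0)%classic.
  by apply: cvgD; [exact: cvg_cst|apply: cvgMr; exact: cvg_harmonic].
rewrite mulr0 addr0 => cB.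
have lt_e : e / 2 < e by rewrite ltr_pdivrMr// ltr_pMr// ltr1n.
have : \forall k \near \oo, B k <= e.
  by apply: filterS (cvgr_le _ cB _ lt_e).
by apply: filterS => k; exact: le_trans (HB k).
Qed.

(** Makes Gaussians available as integrable dominations of test functions, in particular of their
    translates by bounded vectors. The constant m of the proof bounds [gauss1 1] from below on
    [-M, M]. *)
Lemma test_gauss_bound (phi : V -> R) : test_function phi ->
  exists2 K, 0 <= K & forall x, `|phi x| <= K * gaussv 1 x.
Proof.
move=> tphi; have [C C0 phiC] := test_bounded tphi.
have /test_functionP[_ [M HM]] := tphi.
have p0 : 0 < pi^-1 `^ 2^-1 :> R by rewrite powR_gt0// invr_gt0 pi_gt0.
pose m : R := pi^-1 `^ 2^-1 * expR (- M ^+ 2).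
have m0 : 0 < m by rewrite mulr_gt0// expR_gt0.
exists (C / m ^+ n); first by rewrite divr_ge0 ?exprn_ge0// ltW.
move=> x; have [->|px] := eqVneq (phi x) 0.
  by rewrite normr0 !mulr_ge0 ?invr_ge0 ?exprn_ge0 ?gaussv_ge0// ltW.
apply: (le_trans (phiC x)); rewrite -mulrA ler_peMr// mulrC ler_pdivlMr ?exprn_gt0// mul1r.
rewrite -[in X in m ^+ X](card_ord n) -prodr_const; apply: ler_prod => i _; rewrite (ltW m0)/=.
rewrite /gauss1 /m div1r ler_wpM2l// ?(ltW p0)// ler_expR lerN2 mul1r.
have xM : `|x ord0 i| <= M.
  by apply: le_trans (HM x px); rewrite [leRHS]mx_normrE; exact: (le_bigmax _ (fun ij => `|x ij.1 ij.2|) (ord0, i)).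
by rewrite -real_normK ?num_real// lerXn2r ?nnegrE// (le_trans _ xM).
Qed.

Lemma test_L1 (phi : V -> R) : test_function phi -> L1 phi.
Proof.
move=> tphi; have [K _ HK] := test_gauss_bound tphi.
apply: (@intble_le _ _ R lam phi (fun x => K * gaussv 1 x)) => //; first exact: test_measurable.
by apply: L1Z; exact: L1_gaussv.
Qed.

Lemma dotRN (z p : V) : dotR (- z) p = - dotR z p.
Proof. by rewrite /dotR -sumrN; apply: eq_bigr => i _; rewrite mxE mulNr. Qed.

Lemma dotRD (x z p : V) : dotR (x + z) p = dotR x p + dotR z p.
Proof. by rewrite /dotR -big_split; apply: eq_bigr => i _; rewrite /= mxE mulrDl. Qed.

Lemma dotRC (x y : V) : dotR x y = dotR y x.
Proof. by apply: eq_bigr => i _; rewrite mulrC. Qed.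

(** Fourier inversion for a Gaussian, read off the explicit transform of the Gaussian of precision
    1/(4k). It is the only inversion formula that uniqueness rests on. *)
Lemma gaussv_fourier (k : R) (z : V) : 0 < k ->
  gaussv k z = ((k / pi) `^ 2^-1) ^+ n *
    \int[lam]_p (cos (dotR z p) * gaussv (4 * k)^-1 p).
Proof.
move=> k0; have [-> _] : _ /\ _ := @fourier_gaussv R n (4 * k)^-1 z ltac:(by rewrite invr_gt0 mulr_gt0).
rewrite /gaussv /gauss1 big_split/= prodr_const card_ord; congr (_ * _).
rewrite -expR_sum; congr expR; rewrite sumrN /dotR; congr (- _).
rewrite mulr_suml; apply: eq_bigr => i _; rewrite expr2; field; exact: lt0r_neq0.
Qed.

Lemma measurable_dotR2 d (T : measurableType d) (f g : T -> V) :
  measurable_fun setT f -> measurable_fun setT g -> measurable_fun setT (fun t => dotR (f t) (g t)).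
Proof.
move=> mf mg; apply: measurable_sum => i; apply: measurable_funM.
- exact: (measurableT_comp (@measurable_rV_coord R n i) mf).
- exact: (measurableT_comp (@measurable_rV_coord R n i) mg).
Qed.

Section uniqueness.
Variable (u : V -> R).
Hypotheses (Lu : L1 u)
  (uc : forall p, \int[lam]_y (cos (dotR p y) * u y) = 0)
  (us : forall p, \int[lam]_y (sin (dotR p y) * u y) = 0).

Let mu_ : measurable_fun setT u. Proof. exact: L1_measurable. Qed.

(** With the Gaussian written as a Fourier integral and the order of integration exchanged, the
    inner integral combines the cosine and sine transforms of u, which are 0. *)
Let conv_gauss k (c : V) : 0 < k -> \int[lam]_x (u x * gaussv k (x - c)) = 0.
Proof.
move=> k0; have k40 : 0 < (4 * k)^-1 by rewrite invr_gt0 mulr_gt0.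
pose F (z : V * V) := u z.1 * gaussv (4 * k)^-1 z.2 * cos (dotR (z.1 - c) z.2).
have iF : (lam \x lam)%E.-integrable setT (EFin \o F).
  apply: (intbleM_bounded (intble_tensor Lu (@L1_gaussv _ n _ k40))) => [|z]; last exact: cos_norm_le1.
  apply: (measurableT_comp measurable_cosR); apply: measurable_dotR2 => //.
  by apply: measurable_rVB.
transitivity (((k / pi) `^ 2^-1) ^+ n * \int[lam]_x \int[lam]_p F (x, p)).
  rewrite -RintegralZl//; last exact: (intble_Rintegral2 iF).
  apply: eq_Rintegral => x _; rewrite gaussv_fourier// mulrCA; congr (_ * _).
  rewrite -RintegralZl//; last by apply: L1_cosM; exact: L1_gaussv.
  by apply: eq_Rintegral => p _; rewrite /F/= -mulrA [gaussv _ _ * _]mulrC.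
rewrite (Rfubini iF) (_ : (\int[lam]_p _) = 0) ?mulr0//.
apply: Rintegral_eq0 => p.
transitivity (\int[lam]_x (gaussv (4 * k)^-1 p * cos (dotR p c) * (cos (dotR p x) * u x) +
  gaussv (4 * k)^-1 p * sin (dotR p c) * (sin (dotR p x) * u x))).
  apply: eq_Rintegral => x _; rewrite /F/= dotRD dotRN cosB !(dotRC _ p); ring.
rewrite RintegralD//; [|by apply: L1Z; exact: L1_cosM|by apply: L1Z; exact: L1_sinM].
by rewrite !RintegralZl//; [rewrite uc us !mulr0 addr0|exact: L1_sinM|exact: L1_cosM].
Qed.

(** The pairing of u with a test function is the limit of its pairings with Gaussian mollifications
    of this function. By Fubini the latter are averages of the Gaussian convolutions of u, which
    vanish by [conv_gauss]. *)
Lemma fourier0_ae : {ae lam, forall x, u x = 0}.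
Proof.
apply: L1_eq0 => // phi tphi.
have [C C0 phiC] := test_bounded tphi.
have mphi := test_measurable tphi.
pose s k : R := k.+1%:R ^+ 2.
have s0 k : 0 < s k by rewrite exprn_gt0.
have H := @Rintegral_dct _ _ R lam (fun k x => u x * \int[lam]_z (phi (x - z) * gaussv (s k) z))
  (fun x => u x * phi x) (fun x => C * `|u x|).
have mconv k : measurable_fun setT (fun x : V => \int[lam]_z (phi (x - z) * gaussv (s k) z)).
  have mF : measurable_fun setT (fun z : V * V => phi (z.1 - z.2) * gaussv (s k) z.2).
    apply: measurable_funM; last exact: measurable_gaussv.
    by apply: measurableT_comp => //; exact: measurable_rVB.
  exact: (measurable_Rintegral2 lam mF).
have [|||| _] := H.
- by move=> k; apply: measurable_funM.
- move=> x; apply: cvgMr; apply: gaussv_approx (phiC) => //.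
  by have /test_functionP[/(_ 0%N)] := tphi.
- move=> k x; rewrite normrM mulrC ler_wpM2r//.
  apply: le_trans (le_normr_Rintegral measurableT _) _.
    apply: (intbleM_boundedl (C := C)) => //; first exact: L1_gaussv.
    by apply: measurableT_comp => //; exact: measurable_sub.
  apply: (@le_trans _ _ (\int[lam]_z (C * gaussv (s k) z))).
    apply: le_Rintegral => //.
    + apply: integrable_norm.
      apply: (intbleM_boundedl (C := C)) => //; first exact: L1_gaussv.
      by apply: measurableT_comp => //; exact: measurable_sub.
    + by apply: L1Z; exact: L1_gaussv.
    + by move=> z _; rewrite normrM (ger0_norm (gaussv_ge0 _ _)) ler_wpM2r// gaussv_ge0.
  by rewrite RintegralZl ?Rintegral_gaussv ?mulr1//; exact: L1_gaussv.
- by apply: L1Z; exact: integrable_norm.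
move=> cv; apply: (cvg_unique _ cv); first exact: norm_hausdorff.
rewrite (_ : (fun k => _) = cst 0); first exact: cvg_cst.
apply/funext => k /=.
transitivity (\int[lam]_x \int[lam]_c (u x * phi c * gaussv (s k) (x - c))).
  apply: eq_Rintegral => x _; rewrite convC//; last exact: measurable_gaussv1.
  rewrite -RintegralZl//; first by apply: eq_Rintegral => z _; rewrite mulrA.
  apply: (intbleM_boundedl (C := C)) => //; apply: L1_sub; exact: L1_gaussv.
pose F (z : V * V) := u z.1 * phi z.2 * gaussv (s k) (z.1 - z.2).
have iF : (lam \x lam)%E.-integrable setT (EFin \o F).
  have I := intble_tensor Lu (@test_L1 phi tphi).
  apply: (intbleM_bounded (C := ((s k / pi) `^ 2^-1) ^+ n) I) => [|z].
    by apply: measurable_gaussv => //; apply: measurable_rVB.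
  by rewrite ger0_norm ?gaussv_ge0// gaussv_le.
rewrite (Rfubini iF); apply: Rintegral_eq0 => c.
transitivity (\int[lam]_x (phi c * (u x * gaussv (s k) (x - c)))).
  by apply: eq_Rintegral => x _; rewrite /F/= [u x * _]mulrC -mulrA.
rewrite RintegralZl//; first by rewrite conv_gauss// mulr0.
apply: (intbleM_bounded (C := ((s k / pi) `^ 2^-1) ^+ n) Lu) => [|z].
  by apply: measurable_gaussv => //; apply: measurable_rVB.
by rewrite ger0_norm ?gaussv_ge0// gaussv_le.
Qed.

End uniqueness.

Lemma fourier_inj (u v : V -> R) : L1 u -> L1 v -> fourier u =1 fourier v ->
  {ae lam, forall x, u x = v x}.
Proof.
move=> Lu Lv uv.
have Luv : L1 (fun x => u x - v x) by exact: (integrableB measurableT Lu Lv).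
have H := fourier0_ae Luv.
have : {ae lam, forall x, u x - v x = 0}.
  apply: H => p; have [/= Ec Es] := (congr1 (@complex.Re R) (uv p), congr1 (@complex.Im R) (uv p)).
  - under eq_Rintegral do rewrite mulrBr.
    by rewrite RintegralB//; [rewrite Ec subrr|exact: L1_cosM|exact: L1_cosM].
  - under eq_Rintegral do rewrite mulrBr.
    by rewrite RintegralB//; [move: Es => /= /oppr_inj ->; rewrite subrr|exact: L1_sinM|exact: L1_sinM].
by apply: filterS => x /eqP; rewrite subr_eq0 => /eqP.
Qed.

End fourier_uniqueness.

(** * Laplace transforms and one-sided stable laws *)

Section integrals1.
Context {R : realType}.
Local Notation mu := (@lebesgue_measure R).

Lemma lebesgue_scale (c : R) (A : set (measurableTypeR R)) : (0 < c) -> measurable A ->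
  (lebesgue_measure ( *%R c @^-1` A) = (c^-1)%:E * lebesgue_measure A)%E.
Proof.
move=> c0 mA; have c00 : (0 <= c) by exact: ltW.
have mc : measurable_fun setT ( *%R c : measurableTypeR R -> measurableTypeR R).
  exact: measurable_funM.
have E : mscale (NngNum c00) (pushforward (@lebesgue_measure R) ( *%R c : _ -> measurableTypeR R)) A =
    lebesgue_measure A.
  move=> h; apply/esym/lebesgue_measure_unique => //=.
  move=> _ [[a b]] _ <-; rewrite /mscale/= /pushforward (_ : _ @^-1` _ = `]a / c, b / c]%classic); last first.
    by apply/seteqP; split => x /=; rewrite !in_itv/= ltr_pdivrMr// ler_pdivlMr// [(x * c)]mulrC.
  rewrite !lebesgue_measure_itv/= !lte_fin ltr_pM2r ?invr_gt0//.
  case: ifPn => // _; last by rewrite mule0.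
  by rewrite -!EFinB -EFinM; congr (_%:E); field; rewrite gt_eqF.
rewrite -(E mc) /mscale/= muleA -EFinM mulVf ?gt_eqF// mul1e//.
Qed.

Lemma ge0_integral_scale (c : R) (f : measurableTypeR R -> \bar R) : (0 < c) ->
  measurable_fun setT f -> (forall x, 0 <= f x)%E ->
  (\int[mu]_x f (c * x)%R = (c^-1)%:E * \int[mu]_x f x)%E.
Proof.
move=> c0 mf f0; have c00 : (0 <= c^-1) by rewrite invr_ge0 ltW.
have mc : measurable_fun setT ( *%R c : measurableTypeR R -> measurableTypeR R).
  exact: measurable_funM.
transitivity (\int[pushforward mu ( *%R c : _ -> measurableTypeR R)]_x f x)%E.
  by rewrite ge0_integral_pushforward.
transitivity (\int[mscale (NngNum c00) mu]_x f x)%E.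
  by apply: eq_measure_integral => A mA _; rewrite /mscale/=; exact: lebesgue_scale.
by rewrite ge0_integral_mscale.
Qed.

Lemma ge0_integral_scale_pos (c : R) (f : measurableTypeR R -> \bar R) : (0 < c) ->
  measurable_fun (`]0%R, +oo[%classic : set R) f -> (forall x : R, (0 < x)%R -> 0 <= f x)%E ->
  (\int[mu]_(x in `]0%R, +oo[) f (c * x)%R = (c^-1)%:E * \int[mu]_(x in `]0%R, +oo[) f x)%E.
Proof.
move=> c0 mf f0.
rewrite [in RHS]integral_mkcond -ge0_integral_scale//.
- rewrite [LHS]integral_mkcond; apply: eq_integral => x _.
  rewrite !patchE; congr (if _ then _ else _).
  by apply/idP/idP; rewrite !inE/= !in_itv/= !andbT pmulr_rgt0.
- by apply/(measurable_restrictT _ _).1.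
- by move=> x; rewrite patchE; case: ifPn => //; rewrite inE/= in_itv/= andbT => /f0.
Qed.

Lemma powR_continuous (a x : R) : (0 < x) -> {for x, continuous (@powR R ^~ a)}.
Proof.
move=> x0; have [/derivable1_diffP/differentiable_continuous H _] := is_derive1_powR a x0.
exact: H.
Qed.

Lemma integral_powR0 (r t : R) : (0 < r) -> (0 < t) ->
  (\int[mu]_(x in `]0%R, t]) (x `^ (r - 1))%:E = (t `^ r / r)%:E)%E.
Proof.
move=> r0 t0.
(* For r < 1 the integrand is singular at 0, so the interval is exhausted by [t/(i+1), t], on which
   the fundamental theorem of calculus applies. *)
pose F (i : nat) : set R := `[(t / i.+1%:R), t]%classic.
have tp i : (0 < t / i.+1%:R) by rewrite divr_gt0.
have -> : `]0, t]%classic = \bigcup_i F i.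
  apply/seteqP; split => [x|x [i _]]; rewrite /F /= !in_itv/= => /andP[x0 xt]; last first.
    by rewrite xt andbT; exact: lt_le_trans x0.
  have := @archi_boundP R (t / x) (ltW (divr_gt0 t0 x0)) => H.
  exists (Num.bound (t / x)) => //=; rewrite in_itv/= xt andbT ler_pdivrMr//.
  rewrite -ler_pdivrMl// mulrC; apply/ltW/(lt_le_trans H); by rewrite ler_nat.
have ndF : nondecreasing_seq F.
  move=> m n mn; apply/subsetPset => x; rewrite /F/= !in_itv/= => /andP[h ->]; rewrite andbT.
  by apply: le_trans h; rewrite ler_pM2l// lef_pV2 ?posrE// ler_nat.
have : (\int[mu]_(x in F i) (x `^ (r - 1))%:E @[i --> \oo] --> \int[mu]_(x in \bigcup_i F i) (x `^ (r - 1))%:E)%E.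
  apply: ge0_nondecreasing_set_cvg_integral => // i; first exact: measurable_itv.
    by apply/measurable_EFinP; apply: measurable_funTS; exact: measurable_powR.
  by move=> x _; rewrite lee_fin powR_ge0.
have -> : (fun i => (\int[mu]_(x in F i) (x `^ (r - 1))%:E)%E) =
    (fun i => (t `^ r / r - (t * i.+1%:R^-1) `^ r / r)%:E).
  apply/funext => i; rewrite /F.
  have [->|i0] := eqVneq i 0%N.
    by rewrite divr1 set_itv1 integral_set1 subrr.
  have lti : (t / i.+1%:R < t) by rewrite ltr_pdivrMr// ltr_pMr// ltr1n ltnS lt0n.
  have cpow a x : (x \in `[(t / i.+1%:R), t]) -> {for x, continuous (@powR R ^~ a)}.
    by rewrite in_itv/= => /andP[h _]; apply: powR_continuous; exact: lt_le_trans h.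
  rewrite (@continuous_FTC2 R _ (fun x => x `^ r / r))//.
  - by apply: continuous_in_subspaceT => x; rewrite inE => xi; exact: (cpow _ _ xi).
  - split.
    + move=> x; rewrite in_itv/= => /andP[h _].
      have D := is_deriveM (is_derive1_powR r (lt_trans (tp i) h)) (is_derive_cst r^-1 x (1 : R)).
      by case: D.
    + apply: cvgMl; apply: cvg_at_right_filter; apply: cpow; rewrite in_itv/= lexx ltW//.
    + apply: cvgMl; apply: cvg_at_left_filter; apply: cpow; rewrite in_itv/= lexx ltW//.
  - move=> x; rewrite in_itv/= => /andP[h _].
    have D := is_deriveM (is_derive1_powR r (lt_trans (tp i) h)) (is_derive_cst r^-1 x (1 : R)).
    rewrite derive1E; case: D => _ ->; rewrite /GRing.scale/= mulr0 add0r.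
    by field; rewrite gt_eqF.
move=> cv; apply: (cvg_unique _ cv) => //.
have {2}-> : (t `^ r / r) = (t `^ r / r - t `^ r * 0 / r) by rewrite mulr0 mul0r subr0.
apply: cvg_EFin; first exact: nearW.
apply: cvgB; first exact: cvg_cst.
apply: cvgMl.
rewrite (_ : (fun i : nat => _) = (fun i : nat => t `^ r * (i.+1%:R^-1) `^ r)); last first.
  by apply/funext => i; rewrite powRM// ltW.
apply: cvgMr.
have := @powR_cvg0 R r r0 => /cvg_at_rightP; apply; split; last exact: cvg_harmonic.
by move=> i; rewrite invr_gt0.
Qed.

Lemma integral_powRy (q : R) : (1 < q) ->
  (\int[mu]_(x in `[1%R, +oo[) (x `^ (- q))%:E = ((q - 1)^-1)%:E)%E.
Proof.
move=> q1; have q0 : (1 - q != 0) by rewrite subr_eq0 lt_eqF.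
have q0' : (q - 1 != 0) by rewrite subr_eq0 gt_eqF.
have D (x : R) : (0 < x) -> is_derive x (1:R) (fun x => x `^ (1 - q) / (1 - q)) (x `^ (- q)).
  move=> x0; have D := is_deriveM (is_derive1_powR (1 - q) x0) (is_derive_cst (1 - q)^-1 x (1 : R)).
  apply: is_derive_eq; rewrite /GRing.scale/= mulr0 add0r mulrA mulVf// mul1r; congr (_ `^ _); ring.
have cp (a x : R) : (1 <= x) -> {for x, continuous (@powR R ^~ a)}.
  by move=> x1; apply: powR_continuous; exact: lt_le_trans x1.
rewrite (@ge0_continuous_FTC2y R _ (fun x => x `^ (1 - q) / (1 - q)) 1 0).
- by rewrite powR1 sub0e -EFinN; congr (_%:E); field; rewrite q0 q0'.
- by move=> x _; exact: powR_ge0.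
- apply: continuous_in_subspaceT => x; rewrite inE/= in_itv/= andbT => x1; exact: cp.
- rewrite -(mul0r (1 - q)^-1); apply: cvgMl.
  apply: (@cvg_trans _ ((x^-1 : R) `^ (q - 1) @[x --> +oo])).
    apply: near_eq_cvg; near=> x; have x0 : 0 <= x by near: x; exact: nbhs_pinfty_ge.
    by rewrite -(powR_inv1 x0) -powRrM mulN1r opprB.
  apply: (@cvg_comp _ _ _ (fun x : R => x^-1) (fun y => y `^ (q - 1)) _ (0^'+)); last first.
    by apply: powR_cvg0; rewrite subr_gt0.
  move=> P [e /= e0 eP]; near=> x.
  have x0 : 0 < x by near: x; exact: nbhs_pinfty_gt.
  apply: eP; last by rewrite invr_gt0.
  rewrite /ball/= sub0r normrN gtr0_norm ?invr_gt0// -[ltRHS]invrK ltf_pV2 ?posrE ?invr_gt0//.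
  by near: x; apply: nbhs_pinfty_gt; rewrite num_real.
- by move=> x x1; case: (D x (lt_trans ltr01 x1)).
- by apply: cvgMl; apply: cvg_at_right_filter; exact: cp.
- by move=> x; rewrite in_itv/= andbT => x1; rewrite derive1E; case: (D x (lt_trans ltr01 x1)).
Unshelve. all: by end_near. Qed.

End integrals1.

Section laplace.
Context {R : realType}.
Local Notation M := (measurableTypeR R).
Local Notation prob := (probability M R).
Implicit Types P Q : prob.

Definition lap (P : set M -> \bar R) (l : R) : \bar R := (\int[P]_x (expR (- (l * x)))%:E)%E.

Let mexp (l : R) : measurable_fun setT (fun x : M => (expR (- (l * x)))%:E).
Proof.
apply/measurable_EFinP; apply: (measurableT_comp (@measurable_expR R)).
by apply: measurable_funN; exact: measurable_funM.
Qed.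

Definition addRR (z : M * M) : M := z.1 + z.2.

Let measurable_addRR : measurable_fun setT addRR.
Proof. exact: measurable_funD. Qed.

HB.instance Definition _ := @isMeasurableFun.Build _ _ _ _ addRR measurable_addRR.

Definition conv P Q : prob := distribution (P \x Q)%E addRR.

Lemma lap_conv P Q l : lap (conv P Q) l = (lap P l * lap Q l)%E.
Proof.
rewrite /lap /conv ge0_integral_distribution//.
rewrite fubini_tonelli1//.
- rewrite -ge0_integralZr//; last by apply: integral_ge0 => x _; rewrite lee_fin expR_ge0.
  apply: eq_integral => x _; rewrite -ge0_integralZl//.
  by apply: eq_integral => y _; rewrite /addRR/= mulrDr opprD expRD EFinM.
- exact: measurableT_comp.
- by move=> z; rewrite lee_fin expR_ge0.
Qed.

Definition nonneg_law P := P `]-oo, 0%R[%classic = 0%E.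

(** If A is closed downwards, then X + Z in A and Z >= 0 force X in A. With A = ]-oo, y] this is the
    decrease of distribution functions under convolution with a law on [0, oo). *)
Lemma conv_le P Q (A : set M) : measurable A ->
  (forall x z : R, 0 <= z -> A (x + z) -> A x) -> nonneg_law Q -> (conv P Q A <= P A)%E.
Proof.
move=> mA dA Q0.
have -> : conv P Q A = (P \x Q)%E (addRR @^-1` A) by [].
pose N : set M := `]-oo, 0%R[%classic.
have mN : measurable N by exact: measurable_itv.
have mS : measurable (addRR @^-1` A) by rewrite -[X in measurable X]setTI; exact: measurable_addRR.
apply: (@le_trans _ _ ((P \x Q) (A `*` setT `|` setT `*` N))%E).
  apply: le_measure; rewrite ?inE//.
    by apply: measurableU; exact: measurableX.
  move=> [x z] /= Axz; have [z0|z0] := leP 0 z; first by left; split => //; exact: dA Axz.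
  by right; split => //; rewrite /N/= in_itv.
apply: (le_trans (measureU2 _ _ _)); [exact: measurableX|exact: measurableX|].
have EA : (P \x Q)%E (A `*` setT) = (P A * 1)%E by rewrite -(probability_setT Q); exact: product_measure1E.
have EN : (P \x Q)%E (setT `*` N) = (P setT * Q N)%E by exact: product_measure1E.
apply: (@le_trans _ _ (P A * 1 + P setT * Q N)%E); first by rewrite -EA -EN.
by rewrite Q0 mule0 adde0 mule1.
Qed.

Lemma conv_nonneg P Q : nonneg_law P -> nonneg_law Q -> nonneg_law (conv P Q).
Proof.
move=> P0 Q0; apply/eqP; rewrite eq_le measure_ge0 andbT -P0; apply: conv_le => //.
by move=> x z z0 /=; rewrite !in_itv/=; apply: le_lt_trans; rewrite lerDl.
Qed.

Lemma lap_dirac0 l : lap (dirac (0 : M)) l = 1%E.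
Proof. by rewrite /lap integral_dirac// diracT mulr0 oppr0 expR0 mul1e. Qed.

Lemma probability_of_measure (m : {measure set M -> \bar R}) : m setT = 1%E ->
  exists P : prob, forall A, P A = m A.
Proof.
move=> m1.
pose P := mnormalize m (dirac (0 : M) : prob).
exists P => A; by rewrite /P /= /mnormalize m1 onee_eq0/= invr1 mule1.
Qed.

Fixpoint conv_pow (q : prob) k : prob :=
  if k is j.+1 then conv (conv_pow q j) q else dirac (0 : M).

Lemma conv_pow_nonneg q k : nonneg_law q -> nonneg_law (conv_pow q k).
Proof.
move=> q0; elim: k => [|k IH] /=; last exact: conv_nonneg.
by rewrite /nonneg_law/= diracE memNset//= in_itv/= ltxx.
Qed.

Lemma lap_conv_pow (q : prob) k l L : lap q l = L%:E -> lap (conv_pow q k) l = (L ^+ k)%:E.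
Proof.
move=> qL; elim: k => [|k IH] /=; first by rewrite lap_dirac0.
by rewrite lap_conv IH qL -EFinM exprSr.
Qed.

Lemma nneseries_EFin (a : nat -> R) (l : R) : series a n @[n --> \oo] --> l ->
  (\sum_(0 <= k <oo) (a k)%:E = l%:E)%E.
Proof.
move=> al; apply/cvg_lim => //.
rewrite (_ : (fun n => _) = EFin \o series a); last first.
  by apply/funext => n /=; rewrite sumEFin.
by apply: cvg_EFin => //; exact: nearW.
Qed.

Lemma lap0 (m : {measure set M -> \bar R}) : lap m 0 = m setT.
Proof.
rewrite /lap; under eq_integral do rewrite mul0r oppr0 expR0.
by rewrite (integral_cst m measurableT 1%E) mul1e.
Qed.

(** The law of a sum of N independent variables of law q, with N Poisson of mean c: the powers of
    the transform L are weighted by exp(-c) c^k / k! and sum to the exponential. *)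
Lemma compound_poisson (c : R) q : 0 <= c -> nonneg_law q ->
  exists P : prob, nonneg_law P /\
    forall l L, lap q l = L%:E -> lap P l = (expR (c * (L - 1)))%:E.
Proof.
move=> c0 q0.
have w0 k : 0 <= expR (- c) * exp_coeff c k.
  by rewrite mulr_ge0 ?expR_ge0// /exp_coeff/= divr_ge0// exprn_ge0.
pose m_ k : {measure set M -> \bar R} := mscale (NngNum (w0 k)) (conv_pow q k).
pose m : {measure set M -> \bar R} := mseries m_ 0.
have mL l L : lap q l = L%:E -> lap m l = (expR (c * (L - 1)))%:E.
  move=> qL; rewrite /lap ge0_integral_measure_series//.
  rewrite (_ : (fun n => _) = (fun n => \sum_(0 <= k < n) (expR (- c) * exp_coeff (c * L) k)%:E)%E); last first.
    apply/funext => n; apply: eq_bigr => k _; rewrite ge0_integral_mscale//=.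
    rewrite -/(lap _ _) (lap_conv_pow k qL) -EFinM; congr (_%:E).
    by rewrite -mulrA; congr (_ * _); rewrite /exp_coeff/= exprMn; ring.
  apply: nneseries_EFin.
  rewrite mulrBr mulr1 addrC expRD.
  rewrite (_ : series _ = (fun n => expR (- c) * series (exp_coeff (c * L)) n)); last first.
    by apply/funext => n; rewrite /series/= mulr_sumr.
  by apply: cvgMr; exact: is_cvg_series_exp_coeff.
(* The total mass is the transform at l = 0, where L = 1. *)
have mT : m setT = 1%E.
  rewrite -lap0 (mL 0 1) ?subrr ?mulr0 ?expR0//.
  exact: (etrans (lap0 q) (probability_setT q)).
have [P PE] := probability_of_measure mT.
exists P; split.
  rewrite /nonneg_law PE.
  have -> : m `]-oo, 0%R[%classic = (\sum_(0 <= k <oo) m_ k `]-oo, 0%R[%classic)%E by [].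
  rewrite eseries0// => k _ _.
  by rewrite /m_/= /mscale/= conv_pow_nonneg// mule0.
move=> l L /mL <-; rewrite /lap; apply: eq_measure_integral => A _ _; exact: PE.
Qed.

Lemma integral_expR_tail (l x : R) : 0 < l ->
  (\int[lebesgue_measure]_(y in `[x, +oo[) (l * expR (- (l * y)))%:E = (expR (- (l * x)))%:E)%E.
Proof.
move=> l0.
have D (y : R) : is_derive y (1 : R) (fun y => - expR (- (l * y))) (l * expR (- (l * y))).
  have D0 : is_derive y (1 : R) (fun y : R => - (l * y)) (- l).
    have D := is_deriveN (is_deriveZ l (is_derive_id y (1 : R))).
    by apply: is_derive_eq; rewrite /GRing.scale/= mulr1.
  have D1 := is_deriveN (@is_derive1_comp _ expR (fun y => - (l * y)) y _ _ (is_derive_expR _) D0).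
  by apply: is_derive_eq; rewrite mulrN opprK mulrC.
have cexp (y : R) : {for y, continuous (fun y : R => expR (- (l * y)))}.
  have [/derivable1_diffP/differentiable_continuous H _] := D y.
  rewrite (_ : (fun y : R => expR (- (l * y))) = (fun y => - (- expR (- (l * y))))); last first.
    by apply/funext => z; rewrite opprK.
  by apply: continuousN; exact: H.
rewrite (@ge0_continuous_FTC2y R _ (fun y => - expR (- (l * y))) x 0).
- by rewrite sub0e -EFinN opprK.
- by move=> y _; rewrite mulr_ge0 ?expR_ge0// ltW.
- apply: continuous_subspaceT => y; apply: cvgMr; exact: cexp.
- rewrite -[X in _ --> X]oppr0; apply: cvgN.
  apply: (@cvg_comp _ _ _ (fun y => l * y) (fun y => expR (- y)) _ +oo).
    by apply: gt0_cvgMry => //; exact: cvg_id.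
  exact: cvgr_expR.
- by move=> y _; case: (D y).
- by apply: cvg_at_right_filter; apply: cvgN; exact: cexp.
- by move=> y _; rewrite derive1E; case: (D y).
Qed.

(** exp(-l x) is the integral of l exp(-l y) over y >= x; Tonelli then produces the distribution
    function. In this form pointwise limits of distribution functions pass to transforms. *)
Lemma lap_cdf P (l : R) : 0 < l ->
  lap P l = (\int[lebesgue_measure]_y ((l * expR (- (l * y)))%:E * P `]-oo, y]%classic))%E.
Proof.
move=> l0.
pose f (z : M * M) : \bar R := (l * expR (- (l * z.2)) * \1_[set z : M * M | z.1 <= z.2] z)%:E.
have mS : measurable [set z : M * M | z.1 <= z.2].
  by rewrite -[X in measurable X]setTI; exact: (measurable_fun_ler measurable_fst measurable_snd).
have mf : measurable_fun setT f.
  apply/measurable_EFinP; apply: measurable_funM; last exact: measurable_indic.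
  apply: measurable_funM => //; apply: (measurableT_comp (@measurable_expR R)).
  by apply: measurable_funN; exact: measurable_funM.
have f0 z : (0 <= f z)%E by rewrite lee_fin !mulr_ge0 ?expR_ge0// ltW.
transitivity (\int[P]_x \int[lebesgue_measure]_y f (x, y))%E.
  apply: eq_integral => x _.
  transitivity (\int[lebesgue_measure]_(y in `[x, +oo[) (l * expR (- (l * y)))%:E)%E; last first.
    rewrite [LHS]integral_mkcond; apply: eq_integral => y _; rewrite patchE /f/= indicE.
    have -> : (y \in `[x, +oo[%classic) = (x <= y) by apply/idP/idP; rewrite inE/= in_itv/= andbT.
    have -> : ((x, y) \in [set z : M * M | z.1 <= z.2]) = (x <= y) by apply/idP/idP; rewrite inE.
    by case: (x <= y); rewrite ?mulr1 ?mulr0.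
  by rewrite integral_expR_tail.
rewrite (fubini_tonelli (m1 := P) (m2 := @lebesgue_measure R) f)//.
apply: eq_integral => y _.
transitivity (\int[P]_x ((l * expR (- (l * y)))%:E * (\1_(`]-oo, y]%classic : set R) x)%:E))%E.
  apply: eq_integral => x _; rewrite /f/= EFinM !indicE.
  have -> // : ((x, y) \in [set z : M * M | z.1 <= z.2]) = (x \in (`]-oo, y]%classic : set R)).
  by apply/idP/idP; rewrite !inE/=.
rewrite ge0_integralZl//; last 2 first.
- by apply/measurable_EFinP; exact: measurable_indic.
- by rewrite lee_fin mulr_ge0 ?expR_ge0// ltW.
by rewrite integral_indic// setIT.
Qed.

Section cdf_limit.
Variables (P_ : nat -> prob) (psi : R -> R).
Hypotheses (P0 : P_ 0 `]-oo, 0%R[%classic = 0%E)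
  (ndP : forall n y, (P_ n.+1 `]-oo, y]%classic <= P_ n `]-oo, y]%classic)%E)
  (Ppsi : forall l, 0 < l -> exists2 u : nat -> R, (forall n, lap (P_ n) l = (u n)%:E) & u n @[n --> \oo] --> psi l)
  (psi0 : psi l @[l --> 0^'+] --> (1 : R)).

Let F_ n (y : R) : R := fine (P_ n `]-oo, y]%classic).
Definition cdf_inf (y : R) : R := inf (range (F_ ^~ y)).

Local Notation F := cdf_inf.

Let F_E n y : P_ n `]-oo, y]%classic = (F_ n y)%:E.
Proof. by rewrite /F_ fineK// fin_num_measure. Qed.

Let F_ge0 n y : 0 <= F_ n y.
Proof. by rewrite -lee_fin -F_E. Qed.

Let F_le1 n y : F_ n y <= 1.
Proof. by rewrite -lee_fin -F_E; exact: probability_le1. Qed.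

Let F_nd n : {homo F_ n : x y / x <= y}.
Proof.
move=> x y xy; rewrite -lee_fin -!F_E; apply: le_measure; rewrite ?inE//.
by apply: subset_itvl; rewrite bnd_simp.
Qed.

Let F_ni y : {homo F_ ^~ y : n m / (n <= m)%N >-> m <= n}.
Proof.
apply/nonincreasing_seqP => n; rewrite -lee_fin -!F_E; exact: ndP.
Qed.

Let F_lb y : has_lbound (range (F_ ^~ y)).
Proof. by exists 0 => _ [n _ <-]. Qed.

Let F_le n y : F y <= F_ n y.
Proof. by apply: ge_inf => //; exists n. Qed.

Let F_inf y e : 0 < e -> exists n, F_ n y < F y + e.
Proof.
move=> e0; have : has_inf (range (F_ ^~ y)) by split => //; exists (F_ 0 y), 0%N.
by move=> /(inf_adherent e0)[_ [n _ <-]] H; exists n.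
Qed.

Let F_cvg y : F_ n y @[n --> \oo] --> F y.
Proof. exact: (nonincreasing_cvgn (F_ni y) (F_lb y)). Qed.

Let F0 y : 0 <= F y.
Proof. by apply: lb_le_inf; [exists (F_ 0 y), 0%N|move=> _ [n _ <-]]. Qed.

Let F_neg0 y : y < 0 -> F_ 0 y = 0.
Proof.
move=> y0; rewrite /F_ (_ : P_ 0 _ = 0%E)//.
apply/eqP; rewrite eq_le measure_ge0 andbT -P0; apply: le_measure; rewrite ?inE//.
by apply: subset_itvl; rewrite bnd_simp.
Qed.

Let Fneg y : y < 0 -> F y = 0.
Proof.
by move=> y0; apply/eqP; rewrite eq_le F0 andbT (le_trans (F_le 0 y))// F_neg0 ?lexx.
Qed.

Let Fneg_ n y : y < 0 -> F_ n y = 0.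
Proof.
by move=> y0; apply/eqP; rewrite eq_le F_ge0 andbT (le_trans (F_ni y (leq0n n)))// F_neg0 ?lexx.
Qed.

Let F_rc n y e : 0 < e -> exists2 dl, 0 < dl & F_ n (y + dl) < F_ n y + e.
Proof.
move=> e0; pose S k : set M := `]-oo, (y + k.+1%:R^-1)]%classic.
have : P_ n (S k) @[k --> \oo] --> P_ n (\bigcap_k S k).
  apply: nonincreasing_cvg_mu => //.
  - by rewrite -ge0_fin_numE ?fin_num_measure//; exact: measurable_itv.
  - by move=> k; exact: measurable_itv.
  - by apply: bigcap_measurable => // k _; exact: measurable_itv.
  - move=> k m km; apply/subsetPset; apply: subset_itvl.
    by rewrite bnd_simp lerD2l lef_pV2 ?posrE// ler_nat.
rewrite -itvNycEbigcap F_E => /fine_cvgP[_].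
rewrite (_ : _ \o _ = fun k => F_ n (y + k.+1%:R^-1)); last by apply/funext => k.
move=> /cvgrPdist_lt/(_ e e0)[N _ /(_ N (leqnn N))] /=.
rewrite ltr_norml => /andP[+ _]; rewrite ltrBrDl => H.
by exists N.+1%:R^-1; rewrite ?invr_gt0//; move: H; lra.
Qed.

Let Fnd : {homo F : x y / x <= y}.
Proof.
move=> x y xy; apply: lb_le_inf; first by exists (F_ 0 y), 0%N.
by move=> _ [n _ <-]; apply: le_trans (F_le n x) (F_nd _ xy).
Qed.

(** An infimum of nondecreasing right-continuous functions is right-continuous: to the right of y it
    stays below the one [F_ n] that is close to it at y. *)
Let Frc : right_continuous F.
Proof.
move=> y; apply/cvgrPdist_lt => e e0.
have e2 : 0 < e / 2 by rewrite divr_gt0.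
have [n Fn] := F_inf y e2; have [dl dl0 Hd] := F_rc n y e2.
near=> z.
have yz : y <= z by near: z; apply: nbhs_right_ge.
have zd : z <= y + dl by near: z; apply: nbhs_right_le; rewrite ltrDl.
have := Fnd yz; have := le_trans (F_le n z) (F_nd n zd).
rewrite ltr_norml; move: Fn Hd; lra.
Unshelve. all: by end_near. Qed.

Let FNy : F @ -oo --> (0 : R).
Proof.
apply: cvg_near_cst; near=> y; apply: Fneg; near: y; apply: nbhs_ninfty_lt; exact: num_real.
Unshelve. all: by end_near. Qed.

(** Dominated convergence in [lap_cdf]. All the [F_ n] are at most 1 and vanish on the negative
    half-line, hence the exponential density dominates. *)
Let psiE l : 0 < l -> lebesgue_measure.-integrable setT (EFin \o (fun y : R => l * expR (- (l * y)) * F y)) /\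
  psi l = \int[lebesgue_measure]_y (l * expR (- (l * y)) * F y).
Proof.
move=> l0; have [u uE u_psi] := Ppsi l0.
have mF n : measurable_fun setT (fun y : R => F_ n y) by exact: nondecreasing_measurable (F_nd n).
have mexp' : measurable_fun setT (fun y : R => l * expR (- (l * y))).
  apply: measurable_funM => //; apply: (measurableT_comp (@measurable_expR R)).
  by apply: measurable_funN; exact: measurable_funM.
have [||||I H] := @Rintegral_dct _ _ R (@lebesgue_measure R) (fun n y => l * expR (- (l * y)) * F_ n y)
   (fun y => l * expR (- (l * y)) * F y) (exponential_pdf l).
- by move=> n; exact: (measurable_funM mexp' (mF n)).
- by move=> y; apply: cvgMr; exact: F_cvg.
- move=> n y; have [y0|y0] := ltP y 0.
    by rewrite Fneg_// mulr0 normr0 exponential_pdf_ge0// ltW.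
  have w0 : 0 <= l * expR (- (l * y)) by rewrite mulr_ge0 ?expR_ge0// ltW.
  rewrite exponential_pdfE// mulNr ger0_norm; last by rewrite mulr_ge0.
  by rewrite ler_piMr.
- exact: integrable_exponential_pdf.
split=> //; apply: (cvg_unique _ u_psi); first exact: norm_hausdorff.
rewrite (_ : u = fun n => \int[lebesgue_measure]_y (l * expR (- (l * y)) * F_ n y))//.
apply/funext => n; apply: EFin_inj; rewrite -uE lap_cdf// /Rintegral.
have E : (\int[lebesgue_measure]_y ((l * expR (- (l * y)))%:E * P_ n `]-oo, y]%classic) =
    \int[lebesgue_measure]_y (l * expR (- (l * y)) * F_ n y)%:E)%E.
  by apply: eq_integral => y _; rewrite EFinM F_E.
by rewrite -E -lap_cdf// uE.
Qed.

Let Fle1 y : F y <= 1.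
Proof. exact: le_trans (F_le 0 y) (F_le1 _ _). Qed.

(** If F stayed below 1 - e, then by [psiE] so would psi on all of (0, oo), against its limit 1 at
    0. *)
Let F_tight e : 0 < e -> exists y, 1 - e < F y.
Proof.
move=> e0; apply: contrapT => /forallNP H.
have Fe y : F y <= 1 - e by rewrite leNgt; exact/negP.
have e1 : 0 <= 1 - e by exact: le_trans (F0 0) (Fe 0).
suff H1 l : 0 < l -> psi l <= 1 - e.
  have : 1 <= 1 - e.
    apply: (cvgr_to_le psi0); near=> l; apply: H1; near: l; exact: nbhs_right_gt.
  by move: e0; lra.
move=> l0; have [I ->] := psiE l0.
apply: (@le_trans _ _ (\int[lebesgue_measure]_y ((1 - e) * exponential_pdf l y))).
  apply: le_Rintegral => //.
    exact: (integrableZl measurableT (1 - e) (integrable_exponential_pdf l0)).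
  move=> y _; have [y0|y0] := ltP y 0.
    by rewrite Fneg// mulr0 mulr_ge0// exponential_pdf_ge0// ltW.
  rewrite exponential_pdfE// mulNr [leRHS]mulrC ler_wpM2l// mulr_ge0 ?expR_ge0// ltW//.
rewrite RintegralZl//; last exact: integrable_exponential_pdf.
by rewrite /Rintegral integral_exponential_pdf// mulr1.
Unshelve. all: by end_near. Qed.

Let Fy : F @ +oo --> (1 : R).
Proof.
apply/cvgrPdist_lt => e e0; have [y0 Hy] := F_tight e0.
near=> y; have yy : y0 <= y by near: y; apply: nbhs_pinfty_ge; exact: num_real.
have := Fnd yy; have := Fle1 y.
rewrite ltr_norml; move: Hy; lra.
Unshelve. all: by end_near. Qed.

HB.instance Definition _ := isCumulative.Build R _ R cdf_inf Fnd Frc.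
HB.instance Definition _ := isCumulativeBounded.Build R 0 1 cdf_inf FNy Fy.

(* The distribution functions decrease along the sequence, so their pointwise infimum is the limit;
   no mass escapes to infinity because [psi] is continuous at 0. *)
Lemma laplace_cdf_limit : exists P : prob, forall l, 0 < l -> lap P l = (psi l)%:E.
Proof.
exists (lebesgue_stieltjes_measure (cdf_inf : cumulative R R) : prob).
move=> l l0; have [I ->] := psiE l0; rewrite lap_cdf// /Rintegral fineK; last exact: integrable_fin_num.
apply: eq_integral => y _; rewrite [RHS]EFinM.
congr (mule _ _).
exact: (cdf_lebesgue_stieltjes_id cdf_inf y).
Qed.

End cdf_limit.

End laplace.

(** * Construction of the one-sided stable laws *)

Section stable_law.
Context {R : realType}.
Local Notation M := (measurableTypeR R).
Local Notation prob := (probability M R).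
Local Notation mu := (@lebesgue_measure R).

Let mjump (b u : R) : measurable_fun setT (fun x : M => (1 - expR (- (u * x `^ (- b))))%:E).
Proof.
apply/measurable_EFinP; apply: measurable_funB => //; apply: (measurableT_comp (@measurable_expR R)).
by apply: measurable_funN; apply: measurable_funM => //; exact: measurable_powR.
Qed.

Let jump_ge0 (b u x : R) : 0 <= u -> (0%E <= (1 - expR (- (u * x `^ (- b))))%:E)%E.
Proof.
by move=> u0; rewrite lee_fin subr_ge0 -expR0 ler_expR oppr_le0 mulr_ge0 ?powR_ge0.
Qed.

(* The Levy exponent of the intensity that is the image of the Lebesgue measure on [(0, oo)]
   under [x |-> x ^ (- b)]. *)
Definition levy (b u : R) : \bar R :=
  (\int[mu]_(x in `]0%R, +oo[) (1 - expR (- (u * x `^ (- b))))%:E)%E.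

(** The substitution that multiplies x by u^(-1/b) removes u from the exponent. For b = 1/beta the
    resulting power u^beta is the stable exponent. *)
Lemma levy_scale (b u : R) : 0 < b -> 0 < u -> levy b u = ((u `^ b^-1)%:E * levy b 1)%E.
Proof.
move=> b0 u0; have c0 : 0 < u `^ (- b^-1) by rewrite powR_gt0.
have := @ge0_integral_scale_pos R _ (fun x => (1 - expR (- (1 * x `^ (- b))))%:E) c0.
rewrite -powRN opprK /levy => <-; last 2 first.
- by apply: measurable_funTS; exact: mjump.
- by move=> x _; apply: jump_ge0.
apply: eq_integral => x; rewrite inE/= in_itv/= andbT => x0.
rewrite mul1r powRM ?powR_ge0 ?(ltW x0)// -powRrM.
by rewrite mulrNN mulVf ?gt_eqF// powRr1// ltW.
Qed.

(** The integrand is at most 1 on ]0, 1] and at most x^(-b) beyond, which is integrable as b > 1. On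
    ]0, 1] it is at least 1 - exp(-1), whence K > 0. *)
Lemma levy_fin (b : R) : 1 < b -> exists2 K, 0 < K & levy b 1 = K%:E.
Proof.
move=> b1.
have S : `]0%R, +oo[%classic = `]0%R, 1%R] `|` `]1%R, +oo[%classic :> set R.
  by rewrite -itv_bndbnd_setU// bnd_simp.
have E : levy b 1 = (\int[mu]_(x in `]0%R, 1%R]) (1 - expR (- (1 * x `^ (- b))))%:E +
    \int[mu]_(x in `]1%R, +oo[) (1 - expR (- (1 * x `^ (- b))))%:E)%E.
  rewrite /levy S ge0_integral_setU//=.
  - by apply: measurable_funTS; exact: mjump.
  - by move=> x _; exact: jump_ge0.
  - rewrite disj_set2E; apply/eqP; rewrite -subset0 => x [] /=; rewrite !in_itv/= andbT => /andP[_].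
    by rewrite leNgt => /negP.
have H1 : (\int[mu]_(x in `]0%R, 1%R]) (1 - expR (- (1 * x `^ (- b))))%:E <= 1)%E.
  apply: (@le_trans _ _ (\int[mu]_(x in `]0%R, 1%R]) (cst 1%E x))%E).
    apply: ge0_le_integral => //.
    - by move=> x _; exact: jump_ge0.
    - by apply: measurable_funTS; exact: mjump.
    - by move=> x _; rewrite lee_fin gerBl expR_ge0.
  rewrite (integral_cst (@lebesgue_measure R)); last exact: measurable_itv.
  rewrite mul1e; rewrite [leLHS](lebesgue_measure_itv `]0%R, 1%R]).
  by rewrite /= lte_fin ltr01 oppr0 adde0.
have H2 : (\int[mu]_(x in `]1%R, +oo[) (1 - expR (- (1 * x `^ (- b))))%:E <= ((b - 1)^-1)%:E)%E.
  rewrite -(integral_powRy b1) -integral_itv_obnd_cbnd; last first.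
    by apply/measurable_EFinP/measurable_funTS; exact: measurable_powR.
  apply: ge0_le_integral => //.
  - by move=> x _; exact: jump_ge0.
  - by apply: measurable_funTS; exact: mjump.
  - by apply/measurable_EFinP/measurable_funTS; exact: measurable_powR.
  - move=> x _; rewrite lee_fin mul1r lerBlDr -lerBlDl.
    exact: expR_ge1Dx.
have H3 : ((1 - expR (-1))%:E <= levy b 1)%E.
  have -> : (1 - expR (-1))%:E = (\int[mu]_(x in `]0%R, 1%R]) (cst (1 - expR (-1))%:E x))%E.
    rewrite (integral_cst (@lebesgue_measure R)); last exact: measurable_itv.
    rewrite [X in (_ = _ * X)%E](lebesgue_measure_itv `]0%R, 1%R]).
    by rewrite /= lte_fin ltr01 oppr0 adde0 mule1.
  rewrite E; apply: (@le_trans _ _ (\int[mu]_(x in `]0%R, 1%R]) (1 - expR (- (1 * x `^ (- b))))%:E)%E); last first.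
    by rewrite leeDl//; apply: integral_ge0 => x _; exact: jump_ge0.
  apply: ge0_le_integral => //.
  - by move=> x _; rewrite lee_fin subr_ge0 -[leRHS]expR0 ler_expR; lra.
  - by apply: measurable_funTS; exact: mjump.
  - move=> x; rewrite /= in_itv/= => /andP[x0 x1]; rewrite lee_fin lerD2l lerN2 ler_expR lerN2 mul1r.
    rewrite powRN invf_ge1 ?powR_gt0// (@le_trans _ _ (1 `^ b))//; last by rewrite powR1.
    by rewrite ge0_ler_powR ?nnegrE// ltW// (lt_trans ltr01).
have f : levy b 1 \is a fin_num.
  rewrite ge0_fin_numE; last by apply: integral_ge0 => x _; exact: jump_ge0.
  by rewrite E; apply: le_lt_trans (leeD H1 H2) _; rewrite -EFinD ltry.
exists (fine (levy b 1)); last by rewrite fineK.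
rewrite fine_gt0//; apply/andP; split; last by rewrite ltey_eq f.
apply: lt_le_trans H3; rewrite lte_fin subr_gt0 -[ltRHS]expR0 ltr_expR; lra.
Qed.

Lemma expRN_le (y : R) : 0 <= y -> expR (- y) <= (1 + y)^-1.
Proof. by move=> y0; rewrite expRN lef_pV2 ?posrE ?expR_gt0 ?ltr_wpDr// expR_ge1Dx. Qed.

Section construction.
Variable beta : R.
Hypotheses (beta0 : 0 < beta) (beta1 : beta < 1).

Let b := beta^-1.
Let b1 : 1 < b. Proof. by rewrite invf_gt1. Qed.
Let b0 : 0 < b. Proof. exact: lt_trans b1. Qed.

Definition jump_size (x : M) : M := x `^ (- beta^-1).

Let mjs : measurable_fun setT jump_size. Proof. exact: measurable_powR. Qed.
HB.instance Definition _ := @isMeasurableFun.Build _ _ _ _ jump_size mjs.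

Let nn1 (n : nat) : n%:R < n.+1%:R :> R. Proof. by rewrite ltr_nat. Qed.
(** The piece of the jump intensity that comes from [n, n+1]: this interval has length one, so the
    piece is a probability law. *)
Let q n : prob := distribution (uniform_prob (nn1 n)) jump_size.

Let q0 n : nonneg_law (q n).
Proof.
have -> : nonneg_law (q n) = (uniform_prob (nn1 n) (jump_size @^-1` `]-oo, 0%R[%classic) = 0%E) by [].
rewrite (_ : _ @^-1` _ = set0) ?measure0//.
apply/seteqP; split => // x; rewrite /= in_itv/= /jump_size ltNge; by rewrite powR_ge0.
Qed.

Let F (n : nat) : set R := `[n%:R, n.+1%:R[%classic.
Let a n l : R := fine (\int[mu]_(x in F n) (1 - expR (- (l * x `^ (- b))))%:E)%E.

Let mexp l : measurable_fun setT (fun x : M => (expR (- (l * x `^ (- b))))%:E).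
Proof.
apply/measurable_EFinP; apply: (measurableT_comp (@measurable_expR R)).
by apply: measurable_funN; apply: measurable_funM => //; exact: measurable_powR.
Qed.

Let q_lap n l : 0 <= l -> lap (q n) l = (1 - a n l)%:E /\
  (\int[mu]_(x in F n) (1 - expR (- (l * x `^ (- b))))%:E)%E = (a n l)%:E.
Proof.
move=> l0.
have mF : measurable (F n) by exact: measurable_itv.
have E : lap (q n) l = (\int[mu]_(x in F n) (expR (- (l * x `^ (- b))))%:E)%E.
  rewrite /lap /q ge0_integral_distribution//; last first.
    apply/measurable_EFinP; apply: (measurableT_comp (@measurable_expR R)).
    by apply: measurable_funN; exact: measurable_funM.
  rewrite (integral_uniform (nn1 n)); [|exact: (mexp l)|by move=> x; rewrite lee_fin expR_ge0].
  rewrite -natrB// subSnn invr1 mul1e /F integral_itv_bndo_bndc//.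
  by apply: measurable_funTS; exact: mexp.
have S : (\int[mu]_(x in F n) (1 - expR (- (l * x `^ (- b))))%:E +
    \int[mu]_(x in F n) (expR (- (l * x `^ (- b))))%:E = 1)%E.
  rewrite -ge0_integralD//.
  - rewrite (_ : (fun x => _) = cst 1%E); last first.
      by apply/funext => x /=; rewrite -EFinD subrK.
    rewrite (integral_cst (@lebesgue_measure R)) ?mul1e//; rewrite [LHS](lebesgue_measure_itv `[n%:R, n.+1%:R[).
    by rewrite /= lte_fin nn1 -EFinD -natrB// subSnn.
  - by move=> x _; exact: jump_ge0.
  - by apply: measurable_funTS; exact: mjump.
  - by apply: measurable_funTS; exact: mexp.
have i1 : (0 <= \int[mu]_(x in F n) (1 - expR (- (l * x `^ (- b))))%:E)%E.
  by apply: integral_ge0 => x _; exact: jump_ge0.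
have i2 : (0 <= \int[mu]_(x in F n) (expR (- (l * x `^ (- b))))%:E)%E.
  by apply: integral_ge0 => x _; rewrite lee_fin expR_ge0.
move: i1 i2 S; rewrite E /a.
case: (integral _ _ _) => [x| |//]; case: (integral _ _ _) => [y| |//] _ _ H; try discriminate H.
by move: H; rewrite -EFinD /= => -[<-]; split => //; congr (_%:E); ring.
Qed.

Let a_sum l : 0 < l -> exists2 A, levy b l = A%:E & \sum_(0 <= k < n) a k l @[n --> \oo] --> A.
Proof.
move=> l0; have [K K0 EK] := levy_fin b1.
exists (l `^ b^-1 * K); first by rewrite levy_scale// EK EFinM.
have S : `[0%R, +oo[%classic = \bigcup_k F k :> set R.
  apply/seteqP; split => [x|x [k _]]; rewrite /F/= !in_itv/= ?andbT.
    by move=> x0; exists (Num.truncn x) => //=; rewrite in_itv/=; exact: truncn_itv.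
  by move=> /andP[+ _]; exact: le_trans.
have E : levy b l = (\sum_(0 <= k <oo) (a k l)%:E)%E.
  rewrite /levy integral_itv_obnd_cbnd; last by apply: measurable_funTS; exact: mjump.
  rewrite S ge0_integral_bigcup//.
  - by apply: eq_eseriesr => k _; case: (q_lap k (ltW l0)).
  - by move=> k; exact: measurable_itv.
  - by apply: measurable_funTS; exact: mjump.
  - by move=> x _; apply: jump_ge0; exact: ltW.
  - apply/trivIsetP => i j _ _ ij; rewrite -subset0 => x [] /=; rewrite /F/= !in_itv/= => /andP[ix xi] /andP[jx xj].
    move: ij; rewrite neq_ltn => /orP[] H.
      have h : i.+1%:R <= j%:R :> R by rewrite ler_nat.
      by have := lt_le_trans xi (le_trans h jx); rewrite ltxx.
    have h : j.+1%:R <= i%:R :> R by rewrite ler_nat.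
    by have := lt_le_trans xj (le_trans h ix); rewrite ltxx.
have a0 k : 0 <= a k l.
  by apply: fine_ge0; apply: integral_ge0 => x _; apply: jump_ge0; exact: ltW.
have C : cvgn (fun n => \sum_(0 <= k < n) (a k l)%:E)%E.
  by apply: is_cvg_nneseries => k _ _; rewrite lee_fin.
move: E; rewrite levy_scale// EK -EFinM => E.
have : (fun n => \sum_(0 <= k < n) (a k l)%:E)%E @ \oo --> (l `^ b^-1 * K)%:E by rewrite E.
move=> /fine_cvg; apply: cvg_trans; apply: near_eq_cvg; near=> n => /=.
by rewrite sumEFin.
Unshelve. all: by end_near. Qed.

(* A limit of convolutions of the compound Poisson laws obtained by cutting the jump intensity into
   pieces of finite mass. *)
Lemma stable_law_lt1 : exists P : prob, forall l, 0 < l -> lap P l = (expR (- (l `^ beta)))%:E.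
Proof.
have [K K0 EK] := levy_fin b1.
have Ki : 0 <= K^-1 by rewrite invr_ge0 ltW.
(* By scaling, the total exponent of the pieces is K l^beta; the rate 1/K normalises it to
   l^beta. *)
have /choice[Q HQ] n := compound_poisson Ki (q0 n).
pose ch := fix ch n : prob := if n is m.+1 then conv (ch m) (Q m.+1) else Q 0%N.
have chL n l : 0 < l -> lap (ch n) l = (expR (- (K^-1 * \sum_(0 <= k < n.+1) a k l)))%:E.
  move=> l0; elim: n => [|n IH].
    rewrite (proj2 (HQ 0%N) l (1 - a 0 l)); last by case: (q_lap 0 (ltW l0)).
    by rewrite big_nat1; congr (expR _)%:E; ring.
  rewrite /= lap_conv IH; rewrite (proj2 (HQ n.+1) l (1 - a n.+1 l)); last by case: (q_lap n.+1 (ltW l0)).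
  by rewrite -EFinM -expRD [in RHS]big_nat_recr//=; congr (expR _)%:E; ring.
apply: (@laplace_cdf_limit R ch (fun l => expR (- (l `^ beta)))).
- by have [] := HQ 0%N.
- move=> n y; apply: conv_le => //; last by have [] := HQ n.+1.
  by move=> x z z0 /=; rewrite !in_itv/=; apply: le_trans; rewrite lerDl.
- move=> l l0; exists (fun n => expR (- (K^-1 * \sum_(0 <= k < n.+1) a k l))); first by move=> n; exact: chL.
  have [A EA aA] := a_sum l0.
  have -> : l `^ beta = K^-1 * A.
    move: EA; rewrite levy_scale// EK -EFinM => -[<-]; rewrite /b invrK.
    by rewrite mulrCA mulVf ?mulr1// gt_eqF.
  apply: (@cvg_comp _ _ _ (fun n => - (K^-1 * \sum_(0 <= k < n.+1) a k l)) expR); last exact: continuous_expR.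
  by apply: cvgN; apply: cvgMr; rewrite (cvg_shiftS (fun n => \sum_(0 <= k < n) a k l)).
- rewrite -[X in _ --> X]expR0; apply: (@cvg_comp _ _ _ (fun l => - (l `^ beta)) expR); last exact: continuous_expR.
  have : - (l `^ beta) @[l --> 0^'+] --> - (0 : R) by apply: cvgN; exact: powR_cvg0.
  by rewrite oppr0.
Qed.

End construction.

Lemma stable_law (beta : R) : 0 < beta -> beta <= 1 ->
  exists P : prob, P `]-oo, 0%R]%classic = 0%E /\
    forall l, 0 < l -> lap P l = (expR (- (l `^ beta)))%:E.
Proof.
move=> beta0; rewrite le_eqVlt => /orP[/eqP ->|beta1].
  (* The exponent 1 arises for [Q] when alpha = 2; there is no subordination then. *)
  exists (dirac (1 : M)); split.
    by rewrite /= diracE memNset//= in_itv/= ler10.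
  move=> l l0; rewrite /lap integral_dirac//; last first.
    apply/measurable_EFinP; apply: (measurableT_comp (@measurable_expR R)).
    by apply: measurable_funN; exact: measurable_funM.
  by rewrite diracT mul1e mulr1 powRr1// ltW.
have [P HP] := stable_law_lt1 beta0 beta1; exists P; split => //.
have f : P `]-oo, 0%R]%classic \is a fin_num by exact: fin_num_measure.
(* On ]-oo, 0] the integrand exp(-l x) is at least 1, so the mass r of this half-line is at most
   exp(-l^beta) for every l > 0. For l^beta = 1/r this yields r <= r/(r+1), which is impossible if r
   > 0. *)
have bound (y : R) : 0 < y -> fine (P `]-oo, 0%R]%classic) <= expR (- y).
  move=> y0; rewrite -lee_fin fineK//.
  have -> : (expR (- y))%:E = lap P (y `^ beta^-1).
    by rewrite HP ?powR_gt0// -powRrM mulVf ?gt_eqF// powRr1// ltW.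
  have -> : P `]-oo, 0%R]%classic = (\int[P]_x (\1_(`]-oo, 0%R]%classic : set R) x)%:E)%E by rewrite integral_indic// setIT.
  apply: ge0_le_integral => //.
  - by apply/measurable_EFinP; exact: measurable_indic.
  - apply/measurable_EFinP; apply: (measurableT_comp (@measurable_expR R)).
    by apply: measurable_funN; exact: measurable_funM.
  - move=> x _; rewrite lee_fin indicE; case: (boolP (x \in _)) => [|_]; last exact: expR_ge0.
    rewrite inE/= in_itv/= => x0; rewrite -expR0 ler_expR oppr_ge0.
    by rewrite mulr_ge0_le0// powR_ge0.
rewrite -(fineK f); congr (_%:E); apply/eqP; rewrite eq_le fine_ge0 ?measure_ge0// andbT leNgt.
apply/negP; set r := fine _ => r0.
have := bound r^-1 _; rewrite invr_gt0 => /(_ r0) h.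
have := le_trans h (expRN_le (ltW _)); rewrite invr_gt0 => /(_ r0).
rewrite leNgt => /negP; apply.
have -> : (1 + r^-1)^-1 = r / (r + 1) by field; rewrite !gt_eqF// ltr_wpDr.
by rewrite ltr_pdivrMr ?ltr_wpDr// ltr_pMr// ltrDr.
Qed.

End stable_law.

(** * Gamma and Mittag-Leffler functions *)

Section gamma.
Context {R : realType}.
Local Notation mu := (@lebesgue_measure R).

(** exp(-g) is the integral of exp(-v) over v >= g, and Tonelli exchanges the two integrals. With g
    = s^b this effects the substitution v = s^b in gamma integrals. *)
Lemma layer_cake_exp d (T : measurableType d) (m : {sigma_finite_measure set T -> \bar R})
    (w g : T -> R) : measurable_fun setT w -> measurable_fun setT g -> (forall x, 0 <= w x) ->
  (\int[m]_x (w x * expR (- g x))%:E =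
   \int[mu]_v ((expR (- v))%:E * \int[m]_(x in [set x | (g x <= v)%R]) (w x)%:E))%E.
Proof.
move=> mw mg w0.
pose S : set (T * measurableTypeR R) := [set z | g z.1 <= z.2].
pose f (z : T * measurableTypeR R) : \bar R := (w z.1 * expR (- z.2) * \1_S z)%:E.
have mg1 : measurable_fun setT (fun z : T * measurableTypeR R => g z.1).
  exact: (measurableT_comp mg measurable_fst).
have mS : measurable S.
  by rewrite -[X in measurable X]setTI; exact: (measurable_fun_ler mg1 measurable_snd).
have mf : measurable_fun setT f.
  apply/measurable_EFinP; apply: measurable_funM; last exact: measurable_indic.
  apply: measurable_funM; first exact: (measurableT_comp mw measurable_fst).
  by apply: (measurableT_comp (@measurable_expR R)); exact: measurable_funN.
have f0 z : (0 <= f z)%E by rewrite lee_fin !mulr_ge0 ?expR_ge0.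
transitivity (\int[m]_x \int[mu]_y f (x, y))%E.
  apply: eq_integral => x _.
  transitivity ((w x)%:E * \int[mu]_(y in `[g x, +oo[) (1 * expR (- (1 * y)))%:E)%E.
    by rewrite integral_expR_tail// -EFinM mul1r.
  have me : measurable_fun `[g x, +oo[ (fun y : R => (1 * expR (- (1 * y)))%:E).
    apply/measurable_EFinP; apply: measurable_funTS; apply: measurable_funM => //.
    apply: (measurableT_comp (@measurable_expR R)).
    by apply: measurable_funN; exact: measurable_funM.
  rewrite -ge0_integralZl//; last by rewrite lee_fin.
  rewrite [LHS]integral_mkcond; apply: eq_integral => y _; rewrite patchE /f/= indicE.
  have -> : (y \in `[g x, +oo[%classic) = (g x <= y) by apply/idP/idP; rewrite inE/= in_itv/= andbT.
  have -> : ((x, y) \in S) = (g x <= y) by apply/idP/idP; rewrite inE.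
  by case: (g x <= y); rewrite ?mulr1 ?mulr0// -EFinM !mul1r.
rewrite (fubini_tonelli (m1 := m) (m2 := @lebesgue_measure R) f)//.
apply: eq_integral => v _.
have mSv : measurable [set x | g x <= v].
  by rewrite -[X in measurable X]setTI; exact: measurable_fun_ler.
rewrite -ge0_integralZl//; last 2 first.
- by apply/measurable_EFinP; exact: measurable_funTS.
- by move=> x _; rewrite lee_fin.
rewrite [RHS]integral_mkcond; apply: eq_integral => x _; rewrite patchE /f/= indicE.
have -> : (x \in [set x | g x <= v]) = (g x <= v) by apply/idP/idP; rewrite inE.
have -> : ((x, v) \in S) = (g x <= v) by apply/idP/idP; rewrite inE.
by case: (g x <= v); rewrite ?mulr1 ?mulr0// -EFinM mulrC.
Qed.

Definition gammaE (r : R) : \bar R :=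
  (\int[mu]_(t in `]0%R, +oo[) (t `^ (r - 1) * expR (- t))%:E)%E.

Lemma GammaE r : Gamma r = fine (gammaE r). Proof. by []. Qed.

Let mpe1 (r : R) : measurable_fun setT (fun t : R => t `^ (r - 1) * expR (- t)).
Proof.
apply: measurable_funM; first exact: measurable_powR.
by apply: (measurableT_comp (@measurable_expR R)); exact: measurable_funN.
Qed.

(** The s > 0 with s^b <= v form ]0, v^(1/b)], of weight v^(r/b)/r. For b = 1 this is the functional
    equation of [Gamma]; for b = beta it evaluates the negative moments of a stable law. *)
Lemma gamma_layer (r b : R) : 0 < r -> 0 < b ->
  (\int[mu]_(s in `]0%R, +oo[) (s `^ (r - 1) * expR (- (s `^ b)))%:E =
   (r^-1)%:E * gammaE (r / b + 1))%E.
Proof.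
move=> r0 b0.
pose w (s : R) : R := s `^ (r - 1) * \1_(`]0%R, +oo[%classic : set R) s.
have mw : measurable_fun setT w by apply: measurable_funM; [exact: measurable_powR|exact: measurable_indic].
have := @layer_cake_exp _ _ (@lebesgue_measure R) w (fun s => s `^ b) mw (measurable_powR _).
have -> : (\int[mu]_x (w x * expR (- (x `^ b)))%:E = \int[mu]_(s in `]0%R, +oo[) (s `^ (r - 1) * expR (- (s `^ b)))%:E)%E.
  rewrite [RHS]integral_mkcond; apply: eq_integral => s _; rewrite patchE /w indicE.
  by case: (s \in _); rewrite ?mulr1 ?mulr0 ?mul0r.
move=> ->; last by move=> x; rewrite mulr_ge0 ?powR_ge0.
rewrite /gammaE -ge0_integralZl//; last 3 first.
- by apply/measurable_EFinP; apply: measurable_funTS; exact: mpe1.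
- by move=> x _; rewrite lee_fin mulr_ge0 ?powR_ge0 ?expR_ge0.
- by rewrite lee_fin invr_ge0 ltW.
rewrite [RHS]integral_mkcond; apply: eq_integral => v _; rewrite patchE.
have E : (\int[mu]_(x in [set x | (x `^ b <= v)%R]) (w x)%:E =
   \int[mu]_(x in [set x | (x `^ b <= v)%R] `&` `]0%R, +oo[) (x `^ (r - 1))%:E)%E.
  rewrite integral_mkcondr; apply: eq_integral => s _; rewrite patchE /w indicE.
  by case: (s \in _); rewrite ?mulr1 ?mulr0.
have vE : (v \in `]0%R, +oo[%classic) = (0 < v) by apply/idP/idP; rewrite inE/= in_itv/= andbT.
rewrite E vE; case: ltP => v0; last first.
  rewrite (_ : _ `&` _ = set0) ?integral_set0 ?mule0//.
  apply/seteqP; split => // x [/= xv]; rewrite in_itv/= andbT => x0.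
  by have := lt_le_trans (powR_gt0 b x0) (le_trans xv v0); rewrite ltxx.
rewrite (_ : _ `&` _ = `]0%R, (v `^ b^-1)]%classic); last first.
  have vb : (v `^ b^-1) `^ b = v by rewrite -powRrM mulVf ?gt_eqF// powRr1// ltW.
  apply/seteqP; split => x /=; rewrite !in_itv/= ?andbT.
    move=> [xv x0]; rewrite x0/= leNgt; apply/negP => H.
    by have := gt0_ltr_powR b0 (powR_ge0 _ _) (ltW x0) H; rewrite vb ltNge xv.
  move=> /andP[x0 xv]; split => //; rewrite -[leRHS]vb ge0_ler_powR ?nnegrE ?powR_ge0// ltW//.
rewrite integral_powR0 ?powR_gt0// -!EFinM; congr (_%:E).
by rewrite -powRrM addrK [b^-1 * r]mulrC; ring.
Qed.

Lemma gammaE_ge0 r : (0 <= gammaE r)%E.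
Proof. by apply: integral_ge0 => x _; rewrite lee_fin mulr_ge0 ?powR_ge0 ?expR_ge0. Qed.

Lemma gammaE_bounds r : 0 < r -> 0 < Gamma r /\ gammaE r = (Gamma r)%:E.
Proof.
move=> r0.
have S : `]0%R, +oo[%classic = `]0%R, 1%R] `|` `]1%R, +oo[%classic :> set R.
  by rewrite -itv_bndbnd_setU// bnd_simp.
have pe0 (x : R) : (0%:E <= (x `^ (r - 1) * expR (- x))%:E)%E by rewrite lee_fin mulr_ge0 ?powR_ge0 ?expR_ge0.
have E : gammaE r = (\int[mu]_(x in `]0%R, 1%R]) (x `^ (r - 1) * expR (- x))%:E +
    \int[mu]_(x in `]1%R, +oo[) (x `^ (r - 1) * expR (- x))%:E)%E.
  rewrite /gammaE S ge0_integral_setU//=.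
  - by apply/measurable_EFinP; apply: measurable_funTS; exact: mpe1.
  - rewrite disj_set2E; apply/eqP; rewrite -subset0 => x [] /=; rewrite !in_itv/= andbT => /andP[_].
    by rewrite leNgt => /negP.
have H1 : (\int[mu]_(x in `]0%R, 1%R]) (x `^ (r - 1) * expR (- x))%:E <= (r^-1)%:E)%E.
  have := integral_powR0 r0 (@ltr01 R); rewrite powR1 mul1r => <-.
  apply: ge0_le_integral => //.
  - by apply/measurable_EFinP; apply: measurable_funTS; exact: mpe1.
  - by apply/measurable_EFinP; apply: measurable_funTS; exact: measurable_powR.
  - move=> x /=; rewrite in_itv/= => /andP[x0 _]; rewrite lee_fin ler_piMr ?powR_ge0//.
    by rewrite -[leRHS]expR0 ler_expR oppr_le0 ltW.
(* With r - 1 <= n - 2 the integrand on ]1, oo[ is at most x^n exp(-x) x^(-2), hence at most n!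
   x^(-2). *)
have [n Hn] : exists n : nat, r + 1 <= n%:R.
  by exists (Num.bound (r + 1)); apply/ltW/archi_boundP; rewrite addr_ge0// ltW.
have H2 : (\int[mu]_(x in `]1%R, +oo[) (x `^ (r - 1) * expR (- x))%:E <= (n`!%:R)%:E)%E.
  have -> : (n`!%:R)%:E = ((n`!%:R)%:E * ((2 - 1)^-1 : R)%:E)%E.
    have -> : 2 - 1 = 1 :> R by lra.
    by rewrite invr1 -EFinM mulr1.
  rewrite -(@integral_powRy R 2 (ltr1n _ 2)) -integral_itv_obnd_cbnd; last first.
    by apply/measurable_EFinP/measurable_funTS; exact: measurable_powR.
  rewrite -ge0_integralZl//; last 2 first.
  - by apply/measurable_EFinP; apply: measurable_funTS; exact: measurable_powR.
  - by move=> x _; rewrite lee_fin powR_ge0.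
  apply: ge0_le_integral => //.
  - by apply/measurable_EFinP; apply: measurable_funTS; exact: mpe1.
  - by apply/measurable_EFinP; apply: measurable_funTS; apply: measurable_funM => //; exact: measurable_powR.
  - move=> x /=; rewrite in_itv/= andbT => x1; have x0 : 0 < x by exact: lt_trans x1.
    rewrite -EFinM lee_fin.
    apply: (@le_trans _ _ (x ^+ n * x `^ (- 2) * expR (- x))); last first.
      by rewrite mulrAC ler_wpM2r ?powR_ge0// pow_exp_bound// ltW.
    rewrite ler_wpM2r ?expR_ge0// -powR_mulrn ?(ltW x0)// -powRD; last by rewrite (gt_eqF x0) implybT.
    by apply: ler_powR; [exact: ltW|lra].
have H3 : ((expR (-1) / r)%:E <= gammaE r)%E.
  have := integral_powR0 r0 (@ltr01 R); rewrite powR1 mul1r => H.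
  rewrite EFinM -H -ge0_integralZl//; last 2 first.
  - by apply/measurable_EFinP; apply: measurable_funTS; exact: measurable_powR.
  - by move=> x _; rewrite lee_fin powR_ge0.
  rewrite E; apply: (@le_trans _ _ (\int[mu]_(x in `]0%R, 1%R]) (x `^ (r - 1) * expR (- x))%:E)%E); last first.
    by rewrite leeDl//; apply: integral_ge0 => x _; exact: pe0.
  apply: ge0_le_integral => //.
  - by move=> x _; rewrite mule_ge0// lee_fin ?expR_ge0 ?powR_ge0.
  - by apply/measurable_EFinP; apply: measurable_funTS; apply: measurable_funM => //; exact: measurable_powR.
  - by apply/measurable_EFinP; apply: measurable_funTS; exact: mpe1.
  - move=> x /=; rewrite in_itv/= => /andP[x0 x1]; rewrite -EFinM lee_fin mulrC ler_wpM2l ?powR_ge0//.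
    by rewrite ler_expR lerN2.
have f : gammaE r \is a fin_num.
  rewrite ge0_fin_numE ?gammaE_ge0// E; apply: le_lt_trans (leeD H1 H2) _; by rewrite -EFinD ltry.
rewrite GammaE fineK//; split => //; rewrite fine_gt0//; apply/andP; split; last by rewrite ltey_eq f.
by apply: lt_le_trans H3; rewrite lte_fin divr_gt0 ?expR_gt0.
Qed.

Lemma Gamma_gt0 (r : R) : 0 < r -> 0 < Gamma r. Proof. by case/gammaE_bounds. Qed.

Lemma GammaS (r : R) : 0 < r -> Gamma (r + 1) = r * Gamma r.
Proof.
move=> r0; have r10 : 0 < r + 1 by rewrite addr_gt0.
have := gamma_layer r0 (@ltr01 R); rewrite divr1.
rewrite (_ : (\int[mu]_(s in _) _)%E = gammaE r); last first.
  apply: eq_integral => s; rewrite inE/= in_itv/= andbT => s0; by rewrite powRr1// ltW.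
rewrite (gammaE_bounds r0).2 (gammaE_bounds r10).2 -EFinM => -[->].
by rewrite mulrA mulfV ?mul1r// gt_eqF.
Qed.

Lemma Gamma1 : Gamma (1 : R) = 1.
Proof.
rewrite GammaE /gammaE (_ : integral _ _ _ = 1%E)//.
have := @integral_expR_tail R 1 0 ltr01; rewrite mulr0 oppr0 expR0 => <-.
rewrite -integral_itv_obnd_cbnd; last first.
  apply/measurable_EFinP; apply: measurable_funTS; apply: measurable_funM => //.
  by apply: (measurableT_comp (@measurable_expR R)); apply: measurable_funN; exact: measurable_funM.
by apply: eq_integral => s _; rewrite subrr powRr0 !mul1r.
Qed.

Lemma Gamma_nat n : Gamma (n.+1%:R : R) = n`!%:R.
Proof.
elim: n => [|n IH]; first by rewrite Gamma1.
by rewrite -[in LHS]natr1 GammaS// IH factS natrM.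
Qed.

(** Bounds the integral below by its part over ]K, K+1[. As K is free, [Gamma] outgrows every
    exponential, which makes the Mittag-Leffler series converge for all arguments. *)
Lemma Gamma_lb (K x : R) : 1 <= K -> 1 <= x -> K `^ (x - 1) * expR (- (K + 1)) <= Gamma x.
Proof.
move=> K1 x1; have K0 : 0 < K by exact: lt_le_trans K1.
have x0 : 0 < x by exact: lt_le_trans x1.
rewrite -lee_fin -(gammaE_bounds x0).2.
apply: (@le_trans _ _ (\int[mu]_(t in `]K, (K + 1)%R[) (t `^ (x - 1) * expR (- t))%:E)%E); last first.
  apply: ge0_subset_integral => //.
  - by apply/measurable_EFinP; apply: measurable_funTS; exact: mpe1.
  - by move=> t _; rewrite lee_fin mulr_ge0 ?powR_ge0 ?expR_ge0.
  - by move=> t /=; rewrite !in_itv/= andbT => /andP[h _]; exact: lt_trans h.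
have -> : (K `^ (x - 1) * expR (- (K + 1)))%:E =
   (\int[mu]_(t in `]K, (K + 1)%R[) cst (K `^ (x - 1) * expR (- (K + 1)))%:E t)%E.
  rewrite (integral_cst (@lebesgue_measure R)); last exact: measurable_itv.
  rewrite [X in (_ = _ * X)%E](lebesgue_measure_itv `]K, K + 1[).
  by rewrite /= lte_fin ltrDl ltr01 -EFinD [K + 1]addrC addrK mule1.
apply: ge0_le_integral => //.
- by move=> t _; rewrite lee_fin mulr_ge0 ?powR_ge0 ?expR_ge0.
- by apply/measurable_EFinP; apply: measurable_funTS; exact: mpe1.
- move=> t /=; rewrite in_itv/= => /andP[tK tK1]; rewrite lee_fin ler_pM ?powR_ge0 ?expR_ge0//.
    rewrite ge0_ler_powR ?nnegrE ?subr_ge0// ?ltW//; exact: lt_trans tK.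
  by rewrite ler_expR lerN2 ltW.
Qed.

End gamma.

(** * Moments of the stable laws *)

Section stable_moments.
Context {R : realType}.
Local Notation M := (measurableTypeR R).
Local Notation mu := (@lebesgue_measure R).

Let mpe (u r : R) : measurable_fun setT (fun t : R => t `^ (r - 1) * expR (- (u * t))).
Proof.
apply: measurable_funM; first exact: measurable_powR.
by apply: (measurableT_comp (@measurable_expR R)); apply: measurable_funN; exact: measurable_funM.
Qed.

Lemma gamma_scale (r u : R) : 0 < r -> 0 < u ->
  (\int[mu]_(s in `]0%R, +oo[) (s `^ (r - 1) * expR (- (u * s)))%:E = (u `^ (- r) * Gamma r)%:E)%E.
Proof.
move=> r0 u0.
have m1 : measurable_fun (`]0%R, +oo[%classic : set R) (fun s : M => (s `^ (r - 1) * expR (- s))%:E).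
  apply/measurable_EFinP; apply: measurable_funTS.
  by have := mpe 1 r; under eq_fun do rewrite mul1r.
have := @ge0_integral_scale_pos R u _ u0 m1.
have pe0 (x : R) : 0 < x -> (0%:E <= (x `^ (r - 1) * expR (- x))%:E)%E.
  by move=> _; rewrite lee_fin mulr_ge0 ?powR_ge0 ?expR_ge0.
move/(_ pe0).
rewrite -/(gammaE r) (gammaE_bounds r0).2 -EFinM => H.
have -> : (u `^ (- r) * Gamma r)%:E = ((u `^ (1 - r))%:E * (u^-1 * Gamma r)%:E)%E.
  rewrite -EFinM mulrA; congr (_ * _)%:E.
  have -> : 1 - r = (- r) + 1 by ring.
  rewrite powRD; last by rewrite (gt_eqF u0) implybT.
  by rewrite powRr1 ?mulfK// ?gt_eqF// ltW.
rewrite -H//.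
rewrite -ge0_integralZl//; last 3 first.
- apply/measurable_EFinP; apply: measurable_funTS; apply: measurable_funM.
    by apply: (measurableT_comp (measurable_powR _)); exact: measurable_funM.
  by apply: (measurableT_comp (@measurable_expR R)); apply: measurable_funN; exact: measurable_funM.
- by move=> x _; rewrite lee_fin mulr_ge0 ?powR_ge0 ?expR_ge0.
- by rewrite lee_fin powR_ge0.
apply: eq_integral => s; rewrite inE/= in_itv/= andbT => s0.
rewrite -EFinM mulrA; congr (_ * _)%:E.
rewrite powRM ?(ltW u0) ?(ltW s0)// mulrA -powRD; last by rewrite (gt_eqF u0) implybT.
have -> : 1 - r + (r - 1) = 0 by ring.
by rewrite powRr0 mul1r.
Qed.

Section law.
Variables (P : probability M R) (beta : R).
Hypotheses (P0 : P `]-oo, 0%R]%classic = 0%E) (beta0 : 0 < beta)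
  (Plap : forall l, 0 < l -> lap P l = (expR (- (l `^ beta)))%:E).

Lemma stable_pos : {ae P, forall u, 0 < u}.
Proof.
exists `]-oo, 0%R]%classic; split => // x /= H; rewrite in_itv/= leNgt; exact/negP.
Qed.

Lemma stable_ae (Q : M -> Prop) : (forall u : R, 0 < u -> Q u) -> {ae P, forall u, Q u}.
Proof.
move=> H; have [N [mN N0 HN]] := stable_pos; exists N; split => // x /= Qx; apply: HN => /= x0.
by apply: Qx; exact: H.
Qed.

(** u^(-r) Gamma(r) is the integral of s^(r-1) exp(-u s) over s > 0. After the exchange with the
    expectation the inner integral is the Laplace transform exp(-s^beta), and [gamma_layer]
    evaluates the outer one. *)
Lemma neg_moment (r : R) : 0 < r ->
  (\int[P]_u (u `^ (- r))%:E = (Gamma (r / beta + 1) / (r * Gamma r))%:E)%E.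
Proof.
move=> r0.
have rb0 : 0 < r / beta + 1 by rewrite addr_gt0// divr_gt0.
pose f (z : M * M) : \bar R := (z.2 `^ (r - 1) * expR (- (z.1 * z.2)) * \1_(`]0%R, +oo[%classic : set R) z.2)%:E.
have mf : measurable_fun setT f.
  apply/measurable_EFinP; apply: measurable_funM; last first.
    by apply: (measurableT_comp _ measurable_snd); exact: measurable_indic.
  apply: measurable_funM; first exact: (measurableT_comp (measurable_powR _) measurable_snd).
  by apply: (measurableT_comp (@measurable_expR R)); apply: measurable_funN; exact: measurable_funM.
have f0 z : (0 <= f z)%E by rewrite lee_fin !mulr_ge0 ?powR_ge0 ?expR_ge0.
have fE u s : f (u, s) = ((fun s => (s `^ (r - 1) * expR (- (u * s)))%:E) \_ `]0%R, +oo[) s.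
  by rewrite patchE /f/= indicE; case: (s \in _); rewrite ?mulr1 ?mulr0.
have E1 : (\int[P]_u ((u `^ (- r))%:E * (Gamma r)%:E) = \int[P]_u \int[mu]_s f (u, s))%E.
  apply: ae_eq_integral => //.
  - apply: emeasurable_funM => //; apply/measurable_EFinP; exact: measurable_powR.
  - exact: (measurable_fun_fubini_tonelli_F f).
  - apply: stable_ae => u u0 _ /=.
    under eq_integral do rewrite fE.
    by rewrite -integral_mkcond gamma_scale.
rewrite (fubini_tonelli (m1 := P) (m2 := @lebesgue_measure R) f)// in E1.
have E2 : (\int[mu]_s \int[P]_u f (u, s) =
    \int[mu]_(s in `]0%R, +oo[) (s `^ (r - 1) * expR (- (s `^ beta)))%:E)%E.
  rewrite [RHS]integral_mkcond; apply: eq_integral => s _; rewrite patchE.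
  under eq_integral do rewrite fE patchE.
  case: ifPn => [|_]; last by rewrite integral0.
  rewrite inE/= in_itv/= andbT => s0.
  rewrite EFinM -Plap// /lap -ge0_integralZl//; last 2 first.
  - by apply/measurable_EFinP; apply: (measurableT_comp (@measurable_expR R)); apply: measurable_funN; exact: measurable_funM.
  - by rewrite lee_fin powR_ge0.
  by apply: eq_integral => u _; rewrite -EFinM [s * u]mulrC.
have g0 := Gamma_gt0 r0.
have Z : (\int[P]_u ((u `^ (- r))%:E * (Gamma r)%:E) = \int[P]_u (u `^ (- r))%:E * (Gamma r)%:E)%E.
  apply: ge0_integralZr => //; last by rewrite lee_fin ltW.
  - by apply/measurable_EFinP; exact: measurable_powR.
  - by move=> u _; rewrite lee_fin powR_ge0.
rewrite E2 gamma_layer// (gammaE_bounds rb0).2 Z in E1.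
move: E1; have : (0 <= \int[P]_u (u `^ (- r))%:E)%E by apply: integral_ge0 => u _; rewrite lee_fin powR_ge0.
case: (integral _ _ _) => [x _| _|//].
  rewrite -!EFinM => -[H]; congr (_%:E).
  have -> : x = x * Gamma r / Gamma r by rewrite mulfK// gt_eqF.
  by rewrite H; field; rewrite !gt_eqF.
by rewrite gt0_mulye ?lte_fin.
Qed.

(** By [levy_scale], u^k is up to a constant the integral of 1 - exp(-u s^(-1/k)) over s > 0. Taking
    expectations inside turns it into the integral of 1 - exp(-s^(-beta/k)), that is
    [levy (beta / k) 1], finite because beta/k > 1. *)
Lemma pos_moment (k : R) : 0 < k -> k < beta -> k < 1 -> (\int[P]_u (u `^ k)%:E < +oo)%E.
Proof.
move=> k0 kb k1.
have i1 : 1 < k^-1 by rewrite invf_gt1.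
have bk : 1 < beta / k by rewrite ltr_pdivlMr// mul1r.
have [K K0 EK] := levy_fin i1; have [L L0 EL] := levy_fin bk.
pose f (z : M * M) : \bar R := ((1 - expR (- (z.1 * z.2 `^ (- k^-1)))) * \1_(`]0%R, +oo[ `*` `]0%R, +oo[ : set (M * M)) z)%:E.
have mf : measurable_fun setT f.
  apply/measurable_EFinP; apply: measurable_funM; last first.
    by apply: measurable_indic; apply: measurableX; exact: measurable_itv.
  apply: measurable_funB => //; apply: (measurableT_comp (@measurable_expR R)).
  apply: measurable_funN; apply: measurable_funM => //.
  exact: (measurableT_comp (measurable_powR _) measurable_snd).
have f0 z : (0 <= f z)%E.
  rewrite /f lee_fin indicE; case: (boolP (z \in _)) => [|_]; last by rewrite mulr0.
  rewrite inE/= !in_itv/= !andbT => -[z1 z2]; rewrite mulr1 subr_ge0 -expR0 ler_expR oppr_le0.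
  by rewrite mulr_ge0 ?powR_ge0// ltW.
have fE u s : 0 < u -> f (u, s) = ((fun s => (1 - expR (- (u * s `^ (- k^-1))))%:E) \_ `]0%R, +oo[) s.
  move=> u0; rewrite patchE /f/= indicE.
  have -> : ((u, s) \in (`]0%R, +oo[ `*` `]0%R, +oo[ : set (M * M))) = (s \in (`]0%R, +oo[%classic : set R)).
    apply/idP/idP; rewrite !inE/= !in_itv/= !andbT; [by case|by move=> s0; split].
  by case: (s \in _); rewrite ?mulr1 ?mulr0.
have E1 : (\int[P]_u ((u `^ k)%:E * K%:E) = \int[P]_u \int[mu]_s f (u, s))%E.
  apply: ae_eq_integral => //.
  - apply: emeasurable_funM => //; apply/measurable_EFinP; exact: measurable_powR.
  - exact: (measurable_fun_fubini_tonelli_F f).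
  - apply: stable_ae => u u0 _ /=.
    under eq_integral do rewrite fE//.
    by rewrite -integral_mkcond -/(levy _ _) levy_scale ?invr_gt0// invrK EK.
have E2 : (\int[mu]_s \int[P]_u f (u, s) = L%:E)%E.
  rewrite -EL /levy [RHS]integral_mkcond; apply: eq_integral => s _; rewrite patchE.
  have [s0|s0] := ltP 0 s; last first.
    have -> : (s \in (`]0%R, +oo[%classic : set R)) = false.
      by apply/negbTE; rewrite notin_setE/= in_itv/= andbT; apply/negP; rewrite -leNgt.
    apply: integral0_eq => u _; rewrite /f indicE memNset ?mulr0// => -[_] /=.
    by rewrite in_itv/= andbT ltNge s0.
  have sE : (s \in (`]0%R, +oo[%classic : set R)) = true by apply/idP; rewrite inE/= in_itv/= andbT.
  rewrite sE.
  have p0 := powR_gt0 (- k^-1) s0.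
  have mfs : measurable_fun setT (fun u => f (u, s)) by exact: (measurableT_comp mf (pair2_measurable s)).
  have me : measurable_fun setT (fun u : M => (expR (- (s `^ (- k^-1) * u)))%:E).
    apply/measurable_EFinP; apply: (measurableT_comp (@measurable_expR R)).
    by apply: measurable_funN; exact: measurable_funM.
  have S : (\int[P]_u f (u, s) + lap P (s `^ (- k^-1)) = 1)%E.
    rewrite /lap -ge0_integralD//.
    rewrite -[RHS](@probability_setT _ _ _ P) -[RHS]mul1e -(integral_cst P measurableT 1%E).
    apply: ae_eq_integral => //; first exact: emeasurable_funD.
    apply: stable_ae => u u0 _ /=; rewrite fE// patchE sE.
    by rewrite -EFinD [_ * u]mulrC subrK.
  move: S; rewrite Plap// -powRrM mulNr mulrC -mulrN mul1r.
  case: (integral _ _ _) => [x| |] H; try discriminate H.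
  move: H; rewrite -EFinD => -[H]; congr (_%:E); by rewrite -H addrK.
rewrite (fubini_tonelli (m1 := P) (m2 := @lebesgue_measure R) f)// E2 in E1.
have Z : (\int[P]_u ((u `^ k)%:E * K%:E) = \int[P]_u (u `^ k)%:E * K%:E)%E.
  apply: ge0_integralZr => //; last by rewrite lee_fin ltW.
  - by apply/measurable_EFinP; exact: measurable_powR.
  - by move=> u _; rewrite lee_fin powR_ge0.
rewrite Z in E1.
move: E1; case: (integral _ _ _) => [x| |] H.
- exact: ltry.
- by move: H; rewrite gt0_mulye ?lte_fin.
- by [].
Qed.

End law.
End stable_moments.

(** * Mittag-Leffler functions as mixtures of exponentials *)

Section mittag_leffler.
Context {R : realType}.
Local Notation M := (measurableTypeR R).

Lemma exp_partial_le (x : R) n : 0 <= x -> series (exp_coeff x) n <= expR x.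
Proof.
move=> x0; rewrite /expR; apply: nondecreasing_cvgn_le; last exact: is_cvg_series_exp_coeff.
apply: nondecreasing_series => k _ _; exact: exp_coeff_ge0.
Qed.

(** Integration of the exponential series term by term: w exp(l Y) dominates all partial sums for
    the argument -l Y. The weight w is 1 for the parameter gamma = 1 and beta u^(-beta) for gamma =
    beta. *)
Lemma exp_series_integral d (T : measurableType d) (m : {measure set T -> \bar R}) (w Y : T -> R) (l : R) :
  measurable_fun setT w -> measurable_fun setT Y -> (forall x, 0 <= w x) -> (forall x, 0 <= Y x) ->
  0 <= l -> m.-integrable setT (EFin \o (fun x => w x * expR (l * Y x))) ->
  series (fun k => (- l) ^+ k * (\int[m]_x (w x * Y x ^+ k) / k`!%:R)) n @[n --> \oo] -->
    \int[m]_x (w x * expR (- (l * Y x))).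
Proof.
move=> mw mY w0 Y0 l0 I.
have iw k : m.-integrable setT (EFin \o (fun x => l ^+ k * (w x * Y x ^+ k))).
  apply: (@intble_le _ _ R m _ (fun x => k`!%:R * (w x * expR (l * Y x)))).
  - by apply: measurable_funM => //; apply: measurable_funM => //; exact: measurable_funX.
  - move=> x; rewrite ger0_norm ?mulr_ge0 ?exprn_ge0// mulrCA [leRHS]mulrCA ler_wpM2l// -exprMn.
    have := @exp_partial_le (l * Y x) k.+1 (mulr_ge0 l0 (Y0 x)).
    rewrite /series/= big_nat_recr//= => H; rewrite [leRHS]mulrC -ler_pdivrMr ?ltr0n ?fact_gt0//.
    apply: le_trans H; rewrite lerDr; apply: sumr_ge0 => i _; apply: exp_coeff_ge0; exact: mulr_ge0.
  - exact: (integrableZl measurableT _ I).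
have [||||_] := @Rintegral_dct _ _ R m (fun n x => w x * series (exp_coeff (- (l * Y x))) n)
   (fun x => w x * expR (- (l * Y x))) (fun x => w x * expR (l * Y x)).
- move=> n; apply: measurable_funM => //; rewrite /series/=; apply: measurable_sum => k.
  rewrite /exp_coeff/=; apply: measurable_funM => //; apply: measurable_funX.
  by apply: measurable_funN; exact: measurable_funM.
- by move=> x; apply: cvgMr; exact: is_cvg_series_exp_coeff.
- move=> n x; rewrite normrM (ger0_norm (w0 x)) ler_wpM2l//.
  apply: le_trans (exp_partial_le n (mulr_ge0 l0 (Y0 x))).
  apply: le_trans (ler_norm_sum _ _ _) _; apply: ler_sum => k _.
  by rewrite /exp_coeff/= normrM normrX normrN !ger0_norm// ?invr_ge0// mulr_ge0.
- exact: I.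
apply: cvg_trans; apply: near_eq_cvg; near=> n.
transitivity (\int[m]_x \sum_(0 <= k < n) ((-1) ^+ k / k`!%:R * (l ^+ k * (w x * Y x ^+ k)))).
  apply: eq_Rintegral => x _; rewrite /series/= mulr_sumr; apply: eq_bigr => k _.
  rewrite /exp_coeff/= -mulNr -[- l]mulN1r !exprMn; ring.
elim: (n : nat) => [|j IH].
  by rewrite /series/= big_geq//; apply: Rintegral_eq0 => x; rewrite big_geq.
have Is i : m.-integrable setT (EFin \o (fun x => \sum_(0 <= k < i) ((-1) ^+ k / k`!%:R * (l ^+ k * (w x * Y x ^+ k))))).
  elim: i => [|i IHi].
    by under [X in _ \o X]eq_fun do rewrite big_geq//; exact: integrable0.
  under [X in _ \o X]eq_fun do rewrite big_nat_recr//=.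
  exact: (integrableD measurableT IHi (integrableZl measurableT _ (iw i))).
under eq_Rintegral do rewrite big_nat_recr//=.
rewrite RintegralD//; last exact: (integrableZl measurableT _ (iw j)).
rewrite IH seriesSr; congr (_ + _).
rewrite RintegralZl//.
(* The domination controls only l^k times the k-th moment, so the moments themselves are reached by
   dividing by l^k. *)
have [->|ln0] := eqVneq l 0.
  case: j {IH} => [|j].
    by under eq_Rintegral do rewrite expr0 mul1r; rewrite oppr0 !expr0; field.
  under eq_Rintegral do rewrite expr0n/= mul0r.
  by rewrite oppr0 expr0n/= mul0r (Rintegral_eq0 m) ?mulr0.
have iw' : m.-integrable setT (EFin \o (fun x => w x * Y x ^+ j)).
  have := integrableZl measurableT (l ^- j) (iw j).
  by apply: eq_integrable => // x _; rewrite /= -EFinM mulKf// expf_neq0.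
rewrite RintegralZl// -[- l]mulN1r exprMn; ring.
Unshelve. all: by end_near. Qed.

Section representation.
Variables (P : probability M R) (beta : R).
Hypotheses (P0 : P `]-oo, 0%R]%classic = 0%E) (beta0 : 0 < beta)
  (Plap : forall l, 0 < l -> lap P l = (expR (- (l `^ beta)))%:E).

Let Y (u : R) : R := u `^ (- beta).
Let mY : measurable_fun setT (Y : M -> R). Proof. exact: measurable_powR. Qed.
Let Y0 u : 0 <= Y u. Proof. exact: powR_ge0. Qed.

Let bg0 k : 0 < beta * k%:R + 1. Proof. by rewrite ltr_wpDl// mulr_ge0// ltW. Qed.

Let Ymoment k : (\int[P]_u (Y u ^+ k)%:E = (k`!%:R / Gamma (beta * k%:R + 1))%:E)%E.
Proof.
case: k => [|k].
  rewrite mulr0 add0r Gamma1 divr1 fact0; under eq_integral do rewrite expr0.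
  by rewrite (integral_cst P measurableT 1%E) mul1e; exact: probability_setT.
have bk0 : 0 < beta * k.+1%:R by rewrite mulr_gt0.
under eq_integral do rewrite /Y -powR_mulrn ?powR_ge0// -powRrM mulNr.
rewrite (neg_moment P0 beta0 Plap bk0) mulrAC mulfV ?gt_eqF// mul1r -GammaS//.
by rewrite natr1 Gamma_nat.
Qed.

Let RYmoment k : \int[P]_u (Y u ^+ k) = k`!%:R / Gamma (beta * k%:R + 1).
Proof. by rewrite /Rintegral Ymoment. Qed.

Let expY_intble (l : R) : 0 <= l -> P.-integrable setT (EFin \o (fun u : M => expR (l * Y u))).
Proof.
move=> l0; apply/intbleP; split.
  by apply: (measurableT_comp (@measurable_expR R)); exact: measurable_funM.
(* This K has K^(beta k) = (2l + 1)^k, so by [Gamma_lb] the k-th term of the series is at most a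
   constant times 2^(-k). *)
pose K : R := (2 * l + 1) `^ beta^-1.
have l1 : 1 <= 2 * l + 1 by rewrite lerDr mulr_ge0.
have K1 : 1 <= K by rewrite -(powRr0 (2 * l + 1)) ler_powR// invr_ge0 ltW.
have -> : (\int[P]_x `|expR (l * Y x)|%:E = \sum_(0 <= k <oo) (l ^+ k / Gamma (beta * k%:R + 1))%:E)%E.
  transitivity (\int[P]_x (\sum_(0 <= k <oo) (exp_coeff (l * Y x) k)%:E))%E.
    apply: eq_integral => u _; rewrite ger0_norm ?expR_ge0//; apply/esym/nneseries_EFin.
    exact: is_cvg_series_exp_coeff.
  rewrite integral_nneseries//.
  - apply: eq_eseriesr => k _.
    transitivity ((l ^+ k / k`!%:R)%:E * \int[P]_u (Y u ^+ k)%:E)%E.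
      rewrite -ge0_integralZl//.
      + by apply: eq_integral => u _; rewrite -EFinM /exp_coeff/= exprMn; congr (_%:E); ring.
      + by apply/measurable_EFinP; exact: measurable_funX.
      + by move=> u _; rewrite lee_fin exprn_ge0.
      + by rewrite lee_fin divr_ge0// exprn_ge0.
    rewrite Ymoment -EFinM; congr (_%:E); field.
    by rewrite gt_eqF ?Gamma_gt0//= pnatr_eq0 -lt0n fact_gt0.
  - move=> k; apply/measurable_EFinP; rewrite /exp_coeff/=; apply: measurable_funM => //.
    by apply: measurable_funX; exact: measurable_funM.
  - by move=> k u _; rewrite lee_fin exp_coeff_ge0// mulr_ge0.
pose C := expR (K + 1).
apply: (@le_lt_trans _ _ (\sum_(0 <= k <oo) (C * (2^-1) ^+ k)%:E)%E).
  apply: lee_nneseries => [k _ _|k _].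
    by rewrite lee_fin divr_ge0 ?exprn_ge0// ltW ?Gamma_gt0.
  rewrite lee_fin ler_pdivrMr ?Gamma_gt0//.
  have x1 : 1 <= beta * k%:R + 1 by rewrite lerDr mulr_ge0// ltW.
  have := Gamma_lb K1 x1; rewrite addrK /K -powRrM mulrA mulVf ?gt_eqF// mul1r powR_mulrn; last by rewrite (le_trans _ l1).
  rewrite -/K expRN ler_pdivrMr ?expR_gt0// -/C => H.
  apply: (@le_trans _ _ ((2^-1) ^+ k * (2 * l + 1) ^+ k)).
    rewrite -exprMn lerXn2r ?nnegrE ?mulr_ge0 ?invr_ge0 ?addr_ge0 ?mulr_ge0//; lra.
  by rewrite [C * _]mulrC -mulrA ler_wpM2l ?exprn_ge0 ?invr_ge0// [C * _]mulrC.
rewrite (@nneseries_EFin R _ (C * 2)) ?ltry//.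
have := @cvg_geometric_series R C 2^-1; rewrite ger0_norm ?invr_ge0// => H.
have := H _; rewrite (_ : C / (1 - 2^-1) = C * 2); last by field.
by apply; rewrite invf_lt1 ?ltr1n.
Qed.

Lemma mittag_leffler_stable1 (l : R) : 0 <= l ->
  mittag_leffler beta 1 (- l) = \int[P]_u expR (- (l * u `^ (- beta))).
Proof.
move=> l0; have m1 : measurable_fun setT (fun _ : M => 1 : R) by [].
have I : P.-integrable setT (EFin \o (fun x : M => 1 * expR (l * Y x))).
  by under [X in _ \o X]eq_fun do rewrite mul1r; exact: expY_intble.
have := exp_series_integral m1 mY (fun=> ler01) Y0 l0 I.
under [X in _ --> X -> _]eq_Rintegral do rewrite mul1r.
move=> H; apply/cvg_lim => //; apply: cvg_trans H; apply: near_eq_cvg; near=> n.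
rewrite /series/=; apply: eq_bigr => k _; congr (_ * _).
under eq_Rintegral do rewrite mul1r.
rewrite RYmoment; field.
by rewrite gt_eqF ?Gamma_gt0//= pnatr_eq0 -lt0n fact_gt0.
Unshelve. all: by end_near. Qed.

(** The weight shifts the moments by one, and the functional equation of [Gamma] gives beta (k+1)! /
    Gamma(beta (k+1) + 1) = k! / Gamma(beta k + beta). Its integrability costs one more unit in the
    exponential, through Y <= exp Y. *)
Lemma mittag_leffler_stable2 (l : R) : 0 <= l ->
  P.-integrable setT (EFin \o (fun u : M => beta * u `^ (- beta))) /\
  mittag_leffler beta beta (- l) = \int[P]_u (beta * u `^ (- beta) * expR (- (l * u `^ (- beta)))).
Proof.
move=> l0; have mw : measurable_fun setT (fun u : M => beta * Y u) by exact: measurable_funM.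
have w0 u : 0 <= beta * Y u by rewrite mulr_ge0// ltW.
have Z (r : R) : 0 <= r -> P.-integrable setT (EFin \o (fun u : M => beta * Y u * expR (r * Y u))).
  move=> r0; apply: (@intble_le _ _ R P _ (fun u : M => beta * expR ((r + 1) * Y u))).
  - apply: measurable_funM => //; apply: (measurableT_comp (@measurable_expR R)); exact: measurable_funM.
  - move=> u; rewrite ger0_norm; last by rewrite mulr_ge0 ?expR_ge0.
    rewrite -mulrA ler_wpM2l ?(ltW beta0)// mulrDl expRD mul1r mulrC ler_wpM2l ?expR_ge0//.
    by apply: le_trans (expR_ge1Dx _); rewrite lerDr.
  - exact: (integrableZl measurableT beta (expY_intble (addr_ge0 r0 ler01))).
split.
  by have := Z 0 (lexx 0); apply: eq_integrable => // u _; rewrite /= mul0r expR0 mulr1.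
have := exp_series_integral mw mY w0 Y0 l0 (Z l l0).
move=> H; apply/cvg_lim => //; apply: cvg_trans H; apply: near_eq_cvg; near=> n.
rewrite /series/=; apply: eq_bigr => k _; congr (_ * _).
have iY : P.-integrable setT (EFin \o (fun u : M => Y u ^+ k.+1)).
  apply/intbleP; split; first exact: measurable_funX.
  under eq_integral do rewrite ger0_norm ?exprn_ge0//.
  by rewrite Ymoment ltry.
have -> : \int[P]_x (beta * Y x * Y x ^+ k) = beta * \int[P]_x (Y x ^+ k.+1).
  by rewrite -RintegralZl//; apply: eq_Rintegral => u _; rewrite exprS mulrA.
have bk0 : 0 < beta * k%:R + beta by rewrite ltr_wpDl// mulr_ge0// ltW.
rewrite RYmoment -natr1 mulrDr mulr1 GammaS// factS natrM -natr1.
field; rewrite gt_eqF ?Gamma_gt0//= pnatr_eq0 -lt0n fact_gt0/=.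
have -> : beta * k%:R + beta = beta * (k%:R + 1) by ring.
by rewrite gt_eqF// mulr_gt0// ltr_wpDl.
Unshelve. all: by end_near. Qed.

End representation.
End mittag_leffler.

Section Rintegral_any.
Context d (T : measurableType d) (R : realType) (mu : {measure set T -> \bar R}).
Implicit Types f : T -> R.

(* [fine] sends an infinite integral to [0]. *)
Lemma Rintegral_nonintegrable f : measurable_fun setT f ->
  ~ mu.-integrable setT (EFin \o f) -> \int[mu]_x f x = 0.
Proof.
move=> mf nf; have mf' : measurable_fun setT (EFin \o f) by exact/measurable_EFinP.
rewrite /Rintegral integralE.
have p0 : (0 <= \int[mu]_x (EFin \o f)^\+ x)%E by exact: integral_ge0.
have n0 : (0 <= \int[mu]_x (EFin \o f)^\- x)%E by exact: integral_ge0.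
suff : (\int[mu]_x (EFin \o f)^\+ x = +oo \/ \int[mu]_x (EFin \o f)^\- x = +oo)%E.
  move: p0 n0; case: (integral _ _ _) => [x| |]; case: (integral _ _ _) => [y| |] //= _ _ [].
- by [].
- by [].
apply: contrapT => /not_orP[/eqP H1 /eqP H2]; apply: nf.
apply/integrableP; split => //; rewrite /=.
have -> : (\int[mu]_x `|f x|%:E = \int[mu]_x ((EFin \o f)^\+ x + (EFin \o f)^\- x))%E.
  by apply: eq_integral => x _; rewrite -[RHS]/(((EFin \o f)^\+ \+ (EFin \o f)^\-)%E x) -fune_abse.
rewrite ge0_integralD//; last 2 first.
- exact: measurable_funepos.
- exact: measurable_funeneg.
by rewrite lte_add_pinfty// ltey.
Qed.

(** If f is not integrable and c is not 0, then c f is not integrable either, and both sides are 0.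
    Constants thus move through inner integrals that are finite only almost everywhere. *)
Lemma RintegralZl_any f (c : R) : measurable_fun setT f ->
  \int[mu]_x (c * f x) = c * \int[mu]_x f x.
Proof.
move=> mf; have [->|c0] := eqVneq c 0.
  by rewrite mul0r; apply: Rintegral_eq0 => x; rewrite mul0r.
have [I|I] := pselect (mu.-integrable setT (EFin \o f)); first by rewrite RintegralZl.
rewrite (Rintegral_nonintegrable mf I) mulr0; apply: Rintegral_nonintegrable.
  exact: measurable_funM.
move=> J; apply: I; have := integrableZl measurableT c^-1 J.
by apply: eq_integrable => // x _; rewrite /= -EFinM mulKf.
Qed.

Lemma RintegralZr_any f (c : R) : measurable_fun setT f ->
  \int[mu]_x (f x * c) = (\int[mu]_x f x) * c.
Proof. by move=> mf; under eq_Rintegral do rewrite mulrC; rewrite RintegralZl_any// mulrC. Qed.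

Lemma ae_eq_Rintegral f g : measurable_fun setT f -> measurable_fun setT g ->
  {ae mu, forall x, f x = g x} -> \int[mu]_x f x = \int[mu]_x g x.
Proof.
move=> mf mg fg; rewrite /Rintegral; congr fine; apply: ae_eq_integral => //.
- exact/measurable_EFinP.
- exact/measurable_EFinP.
- by apply: filterS fg => x -> _.
Qed.

End Rintegral_any.

(** * Gaussian mixtures *)

Section mixture.
Context d0 (Th : measurableType d0) (R : realType) (m : {sigma_finite_measure set Th -> \bar R}) (n : nat).
Local Notation V := 'rV[R]_n.
Local Notation lam := (lebesgue_rV R n).
Variables (W k : Th -> R).
Hypotheses (mW : measurable_fun setT W) (mk : measurable_fun setT k)
  (W0 : forall x, 0 <= W x) (k0 : forall x, 0 < k x) (W1 : m.-integrable setT (EFin \o W)).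

Definition mix (y : V) : R := \int[m]_x (W x * gaussv (k x) y).

Lemma measurable_mix_density : measurable_fun setT (fun z : Th * V => W z.1 * gaussv (k z.1) z.2).
Proof.
apply: measurable_funM; first exact: (measurableT_comp mW measurable_fst).
by apply: measurable_gaussv => //; exact: (measurableT_comp mk measurable_fst).
Qed.

Lemma mix_intble : (m \x lam)%E.-integrable setT (EFin \o (fun z : Th * V => W z.1 * gaussv (k z.1) z.2)).
Proof.
apply: intble_prod12; first exact: measurable_mix_density.
have /intbleP[_] := W1; apply: le_lt_trans; apply: eq_leW; apply: eq_integral => x _ /=.
transitivity ((W x)%:E * \int[lam]_y (gaussv (k x) y)%:E)%E; last first.
  by rewrite integral_gaussv// mule1 ger0_norm.
rewrite -ge0_integralZl//.
- by apply: eq_integral => y _; rewrite ger0_norm// mulr_ge0// gaussv_ge0.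
- by apply/measurable_EFinP; exact: measurable_gaussv1.
- by move=> y _; rewrite lee_fin gaussv_ge0.
- by rewrite lee_fin.
Qed.

Lemma mix_L1 : L1 mix.
Proof. exact: (intble_Rintegral1 mix_intble). Qed.

Lemma mix_fourier p : fourier mix p =
  Complex (\int[m]_x (W x * expR (- (dotR p p / (4 * k x))))) 0.
Proof.
have H (t : R -> R) (c : Th -> R) : measurable_fun setT t -> (forall x, `|t x| <= 1) ->
    (forall x, \int[lam]_y (t (dotR p y) * gaussv (k x) y) = c x) ->
    \int[lam]_y (t (dotR p y) * mix y) = \int[m]_x (W x * c x).
  move=> mt t1 tc.
  have mtp : measurable_fun setT (fun y : V => t (dotR p y)).
    by apply: measurableT_comp => //; exact: measurable_dotR.
  have I : (m \x lam)%E.-integrable setT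
      (EFin \o (fun z : Th * V => t (dotR p z.2) * (W z.1 * gaussv (k z.1) z.2))).
    apply: (intbleM_boundedl (C := 1) mix_intble) => [|z]; last exact: t1.
    exact: (measurableT_comp mtp measurable_snd).
  transitivity (\int[lam]_y \int[m]_x (t (dotR p y) * (W x * gaussv (k x) y))).
    apply: eq_Rintegral => y _; rewrite RintegralZl_any//.
    exact: (measurableT_comp measurable_mix_density (pair2_measurable y)).
  rewrite -(Rfubini I); apply: eq_Rintegral => x _.
  under eq_Rintegral do rewrite mulrCA.
  rewrite /= -(tc x); apply: (@RintegralZl_any _ _ _ lam (fun y => t (dotR p y) * gaussv (k x) y)).
  by apply: measurable_funM => //; exact: measurable_gaussv1.
rewrite /fourier; congr Complex.
- apply: (H _ _ measurable_cosR cos_norm_le1) => x.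
  by have [-> _] := fourier_gaussv p (k0 x).
- rewrite (H sin (fun=> 0) measurable_sinR sin_norm_le1) => [|x].
    by rewrite Rintegral_eq0 ?oppr0// => x; rewrite mulr0.
  by have [_ ->] := fourier_gaussv p (k0 x).
Qed.

(** The mixture shows that the set from which [inverse_fourier] chooses is inhabited, so the chosen
    function belongs to it; injectivity of the transform then identifies the two almost everywhere,
    which is the most that can be said of a choice. *)
Lemma inverse_fourier_mix (phi : V -> R) :
  (forall p, \int[m]_x (W x * expR (- (dotR p p / (4 * k x)))) = phi p) ->
  measurable_fun setT (inverse_fourier phi) /\ {ae lam, forall y, inverse_fourier phi y = mix y}.
Proof.
move=> H; pose S := [set u : V -> R | L1 u /\ forall p, fourier u p = Complex (phi p) 0].
have Smix : S mix by split; [exact: mix_L1|move=> p; rewrite mix_fourier H].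
have [Lu Fu] : S (inverse_fourier phi) by exact: (xgetPex _ (ex_intro _ mix Smix)).
split; first exact: L1_measurable.
by apply: fourier_inj => //; [exact: mix_L1|move=> p; rewrite Fu mix_fourier H].
Qed.

End mixture.

(** * The symbols of the kernels as mixtures over [P] and [Q] *)

Section subordination.
Context {R : realType}.
Local Notation M := (measurableTypeR R).
Variables (P Q : probability M R) (a alpha beta : R).
Hypotheses (P0 : P `]-oo, 0%R]%classic = 0%E) (Q0 : Q `]-oo, 0%R]%classic = 0%E)
  (a0 : 0 < a) (alpha1 : 1 < alpha) (beta0 : 0 < beta) (beta1 : beta < 1)
  (Plap : forall l, 0 < l -> lap P l = (expR (- (l `^ beta)))%:E)
  (Qlap : forall l, 0 < l -> lap Q l = (expR (- (l `^ (alpha / 2))))%:E).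

Let alpha0 : 0 < alpha. Proof. exact: lt_trans alpha1. Qed.

(* [(4 a^(2/alpha) t^(2beta/alpha) u^(-2beta/alpha) v)^-1] for positive [t], [u], [v]; written
   with [expR] and [ln] so as to be positive everywhere. *)
Definition subk (t : R) (z : M * M) : R :=
  expR ((2 / alpha) * (beta * ln z.1 - beta * ln t - ln a) - ln z.2) / 4.

Lemma subk_gt0 t z : 0 < subk t z.
Proof. by rewrite divr_gt0 ?expR_gt0. Qed.

Lemma measurable_subk d (T : measurableType d) (t : T -> R) (z : T -> M * M) :
  measurable_fun setT t -> measurable_fun setT z -> measurable_fun setT (fun x => subk (t x) (z x)).
Proof.
move=> mt mz; apply: measurable_funM => //; apply: (measurableT_comp (@measurable_expR R)).
have m1 : measurable_fun setT (fun x => (z x).1) by exact: (measurableT_comp measurable_fst mz).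
have m2 : measurable_fun setT (fun x => (z x).2) by exact: (measurableT_comp measurable_snd mz).
have mln (g : T -> R) : measurable_fun setT g -> measurable_fun setT (fun x => ln (g x)).
  by move=> mg; exact: (measurableT_comp (@measurable_ln R) mg).
apply: measurable_funB; last exact: mln.
apply: measurable_funM => //; apply: measurable_funB => //; apply: measurable_funB.
- by apply: measurable_funM => //; exact: mln.
- by apply: measurable_funM => //; exact: mln.
Qed.

Lemma measurable_subk_exponent d (T : measurableType d) (s t : R) (z : T -> M * M) :
  measurable_fun setT z -> measurable_fun setT (fun x => s / (4 * subk t (z x))).
Proof.
move=> mz; rewrite (_ : (fun x => _) = (fun x => s * (4 * subk t (z x)) `^ (-1))); last first.
  by apply/funext => x; rewrite powR_inv1// mulr_ge0// ltW// subk_gt0.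
apply: measurable_funM => //; apply: (measurableT_comp (measurable_powR _)).
by apply: measurable_funM => //; exact: measurable_subk.
Qed.

Lemma subk_sqrt t z : 0 < t -> subk t z `^ 2^-1 = t `^ (- (beta / alpha)) * subk 1 z `^ 2^-1.
Proof.
move=> t0; rewrite /subk ln1 mulr0 subr0 !powRM ?expR_ge0// mulrA; congr (_ * _).
rewrite -!expRM /powR (gt_eqF t0) -expRD; congr expR; field; exact: lt0r_neq0.
Qed.

Lemma subordinate (s t u : R) : 0 <= s -> 0 < t -> 0 < u ->
  \int[Q]_v expR (- (s / (4 * subk t (u, v)))) = expR (- (a * s `^ (alpha / 2) * t `^ beta * u `^ (- beta))).
Proof.
move=> s0 t0 u0.
have al20 : alpha / 2 != 0 by rewrite mulf_neq0// ?invr_eq0// gt_eqF.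
(* At frequency 0 the argument lies outside the range of [Qlap]; both sides are then 1. *)
move: s0; rewrite le_eqVlt => /orP[/eqP <-|s0].
  rewrite powR0// !mulr0 !mul0r oppr0 expR0.
  transitivity (\int[Q]_v (1 : R)); first by apply: eq_Rintegral => v _; rewrite mul0r oppr0 expR0.
  by rewrite (Rintegral_cst Q measurableT) mul1r [X in fine X](@probability_setT _ _ _ Q).
pose x := a * t `^ beta * u `^ (- beta).
have x0 : 0 < x by rewrite !mulr_gt0 ?powR_gt0.
(* Chosen such that the exponent s / (4 subk) equals l v for v > 0, while l^(alpha/2) = s^(alpha/2)
   x. *)
pose l := s * x `^ (2 / alpha).
have l0 : 0 < l by rewrite mulr_gt0 ?powR_gt0.
rewrite /Rintegral; have -> : (\int[Q]_v (expR (- (s / (4 * subk t (u, v)))))%:E)%E = lap Q l.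
  apply: ae_eq_integral => //.
  - apply/measurable_EFinP; apply: (measurableT_comp (@measurable_expR R)); apply: measurable_funN.
    exact: measurable_subk_exponent.
  - apply/measurable_EFinP; apply: (measurableT_comp (@measurable_expR R)).
    by apply: measurable_funN; exact: measurable_funM.
  - apply: (stable_ae Q0) => v v0 _ /=; congr (expR (- _))%:E; rewrite /l -mulrA; congr (_ * _).
    have -> : 4 * subk t (u, v) = expR ((2 / alpha) * (beta * ln u - beta * ln t - ln a) - ln v).
      by rewrite /subk/=; field.
    rewrite -expRN opprB expRB lnK ?posrE//.
    have -> : x `^ (2 / alpha) = expR ((2 / alpha) * (ln a + beta * ln t - beta * ln u)).
      rewrite /powR (gt_eqF x0); congr (expR (_ * _)).
      by rewrite /x !lnM ?posrE ?mulr_gt0 ?powR_gt0// !ln_powR mulNr.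
    rewrite -expRN mulrC; congr (expR _ * _); ring.
rewrite Qlap//=; congr (expR (- _)).
rewrite /l powRM ?powR_ge0 ?(ltW s0)// -powRrM (_ : 2 / alpha * (alpha / 2) = 1); last by field; exact: lt0r_neq0.
by rewrite powRr1 ?(ltW x0)// /x; ring.
Qed.

Local Notation PQ := (P \x Q)%E.

Lemma intble_fst (w : M -> R) : P.-integrable setT (EFin \o w) ->
  PQ.-integrable setT (EFin \o (fun z => w z.1)).
Proof.
move=> iw.
have i1 : Q.-integrable setT (EFin \o (fun _ : M => 1 : R)).
  apply/intbleP; split => //; under eq_integral do rewrite normr1.
  by rewrite (integral_cst Q measurableT 1%E) mul1e [X in (X < _)%E](@probability_setT _ _ _ Q) ltry.
have := intble_tensor iw i1.
by apply: eq_integrable => // z _; rewrite /= mulr1.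
Qed.

Lemma subordinate_mix (w : M -> R) (s t : R) : P.-integrable setT (EFin \o w) ->
  0 <= s -> 0 < t ->
  \int[PQ]_z (w z.1 * expR (- (s / (4 * subk t z)))) =
  \int[P]_u (w u * expR (- (a * s `^ (alpha / 2) * t `^ beta * u `^ (- beta)))).
Proof.
move=> iw s0 t0; have mw := intble_measurable iw.
have me : measurable_fun setT (fun z : M * M => expR (- (s / (4 * subk t z)))).
  apply: (measurableT_comp (@measurable_expR R)); apply: measurable_funN.
  exact: measurable_subk_exponent.
have I : PQ.-integrable setT (EFin \o (fun z => w z.1 * expR (- (s / (4 * subk t z))))).
  apply: (intbleM_bounded (C := 1) (intble_fst iw)) => // z.
  rewrite ger0_norm ?expR_ge0// -expR0 ler_expR oppr_le0 divr_ge0//.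
  by rewrite mulr_ge0// ltW// subk_gt0.
rewrite -(Rfubini12 I); apply: ae_eq_Rintegral.
- exact: (measurable_Rintegral2 Q (intble_measurable I)).
- apply: measurable_funM => //; apply: (measurableT_comp (@measurable_expR R)); apply: measurable_funN.
  by apply: measurable_funM => //; exact: measurable_powR.
- apply: (stable_ae P0) => u u0 /=.
  rewrite RintegralZl_any ?subordinate//.
  exact: (measurableT_comp me (pair1_measurable u)).
Qed.

(** For positive u and v the root of [subk 1] is a^(-1/alpha) u^(beta/alpha) v^(-1/2) / 2. The
    integral therefore splits into the moment of [P] in the hypothesis and a negative moment of
    [Q]. *)
Lemma subk_moment (w : M -> R) : measurable_fun setT w -> (forall u, 0 <= w u) ->
  (\int[P]_u (w u * u `^ (beta / alpha))%:E < +oo)%E ->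
  PQ.-integrable setT (EFin \o (fun z => w z.1 * subk 1 z `^ 2^-1)).
Proof.
move=> mw w0 wfin.
have ag : 0 < alpha / 2 by rewrite divr_gt0.
have i1 : P.-integrable setT (EFin \o (fun u : M => w u * u `^ (beta / alpha))).
  apply/intbleP; split; first by apply: measurable_funM => //; exact: measurable_powR.
  by under eq_integral do rewrite ger0_norm ?mulr_ge0 ?powR_ge0//.
have i2 : Q.-integrable setT (EFin \o (fun v : M => v `^ (- 2^-1))).
  apply/intbleP; split; first exact: measurable_powR.
  under eq_integral do rewrite ger0_norm ?powR_ge0//.
  by rewrite (neg_moment Q0 ag Qlap) ?invr_gt0// ltry.
have I := integrableZl measurableT (2^-1 * a `^ (- alpha^-1)) (intble_tensor i1 i2).
have msk : measurable_fun setT (fun z : M * M => w z.1 * subk 1 z `^ 2^-1).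
  apply: measurable_funM; first exact: (measurableT_comp mw measurable_fst).
  by apply: (measurableT_comp (measurable_powR _)); exact: measurable_subk.
have /intbleP[mI fI] := I; apply/intbleP; split => //; apply: le_lt_trans fI; apply: eq_leW.
apply: ae_eq_integral => //.
- by apply/measurable_EFinP; exact: measurableT_comp.
- by apply/measurable_EFinP; exact: (measurableT_comp (@normr_measurable R setT) mI).
pose N : set M := `]-oo, 0%R]%classic.
have mN : measurable N by exact: measurable_itv.
exists ((N `*` setT) `|` (setT `*` N)).
have n1 : PQ (N `*` setT) = 0%E.
  have -> : PQ (N `*` setT) = (P N * Q setT)%E by exact: product_measure1E.
  by rewrite P0 mul0e.
have n2 : PQ (setT `*` N) = 0%E.
  have -> : PQ (setT `*` N) = (P setT * Q N)%E by exact: product_measure1E.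
  by rewrite Q0 mule0.
split.
- by apply: measurableU; apply: measurableX.
- by apply: null_set_setU => //; exact: measurableX.
move=> [u v] /= H; rewrite /N/= !in_itv/=.
have [u0|u0] := leP u 0; first by left.
have [v0|v0] := leP v 0; first by right.
exfalso; apply: H => _; congr (`| _ |%:E).
rewrite /subk/= ln1 mulr0 subr0 powRM ?expR_ge0//.
have -> : 4^-1 `^ 2^-1 = 2^-1 :> R.
  rewrite powR12_sqrt// (_ : 4^-1 = 2^-1 ^+ 2) ?sqrtr_sqr ?ger0_norm//.
  by field.
rewrite -expRM /powR (gt_eqF a0) (gt_eqF u0) (gt_eqF v0).
have -> : expR ((2 / alpha * (beta * ln u - ln a) - ln v) * 2^-1) =
   expR (- alpha^-1 * ln a) * expR (beta / alpha * ln u) * expR (- 2^-1 * ln v).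
  by rewrite -!expRD; congr expR; field; exact: lt0r_neq0.
ring.
Qed.

Lemma subordinate_S (s t : R) : 0 <= s -> 0 < t ->
  \int[PQ]_z (1 * expR (- (s / (4 * subk t z)))) = mittag_leffler beta 1 (- (a * s `^ (alpha / 2) * t `^ beta)).
Proof.
move=> s0 t0; rewrite (@subordinate_mix (fun=> 1))//; last first.
  apply/intbleP; split => //; under eq_integral do rewrite normr1.
  by rewrite (integral_cst P measurableT 1%E) mul1e [X in (X < _)%E](@probability_setT _ _ _ P) ltry.
rewrite (mittag_leffler_stable1 P0 beta0 Plap) ?mulr_ge0 ?powR_ge0 ?(ltW a0)//.
by apply: eq_Rintegral => u _; rewrite mul1r.
Qed.

Lemma subordinate_G (s t : R) : 0 <= s -> 0 < t ->
  \int[PQ]_z (beta * z.1 `^ (- beta) * expR (- (s / (4 * subk t z)))) =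
  mittag_leffler beta beta (- (a * s `^ (alpha / 2) * t `^ beta)).
Proof.
move=> s0 t0; have l0 : 0 <= a * s `^ (alpha / 2) * t `^ beta by rewrite !mulr_ge0 ?powR_ge0 ?(ltW a0).
have [I ->] := mittag_leffler_stable2 P0 beta0 Plap l0.
by rewrite (@subordinate_mix (fun u => beta * u `^ (- beta))).
Qed.

Lemma subk_moment_S : PQ.-integrable setT (EFin \o (fun z => 1 * subk 1 z `^ 2^-1)).
Proof.
apply: (@subk_moment (fun=> 1)) => //.
under eq_integral do rewrite mul1r.
have ba : beta / alpha < beta by rewrite ltr_pdivrMr// ltr_pMr.
apply: (pos_moment P0 Plap) => //; first exact: divr_gt0.
exact: lt_trans ba beta1.
Qed.

(** The weight u^(-beta) outweighs u^(beta/alpha): what remains is the negative moment of order beta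
    - beta/alpha, in contrast to the positive moment in [subk_moment_S]. *)
Lemma subk_moment_G : PQ.-integrable setT (EFin \o (fun z => beta * z.1 `^ (- beta) * subk 1 z `^ 2^-1)).
Proof.
apply: (@subk_moment (fun u => beta * u `^ (- beta))).
- by apply: measurable_funM => //; exact: measurable_powR.
- by move=> u; rewrite mulr_ge0 ?powR_ge0// ltW.
have r0 : 0 < beta - beta / alpha by rewrite subr_gt0 ltr_pdivrMr// ltr_pMr.
rewrite (_ : (\int[P]_u _)%E = (beta%:E * \int[P]_u (u `^ (- (beta - beta / alpha)))%:E)%E).
  by rewrite (neg_moment P0 beta0 Plap r0) -EFinM ltry.
rewrite -ge0_integralZl//; last 3 first.
- by apply/measurable_EFinP; exact: measurable_powR.
- by move=> u _; rewrite lee_fin powR_ge0.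
- by rewrite lee_fin ltW.
apply: ae_eq_integral => //.
- apply/measurable_EFinP; apply: measurable_funM; last exact: measurable_powR.
  by apply: measurable_funM => //; exact: measurable_powR.
- by apply/measurable_EFinP; apply: measurable_funM => //; exact: measurable_powR.
- apply: (stable_ae P0) => u u0 _; rewrite -EFinM -mulrA -powRD; last by rewrite (gt_eqF u0) implybT.
  by rewrite opprB addrC.
Qed.

Lemma intble_weight_S : PQ.-integrable setT (EFin \o (fun _ : M * M => 1 : R)).
Proof.
apply: (@intble_fst (fun=> 1)).
apply/intbleP; split => //; under eq_integral do rewrite normr1.
by rewrite (integral_cst P measurableT 1%E) mul1e [X in (X < _)%E](@probability_setT _ _ _ P) ltry.
Qed.

Lemma intble_weight_G : PQ.-integrable setT (EFin \o (fun z => beta * z.1 `^ (- beta))).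
Proof.
apply: (@intble_fst (fun u => beta * u `^ (- beta))).
by have [] := mittag_leffler_stable2 P0 beta0 Plap (lexx 0).
Qed.

End subordination.

(** * Smoothness of mixtures in the [C^p] scale *)

Section uniform_mixture.
Context {R : realType} {n : nat} d0 (T : measurableType d0) (m : {measure set T -> \bar R}).
Local Notation V := 'rV[R]_n.
Local Notation e_ i := (delta_mx ord0 i : V).

Definition unif_tcd d1 (T1 : measurableType d1) (p : nat) (B : R) (g : T1 -> V -> R) :=
  [/\ jmeas g, forall t, times_cont_diff p (g t) &
      forall t l x, (size l <= p)%N -> `|dlist l (g t) x| <= B].

Lemma unif_tcd_partial d1 (T1 : measurableType d1) p B (g : T1 -> V -> R) i :
  unif_tcd p.+1 B g -> unif_tcd p B (fun t => partial i (g t)).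
Proof.
move=> [mg tg bg]; split.
- by apply: jmeas_partial => // t y; exact: tcd_derivable (tg t).
- by move=> t; exact: tcd_partial.
- by move=> t l x lp; rewrite -dlist_rcons; apply: bg; rewrite size_rcons ltnS.
Qed.

Lemma unif_tcdW d1 (T1 : measurableType d1) p q B (g : T1 -> V -> R) :
  (q <= p)%N -> unif_tcd p B g -> unif_tcd q B g.
Proof.
move=> qp [mg tg bg]; split => //; first by move=> t; exact: tcdW (tg t).
by move=> t l x lq; apply: bg; exact: leq_trans qp.
Qed.

Lemma unif_tcd_dlist d1 (T1 : measurableType d1) p B (g : T1 -> V -> R) l :
  unif_tcd (size l + p) B g -> unif_tcd p B (fun t => dlist l (g t)).
Proof.
elim/last_ind: l g => //= l i IH g; rewrite size_rcons addSn => ug.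
have := IH _ (unif_tcd_partial i ug); congr unif_tcd.
by apply/funext => t; rewrite dlist_rcons.
Qed.

Variables (om : T -> R) (sg : T -> V).
Hypotheses (iom : m.-integrable setT (EFin \o om)) (msg : measurable_fun setT sg).

(** A superposition of translates with a signed weight [om]. When t ranges over pairs (parameter,
    z), [sg] is z and [om] is the weighted Gaussian or its derivative, this is a mixture of
    convolutions with all further derivatives falling on g. *)
Definition smix (g : T -> V -> R) (y : V) : R := \int[m]_t (om t * g t (y - sg t)).

Let mom : measurable_fun setT om. Proof. exact: (intble_measurable iom). Qed.

Let mint g y : jmeas g -> measurable_fun setT (fun t => om t * g t (y - sg t)).
Proof.
move=> mg; apply: measurable_funM => //.
by apply: (jmeas_comp mg) => //; exact: measurable_rVB.
Qed.

Let iint g y B : jmeas g -> (forall t x, `|g t x| <= B) ->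
  m.-integrable setT (EFin \o (fun t => om t * g t (y - sg t))).
Proof.
move=> mg gB; apply: (intbleM_bounded (C := B) iom) => //.
by apply: (jmeas_comp mg) => //; exact: measurable_rVB.
Qed.

Lemma smix_continuous g B : jmeas g -> (forall t, continuous (g t)) -> (forall t x, `|g t x| <= B) ->
  continuous (smix g).
Proof.
move=> mg cg gB; apply: seq_continuous => u y uy.
have [||||_] := @Rintegral_dct _ _ R m (fun k t => om t * g t (u k - sg t))
   (fun t => om t * g t (y - sg t)) (fun t => B * `|om t|); last by [].
- by move=> k; exact: mint.
- move=> t; apply: cvgMr; apply: (cvg_comp (fun k => u k - sg t) (g t)); last exact: cg.
  exact: cvgB uy (cvg_cst _).
- by move=> k t; rewrite normrM mulrC ler_wpM2r.
- exact: (integrableZl measurableT B (integrable_norm iom)).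
Qed.

Lemma smix_bound g B y : jmeas g -> (forall t x, `|g t x| <= B) ->
  `|smix g y| <= B * \int[m]_t `|om t|.
Proof.
move=> mg gB; apply: le_trans (le_normr_Rintegral measurableT (iint y mg gB)) _.
rewrite -RintegralZl//; last exact: integrable_norm.
apply: le_Rintegral => //.
- exact: integrable_norm (iint y mg gB).
- exact: (integrableZl measurableT B (integrable_norm iom)).
- by move=> t _; rewrite normrM mulrC ler_wpM2r.
Qed.

Lemma is_derive_smix i g B y : unif_tcd 1 B g ->
  is_derive y (e_ i) (smix g) (smix (fun t => partial i (g t)) y).
Proof.
move=> [mg tg bg]; apply/is_derive_line0.
have mp : jmeas (fun t => partial i (g t)).
  by apply: jmeas_partial => // t x; exact: tcd_derivable (tg t).
have -> : smix (fun t => partial i (g t)) y = \int[m]_t (om t * partial i (g t) (y + 0 *: e_ i - sg t)).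
  by apply: eq_Rintegral => t _; rewrite scale0r addr0.
apply: (@is_derive_Rintegral _ _ R m (fun h t => om t * g t (y + h *: e_ i - sg t))
  (fun h t => om t * partial i (g t) (y + h *: e_ i - sg t)) 0 (fun t => B * `|om t|)).
- by move=> h _; apply: iint => // t x; exact: (bg t [::]).
- move=> h t _.
  have D : is_derive (y + h *: e_ i) (e_ i) (fun z => g t (z - sg t)) (partial i (g t) (y + h *: e_ i - sg t)).
    by apply: derivable_shift; exact: tcd_derivable (tg t).
  have /is_derive_line D2 := D.
  have D3 := is_deriveZ (om t) D2.
  by apply: is_derive_eq.
- by move=> h t _; rewrite normrM mulrC ler_wpM2r//; exact: (bg t [:: i]).
- exact: (integrableZl measurableT B (integrable_norm iom)).
Qed.

Lemma smix_tcd p g B : unif_tcd p B g ->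
  times_cont_diff p (smix g) /\
  forall l, (size l <= p)%N -> dlist l (smix g) = smix (fun t => dlist l (g t)).
Proof.
elim: p g => [|p IH] g ug.
  have [mg tg bg] := ug; split; last by case.
  by apply: (smix_continuous (B := B)) => // t x; exact: (bg t [::]).
have [mg tg bg] := ug.
have u1 : unif_tcd 1 B g by exact: unif_tcdW ug.
have pE i : partial i (smix g) = smix (fun t => partial i (g t)).
  by apply/funext => y; apply: partialE; exact: is_derive_smix u1.
split.
  split.
    apply: (smix_continuous (B := B)) => // [t|t x]; first exact: (tcd_cont (tg t)).
    exact: (bg t [::]).
  move=> i; split; first by move=> x; case: (is_derive_smix i x u1).
  by rewrite pE; have [] := IH _ (unif_tcd_partial i ug).
case/lastP => [//|l i]; rewrite size_rcons ltnS => lp.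
rewrite dlist_rcons pE; have [_ ->//] := IH _ (unif_tcd_partial i ug).
by congr smix; apply/funext => t; rewrite dlist_rcons.
Qed.

End uniform_mixture.

Section gaussian_mixture_C.
Context {R : realType} {n : nat} d0 (Th : measurableType d0) (m : {sigma_finite_measure set Th -> \bar R}).
Local Notation V := 'rV[R]_n.
Local Notation e_ i := (delta_mx ord0 i : V).
Local Notation lam := (lebesgue_rV R n).
Local Notation mlam := (m \x lam)%E.
Variables (W k : Th -> R).
Hypotheses (mW : measurable_fun setT W) (mk : measurable_fun setT k)
  (W0 : forall x, 0 <= W x) (k0 : forall x, 0 < k x)
  (W1 : m.-integrable setT (EFin \o W))
  (W2 : m.-integrable setT (EFin \o (fun x => W x * k x `^ 2^-1))).

Let k20 x : 0 < k x / 2. Proof. by rewrite divr_gt0. Qed.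

Let om (z : Th * V) : R := W z.1 * gaussv (k z.1) z.2.
Let iom : mlam.-integrable setT (EFin \o om). Proof. exact: mix_intble. Qed.

Lemma measurable_partial_gaussv d1 (T1 : measurableType d1) (c : T1 -> R) (y : T1 -> V) i :
  measurable_fun setT c -> measurable_fun setT y ->
  measurable_fun setT (fun t => partial i (gaussv (c t)) (y t)).
Proof.
move=> mc my.
rewrite (_ : (fun t => _) = (fun t => - (2 * c t * y t ord0 i * gaussv (c t) (y t)))); last first.
  by apply/funext => t; rewrite partial_gaussv.
apply: measurable_funN; apply: measurable_funM; last exact: measurable_gaussv.
apply: measurable_funM; first exact: measurable_funM.
exact: (measurableT_comp (@measurable_rV_coord R n i) my).
Qed.

Definition omp i (z : Th * V) : R := W z.1 * partial i (gaussv (k z.1)) z.2.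

Let om2 (z : Th * V) : R := W z.1 * k z.1 `^ 2^-1 * gaussv (k z.1 / 2) z.2.
Let iom2 : mlam.-integrable setT (EFin \o om2).
Proof.
apply: (@mix_intble _ _ _ m n (fun x => W x * k x `^ 2^-1) (fun x => k x / 2)) => //.
- by apply: measurable_funM => //; exact: (measurableT_comp (measurable_powR _) mk).
- exact: measurable_funM.
- by move=> x; rewrite mulr_ge0 ?powR_ge0.
Qed.

Let omp_le i z : `|omp i z| <= gconst n * om2 z.
Proof.
rewrite /omp normrM (ger0_norm (W0 _)).
apply: (@le_trans _ _ (W z.1 * (gconst n * k z.1 `^ 2^-1 * gaussv (k z.1 / 2) z.2))).
  by apply: ler_wpM2l => //; exact: partial_gaussv_bound.
by apply: eq_leW; rewrite /om2; ring.
Qed.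

Lemma omp_intble i : mlam.-integrable setT (EFin \o omp i).
Proof.
apply: (@intble_le _ _ R mlam (omp i) (fun z => gconst n * om2 z)) => //.
- apply: measurable_funM; first exact: (measurableT_comp mW measurable_fst).
  by apply: measurable_partial_gaussv => //; exact: (measurableT_comp mk measurable_fst).
- exact: (integrableZl measurableT (gconst n) iom2).
Qed.

Let snd_meas : measurable_fun setT (fun z : Th * V => z.2). Proof. exact: measurable_snd. Qed.

(** The Gaussian belongs to the weight of the superposition here. In [gmixp] one derivative has
    already been moved onto it, so the two describe the derivatives of order at most p and of order
    p + 1. *)
Definition gmix (g : Th -> V -> R) : V -> R := @smix R n _ _ mlam om snd (fun z => g z.1).
Definition gmixp i (g : Th -> V -> R) : V -> R := @smix R n _ _ mlam (omp i) snd (fun z => g z.1).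

Lemma jmeas_fst (g : Th -> V -> R) : jmeas g -> jmeas (fun z : Th * V => g z.1).
Proof.
move=> mg; apply: (jmeas_comp mg); last exact: measurable_snd.
exact: (measurableT_comp measurable_fst measurable_fst).
Qed.

Lemma unif_tcd_fst p B (g : Th -> V -> R) : unif_tcd p B g -> unif_tcd p B (fun z : Th * V => g z.1).
Proof. move=> [mg tg bg]; have mg1 := jmeas_fst mg; split; first exact: mg1.
- by move=> t; exact: tg.
- by move=> t; exact: bg. Qed.

Lemma Rintegral_weight : \int[mlam]_z `|om z| = \int[m]_x W x.
Proof.
transitivity (\int[mlam]_z om z).
  by apply: eq_Rintegral => z _; rewrite ger0_norm// mulr_ge0// gaussv_ge0.
rewrite -(Rfubini12 iom); apply: eq_Rintegral => x _; rewrite /om/=.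
by rewrite RintegralZl_any ?Rintegral_gaussv ?mulr1//; exact: measurable_gaussv1.
Qed.

Lemma Rintegral_weightp i : \int[mlam]_z `|omp i z| <= gconst n * \int[m]_x (W x * k x `^ 2^-1).
Proof.
apply: (@le_trans _ _ (\int[mlam]_z (gconst n * om2 z))).
  apply: le_Rintegral => //; first exact: integrable_norm (omp_intble i).
  exact: (integrableZl measurableT (gconst n) iom2).
rewrite RintegralZl// ler_wpM2l ?gconst_ge0// -(Rfubini12 iom2); apply: eq_leW.
apply: eq_Rintegral => x _; rewrite /om2/=.
by rewrite RintegralZl_any ?Rintegral_gaussv ?mulr1//; exact: measurable_gaussv1.
Qed.

Section fixed_parameter.
Variables (c : R) (c0 : 0 < c) (g : V -> R) (B : R).
Hypotheses (mg : measurable_fun setT g) (gB : forall x, `|g x| <= B).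

Let c20 : 0 < c / 2. Proof. by rewrite divr_gt0. Qed.
Let c40 : 0 < c / 2 / 2. Proof. by rewrite divr_gt0. Qed.

Lemma measurable_partial_gaussv1 i : measurable_fun setT (partial i (gaussv c) : V -> R).
Proof. exact: measurable_partial_gaussv. Qed.

Lemma L1_partial_gaussv i : L1 (partial i (gaussv c) : V -> R).
Proof.
apply: (@intble_le _ _ R lam _ (fun z => gconst n * c `^ 2^-1 * gaussv (c / 2) z)).
- exact: measurable_partial_gaussv1.
- by move=> z; exact: partial_gaussv_bound.
- by apply: L1Z; exact: L1_gaussv.
Qed.

(** g is only bounded and measurable, so the convolution is first rewritten such that y appears in
    the Gaussian alone. *)
Lemma is_derive_conv_gaussv i y :
  is_derive y (e_ i) (fun y => \int[lam]_z (gaussv c z * g (y - z)))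
    (\int[lam]_z (partial i (gaussv c) z * g (y - z))).
Proof.
rewrite (_ : (fun y => _) = (fun y => \int[lam]_x (g x * gaussv c (y - x)))); last first.
  apply/funext => x; rewrite -convC//; last exact: measurable_gaussv1.
  by apply: eq_Rintegral => z _; rewrite mulrC.
have -> : \int[lam]_z (partial i (gaussv c) z * g (y - z)) = \int[lam]_x (g x * partial i (gaussv c) (y - x)).
  rewrite -convC//; last exact: measurable_partial_gaussv1.
  by apply: eq_Rintegral => z _; rewrite mulrC.
apply/is_derive_line0.
have -> : \int[lam]_x (g x * partial i (gaussv c) (y - x)) =
    \int[lam]_x (g x * partial i (gaussv c) (y + 0 *: e_ i - x)).
  by apply: eq_Rintegral => x _; rewrite scale0r addr0.
apply: (@is_derive_Rintegral _ _ R lam (fun h x => g x * gaussv c (y + h *: e_ i - x))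
  (fun h x => g x * partial i (gaussv c) (y + h *: e_ i - x)) 0
  (fun x => B * (gconst n * c `^ 2^-1 * (Num.sqrt 2 ^+ n * expR (c / 2) * gaussv (c / 2 / 2) (y - x))))).
- move=> h _; apply: (intbleM_boundedl (C := B)) => //.
  by apply: L1_sub; exact: L1_gaussv.
- move=> h x _.
  have D : is_derive (y + h *: e_ i) (e_ i) (fun z => gaussv c (z - x)) (partial i (gaussv c) (y + h *: e_ i - x)).
    by apply: derivable_shift; case: (is_derive_gaussv c i (y + h *: e_ i - x)).
  have /is_derive_line D2 := D.
  have D3 := is_deriveZ (g x) D2.
  by apply: is_derive_eq.
- move=> h x; rewrite subr0 => /ltW h1; rewrite normrM ler_pM//.
  apply: le_trans (partial_gaussv_bound c0 _ _) _.
  rewrite ler_wpM2l ?mulr_ge0 ?powR_ge0 ?gconst_ge0//.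
  by rewrite addrAC; exact: gaussv_shift_bound.
- apply: (L1Z B); apply: (L1Z (gconst n * c `^ 2^-1)); apply: L1Z.
  by apply: L1_sub; exact: L1_gaussv.
Qed.

Lemma conv_partial_gaussv_bound i y :
  `|\int[lam]_z (partial i (gaussv c) z * g (y - z))| <= gconst n * c `^ 2^-1 * B.
Proof.
have B0 : 0 <= B by exact: le_trans (gB 0).
have I : L1 (fun z => partial i (gaussv c) z * g (y - z)).
  apply: (intbleM_bounded (C := B) (L1_partial_gaussv i)) => //.
  by apply: measurableT_comp => //; exact: measurable_sub.
apply: le_trans (le_normr_Rintegral measurableT I) _.
apply: (@le_trans _ _ (\int[lam]_z (gconst n * c `^ 2^-1 * B * gaussv (c / 2) z))).
  apply: le_Rintegral => //; first exact: integrable_norm I.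
    by apply: L1Z; exact: L1_gaussv.
  move=> z _; rewrite normrM mulrAC ler_pM//; exact: partial_gaussv_bound.
by rewrite RintegralZl ?Rintegral_gaussv ?mulr1//; exact: L1_gaussv.
Qed.

End fixed_parameter.

Lemma gmixE g B y : jmeas g -> (forall t x, `|g t x| <= B) ->
  gmix g y = \int[m]_x (W x * \int[lam]_z (gaussv (k x) z * g x (y - z))).
Proof.
move=> mg gB; have mg1 := jmeas_fst mg.
have I : mlam.-integrable setT (EFin \o (fun z => om z * g z.1 (y - z.2))).
  apply: (intbleM_bounded (C := B) iom) => //.
  by apply: (jmeas_comp mg); [exact: measurable_fst|exact: measurable_rVB].
rewrite /gmix /smix -(Rfubini12 I); apply: eq_Rintegral => x _.
rewrite -RintegralZl_any; first by apply: eq_Rintegral => z _; rewrite /om/= mulrA.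
apply: measurable_funM; first exact: measurable_gaussv1.
by apply: (measurableT_comp (jmeas2 x mg)); exact: measurable_sub.
Qed.

Lemma gmixpE i g B y : jmeas g -> (forall t x, `|g t x| <= B) ->
  gmixp i g y = \int[m]_x (W x * \int[lam]_z (partial i (gaussv (k x)) z * g x (y - z))).
Proof.
move=> mg gB; have mg1 := jmeas_fst mg.
have I : mlam.-integrable setT (EFin \o (fun z => omp i z * g z.1 (y - z.2))).
  apply: (intbleM_bounded (C := B) (omp_intble i)) => //.
  by apply: (jmeas_comp mg); [exact: measurable_fst|exact: measurable_rVB].
rewrite /gmixp /smix -(Rfubini12 I); apply: eq_Rintegral => x _.
rewrite -RintegralZl_any; first by apply: eq_Rintegral => z _; rewrite /omp/= mulrA.
apply: measurable_funM; first exact: measurable_partial_gaussv1.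
by apply: (measurableT_comp (jmeas2 x mg)); exact: measurable_sub.
Qed.

(** The z-integral is differentiated first, at a fixed parameter x. The domination used there
    contains exp(k x / 2), against which no integrability of W is assumed; the resulting bound on
    the derivative contains only (k x)^(1/2) and is integrable by [W2]. *)
Lemma is_derive_gmix i g B y : jmeas g -> (forall t x, `|g t x| <= B) ->
  is_derive y (e_ i) (gmix g) (gmixp i g y).
Proof.
move=> mg gB; apply/is_derive_line0.
have mgx x : measurable_fun setT (g x) by exact: jmeas2.
under eq_fun do rewrite (gmixE _ mg gB).
rewrite (gmixpE _ _ mg gB).
have -> : \int[m]_x (W x * \int[lam]_z (partial i (gaussv (k x)) z * g x (y - z))) =
    \int[m]_x (W x * \int[lam]_z (partial i (gaussv (k x)) z * g x (y + 0 *: e_ i - z))).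
  by apply: eq_Rintegral => x _; congr (_ * _); apply: eq_Rintegral => z _; rewrite scale0r addr0.
apply: (@is_derive_Rintegral _ _ R m
  (fun h x => W x * \int[lam]_z (gaussv (k x) z * g x (y + h *: e_ i - z)))
  (fun h x => W x * \int[lam]_z (partial i (gaussv (k x)) z * g x (y + h *: e_ i - z))) 0
  (fun x => gconst n * B * (W x * k x `^ 2^-1))).
- move=> h _.
  have I : mlam.-integrable setT (EFin \o (fun z => om z * g z.1 (y + h *: e_ i - z.2))).
    apply: (intbleM_bounded (C := B) iom) => //.
    by apply: (jmeas_comp mg); [exact: measurable_fst|exact: measurable_rVB].
  have := intble_Rintegral2 I; apply: eq_integrable => // x _; congr (_%:E).
  rewrite -RintegralZl_any; first by apply: eq_Rintegral => z _; rewrite /om/= mulrA.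
  apply: measurable_funM; first exact: measurable_gaussv1.
  by apply: (measurableT_comp (mgx x)); exact: measurable_sub.
- move=> h x _.
  have /is_derive_line D := is_derive_conv_gaussv (k0 x) (mgx x) (gB x) i (y + h *: e_ i).
  have D3 := is_deriveZ (W x) D.
  by apply: is_derive_eq.
- move=> h x _; rewrite normrM (ger0_norm (W0 x)) [leRHS]mulrC -mulrA ler_wpM2l//.
  apply: le_trans (conv_partial_gaussv_bound (k0 x) (mgx x) (gB x) i _) _.
  by apply: eq_leW; ring.
- exact: (integrableZl measurableT (gconst n * B) W2).
Qed.

(** Up to p derivatives go onto g at the price of the mass of W. In a list of length p + 1 the head
    is taken last and goes onto the Gaussian, at the price of the half moment of k. *)
Lemma gmix_tcd p B g : 0 <= B -> unif_tcd p B g ->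
  [/\ times_cont_diff p.+1 (gmix g),
    forall l y, (size l <= p)%N -> `|dlist l (gmix g) y| <= B * \int[m]_x W x &
    forall l y, size l = p.+1 -> `|dlist l (gmix g) y| <= B * (gconst n * \int[m]_x (W x * k x `^ 2^-1))].
Proof.
move=> B0 ug.
have dE q l h : (size l <= q)%N -> unif_tcd q B h -> dlist l (gmix h) = gmix (fun t => dlist l (h t)).
  by move=> lq uh; have [_ ->] := smix_tcd iom snd_meas (unif_tcd_fst uh).
split.
- elim: p g ug => [|p IH] g ug.
    have [mg tg bg] := ug; have gB t x : `|g t x| <= B by exact: (bg t [::]).
    split; first by have [] := smix_tcd iom snd_meas (unif_tcd_fst ug).
    move=> i; split; first by move=> x; case: (is_derive_gmix i x mg gB).
    rewrite (_ : partial i (gmix g) = gmixp i g); last first.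
      by apply/funext => y; apply: partialE; exact: is_derive_gmix mg gB.
    by have [] := smix_tcd (omp_intble i) snd_meas (unif_tcd_fst ug).
  have [mg tg bg] := ug; have gB t x : `|g t x| <= B by exact: (bg t [::]).
  split; first by apply: (@tcd_cont _ _ p.+1); have [] := smix_tcd iom snd_meas (unif_tcd_fst ug).
  move=> i; split; first by move=> x; case: (is_derive_gmix i x mg gB).
  rewrite (_ : partial i (gmix g) = gmix (fun t => partial i (g t))).
    exact: IH (unif_tcd_partial i ug).
  exact: (dE p.+1 [:: i] g).
- move=> l y lp; rewrite (dE p)// -Rintegral_weight.
  have ul : unif_tcd 0 B (fun t => dlist l (g t)).
    by apply: unif_tcd_dlist; rewrite addn0; exact: unif_tcdW ug.
  have [mg _ bg] := ul; have mg1 := jmeas_fst mg; apply: (smix_bound iom snd_meas) => //.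
  by move=> t x; exact: (bg t.1 [::]).
- case=> // i l y /= [lp].
  have ul : unif_tcd 0 B (fun t => dlist l (g t)).
    by apply: unif_tcd_dlist; rewrite addn0 lp.
  have [mg _ bg] := ul; have gB t x : `|dlist l (g t) x| <= B by exact: (bg t [::]).
  rewrite (dE p) ?lp// (partialE (is_derive_gmix i y mg gB)).
  apply: le_trans (smix_bound (omp_intble i) snd_meas y (jmeas_fst mg) (B := B) _) _.
    by move=> t x; exact: (bg t.1 [::]).
  by rewrite ler_wpM2l//; exact: Rintegral_weightp.
Qed.

End gaussian_mixture_C.

(** * Generalised derivatives of convolutions *)

Section convolution_L1.
Context {R : realType} {n : nat}.
Local Notation V := 'rV[R]_n.
Local Notation e_ i := (delta_mx ord0 i : V).
Local Notation lam := (lebesgue_rV R n).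
Implicit Types f g q Phi : V -> R.

Lemma intble_conv f q : L1 f -> L1 q ->
  (lam \x lam)%E.-integrable setT (EFin \o (fun z : V * V => f z.1 * q (z.2 - z.1))) /\
  (\int[lam]_x \int[lam]_y `|f x * q (y - x)|%:E = \int[lam]_x `|f x|%:E * \int[lam]_x `|q x|%:E)%E.
Proof.
move=> Lf Lq; have mf := L1_measurable Lf; have mq := L1_measurable Lq.
have /intbleP[_ f1] := Lf; have /intbleP[_ q1] := Lq.
have mq1 : measurable_fun setT (fun x : V => `|q x|%:E) by apply/measurable_EFinP; exact: measurableT_comp.
have mf1 : measurable_fun setT (fun x : V => `|f x|%:E) by apply/measurable_EFinP; exact: measurableT_comp.
have E : (\int[lam]_x \int[lam]_y `|f x * q (y - x)|%:E = \int[lam]_x `|f x|%:E * \int[lam]_x `|q x|%:E)%E.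
  rewrite -ge0_integralZr//; last exact: integral_ge0.
  apply: eq_integral => x _.
  rewrite -(ge0_integral_flipv false (- x) mq1)// -ge0_integralZl//; last first.
    by apply: (measurableT_comp mq1); exact: measurable_flipv.
  by apply: eq_integral => y _; rewrite flipv_add normrM EFinM.
split=> //; apply: intble_prod12 => /=.
  apply: measurable_funM; first exact: (measurableT_comp mf measurable_fst).
  by apply: (measurableT_comp mq); apply: measurable_rVB; [exact: measurable_snd|exact: measurable_fst].
rewrite E; apply: lte_mul_pinfty => //; first exact: integral_ge0.
by rewrite ge0_fin_numE//; exact: integral_ge0.
Qed.

(** Young's inequality in L^1, by Tonelli. *)
Lemma conv_norm f q : L1 f -> L1 q ->
  (\int[lam]_y `|\int[lam]_x (f x * q (y - x))|%:E <= \int[lam]_x `|f x|%:E * \int[lam]_x `|q x|%:E)%E.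
Proof.
move=> Lf Lq; have [I <-] := intble_conv Lf Lq.
have mF := intble_measurable I.
have mF1 : measurable_fun setT (fun z : V * V => `|f z.1 * q (z.2 - z.1)|%:E).
  by apply/measurable_EFinP; exact: measurableT_comp.
rewrite (fubini_tonelli (m1 := lam) (m2 := lam) (fun z : V * V => `|f z.1 * q (z.2 - z.1)|%:E))//.
apply: ge0_le_integral => //.
- apply/measurable_EFinP; apply: measurableT_comp => //.
  exact: (measurable_Rintegral1 lam mF).
- exact: (measurable_fun_fubini_tonelli_G (fun z : V * V => `|f z.1 * q (z.2 - z.1)|%:E)).
- by move=> y _; apply: abs_Rintegral_le; exact: (measurableT_comp mF (pair2_measurable y)).
Qed.

Section pairing.
Variables (f q Phi : V -> R) (C : R).
Hypotheses (Lf : L1 f) (Lq : L1 q) (mPhi : measurable_fun setT Phi) (PhiC : forall x, `|Phi x| <= C).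

Let mf := L1_measurable Lf.
Let mq := L1_measurable Lq.

(** Moves one factor of the convolution onto the test function. This form keeps q next to Phi and
    serves to differentiate q; [conv_pair'] keeps f next to Phi and serves to differentiate f. *)
Lemma conv_pair : \int[lam]_y ((\int[lam]_x (f x * q (y - x))) * Phi y) =
  \int[lam]_x (f x * \int[lam]_z (q z * Phi (x + z))).
Proof.
have [I _] := intble_conv Lf Lq.
have J : (lam \x lam)%E.-integrable setT (EFin \o (fun z : V * V => f z.1 * q (z.2 - z.1) * Phi z.2)).
  apply: (intbleM_bounded (C := C) I) => //.
  exact: (measurableT_comp mPhi measurable_snd).
transitivity (\int[lam]_y \int[lam]_x (f x * q (y - x) * Phi y)).
  apply: eq_Rintegral => y _; rewrite RintegralZr_any//.
  exact: (measurableT_comp (intble_measurable I) (pair2_measurable y)).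
rewrite -(Rfubini J); apply: eq_Rintegral => x _ /=.
transitivity (\int[lam]_y (f x * (q (y - x) * Phi y))).
  by apply: eq_Rintegral => y _; rewrite mulrA.
rewrite RintegralZl_any; last first.
  by apply: measurable_funM => //; apply: (measurableT_comp mq); exact: measurable_add.
congr (_ * _); rewrite -(@Rintegral_add R n x).
  by apply: eq_Rintegral => z _; rewrite addrK addrC.
by apply: measurable_funM => //; apply: (measurableT_comp mq); exact: measurable_add.
Qed.

Lemma conv_pair' : \int[lam]_y ((\int[lam]_x (f x * q (y - x))) * Phi y) =
  \int[lam]_z (q z * \int[lam]_x (f x * Phi (x + z))).
Proof.
rewrite conv_pair.
have J : (lam \x lam)%E.-integrable setT (EFin \o (fun z : V * V => f z.1 * q z.2 * Phi (z.1 + z.2))).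
  apply: (intbleM_bounded (C := C) (intble_tensor Lf Lq)) => //.
  by apply: (measurableT_comp mPhi); apply: measurable_rVD; [exact: measurable_fst|exact: measurable_snd].
have mS (x : V) : measurable_fun setT (fun z : V => Phi (x + z)).
  by under eq_fun do rewrite addrC; apply: (measurableT_comp mPhi); exact: measurable_add.
transitivity (\int[lam]_x \int[lam]_z (f x * q z * Phi (x + z))).
  apply: eq_Rintegral => x _; rewrite -RintegralZl_any; last exact: measurable_funM.
  by apply: eq_Rintegral => z _; rewrite mulrA.
rewrite (Rfubini J); apply: eq_Rintegral => z _ /=.
rewrite -RintegralZl_any; last first.
  by apply: measurable_funM => //; apply: (measurableT_comp mPhi); exact: measurable_add.
by apply: eq_Rintegral => x _; rewrite [f x * _]mulrC mulrA.
Qed.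

End pairing.

Lemma test_pderiv (phi : V -> R) (k : 'I_n -> nat) : test_function phi -> test_function (pderiv k phi).
Proof. by move=> tphi; rewrite pderiv_klist; exact: test_dlist. Qed.

(** For fixed z the translate phi(. + z) is again a test function, so the defining relation between
    f and g applies under the integral in z. *)
Lemma conv_gen_deriv k f g q : L1 f -> L1 g -> L1 q -> is_gen_deriv k f g ->
  is_gen_deriv k (fun y => \int[lam]_x (f x * q (y - x))) (fun y => \int[lam]_x (g x * q (y - x))).
Proof.
move=> Lf Lg Lq fg phi tphi.
have tp := test_pderiv k tphi.
have [C1 _ b1] := test_bounded tphi; have [C2 _ b2] := test_bounded tp.
rewrite (conv_pair' Lf Lq (test_measurable tp) b2) (conv_pair' Lg Lq (test_measurable tphi) b1).
have mconv h z : L1 h -> measurable_fun setT h.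
  by move=> Lh; exact: L1_measurable.
transitivity (\int[lam]_z ((-1) ^+ (\sum_(i < n) k i)%N * (q z * \int[lam]_x (g x * phi (x + z))))).
  apply: eq_Rintegral => z _; rewrite mulrCA; congr (_ * _).
  rewrite -(fg _ (test_shift z tphi)); apply: eq_Rintegral => x _; congr (_ * _).
  rewrite !pderiv_klist dlist_shift//.
  by have /test_functionP[H _] := tphi; exact: H.
rewrite RintegralZl_any//; apply: measurable_funM; first exact: L1_measurable.
have mH : measurable_fun setT (fun z : V * V => g z.2 * phi (z.2 + z.1)).
  apply: measurable_funM; first exact: (measurableT_comp (L1_measurable Lg) measurable_snd).
  by apply: (measurableT_comp (test_measurable tphi)); apply: measurable_rVD; [exact: measurable_snd|exact: measurable_fst].
exact: (measurable_Rintegral2 lam mH).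
Qed.

(** The integral of a translate of phi does not depend on the translation; its derivative at 0 is
    the integral of the partial derivative. *)
Lemma test_partial_int0 phi i : test_function phi -> \int[lam]_x partial i phi x = 0.
Proof.
move=> tphi; have tp := test_partial i tphi.
have [K K0 HK] := test_gauss_bound tp.
have cst_int h : \int[lam]_x phi (x + h *: e_ i) = \int[lam]_x phi x.
  by rewrite Rintegral_add//; exact: test_measurable.
have D : is_derive (0 : R) 1 (fun h => \int[lam]_x phi (x + h *: e_ i)) (\int[lam]_x partial i phi (x + 0 *: e_ i)).
  apply: (@is_derive_Rintegral _ _ R lam (fun h x => phi (x + h *: e_ i)) (fun h x => partial i phi (x + h *: e_ i)) 0
    (fun x => K * (Num.sqrt 2 ^+ n * expR 1 * gaussv (1 / 2) x))).
  - by move=> h _; apply: L1_add; exact: test_L1.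
  - move=> h x _; apply/is_derive_line.
    have /test_functionP[/(_ 1%N) H _] := tphi.
    have Dp : derivable phi (x + h *: e_ i) (e_ i) by exact: tcd_derivable H.
    exact: derivableP Dp.
  - move=> h x; rewrite subr0 => /ltW h1; apply: le_trans (HK _) _; rewrite ler_wpM2l//.
    exact: gaussv_shift_bound.
  - by apply: L1Z; apply: L1Z; apply: L1_gaussv; rewrite divr_gt0.
have D' : is_derive (0 : R) 1 (fun h => \int[lam]_x phi (x + h *: e_ i)) 0.
  by under eq_fun do rewrite cst_int; exact: is_derive_cst.
transitivity (\int[lam]_x partial i phi (x + 0 *: e_ i)).
  by apply: eq_Rintegral => x _; rewrite scale0r addr0.
by case: D => _ <-; case: D'.
Qed.

Lemma smooth_gaussv k m : times_cont_diff m (gaussv k : V -> R).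
Proof.
apply: tcd_prod => i.
rewrite (_ : (fun x : V => _) = (fun x => gauss1 k (1 * x ord0 i + 0))); last first.
  by apply/funext => x; rewrite mul1r addr0.
refine (@tcd_coord R n _ (gauss1 k) i 1 0 m (@gauss_stable R k) _).
by exists ((k / pi) `^ 2^-1)%:P; apply/funext => x; rewrite hornerC.
Qed.

(** For each x the product of the Gaussian with the translate phi(. + x) is a test function, and the
    integral of its derivative is 0. *)
Lemma conv_gaussv_ibp k g phi i : 0 < k -> L1 g -> test_function phi ->
  \int[lam]_y ((\int[lam]_x (g x * gaussv k (y - x))) * partial i phi y) =
  - \int[lam]_y ((\int[lam]_x (g x * partial i (gaussv k) (y - x))) * phi y).
Proof.
move=> k0 Lg tphi; have tp := test_partial i tphi.
have [C1 _ b1] := test_bounded tphi; have [C2 _ b2] := test_bounded tp.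
rewrite (conv_pair Lg (L1_gaussv n k0) (test_measurable tp) b2).
rewrite (conv_pair Lg (L1_partial_gaussv k0 i) (test_measurable tphi) b1).
rewrite -mulN1r -RintegralZl_any; last first.
  apply: measurable_funM; first exact: L1_measurable.
  have mH : measurable_fun setT (fun z : V * V => partial i (gaussv k) z.2 * phi (z.1 + z.2)).
    apply: measurable_funM; first exact: (measurableT_comp (measurable_partial_gaussv1 k i) measurable_snd).
    by apply: (measurableT_comp (test_measurable tphi)); apply: measurable_rVD; [exact: measurable_fst|exact: measurable_snd].
  exact: (measurable_Rintegral2 lam mH).
apply: eq_Rintegral => x _; rewrite mulrCA; congr (_ * _).
have tx := test_shift x tphi.
have /test_functionP[/(_ 1%N) s1 _] := tx.
have := test_partial_int0 i (testM (smooth_gaussv k) tx).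
have I1 : L1 (fun z => partial i (gaussv k) z * phi (z + x)).
  apply: (intbleM_bounded (C := C1) (L1_partial_gaussv k0 i)) => //.
  by apply: (measurableT_comp (test_measurable tphi)); exact: measurable_add.
have I2 : L1 (fun z => gaussv k z * partial i phi (z + x)).
  apply: (intbleM_bounded (C := C2) (L1_gaussv n k0)) => //.
  by apply: (measurableT_comp (test_measurable tp)); exact: measurable_add.
rewrite (_ : \int[lam]_z _ = \int[lam]_z (partial i (gaussv k) z * phi (z + x) + gaussv k z * partial i phi (z + x))); last first.
  apply: eq_Rintegral => z _; rewrite partialM.
  - rewrite partial_shift// => y; have /test_functionP[/(_ 1%N) H _] := tphi; exact: tcd_derivable H.
  - exact: tcd_derivable (smooth_gaussv k 1).
  - exact: tcd_derivable s1.
rewrite RintegralD//.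
under [X in X + _]eq_Rintegral do rewrite [_ + x]addrC.
under [X in _ + X]eq_Rintegral do rewrite [_ + x]addrC.
by move/eqP; rewrite addr_eq0 => /eqP ->; rewrite mulN1r opprK.
Qed.

(** Two integrable generalised derivatives have the same pairings with test functions and agree
    almost everywhere by [L1_eq0]. The norm of the chosen one may therefore be computed from any
    other. *)
Lemma gen_deriv_norm k f g : L1 g -> is_gen_deriv k f g ->
  [/\ L1 (gen_deriv k f), is_gen_deriv k f (gen_deriv k f) &
   (\int[lam]_x `|gen_deriv k f x|%:E = \int[lam]_x `|g x|%:E)%E].
Proof.
move=> Lg fg.
have [Lh fh] : [set g | L1 g /\ is_gen_deriv k f g] (gen_deriv k f).
  exact: (xgetPex _ (ex_intro _ g (conj Lg fg))).
split => //.
have H : {ae lam, forall x, gen_deriv k f x - g x = 0}.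
  apply: L1_eq0; first exact: (integrableB measurableT Lh Lg).
  move=> phi tphi; have [C _ b] := test_bounded tphi; have mphi := test_measurable tphi.
  under eq_Rintegral do rewrite mulrBl.
  rewrite RintegralB//; [|exact: intbleM_bounded Lh mphi b|exact: intbleM_bounded Lg mphi b].
  have s0 : (-1) ^+ (\sum_(i < n) k i)%N != 0 :> R by rewrite signr_eq0.
  have := fh _ tphi; rewrite (fg _ tphi) => /(mulfI s0) ->.
  by rewrite subrr.
apply: ae_eq_integral => //.
- by apply/measurable_EFinP; apply: measurableT_comp => //; exact: L1_measurable.
- by apply/measurable_EFinP; apply: measurableT_comp => //; exact: L1_measurable.
- by apply: filterS H => x /eqP; rewrite subr_eq0 => /eqP ->.
Qed.

End convolution_L1.

(** * Mixtures of convolutions in the Sobolev scale *)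

Section kernel_mixture.
Context {R : realType} {n : nat}.
Local Notation V := 'rV[R]_n.
Local Notation lam := (lebesgue_rV R n).

Lemma jmeas_dlist d (T : measurableType d) (psi : T -> V -> R) (l : seq 'I_n) :
  jmeas psi -> (forall t N, times_cont_diff N (psi t)) -> jmeas (fun t => dlist l (psi t)).
Proof.
move=> mp sp; elim: l => // i l IH; apply: jmeas_partial => // t y.
by apply: (@tcd_derivable _ _ 0); apply: tcd_dlist; rewrite addn1; exact: sp.
Qed.

Lemma jmeas_lim d (T : measurableType d) (F_ : nat -> T -> V -> R) (F : T -> V -> R) :
  (forall j, jmeas (F_ j)) -> (forall t y, F_ j t y @[j --> \oo] --> F t y) -> jmeas F.
Proof.
move=> mF FF; apply: (measurable_fun_cvg (h := fun j (z : T * V) => F_ j z.1 z.2)) => // z _; exact: FF.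
Qed.

Lemma obox_cover (x : V) :
  (\1_(obox (const_mx (- j%:R)) (const_mx j%:R) : set V) x : R) @[j --> \oo] --> (1 : R).
Proof.
apply: cvg_near_cst.
have : \forall j \near \oo, forall i : 'I_n, `|x ord0 i| < j%:R.
  by apply: filter_forall => i; exact: nbhs_infty_gtr.
apply: filterS => j H; rewrite indicE mem_set// => i; rewrite !mxE -ltr_norml; exact: H.
Qed.

Context d0 (Th : measurableType d0) (m : {sigma_finite_measure set Th -> \bar R}).
Local Notation mlam := (m \x lam)%E.
Variables (W : Th -> R) (q : Th -> V -> R) (A : R).
Hypotheses (mW : measurable_fun setT W) (W0 : forall x, 0 <= W x) (jq : jmeas q)
  (sq : forall x y N, times_cont_diff N (fun z => q x (y - z)))
  (Lq : forall x, L1 (q x)) (bq : forall x, exists C, forall z, `|q x z| <= C)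
  (WA : (\int[m]_x ((W x)%:E * \int[lam]_z `|q x z|%:E) <= A%:E)%E).

Definition kconv (g : Th -> V -> R) x y : R := \int[lam]_z (g x z * q x (y - z)).

Section jmeas_kconv.
Variables (f g : Th -> V -> R) (k : 'I_n -> nat).
Hypotheses (mf : jmeas f) (Lg : forall x, L1 (g x)) (fg : forall x, is_gen_deriv k (f x) (g x)).

Let cut (chi : V -> R) x y : R := \int[lam]_z (g x z * (q x (y - z) * chi z)).

(** A smooth kernel times chi is a test function in z, so the integral against g equals, up to sign,
    one of the jointly measurable f against a derivative of the truncated kernel. *)
Let cut_test chi : test_function chi -> jmeas (cut chi).
Proof.
move=> tchi.
pose psi (t : Th * V) (z : V) : R := q t.1 (t.2 - z) * chi z.
have tpsi t : test_function (psi t) by apply: testM => // N; exact: sq.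
have mpsi : jmeas psi.
  apply: measurable_funM; last exact: (measurableT_comp (test_measurable tchi) measurable_snd).
  apply: (jmeas_comp jq); first exact: (measurableT_comp measurable_fst measurable_fst).
  by apply: measurable_rVB; [exact: (measurableT_comp measurable_snd measurable_fst)|exact: measurable_snd].
rewrite /jmeas (_ : (fun z : Th * V => _) = (fun t => (-1) ^+ (\sum_(i < n) k i)%N *
    \int[lam]_z (f t.1 z * dlist (klist k) (psi t) z))); last first.
  apply/funext => t; have := fg t.1 (tpsi t); rewrite pderiv_klist => ->.
  by rewrite mulrA -exprMn mulrNN mulr1 expr1n mul1r.
apply: measurable_funM => //.
have mH : measurable_fun setT (fun u : (Th * V) * V => f u.1.1 u.2 * dlist (klist k) (psi u.1) u.2).
  apply: measurable_funM.
    by apply: (jmeas_comp mf) => //; exact: (measurableT_comp measurable_fst measurable_fst).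
  by apply: jmeas_dlist => // t N; have /test_functionP[H _] := tpsi t; exact: H.
exact: (measurable_Rintegral2 lam mH).
Qed.

Let cut_lim (chi_ : nat -> V -> R) chi : (forall j, measurable_fun setT (chi_ j)) ->
  (forall j z, `|chi_ j z| <= 1) -> (forall z, chi_ j z @[j --> \oo] --> chi z) ->
  (forall j, jmeas (cut (chi_ j))) -> jmeas (cut chi).
Proof.
move=> mchi chi1 chic jc; apply: (jmeas_lim jc) => x y.
have [C qC] := bq x.
have mq : measurable_fun setT (fun z : V => q x (y - z)).
  by apply: (measurableT_comp (jmeas2 x jq)); exact: measurable_sub.
have [||||_] := @Rintegral_dct _ _ R lam (fun j z => g x z * (q x (y - z) * chi_ j z))
   (fun z => g x z * (q x (y - z) * chi z)) (fun z => C * `|g x z|); last by [].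
- move=> j; apply: measurable_funM; first exact: L1_measurable.
  exact: measurable_funM.
- by move=> z; apply: cvgMr; apply: cvgMr; exact: chic.
- move=> j z; rewrite normrM mulrC ler_wpM2r// normrM -[leRHS]mulr1 ler_pM//.
- exact: (integrableZl measurableT C (integrable_norm (Lg x))).
Qed.

(* [g x] is a generalised derivative picked independently for each [x], so its joint measurability
   is unknown; testing against the truncated kernels moves the derivatives away from [f]. *)
Lemma jmeas_kconv : jmeas (kconv g).
Proof.
have -> : kconv g = cut (fun=> 1).
  by apply/funext => x; apply/funext => y; apply: eq_Rintegral => z _; rewrite mulr1.
(* Two limits remove the truncation: smooth bumps increase to the indicator of a box, and the boxes
   exhaust the space. The kernel is bounded, so a multiple of |g x| dominates in both. *)
apply: (cut_lim (chi_ := fun j => \1_(obox (const_mx (- j%:R)) (const_mx j%:R) : set V))).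
- by move=> j; apply: measurable_indic; exact: measurable_obox.
- by move=> j z; rewrite indicE ger0_norm// lern1 leq_b1.
- exact: obox_cover.
move=> j; pose a : V := const_mx (- j%:R); pose b : V := const_mx j%:R.
apply: (cut_lim (chi_ := fun i => box_bump a b i.+1%:R)).
- by move=> i; apply: test_measurable; exact: box_bump_test.
- by move=> i z; have /andP[h0 h1] := box_bump_bound a b i.+1%:R z; rewrite ger0_norm.
- by move=> z; exact: box_bump_cvg.
- by move=> i; apply: cut_test; exact: box_bump_test.
Qed.

End jmeas_kconv.

Lemma jmeas_kconv0 f : jmeas f -> jmeas (kconv f).
Proof.
move=> mf.
have mH : measurable_fun setT (fun u : (Th * V) * V => f u.1.1 u.2 * q u.1.1 (u.1.2 - u.2)).
  apply: measurable_funM.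
    by apply: (jmeas_comp mf) => //; exact: (measurableT_comp measurable_fst measurable_fst).
  apply: (jmeas_comp jq); first exact: (measurableT_comp measurable_fst measurable_fst).
  by apply: measurable_rVB; [exact: (measurableT_comp measurable_snd measurable_fst)|exact: measurable_snd].
exact: (measurable_Rintegral2 lam mH).
Qed.

Definition kmix (g : Th -> V -> R) (y : V) : R := \int[m]_x (W x * kconv g x y).

Section bounds.
Variables (g : Th -> V -> R) (B : R).
Hypotheses (jg : jmeas (kconv g)) (Lg : forall x, L1 (g x)) (B0 : 0 <= B)
  (gB : forall x, (\int[lam]_z `|g x z|%:E <= B%:E)%E).

Let mH : measurable_fun setT (fun z : Th * V => W z.1 * kconv g z.1 z.2).
Proof. by apply: measurable_funM => //; exact: (measurableT_comp mW measurable_fst). Qed.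

Lemma kmix_abs : (\int[m]_x \int[lam]_y `|W x * kconv g x y|%:E <= (B * A)%:E)%E.
Proof.
apply: (@le_trans _ _ (\int[m]_x (B%:E * ((W x)%:E * \int[lam]_z `|q x z|%:E)))%E); last first.
  rewrite ge0_integralZl//.
  - by rewrite EFinM lee_wpmul2l// lee_fin.
  - apply: emeasurable_funM; first exact/measurable_EFinP.
    apply: (measurable_fun_fubini_tonelli_F (fun z : Th * V => `|q z.1 z.2|%:E)) => //.
    by apply/measurable_EFinP; exact: measurableT_comp.
  - by move=> x _; rewrite mule_ge0// ?lee_fin//; exact: integral_ge0.
apply: ge0_le_integral => //.
- by move=> x _; exact: integral_ge0.
- apply: (measurable_fun_fubini_tonelli_F (fun z : Th * V => `|W z.1 * kconv g z.1 z.2|%:E)) => //.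
  by apply/measurable_EFinP; exact: measurableT_comp.
- apply: emeasurable_funM => //; apply: emeasurable_funM; first exact/measurable_EFinP.
  apply: (measurable_fun_fubini_tonelli_F (fun z : Th * V => `|q z.1 z.2|%:E)) => //.
  by apply/measurable_EFinP; exact: measurableT_comp.
move=> x _.
have -> : (\int[lam]_y `|W x * kconv g x y|%:E = (W x)%:E * \int[lam]_y `|kconv g x y|%:E)%E.
  rewrite -ge0_integralZl//.
  - by apply: eq_integral => y _; rewrite normrM (ger0_norm (W0 x)) EFinM.
  - by apply/measurable_EFinP; apply: measurableT_comp => //; exact: jmeas2.
  - by rewrite lee_fin.
rewrite muleCA lee_wpmul2l ?lee_fin//.
apply: (le_trans (conv_norm (Lg x) (Lq x))).
by rewrite lee_wpmul2r//; exact: integral_ge0.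
Qed.

Lemma kmix_intble : mlam.-integrable setT (EFin \o (fun z => W z.1 * kconv g z.1 z.2)).
Proof. by apply: intble_prod12 => //; apply: le_lt_trans kmix_abs _; rewrite ltry. Qed.

Lemma kmix_L1 : L1 (kmix g).
Proof. exact: (intble_Rintegral1 kmix_intble). Qed.

Lemma kmix_norm : (\int[lam]_y `|kmix g y|%:E <= (B * A)%:E)%E.
Proof.
apply: le_trans kmix_abs.
rewrite (fubini_tonelli (m1 := m) (m2 := lam) (fun z : Th * V => `|W z.1 * kconv g z.1 z.2|%:E))//; last first.
  by apply/measurable_EFinP; exact: measurableT_comp.
apply: ge0_le_integral => //.
- by apply/measurable_EFinP; apply: measurableT_comp => //; exact: L1_measurable kmix_L1.
- apply: (measurable_fun_fubini_tonelli_G (fun z : Th * V => `|W z.1 * kconv g z.1 z.2|%:E)) => //.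
  by apply/measurable_EFinP; exact: measurableT_comp.
- by move=> y _; apply: abs_Rintegral_le; exact: (measurableT_comp mH (pair2_measurable y)).
Qed.

Lemma kmix_pair (Phi : V -> R) (C : R) : measurable_fun setT Phi -> (forall x, `|Phi x| <= C) ->
  \int[lam]_y (kmix g y * Phi y) = \int[m]_x (W x * \int[lam]_y (kconv g x y * Phi y)).
Proof.
move=> mP PC.
have J : mlam.-integrable setT (EFin \o (fun z => W z.1 * kconv g z.1 z.2 * Phi z.2)).
  apply: (intbleM_bounded (C := C) kmix_intble) => //.
  exact: (measurableT_comp mP measurable_snd).
transitivity (\int[lam]_y \int[m]_x (W x * kconv g x y * Phi y)).
  apply: eq_Rintegral => y _; rewrite RintegralZr_any//.
  exact: (measurableT_comp mH (pair2_measurable y)).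
rewrite -(Rfubini J); apply: eq_Rintegral => x _ /=.
rewrite -RintegralZl_any; first by apply: eq_Rintegral => y _; rewrite mulrA.
by apply: measurable_funM => //; exact: jmeas2.
Qed.

End bounds.

End kernel_mixture.

Section gaussian_mixture_H.
Context {R : realType} {n : nat} d0 (Th : measurableType d0) (m : {sigma_finite_measure set Th -> \bar R}).
Local Notation V := 'rV[R]_n.
Local Notation lam := (lebesgue_rV R n).
Variables (W k : Th -> R) (f : Th -> V -> R) (p : nat) (B : R).
Hypotheses (mW : measurable_fun setT W) (mk : measurable_fun setT k)
  (W0 : forall x, 0 <= W x) (k0 : forall x, 0 < k x)
  (W1 : m.-integrable setT (EFin \o W))
  (W2 : m.-integrable setT (EFin \o (fun x => W x * k x `^ 2^-1)))
  (mf : jmeas f) (Hf : forall x, Hspace p (f x)) (B0 : 0 <= B)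
  (fB : forall x (a : 'I_n -> nat), (\sum_(i < n) a i <= p)%N ->
     (\int[lam]_z `|gen_deriv a (f x) z|%:E <= B%:E)%E).

Lemma Hspace_gen_deriv (h : V -> R) (a : 'I_n -> nat) : Hspace p h -> (\sum_(i < n) a i <= p)%N ->
  L1 (gen_deriv a h) /\ is_gen_deriv a h (gen_deriv a h).
Proof.
move=> [_ Hh] ap.
(* No entry is truncated by [inord], since each is at most the sum of all of them, hence at most
   p. *)
pose a' : {ffun 'I_n -> 'I_p.+1} := [ffun i => inord (a i)].
have aE : (fun i => nat_of_ord (a' i)) = a.
  apply/funext => i; rewrite ffunE inordK// ltnS; apply: leq_trans ap.
  by rewrite (bigD1 i)//= leq_addr.
have [|g Lg hg] := Hh a'.
  by rewrite (eq_bigr (fun i => a i)) => // i _; rewrite -[in RHS]aE.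
by rewrite aE in hg; have [] := gen_deriv_norm Lg hg.
Qed.

Let q x : V -> R := gaussv (k x).
Let qp i x : V -> R := partial i (gaussv (k x)).
Let A1 : R := \int[m]_x W x.
Let A2 : R := gconst n * \int[m]_x (W x * k x `^ 2^-1).

Let jq : jmeas q.
Proof. by apply: measurable_gaussv => //; exact: (measurableT_comp mk measurable_fst). Qed.

Let jqp i : jmeas (qp i).
Proof. by apply: measurable_partial_gaussv => //; exact: (measurableT_comp mk measurable_fst). Qed.

Let sq x (y : V) N : times_cont_diff N (fun z => q x (y - z)).
Proof. exact: tcd_gaussv. Qed.

Let sqp i x (y : V) N : times_cont_diff N (fun z => qp i x (y - z)).
Proof.
rewrite (_ : (fun z => _) = (fun z => (-1) * partial i (fun z => q x (y - z)) z)).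
  apply: tcdM; first exact: tcd_cst.
  by apply: tcd_partial; exact: sq.
apply/funext => z; rewrite (_ : partial i _ z = - qp i x (y - z)); first by rewrite mulN1r opprK.
apply: partialE.
have D := is_derive_gaussv (k x) i (y - z); rewrite /qp partial_gaussv.
apply/is_derive_line0.
have /is_derive_line0 D1 := D.
have D2 : is_derive (0 : R) 1 (fun s : R => - s) (-1).
  have D3 := is_deriveN (is_derive_id (0 : R) (1 : R)).
  by apply: is_derive_eq.
have D4 : is_derive (- 0 : R) 1 (fun s => gaussv (k x) (y - z + s *: delta_mx ord0 i)) (- (2 * k x * (y - z) ord0 i * gaussv (k x) (y - z))).
  by rewrite oppr0.
have D5 := @is_derive1_comp _ (fun s => gaussv (k x) (y - z + s *: delta_mx ord0 i)) (fun s => - s) 0 _ _ D4 D2.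
rewrite (_ : (fun s => _) = (fun s => gaussv (k x) (y - z + s *: delta_mx ord0 i)) \o (fun s => - s)).
  by apply: is_derive_eq; rewrite mulrN1.
by apply/funext => s /=; rewrite /q opprD addrA scaleNr.
Qed.

Let Lq x : L1 (q x). Proof. exact: L1_gaussv. Qed.
Let Lqp i x : L1 (qp i x). Proof. exact: L1_partial_gaussv. Qed.

Let bq x : exists C, forall z : V, `|q x z| <= C.
Proof. by eexists => z; rewrite ger0_norm ?gaussv_ge0//; exact: gaussv_le. Qed.

Let bqp i x : exists C, forall z : V, `|qp i x z| <= C.
Proof.
have k2 : 0 < k x / 2 by rewrite divr_gt0.
exists (gconst n * k x `^ 2^-1 * ((k x / 2 / pi) `^ 2^-1) ^+ n) => z.
apply: le_trans (partial_gaussv_bound (k0 x) i z) _.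
by rewrite ler_wpM2l ?mulr_ge0 ?gconst_ge0 ?powR_ge0//; exact: gaussv_le.
Qed.

Let finE (w : Th -> R) : (forall x, 0 <= w x) -> m.-integrable setT (EFin \o w) ->
  (\int[m]_x (w x)%:E = (\int[m]_x w x)%:E)%E.
Proof. by move=> w0 iw; rewrite /Rintegral fineK//; exact: integrable_fin_num. Qed.

Let WA1 : (\int[m]_x ((W x)%:E * \int[lam]_z `|q x z|%:E) <= A1%:E)%E.
Proof.
rewrite /A1 -finE//; apply: eq_leW; apply: eq_integral => x _.
rewrite (_ : integral _ _ _ = 1%E) ?mule1// -(integral_gaussv n (k0 x)).
by apply: eq_integral => z _; rewrite ger0_norm// gaussv_ge0.
Qed.

Let WA2 i : (\int[m]_x ((W x)%:E * \int[lam]_z `|qp i x z|%:E) <= A2%:E)%E.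
Proof.
have w20 x : 0 <= W x * k x `^ 2^-1 by rewrite mulr_ge0 ?powR_ge0.
have mw2 : measurable_fun setT (fun x => (W x * k x `^ 2^-1)%:E) by exact: measurable_int W2.
rewrite /A2 EFinM -finE// -ge0_integralZl//; last 2 first.
- by move=> x _; rewrite lee_fin.
- by rewrite lee_fin gconst_ge0.
apply: ge0_le_integral => //.
- by move=> x _; rewrite mule_ge0 ?lee_fin//; exact: integral_ge0.
- apply: emeasurable_funM; first exact/measurable_EFinP.
  apply: (measurable_fun_fubini_tonelli_F (fun z : Th * V => `|qp i z.1 z.2|%:E)) => //.
  by apply/measurable_EFinP; apply: measurableT_comp => //; exact: jqp.
- exact: emeasurable_funM.
move=> x _; have k2 : 0 < k x / 2 by rewrite divr_gt0.
rewrite [(W x * _)%:E]EFinM muleCA lee_wpmul2l ?lee_fin//.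
apply: (@le_trans _ _ (\int[lam]_z ((gconst n * k x `^ 2^-1)%:E * (gaussv (k x / 2) z)%:E))%E).
  apply: ge0_le_integral => //.
  - by apply/measurable_EFinP; apply: measurableT_comp => //; exact: L1_measurable (Lqp i x).
  - by apply/measurable_EFinP; apply: measurable_funM => //; exact: measurable_gaussv1.
  - by move=> z _; rewrite -EFinM lee_fin; exact: partial_gaussv_bound.
rewrite ge0_integralZl//.
- by rewrite integral_gaussv// mule1 EFinM.
- by apply/measurable_EFinP; exact: measurable_gaussv1.
- by move=> z _; rewrite lee_fin gaussv_ge0.
- by rewrite lee_fin mulr_ge0 ?gconst_ge0 ?powR_ge0.
Qed.

Let g (a : 'I_n -> nat) x : V -> R := gen_deriv a (f x).
Let F : V -> R := kmix m W q f.

Let Lf x : L1 (f x). Proof. by have [] := Hf x. Qed.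

Let fL1B x : (\int[lam]_z `|f x z|%:E <= B%:E)%E.
Proof.
have f0 : is_gen_deriv (fun=> 0%N) (f x) (f x).
  move=> phi _; rewrite big1// expr0 mul1r; apply: eq_Rintegral => z _; congr (_ * _).
  by rewrite /pderiv; elim: (enum _).
have [_ _ <-] := gen_deriv_norm (Lf x) f0.
by apply: fB; rewrite big1.
Qed.

Let jf : jmeas (kconv q f). Proof. exact: jmeas_kconv0. Qed.

Lemma gmix_L1 : L1 F.
Proof. exact: (kmix_L1 mW W0 jq Lq WA1 jf Lf B0 fL1B). Qed.

Let F_low a : (\sum_(i < n) a i <= p)%N ->
  exists h, [/\ L1 h, is_gen_deriv a F h & (\int[lam]_y `|h y|%:E <= (B * A1)%:E)%E].
Proof.
move=> ap; have Hg x := Hspace_gen_deriv (Hf x) ap.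
have Lg x : L1 (g a x) by case: (Hg x).
have jg : jmeas (kconv q (g a)).
  have Hg2 x : is_gen_deriv a (f x) (g a x) by case: (Hg x).
  exact: (jmeas_kconv jq sq bq mf Lg Hg2).
have gB x : (\int[lam]_z `|g a x z|%:E <= B%:E)%E by exact: fB.
exists (kmix m W q (g a)); split.
- exact: (kmix_L1 mW W0 jq Lq WA1 jg Lg B0 gB).
- move=> phi tphi; have tp := test_pderiv a tphi.
  have [C1 _ b1] := test_bounded tphi; have [C2 _ b2] := test_bounded tp.
  rewrite (kmix_pair mW W0 jq Lq WA1 jf Lf B0 fL1B (test_measurable tp) b2).
  rewrite (kmix_pair mW W0 jq Lq WA1 jg Lg B0 gB (test_measurable tphi) b1).
  rewrite -RintegralZl_any; last first.
    apply: measurable_funM => //.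
    have mH : measurable_fun setT (fun z : Th * V => kconv q (g a) z.1 z.2 * phi z.2).
      by apply: measurable_funM => //; exact: (measurableT_comp (test_measurable tphi) measurable_snd).
    exact: (measurable_Rintegral2 lam mH).
  apply: eq_Rintegral => x _; rewrite mulrCA; congr (_ * _).
  by have [_ fg] := Hg x; exact: (conv_gen_deriv (Lf x) (Lg x) (Lq x) fg).
- exact: (kmix_norm mW W0 jq Lq WA1 jg Lg B0 gB).
Qed.

(** One unit of a is split off in some direction i: the rest b has order p and goes onto the data,
    and the derivative in direction i goes onto the Gaussian by [conv_gaussv_ibp]. *)
Let F_top a : (\sum_(i < n) a i = p.+1)%N ->
  exists h, [/\ L1 h, is_gen_deriv a F h & (\int[lam]_y `|h y|%:E <= (B * A2)%:E)%E].
Proof.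
move=> ap.
have [i ai] : exists i, (0 < a i)%N.
  apply: contrapT => /forallNP H; move: ap; rewrite big1// => i _.
  by apply/eqP; rewrite -leqn0 leqNgt; exact/negP.
pose b j := if j == i then (a j).-1 else a j.
have ab : (\sum_(j < n) a j = (\sum_(j < n) b j).+1)%N.
  rewrite (bigD1 i)//= [in RHS](bigD1 i)//= /b eqxx -addSn prednK//; congr addn.
  by apply: eq_bigr => j /negbTE ->.
have bp : (\sum_(j < n) b j <= p)%N by rewrite -ltnS -ab ap.
have Hg x := Hspace_gen_deriv (Hf x) bp.
have Lg x : L1 (g b x) by case: (Hg x).
have jg : jmeas (kconv q (g b)).
  have Hg2 x : is_gen_deriv b (f x) (g b x) by case: (Hg x).
  exact: (jmeas_kconv jq sq bq mf Lg Hg2).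
have jgp : jmeas (kconv (qp i) (g b)).
  by apply: (jmeas_kconv (jqp i) (sqp i) (bqp i) mf Lg (k := b)) => x; case: (Hg x).
have gB x : (\int[lam]_z `|g b x z|%:E <= B%:E)%E by exact: fB.
have pE phi : test_function phi -> pderiv a phi = pderiv b (partial i phi).
  move=> tphi; rewrite !pderiv_klist -dlist_rcons; apply: dlist_perm; last first.
    by have /test_functionP[H _] := tphi; exact: H.
  apply/allP => j _ /=; rewrite -cats1 count_cat !count_klist /= addn0 /b eq_sym.
  by case: (eqVneq i j) => [<-|_]; rewrite ?addn0// addn1 prednK.
exists (kmix m W (qp i) (g b)); split.
- exact: (kmix_L1 mW W0 (jqp i) (Lqp i) (WA2 i) jgp Lg B0 gB).
- move=> phi tphi; have ti := test_partial i tphi; have tp := test_pderiv b ti.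
  have [C1 _ b1] := test_bounded tphi; have [C2 _ b2] := test_bounded tp.
  rewrite pE// (kmix_pair mW W0 jq Lq WA1 jf Lf B0 fL1B (test_measurable tp) b2).
  rewrite (kmix_pair mW W0 (jqp i) (Lqp i) (WA2 i) jgp Lg B0 gB (test_measurable tphi) b1).
  rewrite -RintegralZl_any; last first.
    apply: measurable_funM => //.
    have mH : measurable_fun setT (fun z : Th * V => kconv (qp i) (g b) z.1 z.2 * phi z.2).
      by apply: measurable_funM => //; exact: (measurableT_comp (test_measurable tphi) measurable_snd).
    exact: (measurable_Rintegral2 lam mH).
  apply: eq_Rintegral => x _; rewrite mulrCA; congr (_ * _).
  have [_ fg] := Hg x; rewrite (conv_gen_deriv (Lf x) (Lg x) (Lq x) fg)//.
  by rewrite (conv_gaussv_ibp i (k0 x) (Lg x) tphi) ab exprS mulN1r mulrN mulNr.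
- exact: (kmix_norm mW W0 (jqp i) (Lqp i) (WA2 i) jgp Lg B0 gB).
Qed.

Lemma gmix_Hspace : Hspace p.+1 F /\
  forall a : 'I_n -> nat, (\sum_(i < n) a i <= p.+1)%N ->
    (\int[lam]_y `|gen_deriv a F y|%:E <= (B * (A1 + A2))%:E)%E.
Proof.
have A10 : 0 <= A1 by apply: Rintegral_ge0.
have A20 : 0 <= A2.
  by rewrite mulr_ge0 ?gconst_ge0//; apply: Rintegral_ge0 => x _; rewrite mulr_ge0 ?powR_ge0.
have H a : (\sum_(i < n) a i <= p.+1)%N ->
    exists h, [/\ L1 h, is_gen_deriv a F h & (\int[lam]_y `|h y|%:E <= (B * (A1 + A2))%:E)%E].
  rewrite leq_eqVlt ltnS => /orP[/eqP/F_top|/F_low] [h [Lh hF hB]]; exists h; split => //;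
    apply: (le_trans hB); rewrite lee_fin ler_wpM2l// ?lerDl ?lerDr//.
split.
  split; first exact: gmix_L1.
  by move=> a /H[h [Lh hF _]]; exists h.
by move=> a /H[h [Lh hF hB]]; have [_ _ ->] := gen_deriv_norm Lh hF.
Qed.

End gaussian_mixture_H.

Section product_sigma_finite.
Context {R : realType} d1 d2 (T1 : measurableType d1) (T2 : measurableType d2)
  (m1 : {sigma_finite_measure set T1 -> \bar R}) (m2 : {sigma_finite_measure set T2 -> \bar R}).

Let sigma_finite_prod : sigma_finite setT (m1 \x m2)%E.
Proof.
have /sigma_finiteP[F [TF ndF Foo]] := sigma_finiteT m1.
have /sigma_finiteP[G [TG ndG Goo]] := sigma_finiteT m2.
exists (fun i => F i `*` G i).
  rewrite -setXTT TF TG predeqE => -[x y]; split.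
    move=> [/= [i _ Fx] [j _ Gy]]; exists (maxn i j) => //; split.
    - by move: x Fx; exact/subsetPset/ndF/leq_maxl.
    - by move: y Gy; exact/subsetPset/ndG/leq_maxr.
  by move=> [i _ [/= ? ?]]; split; exists i.
move=> i; have [? ?] := Foo i; have [? ?] := Goo i.
split; first exact: measurableX.
by rewrite product_measure1E// lte_mul_pinfty// ge0_fin_numE.
Qed.

(* In the library, the canonical sigma-finite structure on [m1 \x m2] is restricted to
   subprobabilities. *)
Definition sprod : {sigma_finite_measure set (T1 * T2)%type -> \bar R} :=
  HB.pack (m1 \x m2)%E (Measure_isSigmaFinite.Build _ _ _ (m1 \x m2)%E sigma_finite_prod).

End product_sigma_finite.

Section ae_invariance.
Context {R : realType} {n : nat}.
Local Notation V := 'rV[R]_n.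
Local Notation lam := (lebesgue_rV R n).
Variables (u v : V -> R).
Hypotheses (mu : measurable_fun setT u) (uv : {ae lam, forall y, u y = v y}) (Lv : L1 v).

Lemma L1_ae : L1 u.
Proof.
have mv := L1_measurable Lv; have /intbleP[_ v1] := Lv.
apply/intbleP; split=> //; apply: le_lt_trans v1; apply: eq_leW.
apply: ae_eq_integral => //.
- by apply/measurable_EFinP; exact: measurableT_comp.
- by apply/measurable_EFinP; exact: measurableT_comp.
- by apply: filterS uv => y -> _.
Qed.

(** Needed because the time integral agrees with the mixture only almost everywhere in the Sobolev
    case. *)
Lemma is_gen_deriv_ae (a : 'I_n -> nat) g : is_gen_deriv a v g -> is_gen_deriv a u g.
Proof.
move=> ag phi tphi; rewrite -ag//; have mv := L1_measurable Lv.
have mp := test_measurable (test_pderiv a tphi).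
apply: ae_eq_Rintegral; [exact: measurable_funM|exact: measurable_funM|].
by apply: filterS uv => y ->.
Qed.

End ae_invariance.

(** * The two kernels *)

Section duhamel.
Context {R : realType} {n : nat} dX d0 (X : measurableType dX) (Th : measurableType d0)
  (nu : {sigma_finite_measure set X -> \bar R}) (m0 : {sigma_finite_measure set Th -> \bar R}).
Local Notation V := 'rV[R]_n.
Local Notation lam := (lebesgue_rV R n).
Local Notation m := (sprod nu m0).
Variables (c : X -> R) (w : Th -> R) (k : X * Th -> R) (K f : X -> V -> R).
Let W (z : X * Th) : R := c z.1 * w z.2.
Let q (z : X * Th) : V -> R := gaussv (k z).
Let fX (z : X * Th) : V -> R := f z.1.
Hypotheses (mc : measurable_fun setT c) (c0 : forall s, 0 <= c s)
  (mw : measurable_fun setT w) (w0 : forall t, 0 <= w t)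
  (mk : measurable_fun setT k) (k0 : forall z, 0 < k z)
  (W1 : m.-integrable setT (EFin \o W))
  (W2 : m.-integrable setT (EFin \o (fun z => W z * k z `^ 2^-1)))
  (mK : forall s, measurable_fun setT (K s))
  (KE : forall s, {ae lam, forall y, K s y = c s * mix m0 w (fun t => k (s, t)) y})
  (jf : jmeas f).

(** Common form of the two terms of [Psi]: nu is a Dirac mass for the initial value and Lebesgue
    measure for the source term. The kernel at time s is, up to a null set, a weight c s times a
    mixture over [Th]. *)
Definition duhamel (y : V) : R := \int[nu]_s \int[lam]_x (K s (y - x) * f s x).

Let H (y : V) (u : (X * Th) * V) : R := W u.1 * (f u.1.1 u.2 * q u.1 (y - u.2)).

Let mW : measurable_fun setT W.
Proof.
by apply: measurable_funM; [exact: (measurableT_comp mc measurable_fst)|exact: (measurableT_comp mw measurable_snd)].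
Qed.

Let W0 z : 0 <= W z. Proof. exact: mulr_ge0. Qed.

Let jfX : jmeas fX.
Proof.
apply: (jmeas_comp jf); last exact: measurable_snd.
exact: (measurableT_comp measurable_fst measurable_fst).
Qed.

Let mH d (T : measurableType d) (y : T -> V) (u : T -> (X * Th) * V) :
  measurable_fun setT y -> measurable_fun setT u -> measurable_fun setT (fun t => H (y t) (u t)).
Proof.
move=> my mu.
have mu1 : measurable_fun setT (fun t => (u t).1) by exact: (measurableT_comp measurable_fst mu).
have mu2 : measurable_fun setT (fun t => (u t).2) by exact: (measurableT_comp measurable_snd mu).
apply: measurable_funM; first exact: (measurableT_comp mW mu1).
apply: measurable_funM.
  by apply: (jmeas_comp jf) => //; exact: (measurableT_comp measurable_fst mu1).
by apply: measurable_gaussv; [exact: (measurableT_comp mk mu1)|exact: measurable_rVB].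
Qed.

(** The kernel is known almost everywhere only. [convC] makes its argument the integration variable,
    where a null set is harmless; afterwards the substitution is undone. No integrability enters
    yet. *)
Lemma duhamelE y : duhamel y = \int[nu]_s \int[lam]_x \int[m0]_t H y ((s, t), x).
Proof.
apply: eq_Rintegral => s _.
have mfs := jmeas2 s jf.
have mks : measurable_fun setT (fun t => k (s, t)) by exact: (measurableT_comp mk (pair1_measurable s)).
have mG : measurable_fun setT (fun u : V * Th => w u.2 * gaussv (k (s, u.2)) u.1).
  apply: measurable_funM; first exact: (measurableT_comp mw measurable_snd).
  by apply: measurable_gaussv; [exact: (measurableT_comp mks measurable_snd)|exact: measurable_fst].
have mmix : measurable_fun setT (fun y : V => c s * mix m0 w (fun t => k (s, t)) y : R).
  by apply: measurable_funM => //; exact: (measurable_Rintegral2 m0 mG).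
rewrite convC//.
transitivity (\int[lam]_z ((c s * mix m0 w (fun t => k (s, t)) z) * f s (y - z))).
  apply: ae_eq_Rintegral.
  - by apply: measurable_funM => //; apply: (measurableT_comp mfs); exact: measurable_sub.
  - by apply: measurable_funM => //; apply: (measurableT_comp mfs); exact: measurable_sub.
  - by apply: filterS (KE s) => x ->.
rewrite -(@convC _ _ (fun z => c s * mix m0 w (fun t => k (s, t)) z))//.
apply: eq_Rintegral => x _; rewrite /mix.
have mg1 : measurable_fun setT (fun t => w t * gaussv (k (s, t)) (y - x)).
  exact: (measurableT_comp mG (pair1_measurable (y - x))).
rewrite -RintegralZl_any// -RintegralZr_any; last exact: measurable_funM.
by apply: eq_Rintegral => t _; rewrite /H/W/q/=; ring.
Qed.

Lemma measurable_duhamel : measurable_fun setT duhamel.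
Proof.
rewrite (_ : duhamel = fun y => \int[nu]_s \int[lam]_x \int[m0]_t H y ((s, t), x)); last first.
  by apply/funext => y; exact: duhamelE.
have m3 : measurable_fun setT (fun u : ((V * X) * V) * Th => H u.1.1.1 ((u.1.1.2, u.2), u.1.2)).
  have m1 : measurable_fun setT (fun u : ((V * X) * V) * Th => u.1.1).
    exact: (measurableT_comp measurable_fst measurable_fst).
  apply: mH; first exact: (measurableT_comp measurable_fst m1).
  apply/measurable_fun_pairP; split; last exact: (measurableT_comp measurable_snd measurable_fst).
  apply/measurable_fun_pairP; split; last exact: measurable_snd.
  exact: (measurableT_comp measurable_snd m1).
exact: (measurable_Rintegral2 nu (measurable_Rintegral2 lam (measurable_Rintegral2 m0 m3))).
Qed.

Let mHy y : measurable_fun setT (H y). Proof. exact: mH. Qed.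

(** The integral in (s, t, x) is finite at this y, so for almost every s the integrals in x and t
    may be exchanged, and then those in s and t combine to one over m. *)
Lemma duhamel_kmix y : (m \x lam)%E.-integrable setT (EFin \o H y) -> duhamel y = kmix m W q fX y.
Proof.
move=> I; rewrite duhamelE /kmix.
transitivity (\int[m]_z \int[lam]_x H y (z, x)); last first.
  apply: eq_Rintegral => z _; rewrite -RintegralZl_any//.
  apply: measurable_funM; first exact: (jmeas2 z jfX).
  by apply: (measurableT_comp (measurable_gaussv1 _)); exact: measurable_sub.
rewrite -(Rfubini12 (intble_Rintegral2 I)).
have mHE : measurable_fun setT (fun u : (X * Th) * V => `|H y u|%:E).
  by apply/measurable_EFinP; exact: measurableT_comp.
pose h (z : X * Th) : \bar R := (\int[lam]_x `|H y (z, x)|%:E)%E.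
have mh : measurable_fun setT h by exact: (measurable_fun_fubini_tonelli_F (fun u : (X * Th) * V => `|H y u|%:E)).
have h0 z : (0 <= h z)%E by exact: integral_ge0.
have hfin : (\int[m]_z h z < +oo)%E.
  have /intbleP[_] := I.
  by rewrite (fubini_tonelli1 (fun u : (X * Th) * V => `|H y u|%:E)).
have hae : {ae nu, forall s, (\int[m0]_t h (s, t) < +oo)%E}.
  have J : nu.-integrable setT (fun s => \int[m0]_t h (s, t))%E.
    apply/integrableP; split; first exact: (measurable_fun_fubini_tonelli_F h).
    under eq_integral do rewrite gee0_abs ?integral_ge0//.
    by rewrite -(fubini_tonelli1 h).
  apply: filterS (integrable_ae measurableT J) => s /(_ Logic.I).
  by rewrite ge0_fin_numE//; exact: integral_ge0.
apply: ae_eq_Rintegral.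
- apply: (measurable_Rintegral2 lam (F := fun u : X * V => \int[m0]_t H y ((u.1, t), u.2))).
  apply: (measurable_Rintegral2 m0 (F := fun u : (X * V) * Th => H y ((u.1.1, u.2), u.1.2))).
  apply: mH => //; apply/measurable_fun_pairP; split; last exact: (measurableT_comp measurable_snd measurable_fst).
  apply/measurable_fun_pairP; split; last exact: measurable_snd.
  exact: (measurableT_comp measurable_fst measurable_fst).
- apply: (measurable_Rintegral2 m0 (F := fun z => \int[lam]_x H y (z, x))).
  exact: (measurable_Rintegral2 lam).
apply: filterS hae => s hs /=.
have Is : (m0 \x lam)%E.-integrable setT (EFin \o (fun u : Th * V => H y ((s, u.1), u.2))).
  apply: intble_prod12 => //; apply: mH => //.
  apply/measurable_fun_pairP; split; last exact: measurable_snd.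
  by apply/measurable_fun_pairP; split; [exact: measurable_cst|exact: measurable_fst].
by rewrite -(Rfubini Is).
Qed.

Let gauss_mass z y : (\int[lam]_x (q z (y - x))%:E = 1)%E.
Proof.
rewrite -(integral_gaussv n (k0 z)).
rewrite -[RHS](@ge0_integral_flipv _ _ true y (fun x => (gaussv (k z) x)%:E)).
- by apply: eq_integral => x _; rewrite flipv_sub.
- by apply/measurable_EFinP; exact: measurable_gaussv1.
- by move=> x; rewrite lee_fin gaussv_ge0.
Qed.

Let gauss_mass' z x : (\int[lam]_y (q z (y - x))%:E = 1)%E.
Proof.
rewrite -(integral_gaussv n (k0 z)).
rewrite -[RHS](@ge0_integral_flipv _ _ false (- x) (fun x => (gaussv (k z) x)%:E)).
- by apply: eq_integral => y _; rewrite flipv_add.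
- by apply/measurable_EFinP; exact: measurable_gaussv1.
- by move=> y; rewrite lee_fin gaussv_ge0.
Qed.

(** For bounded f the integrand is integrable at every y, so that the time integral equals the
    mixture everywhere. Equality almost everywhere would not do for classical derivatives. *)
Lemma duhamel_C p B : 0 <= B -> unif_tcd p B f ->
  [/\ times_cont_diff p.+1 duhamel,
    forall l y, (size l <= p)%N -> `|dlist l duhamel y| <= B * \int[m]_z W z &
    forall l y, size l = p.+1 -> `|dlist l duhamel y| <= B * (gconst n * \int[m]_z (W z * k z `^ 2^-1))].
Proof.
move=> B0 [_ sf fB].
have fB0 s x : `|f s x| <= B by exact: (fB s [::] x).
suff -> : duhamel = gmix m W k fX by apply: gmix_tcd => //; split => //; [move=> z; exact: sf|move=> z; exact: fB].
apply/funext => y; rewrite duhamel_kmix.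
  rewrite /kmix; have /esym := gmixE mW mk W0 k0 W1 y jfX (fun z => fB0 z.1); apply: etrans.
  apply: eq_Rintegral => z _; congr (_ * _); rewrite /kconv.
  rewrite -(@convC _ _ (fX z) (q z))//; last exact: measurable_gaussv1.
    by apply: eq_Rintegral => x _; rewrite mulrC.
  exact: (jmeas2 z jfX).
apply: intble_prod12 => //=.
apply: (@le_lt_trans _ _ (\int[m]_z (B%:E * (W z)%:E))%E).
  apply: ge0_le_integral => //.
  - by move=> z _; exact: integral_ge0.
  - apply: (measurable_fun_fubini_tonelli_F (fun u : (X * Th) * V => `|H y u|%:E)) => //.
    by apply/measurable_EFinP; exact: measurableT_comp.
  - by apply: emeasurable_funM => //; exact/measurable_EFinP.
  move=> z _.
  apply: (@le_trans _ _ (\int[lam]_x ((B * W z)%:E * (q z (y - x))%:E))%E).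
    apply: ge0_le_integral => //.
    - by apply/measurable_EFinP; apply: measurableT_comp => //; exact: (measurableT_comp (mHy y) (pair1_measurable z)).
    - apply/measurable_EFinP; apply: measurable_funM => //.
      by apply: (measurableT_comp (measurable_gaussv1 _)); exact: measurable_sub.
    move=> x _; rewrite -EFinM lee_fin (_ : H y (z, x) = W z * (fX z x * q z (y - x)))//.
    rewrite normrM [X in _ * X]normrM (ger0_norm (W0 z)) (ger0_norm (gaussv_ge0 _ _)).
    rewrite mulrA; apply: ler_wpM2r; first exact: gaussv_ge0.
    by rewrite mulrC; apply: ler_wpM2r => //; exact: fB0.
  rewrite ge0_integralZl//.
  - by rewrite gauss_mass mule1 EFinM.
  - apply/measurable_EFinP.
    by apply: (measurableT_comp (measurable_gaussv1 _)); exact: measurable_sub.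
  - by move=> x _; rewrite lee_fin gaussv_ge0.
  - by rewrite lee_fin mulr_ge0.
rewrite ge0_integralZl//; last 2 first.
- exact/measurable_EFinP.
- by move=> z _; rewrite lee_fin.
have /intbleP[_ W1'] := W1.
apply: lte_mul_pinfty; rewrite ?lee_fin//.
by apply: le_lt_trans W1'; apply: eq_leW; apply: eq_integral => z _; rewrite ger0_norm.
Qed.

Section Hspace_case.
Variables (p : nat) (B : R).
Hypotheses (Hf : forall s, Hspace p (f s)) (B0 : 0 <= B)
  (fB : forall s (a : 'I_n -> nat), (\sum_(i < n) a i <= p)%N ->
     (\int[lam]_z `|gen_deriv a (f s) z|%:E <= B%:E)%E).

Let fL1B s : (\int[lam]_z `|f s z|%:E <= B%:E)%E.
Proof.
have [Lf _] := Hf s.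
have f0 : is_gen_deriv (fun=> 0%N) (f s) (f s).
  move=> phi _; rewrite big1// expr0 mul1r; apply: eq_Rintegral => z _; congr (_ * _).
  by rewrite /pderiv; elim: (enum _).
have [_ _ <-] := gen_deriv_norm Lf f0.
by apply: fB; rewrite big1.
Qed.

(** With f only in L^1, integrability at a given y can fail. The integrand is integrable in all
    variables together, since the Gaussian has mass 1 in y, and hence at almost every y. *)
Lemma duhamel_ae : {ae lam, forall y, duhamel y = kmix m W q fX y}.
Proof.
suff I : (sprod m lam \x lam)%E.-integrable setT (EFin \o (fun u : ((X * Th) * V) * V => H u.2 u.1)).
  have A := @ae_intble1 _ _ _ _ _ (sprod m lam) lam _ I.
  by apply: filterS A => y Iy; apply: duhamel_kmix; exact: Iy.
have J : (m \x lam)%E.-integrable setT (EFin \o (fun u : (X * Th) * V => W u.1 * fX u.1 u.2)).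
  apply: intble_prod12.
    by apply: measurable_funM => //; exact: (measurableT_comp mW measurable_fst).
  apply: (@le_lt_trans _ _ (\int[m]_z (B%:E * (W z)%:E))%E).
    apply: ge0_le_integral => //.
    - by move=> z _; exact: integral_ge0.
    - apply: (measurable_fun_fubini_tonelli_F (fun u : (X * Th) * V => `|W u.1 * fX u.1 u.2|%:E)) => //.
      apply/measurable_EFinP; apply: measurableT_comp => //.
      by apply: measurable_funM => //; exact: (measurableT_comp mW measurable_fst).
    - by apply: emeasurable_funM => //; exact/measurable_EFinP.
    move=> z _ /=.
    rewrite (_ : integral _ _ _ = (W z)%:E * \int[lam]_x `|fX z x|%:E)%E; last first.
      rewrite -ge0_integralZl//.
      - by apply: eq_integral => x _; rewrite normrM (ger0_norm (W0 z)) EFinM.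
      - by apply/measurable_EFinP; apply: measurableT_comp => //; exact: (jmeas2 z jfX).
      - by rewrite lee_fin.
    by rewrite muleC lee_wpmul2r ?lee_fin//; exact: fL1B.
  rewrite ge0_integralZl//; last 2 first.
  - exact/measurable_EFinP.
  - by move=> z _; rewrite lee_fin.
  have /intbleP[_ W1'] := W1.
  apply: lte_mul_pinfty; rewrite ?lee_fin//.
  by apply: le_lt_trans W1'; apply: eq_leW; apply: eq_integral => z _; rewrite ger0_norm.
apply: (@intble_prod12 _ _ _ _ _ (sprod m lam) lam).
  by apply: mH; [exact: measurable_snd|exact: measurable_fst].
have /intbleP[_] := J; apply: le_lt_trans; apply: eq_leW; apply: eq_integral => -[z x] _ /=.
transitivity ((`|W z * fX z x|%:E * \int[lam]_y (q z (y - x))%:E)%E); last by rewrite gauss_mass' mule1.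
rewrite -ge0_integralZl//.
- by apply: eq_integral => y _; rewrite /H/= mulrA normrM (ger0_norm (gaussv_ge0 _ _)) EFinM.
- apply/measurable_EFinP; apply: (measurableT_comp (measurable_gaussv1 _)).
  exact: measurable_add.
- by move=> y _; rewrite lee_fin gaussv_ge0.
Qed.

Lemma duhamel_H : Hspace p.+1 duhamel /\
  forall a : 'I_n -> nat, (\sum_(i < n) a i <= p.+1)%N ->
    (\int[lam]_y `|gen_deriv a duhamel y|%:E <=
      (B * (\int[m]_z W z + gconst n * \int[m]_z (W z * k z `^ 2^-1)))%:E)%E.
Proof.
have [[LF HF] FB] := @gmix_Hspace _ _ _ _ m W k fX p B mW mk W0 k0 W1 W2 jfX (fun z => Hf z.1) B0 (fun z => @fB z.1).
have E := duhamel_ae.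
have Lu := L1_ae measurable_duhamel E LF.
split; first by split=> // a /HF[g Lg ag]; exists g => //; exact: (is_gen_deriv_ae measurable_duhamel E LF ag).
move=> a ap; have [Lg ag] := Hspace_gen_deriv (conj LF HF) ap.
have [_ _ ->] := gen_deriv_norm Lg (is_gen_deriv_ae measurable_duhamel E LF ag).
exact: FB.
Qed.

End Hspace_case.

End duhamel.

(** * Bounds with the time dependence separated *)

Section subordinated_duhamel.
Context {R : realType} {n : nat} dX (X : measurableType dX)
  (nu : {sigma_finite_measure set X -> \bar R}).
Local Notation V := 'rV[R]_n.
Local Notation M := (measurableTypeR R).
Local Notation lam := (lebesgue_rV R n).
Variables (P Q : probability M R) (a alpha beta : R) (w : M * M -> R) (c tau : X -> R) (K f : X -> V -> R).
Local Notation PQ := (sprod P Q).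
Local Notation k1 z := (subk a alpha beta 1 z `^ 2^-1).
Hypotheses (alpha1 : 1 < alpha) (mw : measurable_fun setT w) (w0 : forall z, 0 <= w z)
  (iw : PQ.-integrable setT (EFin \o w))
  (iwk : PQ.-integrable setT (EFin \o (fun z => w z * k1 z)))
  (mc : measurable_fun setT c) (c0 : forall s, 0 <= c s)
  (mtau : measurable_fun setT tau) (ctau : forall s, c s != 0 -> 0 < tau s)
  (ic : nu.-integrable setT (EFin \o c))
  (ict : nu.-integrable setT (EFin \o (fun s => c s * tau s `^ (- (beta / alpha)))))
  (mK : forall s, measurable_fun setT (K s))
  (KE : forall s, {ae lam, forall y, K s y = c s * mix PQ w (subk a alpha beta (tau s)) y})
  (jf : jmeas f).

Let k (z : X * (M * M)) : R := subk a alpha beta (tau z.1) z.2.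

Let mk : measurable_fun setT k.
Proof. by apply: measurable_subk => //; exact: (measurableT_comp mtau measurable_fst). Qed.

Let k0 z : 0 < k z. Proof. exact: subk_gt0. Qed.

Let W1 : (sprod nu PQ).-integrable setT (EFin \o (fun z : X * (M * M) => c z.1 * w z.2)).
Proof. exact: (intble_tensor ic iw). Qed.

(** The scaling of [subk] holds for positive elapsed time [tau]; where [tau] may fail to be
    positive, c vanishes and so do both sides. *)
Let W2E z : c z.1 * w z.2 * k z `^ 2^-1 = (c z.1 * tau z.1 `^ (- (beta / alpha))) * (w z.2 * k1 z.2).
Proof.
have [->|cz] := eqVneq (c z.1) 0; first by rewrite !mul0r.
by rewrite /k subk_sqrt; [ring|exact: alpha1|exact: ctau].
Qed.

Let W2 : (sprod nu PQ).-integrable setT (EFin \o (fun z : X * (M * M) => c z.1 * w z.2 * k z `^ 2^-1)).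
Proof.
rewrite (_ : (fun z => _) = (fun z : X * (M * M) => (c z.1 * tau z.1 `^ (- (beta / alpha))) * (w z.2 * k1 z.2))).
  exact: (intble_tensor ict iwk).
by apply/funext => z; exact: W2E.
Qed.

(** The mass bounds the derivatives of order at most p, the half moment those of order p + 1. Each
    factors into a constant over [P] and [Q] and a time integral, because time enters the half
    moment through [tau] to the power -beta/alpha alone. *)
Definition subordinated_bound : R := \int[PQ]_z w z * \int[nu]_s c s +
  gconst n * \int[PQ]_z (w z * k1 z) * \int[nu]_s (c s * tau s `^ (- (beta / alpha))).

Let Rintegral_tensor (u : X -> R) (v : M * M -> R) :
  nu.-integrable setT (EFin \o u) -> PQ.-integrable setT (EFin \o v) ->
  \int[sprod nu PQ]_z (u z.1 * v z.2) = \int[PQ]_z v z * \int[nu]_s u s.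
Proof.
move=> iu iv; rewrite -(@Rfubini12 _ _ _ _ _ nu PQ _ (intble_tensor iu iv))/=.
rewrite mulrC -RintegralZr_any; last exact: (intble_measurable iu).
by apply: eq_Rintegral => s _; rewrite RintegralZl_any//; exact: (intble_measurable iv).
Qed.

Let I1 : \int[sprod nu PQ]_z (c z.1 * w z.2) = \int[PQ]_z w z * \int[nu]_s c s.
Proof. exact: Rintegral_tensor. Qed.

Let I2 : \int[sprod nu PQ]_z (c z.1 * w z.2 * k z `^ 2^-1) =
  \int[PQ]_z (w z * k1 z) * \int[nu]_s (c s * tau s `^ (- (beta / alpha))).
Proof.
transitivity (\int[sprod nu PQ]_z ((c z.1 * tau z.1 `^ (- (beta / alpha))) * (w z.2 * k1 z.2))).
  by apply: eq_Rintegral => z _; exact: W2E.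
exact: (Rintegral_tensor ict iwk).
Qed.

Let I10 : 0 <= \int[sprod nu PQ]_z (c z.1 * w z.2).
Proof. by apply: Rintegral_ge0 => z _; rewrite mulr_ge0. Qed.

Let I20 : 0 <= gconst n * \int[sprod nu PQ]_z (c z.1 * w z.2 * k z `^ 2^-1).
Proof. by rewrite mulr_ge0 ?gconst_ge0//; apply: Rintegral_ge0 => z _; rewrite !mulr_ge0 ?powR_ge0. Qed.

Lemma subordinated_boundE : subordinated_bound =
  \int[sprod nu PQ]_z (c z.1 * w z.2) + gconst n * \int[sprod nu PQ]_z (c z.1 * w z.2 * k z `^ 2^-1).
Proof. by rewrite I1 I2 mulrA. Qed.

Lemma subordinated_C p B : 0 <= B -> unif_tcd p B f ->
  times_cont_diff p.+1 (duhamel nu K f) /\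
  forall l y, (size l <= p.+1)%N -> `|dlist l (duhamel nu K f) y| <= B * subordinated_bound.
Proof.
move=> B0 uf; rewrite subordinated_boundE.
have [tc b1 b2] := duhamel_C mc c0 mw w0 mk k0 W1 W2 mK KE jf B0 uf.
split=> // l y; rewrite leq_eqVlt ltnS => /orP[/eqP|] lp.
- by apply: (le_trans (b2 l y lp)); rewrite ler_wpM2l// lerDr.
- by apply: (le_trans (b1 l y lp)); rewrite ler_wpM2l// lerDl.
Qed.

Lemma subordinated_H p B : (forall s, Hspace p (f s)) -> 0 <= B ->
  (forall s (b : 'I_n -> nat), (\sum_(i < n) b i <= p)%N ->
     (\int[lam]_z `|gen_deriv b (f s) z|%:E <= B%:E)%E) ->
  Hspace p.+1 (duhamel nu K f) /\
  forall b : 'I_n -> nat, (\sum_(i < n) b i <= p.+1)%N ->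
    (\int[lam]_y `|gen_deriv b (duhamel nu K f) y|%:E <= (B * subordinated_bound)%:E)%E.
Proof.
move=> Hf B0 fB; rewrite subordinated_boundE.
exact: (duhamel_H mc c0 mw w0 mk k0 W1 W2 mK KE jf Hf B0 fB).
Qed.

End subordinated_duhamel.

Section subordinated_kernels.
Context {R : realType} (n : nat).
Local Notation V := 'rV[R]_n.
Local Notation M := (measurableTypeR R).
Local Notation lam := (lebesgue_rV R n).
Variables (P Q : probability M R) (a alpha beta : R).
Hypotheses (P0 : P `]-oo, 0%R]%classic = 0%E) (Q0 : Q `]-oo, 0%R]%classic = 0%E)
  (a0 : 0 < a) (alpha1 : 1 < alpha) (beta0 : 0 < beta) (beta1 : beta < 1)
  (Plap : forall l, 0 < l -> lap P l = (expR (- (l `^ beta)))%:E)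
  (Qlap : forall l, 0 < l -> lap Q l = (expR (- (l `^ (alpha / 2))))%:E).
Local Notation PQ := (sprod P Q).

Let dotR_ge0 (p : V) : 0 <= dotR p p.
Proof. by apply: sumr_ge0 => i _; rewrite -expr2 sqr_ge0. Qed.

Let enorm_powR (p : V) : enorm p `^ alpha = dotR p p `^ (alpha / 2).
Proof. by rewrite /enorm -powR12_sqrt// -powRrM mulrC. Qed.

Let mk t : measurable_fun setT (subk a alpha beta t : M * M -> R).
Proof. by apply: measurable_subk => //; exact: measurable_id. Qed.

Definition weight_G (z : M * M) : R := beta * z.1 `^ (- beta).

Lemma measurable_weight_G : measurable_fun setT weight_G.
Proof.
apply: measurable_funM => //.
exact: (measurableT_comp (measurable_powR (- beta)) measurable_fst).
Qed.

Lemma weight_G_ge0 z : 0 <= weight_G z.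
Proof. by rewrite mulr_ge0 ?powR_ge0// ltW. Qed.

Lemma S_kernel_mix t : 0 < t ->
  measurable_fun setT (S_kernel a alpha beta t : V -> R) /\
  {ae lam, forall y, S_kernel a alpha beta t y = mix PQ (fun=> 1) (subk a alpha beta t) y}.
Proof.
move=> t0; apply: inverse_fourier_mix => //.
- by move=> z; exact: subk_gt0.
- exact: intble_weight_S.
move=> p; rewrite enorm_powR !mulNr.
exact: (subordinate_S P0 Q0 a0 alpha1 beta0 Plap Qlap (dotR_ge0 p) t0).
Qed.

Lemma G_kernel_mix t : 0 < t ->
  measurable_fun setT (G_kernel a alpha beta t : V -> R) /\
  {ae lam, forall y, G_kernel a alpha beta t y =
    t `^ (beta - 1) * mix PQ weight_G (subk a alpha beta t) y}.
Proof.
move=> t0.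
have [|mG GE] := @inverse_fourier_mix _ _ R PQ n _ _ measurable_weight_G (mk t) weight_G_ge0
  (fun z => subk_gt0 a alpha beta t z) (intble_weight_G Q P0 beta0 Plap)
  (fun p : V => mittag_leffler beta beta (- a * enorm p `^ alpha * t `^ beta)).
  move=> p; rewrite enorm_powR !mulNr.
  exact: (subordinate_G P0 Q0 a0 alpha1 beta0 Plap Qlap (dotR_ge0 p) t0).
split; first exact: measurable_funM.
by apply: filterS GE => y; rewrite /G_kernel => ->.
Qed.

Let d0 : {sigma_finite_measure set M -> \bar R} := dirac (0 : M).

Let Rintegral_d0 (u : R) : \int[d0]_s u = u.
Proof. by rewrite /Rintegral integral_dirac// diracT mul1e. Qed.

Let intble_d0 (u : R) : d0.-integrable setT (EFin \o (fun=> u)).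
Proof.
apply/intbleP; split=> //.
by rewrite integral_dirac// diracT mul1e ltry.
Qed.

Definition S_conv t (f0 : V -> R) (y : V) : R := \int[lam]_x (S_kernel a alpha beta t (y - x) * f0 x).

Let S_convE t f0 : S_conv t f0 = duhamel d0 (fun=> S_kernel a alpha beta t) (fun=> f0).
Proof. by apply/funext => y; rewrite /duhamel Rintegral_d0. Qed.

Section S_conv.
Variables (t : R) (t0 : 0 < t).

Definition S_bound : R := \int[PQ]_z (1 : R) +
  gconst n * \int[PQ]_z (1 * subk a alpha beta 1 z `^ 2^-1) * t `^ (- (beta / alpha)).

Let S_boundE : subordinated_bound (n := n) d0 P Q a alpha beta (fun=> 1) (fun=> 1) (fun=> t) = S_bound.
Proof. by rewrite /subordinated_bound !Rintegral_d0 mul1r mulr1. Qed.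

Let mS := (S_kernel_mix t0).1.
Let SE (s : M) : {ae lam, forall y, S_kernel a alpha beta t y = 1 * mix PQ (fun=> 1) (subk a alpha beta t) y}.
Proof. by apply: filterS (S_kernel_mix t0).2 => y ->; rewrite mul1r. Qed.

Lemma S_conv_C p B f0 : 0 <= B -> unif_tcd p B (fun _ : M => f0) ->
  times_cont_diff p.+1 (S_conv t f0) /\
  forall l y, (size l <= p.+1)%N -> `|dlist l (S_conv t f0) y| <= B * S_bound.
Proof.
move=> B0 uf; rewrite S_convE -S_boundE; have [jf _ _] := uf.
apply: (subordinated_C (nu := d0)) => //.
- exact: intble_weight_S.
- exact: (subk_moment_S P0 Q0 a0 alpha1 beta0 beta1 Plap Qlap).
Qed.

Lemma S_conv_H p B f0 : measurable_fun setT f0 -> Hspace p f0 -> 0 <= B ->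
  (forall b : 'I_n -> nat, (\sum_(i < n) b i <= p)%N ->
     (\int[lam]_z `|gen_deriv b f0 z|%:E <= B%:E)%E) ->
  Hspace p.+1 (S_conv t f0) /\
  forall b : 'I_n -> nat, (\sum_(i < n) b i <= p.+1)%N ->
    (\int[lam]_y `|gen_deriv b (S_conv t f0) y|%:E <= (B * S_bound)%:E)%E.
Proof.
move=> mf Hf B0 fB; rewrite S_convE -S_boundE.
apply: (subordinated_H (nu := d0)) => //.
- exact: intble_weight_S.
- exact: (subk_moment_S P0 Q0 a0 alpha1 beta0 beta1 Plap Qlap).
- exact: (measurableT_comp mf measurable_snd).
Qed.

End S_conv.

Section G_conv.
Variables (t : R) (t0 : 0 < t).

(** The power of the elapsed time, extended by 0 so that the time integral runs over the whole line.
    r = beta is the prefactor of the kernel; r = beta - beta/alpha is what the scaling of the half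
    moment makes of it. *)
Let pw (r x : R) : R := if 0 < x <= t then x `^ (r - 1) else 0.

Let mpw r : measurable_fun setT (pw r : M -> R).
Proof.
apply: measurable_fun_ifT; [|exact: measurable_powR|exact: measurable_cst].
by apply: measurable_and; [exact: measurable_fun_ltr|exact: measurable_fun_ler].
Qed.

Let mpw' r : measurable_fun setT (fun s : M => pw r (t - s)).
Proof. by apply: (measurableT_comp (mpw r)); exact: measurable_funB. Qed.

Let pw_ge0 r x : 0 <= pw r x.
Proof. by rewrite /pw; case: ifP => // _; exact: powR_ge0. Qed.

Let integral_pw r : 0 < r -> (\int[@lebesgue_measure R]_s (pw r (t - s))%:E = (t `^ r / r)%:E)%E.
Proof.
move=> r0; rewrite -(integral_powR0 r0 t0) [RHS]integral_mkcond.
transitivity (\int[@lebesgue_measure R]_s (pw r s)%:E)%E.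
  rewrite -(@ge0_integral_flip _ true t (fun x => (pw r x)%:E)).
  - by apply: eq_integral => s _; rewrite /flip expr1 mulN1r.
  - by apply/measurable_EFinP; exact: mpw.
  - by move=> x; rewrite lee_fin.
apply: eq_integral => s _; rewrite patchE /pw.
have -> : (s \in `]0%R, t]%classic) = (0 < s <= t).
  by apply/idP/idP => [|H]; [rewrite inE/= in_itv|rewrite inE/= in_itv].
by case: ifP.
Qed.

Let intble_pw r : 0 < r -> (@lebesgue_measure R).-integrable setT (EFin \o (fun s => pw r (t - s))).
Proof.
move=> r0; apply/intbleP; split; first exact: mpw'.
by under eq_integral do rewrite ger0_norm//; rewrite integral_pw// ltry.
Qed.

Let Rintegral_pw r : 0 < r -> \int[@lebesgue_measure R]_s pw r (t - s) = t `^ r / r.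
Proof. by move=> r0; rewrite /Rintegral integral_pw. Qed.

Let ba : 0 < beta - beta / alpha.
Proof. by rewrite subr_gt0 ltr_pdivrMr ?ltr_pMr// (lt_trans _ alpha1). Qed.

Let pw_tau s : pw beta (t - s) * (t - s) `^ (- (beta / alpha)) = pw (beta - beta / alpha) (t - s).
Proof.
rewrite /pw; case: ifP => [/andP[s0 _]|]; last by rewrite mul0r.
by rewrite -powRD; [congr powR; ring|rewrite (gt_eqF s0) implybT].
Qed.

(** Cut off so that the kernel is a mixture at every s: [G_kernel_mix] speaks of positive elapsed
    times only, and the zero function matches the vanishing weight [pw]. *)
Let K (s : M) : V -> R := if 0 < t - s <= t then G_kernel a alpha beta (t - s) else fun=> 0.

Definition G_bound : R := \int[PQ]_z weight_G z * (t `^ beta / beta) +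
  gconst n * \int[PQ]_z (weight_G z * subk a alpha beta 1 z `^ 2^-1) *
    (t `^ (beta - beta / alpha) / (beta - beta / alpha)).

Let G_boundE : subordinated_bound (n := n) (@lebesgue_measure R) P Q a alpha beta weight_G
  (fun s => pw beta (t - s)) (fun s => t - s) = G_bound.
Proof.
rewrite /subordinated_bound Rintegral_pw//; congr (_ + _ * _).
by rewrite -Rintegral_pw//; apply: eq_Rintegral => s _; exact: pw_tau.
Qed.

Definition G_conv (h : M -> V -> R) (y : V) : R := \int[lebesgue_measure]_(s in `[0, t])
  \int[lam]_x (G_kernel a alpha beta (t - s) (y - x) * h s x).

Let G_convE h : G_conv h = duhamel (@lebesgue_measure R) K h.
Proof.
apply/funext => y; rewrite /G_conv Rintegral_mkcond; apply: eq_Rintegral => s _.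
rewrite patchE /K; case: ifPn => [|] sI; case: ifPn => // ts.
- move: sI; rewrite inE/= in_itv/= => /andP[s0 st].
  have -> : t - s = 0.
    apply/eqP; move: ts; rewrite gerBl s0 andbT -leNgt => ts.
    by rewrite eq_le ts subr_ge0.
  apply: eq_Rintegral => x _; rewrite /G_kernel powR0 ?mul0r//.
  by rewrite lt_eqF// subr_lt0.
- exfalso; move/negP: sI; apply; rewrite inE/= in_itv/=.
  by move: ts; rewrite subr_gt0 gerBl => /andP[/ltW -> ->].
- by rewrite [RHS]Rintegral_eq0// => x; rewrite mul0r.
Qed.

Let mK s : measurable_fun setT (K s).
Proof. by rewrite /K; case: ifP => [/andP[s0 _]|_] //; case: (G_kernel_mix s0). Qed.

Let KE s : {ae lam, forall y, K s y = pw beta (t - s) * mix PQ weight_G (subk a alpha beta (t - s)) y}.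
Proof.
rewrite /K /pw; case: ifP => [/andP[s0 _]|_]; first by case: (G_kernel_mix s0).
by apply: aeW => y; rewrite mul0r.
Qed.

Let ctau s : pw beta (t - s) != 0 -> 0 < t - s.
Proof. by rewrite /pw; case: ifP => [/andP[]|]//; rewrite eqxx. Qed.

Let iw := intble_weight_G Q P0 beta0 Plap.
Let iwk := subk_moment_G P0 Q0 a0 alpha1 beta0 Plap Qlap.

Let ict : (@lebesgue_measure R).-integrable setT
  (EFin \o (fun s => pw beta (t - s) * (t - s) `^ (- (beta / alpha)))).
Proof.
rewrite (_ : (fun s => _) = (fun s => pw (beta - beta / alpha) (t - s))); first exact: intble_pw.
by apply/funext => s; exact: pw_tau.
Qed.

Let mtau : measurable_fun setT (fun s : M => t - s).
Proof. exact: measurable_funB. Qed.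

Lemma G_conv_C p B h : 0 <= B -> unif_tcd p B h ->
  times_cont_diff p.+1 (G_conv h) /\
  forall l y, (size l <= p.+1)%N -> `|dlist l (G_conv h) y| <= B * G_bound.
Proof.
move=> B0 uh; rewrite G_convE -G_boundE; have [jh _ _] := uh.
exact: (subordinated_C alpha1 measurable_weight_G weight_G_ge0 iw iwk (mpw' beta)
  (fun s => pw_ge0 beta (t - s)) mtau ctau (intble_pw beta0) ict mK KE jh B0 uh).
Qed.

Lemma G_conv_H p B h : jmeas h -> (forall s, Hspace p (h s)) -> 0 <= B ->
  (forall s (b : 'I_n -> nat), (\sum_(i < n) b i <= p)%N ->
     (\int[lam]_z `|gen_deriv b (h s) z|%:E <= B%:E)%E) ->
  Hspace p.+1 (G_conv h) /\
  forall b : 'I_n -> nat, (\sum_(i < n) b i <= p.+1)%N ->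
    (\int[lam]_y `|gen_deriv b (G_conv h) y|%:E <= (B * G_bound)%:E)%E.
Proof.
move=> jh Hh B0 hB; rewrite G_convE -G_boundE.
exact: (subordinated_H alpha1 measurable_weight_G weight_G_ge0 iw iwk (mpw' beta)
  (fun s => pw_ge0 beta (t - s)) mtau ctau (intble_pw beta0) ict mK KE jh Hh B0 hB).
Qed.

End G_conv.

End subordinated_kernels.

(** * The norms as uniform bounds over multi-indices *)

Section norms.
Context {R : realType} {n : nat}.
Local Notation V := 'rV[R]_n.
Local Notation e_ i := (delta_mx ord0 i : V).
Local Notation lam := (lebesgue_rV R n).
Implicit Types f g : V -> R.

Lemma dlistD l f g : times_cont_diff (size l) f -> times_cont_diff (size l) g ->
  dlist l (fun x => f x + g x) = (fun x => dlist l f x + dlist l g x).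
Proof.
elim/last_ind: l f g => //= l i IH f g; rewrite size_rcons => tf tg.
rewrite !dlist_rcons -IH; [|exact: tcd_partial|exact: tcd_partial].
by congr dlist; apply/funext => x; apply: deriveD; [exact: tcd_derivable tf|exact: tcd_derivable tg].
Qed.

Lemma sum_count_mem (l : seq 'I_n) : (\sum_(i < n) count_mem i l)%N = size l.
Proof.
rewrite -size_klist; apply: perm_size; apply/allP => i _ /=.
by rewrite count_klist.
Qed.

Definition multi_index p (b : 'I_n -> nat) : {ffun 'I_n -> 'I_p.+1} := [ffun i => inord (b i)].

Lemma multi_indexE p (b : 'I_n -> nat) : (\sum_(i < n) b i <= p)%N ->
  (fun i => nat_of_ord (multi_index p b i)) = b.
Proof.
move=> bp; apply/funext => i; rewrite ffunE inordK// ltnS; apply: leq_trans bp.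
by rewrite (bigD1 i)//= leq_addr.
Qed.

Lemma le_term_sum p (G : ('I_n -> nat) -> \bar R) (b : 'I_n -> nat) :
  (forall b, (0 <= G b)%E) -> (\sum_(i < n) b i <= p)%N ->
  (G b <= \sum_(k : {ffun 'I_n -> 'I_p.+1} | (\sum_(i < n) k i <= p)%N) G (fun i => k i))%E.
Proof.
move=> G0 bp; have bE := multi_indexE bp.
rewrite (bigD1 (multi_index p b)) /=; last by rewrite (eq_bigr b)// => i _; rewrite -[in RHS]bE.
by rewrite bE leeDl// sume_ge0.
Qed.

Definition multi_indices p : R := \sum_(k : {ffun 'I_n -> 'I_p.+1} | (\sum_(i < n) k i <= p)%N) 1.

Lemma multi_indices_ge0 p : 0 <= multi_indices p.
Proof. exact: sumr_ge0. Qed.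

Lemma sum_le_multi_indices p (G : ('I_n -> nat) -> \bar R) (E : R) :
  (forall b, (\sum_(i < n) b i <= p)%N -> (G b <= E%:E)%E) ->
  (\sum_(k : {ffun 'I_n -> 'I_p.+1} | (\sum_(i < n) k i <= p)%N) G (fun i => k i) <=
    (multi_indices p * E)%:E)%E.
Proof.
move=> GE; rewrite mulr_suml -sumEFin; apply: lee_sum => k kp.
by rewrite mul1r; exact: GE.
Qed.

Lemma Cnorm_ge0 p f : (0 <= Cnorm p f)%E.
Proof.
apply: sume_ge0 => k _; apply: (@le_trans _ _ (`|pderiv (fun i => k i) f 0|%:E)); first by rewrite lee_fin.
by apply: ereal_sup_ubound; exists 0.
Qed.

Lemma dlist_le_Cnorm p f B : times_cont_diff p f -> (Cnorm p f <= B%:E)%E ->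
  forall l x, (size l <= p)%N -> `|dlist l f x| <= B.
Proof.
move=> tf fB l x lp; rewrite -lee_fin; apply: le_trans fB.
rewrite dlist_pderiv; last exact: tcdW tf.
apply: (@le_trans _ _ (ereal_sup [set `|pderiv (fun i => count_mem i l) f x|%:E | x in [set: V]])).
  by apply: ereal_sup_ubound; exists x.
apply: (@le_term_sum p (fun b => ereal_sup [set `|pderiv b f x|%:E | x in [set: V]])) => [b|].
  apply: (@le_trans _ _ (`|pderiv b f 0|%:E)); first by rewrite lee_fin.
  by apply: ereal_sup_ubound; exists 0.
by rewrite sum_count_mem.
Qed.

Lemma Cnorm_le p f E : (forall l x, (size l <= p)%N -> `|dlist l f x| <= E) ->
  (Cnorm p f <= (multi_indices p * E)%:E)%E.
Proof.
move=> fE; apply: (@sum_le_multi_indices p (fun b => ereal_sup [set `|pderiv b f x|%:E | x in [set: V]])) => b bp.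
apply: ge_ereal_sup => _ [x _ <-]; rewrite lee_fin pderiv_klist; apply: fE.
by rewrite size_klist.
Qed.

Lemma Hnorm_ge0 p f : (0 <= Hnorm p f)%E.
Proof. by apply: sume_ge0 => k _; exact: integral_ge0. Qed.

Lemma gen_deriv_le_Hnorm p f B : (Hnorm p f <= B%:E)%E -> forall b : 'I_n -> nat,
  (\sum_(i < n) b i <= p)%N -> (\int[lam]_x `|gen_deriv b f x|%:E <= B%:E)%E.
Proof.
move=> fB b bp; apply: le_trans fB.
by apply: (@le_term_sum p (fun b => \int[lam]_x `|gen_deriv b f x|%:E)%E) => // k; exact: integral_ge0.
Qed.

Lemma Hnorm_le p f E : (forall b : 'I_n -> nat, (\sum_(i < n) b i <= p)%N ->
    (\int[lam]_x `|gen_deriv b f x|%:E <= E%:E)%E) ->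
  (Hnorm p f <= (multi_indices p * E)%:E)%E.
Proof. exact: (@sum_le_multi_indices p (fun b => \int[lam]_x `|gen_deriv b f x|%:E)%E). Qed.

Lemma Hnorm_lty p f : Hspace p f -> (Hnorm p f < +oo)%E.
Proof.
move=> Hf; apply: lte_sum_pinfty => k kp; have [Lg _] := Hspace_gen_deriv Hf kp.
by have /intbleP[] := Lg.
Qed.

Lemma is_gen_derivD (b : 'I_n -> nat) f g u v : L1 f -> L1 g -> L1 u -> L1 v ->
  is_gen_deriv b f u -> is_gen_deriv b g v ->
  is_gen_deriv b (fun x => f x + g x) (fun x => u x + v x).
Proof.
move=> Lf Lg Lu Lv fu gv phi tphi; have tp := test_pderiv b tphi.
have [C1 _ b1] := test_bounded tphi; have [C2 _ b2] := test_bounded tp.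
have I w psi C : L1 w -> test_function psi -> (forall x, `|psi x| <= C) -> L1 (fun x => w x * psi x).
  by move=> Lw tpsi psiC; apply: (intbleM_bounded (C := C) Lw) => //; exact: test_measurable.
under eq_Rintegral do rewrite mulrDl.
rewrite RintegralD//; [|exact: I b2|exact: I b2].
under [X in _ = _ * X]eq_Rintegral do rewrite mulrDl.
rewrite RintegralD//; [|exact: I b1|exact: I b1].
by rewrite mulrDr fu// gv.
Qed.

Lemma HspaceD p f g : Hspace p f -> Hspace p g -> Hspace p (fun x => f x + g x).
Proof.
move=> [Lf Hf] [Lg Hg]; split=> [|k kp]; first exact: L1D.
have [u Lu fu] := Hf k kp; have [v Lv gv] := Hg k kp.
by exists (fun x => u x + v x); [exact: L1D|exact: is_gen_derivD].
Qed.

(** The chosen derivative of a sum need not be the sum of the chosen ones, but the latter is a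
    generalised derivative of the sum, and the norm does not depend on the choice. *)
Lemma gen_derivD_norm p (b : 'I_n -> nat) f g : (\sum_(i < n) b i <= p)%N -> Hspace p f -> Hspace p g ->
  (\int[lam]_x `|gen_deriv b (fun x => (f x + g x)%R) x|%:E <=
    \int[lam]_x `|gen_deriv b f x|%:E + \int[lam]_x `|gen_deriv b g x|%:E)%E.
Proof.
move=> bp Hf Hg; have [[Lf _] [Lg _]] := (Hf, Hg).
have [Lu fu] := Hspace_gen_deriv Hf bp; have [Lv gv] := Hspace_gen_deriv Hg bp.
have [_ _ ->] := gen_deriv_norm (L1D Lu Lv) (is_gen_derivD Lf Lg Lu Lv fu gv).
have mabs w : L1 w -> measurable_fun setT (fun x : V => `|w x|%:E).
  by move=> Lw; apply/measurable_EFinP; apply: measurableT_comp => //; exact: L1_measurable.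
rewrite -ge0_integralD//; [|exact: mabs|exact: mabs].
apply: ge0_le_integral => //.
- by apply: mabs; exact: L1D.
- by apply: emeasurable_funD; exact: mabs.
- by move=> x _; rewrite -EFinD lee_fin ler_normD.
Qed.

End norms.

Section time_clamp.
Context {R : realType} {n : nat} (T : R) (T0 : 0 <= T).
Local Notation V := 'rV[R]_n.
Local Notation M := (measurableTypeR R).

(* Extends [h] from [0, T] to the whole line, with the same bounds. *)
Definition clamp (s : R) : R := Num.max 0 (Num.min s T).

Lemma clamp_itv s : 0 <= clamp s <= T.
Proof. by rewrite /clamp le_max lexx/= ge_max T0/= ge_min lexx orbT. Qed.

Lemma clamp_id s : 0 <= s <= T -> clamp s = s.
Proof. by move=> /andP[s0 sT]; rewrite /clamp min_l// max_r. Qed.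

Lemma jmeas_clamp (h : R -> V -> R) :
  measurable_fun (`[0, T] `*` [set: V]) (fun sx : R * V => h sx.1 sx.2) ->
  jmeas (fun s : M => h (clamp s)).
Proof.
move=> mh.
have mc : measurable_fun setT (clamp : M -> M).
  by apply: measurable_maxr => //; exact: measurable_minr.
apply: (@measurable_comp _ _ _ _ _ _ (`[0, T] `*` [set: V] : set (M * V))
  (fun sx : M * V => h sx.1 sx.2) setT (fun z : M * V => (clamp z.1, z.2))) => //.
- by apply: measurableX => //; exact: measurable_itv.
- by move=> _ [[s x] _ <-]; split => //=; rewrite in_itv/= clamp_itv.
apply/measurable_fun_pairP; split; last exact: measurable_snd.
exact: (measurableT_comp mc measurable_fst).
Qed.

End time_clamp.
(** The masses of the mixtures contribute t^0 and t^beta. With e = beta/alpha, each is t^e times the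
    wanted power, and t^e <= T^e on ]0, T]. The half moments have the wanted powers already. *)
Lemma subordinated_bounds (R : realType) (n : nat) (P Q : probability (measurableTypeR R) R)
    (a alpha beta T : R) : 1 < alpha -> 0 < beta -> 0 < T ->
  exists2 D : R, 0 <= D & forall t, 0 < t <= T ->
    S_bound n P Q a alpha beta t <= D * t `^ (- (beta / alpha)) /\
    G_bound n P Q a alpha beta t <= D * t `^ (beta - beta / alpha).
Proof.
move=> alpha1 beta0 T0; have alpha0 : 0 < alpha by exact: lt_trans alpha1.
set e := beta / alpha; have e0 : 0 < e by exact: divr_gt0.
have be0 : 0 < beta - e by rewrite subr_gt0 ltr_pdivrMr ?ltr_pMr.
pose I1 : R := \int[sprod P Q]_z 1.
pose J1 := gconst n * \int[sprod P Q]_z (1 * subk a alpha beta 1 z `^ 2^-1).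
pose I2 : R := \int[sprod P Q]_z weight_G beta z.
pose J2 := gconst n * \int[sprod P Q]_z (weight_G beta z * subk a alpha beta 1 z `^ 2^-1).
have I10 : 0 <= I1 by exact: Rintegral_ge0.
have J10 : 0 <= J1.
  by rewrite mulr_ge0 ?gconst_ge0//; apply: Rintegral_ge0 => z _; rewrite mulr_ge0 ?powR_ge0.
have I20 : 0 <= I2 by apply: Rintegral_ge0 => z _; exact: weight_G_ge0.
have J20 : 0 <= J2.
  apply: mulr_ge0; first exact: gconst_ge0.
  apply: Rintegral_ge0 => z _; apply: mulr_ge0; [exact: weight_G_ge0|exact: powR_ge0].
have D10 : 0 <= I1 * T `^ e + J1 by rewrite addr_ge0// mulr_ge0// powR_ge0.
have D20 : 0 <= I2 / beta * T `^ e + J2 / (beta - e).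
  apply: addr_ge0; last by rewrite mulr_ge0// invr_ge0 ltW.
  by apply: mulr_ge0; [rewrite mulr_ge0// invr_ge0 ltW|exact: powR_ge0].
exists ((I1 * T `^ e + J1) + (I2 / beta * T `^ e + J2 / (beta - e))); first exact: addr_ge0.
move=> t /andP[t0 tT].
have te : t `^ e <= T `^ e by rewrite ge0_ler_powR ?nnegrE// ltW.
have tz r : t `^ r = t `^ (r - e) * t `^ e.
  by rewrite -powRD; [congr powR; ring|rewrite (gt_eqF t0) implybT].
split.
- apply: (@le_trans _ _ ((I1 * T `^ e + J1) * t `^ (- e))); last by rewrite ler_wpM2r ?powR_ge0// lerDl.
  rewrite /S_bound -/I1 -/J1 -/e mulrDl lerD2r -mulrA ler_peMr//.
  have := tz 0; rewrite powRr0 sub0r => ->.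
  by rewrite mulrC ler_wpM2r ?powR_ge0.
- apply: (@le_trans _ _ ((I2 / beta * T `^ e + J2 / (beta - e)) * t `^ (beta - e))); last first.
    by rewrite ler_wpM2r ?powR_ge0// lerDr.
  rewrite /G_bound -/I2 -/J2 -/e mulrDl; apply: lerD; last by rewrite mulrA mulrAC.
  rewrite (tz beta) mulrCA [leRHS](_ : _ = t `^ (beta - e) * (I2 / beta * T `^ e)); last by ring.
  rewrite (_ : _ * (I2 * _) = t `^ (beta - e) * (I2 / beta * t `^ e)); last by ring.
  by rewrite !ler_wpM2l ?powR_ge0// mulr_ge0// invr_ge0 ltW.
Qed.

Theorem theorem9 (R : realType) (d : nat) (a alpha beta T : R) (p : nat)
  (hd : (1 <= d)%N) (ha : 0 < a) (halpha1 : 1 < alpha) (halpha2 : alpha <= 2)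
  (hbeta0 : 0 < beta) (hbeta1 : beta < 1) (hT : 0 < T) :
  exists C : R, 0 < C /\
  (forall (f0 : 'rV[R]_d -> R) (h : R -> 'rV[R]_d -> R),
     Cspace p f0 ->
     measurable_fun (`[0, T] `*` [set: 'rV[R]_d])
       (fun sx : R * 'rV[R]_d => h sx.1 sx.2) ->
     (forall s, 0 <= s <= T -> Cspace p (h s)) ->
     (ereal_sup [set Cnorm p (h s) | s in `[0%R, T]] < +oo)%E ->
     forall t, 0 < t <= T ->
       Cspace p.+1 (Psi a alpha beta h t f0) /\
       (Cnorm p.+1 (Psi a alpha beta h t f0) <=
          (C * t `^ (- (beta / alpha)))%:E * Cnorm p f0 +
          (C * t `^ (beta - beta / alpha))%:E *
            ereal_sup [set Cnorm p (h s) | s in `[0%R, T]])%E) /\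
  (forall (f0 : 'rV[R]_d -> R) (h : R -> 'rV[R]_d -> R),
     Hspace p f0 ->
     measurable_fun (`[0, T] `*` [set: 'rV[R]_d])
       (fun sx : R * 'rV[R]_d => h sx.1 sx.2) ->
     (forall s, 0 <= s <= T -> Hspace p (h s)) ->
     (ereal_sup [set Hnorm p (h s) | s in `[0%R, T]] < +oo)%E ->
     forall t, 0 < t <= T ->
       Hspace p.+1 (Psi a alpha beta h t f0) /\
       (Hnorm p.+1 (Psi a alpha beta h t f0) <=
          (C * t `^ (- (beta / alpha)))%:E * Hnorm p f0 +
          (C * t `^ (beta - beta / alpha))%:E *
            ereal_sup [set Hnorm p (h s) | s in `[0%R, T]])%E).
Proof.
have [P [P0 Plap]] := stable_law hbeta0 (ltW hbeta1).
have al2 : 0 < alpha / 2 by rewrite divr_gt0// (lt_trans _ halpha1).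
have al21 : alpha / 2 <= 1 by rewrite ler_pdivrMr// mul1r.
have [Q [Q0 Qlap]] := stable_law al2 al21.
have [D D0 HD] := subordinated_bounds d P Q a halpha1 hbeta0 hT.
(* The number of multi-indices of order at most p + 1, that is of summands in the norms on the
   left. *)
pose N : R := @multi_indices R d p.+1.
have N0 : 0 <= N := multi_indices_ge0 p.+1.
have PsiE h t f0 : 0 < t <= T -> Psi a alpha beta h t f0 =
    (fun y : 'rV[R]_d => S_conv a alpha beta t f0 y + G_conv a alpha beta t (fun s => h (clamp T s)) y).
  move=> /andP[t0 tT]; apply/funext => y; congr (_ + _); apply: eq_Rintegral => s.
  rewrite inE/= in_itv/= => /andP[s0 st].
  by rewrite clamp_id// s0 (le_trans st).
(* The constant is N D + 1; the summand 1 makes it positive even if N D is 0. *)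
have final t B0 Bh (Nm : \bar R) : 0 < t <= T -> 0 <= B0 -> 0 <= Bh ->
    (Nm <= (N * (B0 * S_bound d P Q a alpha beta t + Bh * G_bound d P Q a alpha beta t))%:E)%E ->
    (Nm <= ((N * D + 1) * t `^ (- (beta / alpha)))%:E * B0%:E +
      ((N * D + 1) * t `^ (beta - beta / alpha))%:E * Bh%:E)%E.
  move=> tT B00 Bh0 /le_trans; apply; rewrite -!EFinM -EFinD lee_fin mulrDr.
  have [HS HG] := HD t tT.
  have aux B b c : 0 <= B -> 0 <= c -> b <= D * c -> N * (B * b) <= (N * D + 1) * c * B.
    move=> B1 c1 bc; apply: (@le_trans _ _ (N * (B * (D * c)))); first by rewrite !ler_wpM2l.
    rewrite (_ : _ * c * B = N * (B * (D * c)) + c * B); last by ring.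
    by rewrite lerDl mulr_ge0.
  by apply: lerD; apply: aux; rewrite ?powR_ge0.
(* Clamping the time extends the bound on [0, T] to all times, as the estimates for families over
   the whole line require. *)
have sup_fin (nrm : ('rV[R]_d -> R) -> \bar R) (h : R -> 'rV[R]_d -> R) : (forall f, 0 <= nrm f)%E ->
    (ereal_sup [set nrm (h s) | s in `[0%R, T]] < +oo)%E ->
    exists2 B, 0 <= B & ereal_sup [set nrm (h s) | s in `[0%R, T]] = B%:E /\
      forall s, (nrm (h (clamp T s)) <= B%:E)%E.
  move=> nrm0 hoo.
  have H s : 0 <= s <= T -> (nrm (h s) <= ereal_sup [set nrm (h s) | s in `[0%R, T]])%E.
    by move=> sT; apply: ereal_sup_ubound; exists s => //=; rewrite in_itv.
  have ge0 : (0 <= ereal_sup [set nrm (h s) | s in `[0%R, T]])%E.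
    by apply: le_trans (nrm0 (h 0)) (H 0 _); rewrite lexx ltW.
  have BE : (fine (ereal_sup [set nrm (h s) | s in `[0%R, T]]))%:E = ereal_sup [set nrm (h s) | s in `[0%R, T]].
    by rewrite fineK// ge0_fin_numE.
  exists (fine (ereal_sup [set nrm (h s) | s in `[0%R, T]])); first exact: fine_ge0.
  by split=> // s; rewrite BE; apply: H; exact/clamp_itv/ltW.
have fin (nf : \bar R) : (0 <= nf)%E -> (nf < +oo)%E -> exists2 B, 0 <= B & nf = B%:E.
  move=> n0 noo; exists (fine nf); first exact: fine_ge0.
  by rewrite fineK// ge0_fin_numE.
exists (N * D + 1); split; first by rewrite ltr_wpDl// mulr_ge0.
split=> f0 h Hf mh Hh hoo t tT; rewrite PsiE//; have /andP[t0 _] := tT.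
- have [tf foo] := Hf.
  have [B0 B00 f0E] := fin _ (Cnorm_ge0 p f0) foo.
  have [Bh Bh0 [hE hB]] := sup_fin _ h (@Cnorm_ge0 R d p) hoo.
  (* The initial value as a constant family over the time axis that carries the Dirac mass. *)
  have uf : unif_tcd p B0 (fun _ : measurableTypeR R => f0).
    split=> // [|s]; last by apply: dlist_le_Cnorm => //; rewrite f0E.
    apply: (measurableT_comp _ measurable_snd); apply: continuous_measurable_rV.
    by apply: (@tcd_cont _ _ p).
  have th s : times_cont_diff p (h (clamp T s)) by have [] := Hh _ (clamp_itv (ltW hT) s).
  have uh : unif_tcd p Bh (fun s : measurableTypeR R => h (clamp T s)).
    by split=> // [|s]; [exact: (jmeas_clamp (ltW hT) mh)|exact: dlist_le_Cnorm].
  have [tS bS] := S_conv_C P0 Q0 ha halpha1 hbeta0 hbeta1 Plap Qlap t0 B00 uf.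
  have [tG bG] := G_conv_C P0 Q0 ha halpha1 hbeta0 hbeta1 Plap Qlap t0 Bh0 uh.
  rewrite f0E hE.
  have CB : (Cnorm p.+1 (fun y => S_conv a alpha beta t f0 y + G_conv a alpha beta t (fun s => h (clamp T s)) y)%R <=
      (N * (B0 * S_bound d P Q a alpha beta t + Bh * G_bound d P Q a alpha beta t))%:E)%E.
    apply: Cnorm_le => l y lp; rewrite dlistD; [|exact: tcdW tS|exact: tcdW tG].
    by apply: le_trans (ler_normD _ _) _; apply: lerD; [exact: bS|exact: bG].
  split; last exact: final.
  by split; [exact: tcdD|apply: le_lt_trans CB _; rewrite ltry].
- have [B0 B00 f0E] := fin _ (Hnorm_ge0 p f0) (Hnorm_lty Hf).
  have [Bh Bh0 [hE hB]] := sup_fin _ h (@Hnorm_ge0 R d p) hoo.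
  have f0B : (Hnorm p f0 <= B0%:E)%E by rewrite f0E.
  have [HS bS] := S_conv_H P0 Q0 ha halpha1 hbeta0 hbeta1 Plap Qlap t0 (L1_measurable Hf.1) Hf B00 (gen_deriv_le_Hnorm f0B).
  have [HG bG] := G_conv_H P0 Q0 ha halpha1 hbeta0 hbeta1 Plap Qlap t0 (jmeas_clamp (ltW hT) mh)
    (fun s => Hh _ (clamp_itv (ltW hT) s)) Bh0 (fun s => gen_deriv_le_Hnorm (hB s)).
  split; first exact: HspaceD.
  rewrite f0E hE; apply: final => //; apply: Hnorm_le => b bp.
  by apply: le_trans (gen_derivD_norm bp HS HG) _; rewrite EFinD; apply: leeD; [exact: bS|exact: bG].
Qed.
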